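(* Suppose that either $\omega^2\notin\sigma(\mathcal A_\theta)\cup\sigma_d(\mathcal A)$, or $\omega^2\in\sigma(\mathcal A_\theta)$ and $\omega$ is a regular frequency. Then the interior problem: find $u^{int}\in H^1(a^l,a^r)$ such that $$-\big(\mu\,(u^{int})'\big)'-\rho\,\omega^2u^{int}=f\ \text{ in }(a^l,a^r),$$ $$\big[-\mu (u^{int})'-iz\,u^{int}\big](a^l)=\Lambda^l\,\big[\mu (u^{int})'-iz\,u^{int}\big](a^l),\qquad \big[\mu (u^{int})'-iz\,u^{int}\big](a^r)=\Lambda^r\,\big[-\mu (u^{int})'-iz\,u^{int}\big](a^r),$$ is well-posed in $H^1(a^l,a^r)$, and $$\lim_{\varepsilon\to0}\|u^{int}_\varepsilon-u^{int}\|_{H^1(a^l,a^r)}=0,$$ where $u^{int}_\varepsilon$ is the restriction to $(a^l,a^r)$ of the unique solution $u_\varepsilon\in H^1(\mathbb R)$ of $-(\mu u_\varepsilon')'-\rho(\omega^2+i\varepsilon)u_\varepsilon=f$ in $\mathbb R$ $(\varepsilon>0)$. (In the regular case, the limit is taken along the sequence $(\varepsilon_j)$ occurring in the definition of a regular frequency.)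
   Context: Periodic coefficients. $\mu_p,\rho_p:\mathbb R^2\to\mathbb R$ are continuous, $1$-periodic in each variable and bounded below by positive constants; $(\theta_1,\theta_2)\in\mathbb R^2$ with $\theta_2>0$ and $\delta:=\theta_1/\theta_2$ irrational; $z>0$; $\omega\in\mathbb R$. For $s\in\mathbb R$ put $\mu_s(x):=\mu_p(s+\theta_1x,\theta_2x)$, $\rho_s(x):=\rho_p(s+\theta_1x,\theta_2x)$. Equations $-(\mu u')'-\rho\kappa u=g$ are understood weakly for $u\in H^1$, so that $u$ and $\mu u'$ have point values. Diophantine assumption. The irrationality measure $m(\delta):=\sup\{\nu>0:\ |\delta-p/q|\le q^{-\nu}\text{ for infinitely many }(p,q)\in\mathbb Z\times\mathbb N^*\}$ is finite and $\mu_p,\rho_p\in C^m(\mathbb R^2)$ for some integer $m>m(\delta)$. Whole-line data. $a^l<a^r$ are reals with $a^l\theta_2,a^r\theta_2\in\mathbb Z$; $\mu,\rho:\mathbb R\to\mathbb R$ are measurable, bounded above and below by positive constants, with $\mu=\mu_0$, $\rho=\rho_0$ on $\mathbb R\setminus(a^l,a^r)$ (here $\mu_0,\rho_0$ are $\mu_s,\rho_s$ at $s=0$); $f\in L^2(\mathbb R)$ with $\operatorname{supp}f\subset(a^l,a^r)$. $\mathcal Au=-\frac1\rho(\mu u')'$ with domain $\{u\in H^1(\mathbb R):\mu u'\in H^1(\mathbb R)\}$ is self-adjoint in $L^2(\mathbb R;\rho\,dx)$, with discrete spectrum $\sigma_d(\mathcal A)$; $\mathcal A_\theta u=-\frac1{\rho_0}(\mu_0u')'$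 with domain $\{u\in H^1(\mathbb R):\mu_0u'\in H^1(\mathbb R)\}$ is self-adjoint in $L^2(\mathbb R;\rho_0\,dx)$. In the interior problem, values of $\mu (u^{int})'$ at $a^l,a^r$ are traces from inside $(a^l,a^r)$. Robin operators. $R^r_{\pm,s}u:=\mp\mu_su'-izu$, $R^l_{\pm,s}u:=\pm\mu_su'-izu$. Function space and winding number. $L^2_{per}(\mathbb R)$: $1$-periodic functions in $L^2_{loc}(\mathbb R)$, with the $L^2(0,1)$ inner product. $\mathcal N_{per}$: continuous $1$-periodic functions $f:\mathbb R\to\mathbb C$ that never vanish; writing $f=|f|e^{i\,\mathrm{Arg} f}$ with $\mathrm{Arg} f$ continuous on $\mathbb R$, the winding number is $\mathbf w(f):=(\mathrm{Arg} f(1)-\mathrm{Arg} f(0))/2\pi$. Fundamental eigenpairs for $\varepsilon>0$. $u^r_{s,\varepsilon}\in H^1(0,\infty)$ and $u^l_{s,\varepsilon}\in H^1(-\infty,0)$ are the unique solutions of $-(\mu_su')'-\rho_s(\omega^2+i\varepsilon)u=0$ with $R^r_{+,s}u^r_{s,\varepsilon}(0)=1$, $R^l_{+,s}u^l_{s,\varepsilon}(0)=1$. Put $p^r_\varepsilon(s)=R^r_{+,s}u^r_{s,\varepsilon}(1/\theta_2)$, $\boldsymbol s^r_\varepsilon(s)=R^r_{-,s}u^r_{s,\varepsilon}(1/\theta_2)$, $p^l_\varepsilon(s)=R^l_{+,s}u^l_{s,\varepsilon}(-1/\theta_2)$, $\boldsymbol s^l_\varepsilon(s)=R^l_{-,s}u^l_{s,\varepsilon}(-1/\theta_2)$,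 and define on $L^2_{per}(\mathbb R)$: $\mathcal P^r_\varepsilon\varphi(s)=p^r_\varepsilon(s-\delta)\varphi(s-\delta)$, $\mathcal S^r_\varepsilon\varphi(s)=\boldsymbol s^r_\varepsilon(s-\delta)\varphi(s-\delta)$, $\mathcal P^l_\varepsilon\varphi(s)=p^l_\varepsilon(s+\delta)\varphi(s+\delta)$, $\mathcal S^l_\varepsilon\varphi(s)=\boldsymbol s^l_\varepsilon(s+\delta)\varphi(s+\delta)$. For $i\in\{l,r\}$ there is a unique pair $(\lambda^i_{0,\varepsilon},\varphi^i_{0,\varepsilon})\in\mathbb C\times\mathcal N_{per}$ with $|\lambda^i_{0,\varepsilon}|<1$, $\mathbf w(\varphi^i_{0,\varepsilon})=0$, $\varphi^i_{0,\varepsilon}(0)=1$ and $\mathcal P^i_\varepsilon\varphi^i_{0,\varepsilon}=\lambda^i_{0,\varepsilon}\varphi^i_{0,\varepsilon}$; put $\psi^i_{0,\varepsilon}:=\mathcal S^i_\varepsilon\varphi^i_{0,\varepsilon}$. Cell symbols without absorption. $e^{r,0}_s,e^{r,1}_s\in H^1(0,1/\theta_2)$ solve $-(\mu_su')'-\rho_s\omega^2u=0$ on $(0,1/\theta_2)$ with $R^r_{+,s}e^{r,0}_s(0)=1,\ R^r_{-,s}e^{r,0}_s(1/\theta_2)=0$ and $R^r_{+,s}e^{r,1}_s(0)=0,\ R^r_{-,s}e^{r,1}_s(1/\theta_2)=1$; $t^{r,00}(s)=R^r_{-,s}e^{r,0}_s(0)$, $t^{r,10}(s)=R^r_{-,s}e^{r,1}_s(0)$.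 Likewise $e^{l,0}_s,e^{l,1}_s\in H^1(-1/\theta_2,0)$ solve the same equation on $(-1/\theta_2,0)$ with $R^l_{+,s}e^{l,0}_s(0)=1,\ R^l_{-,s}e^{l,0}_s(-1/\theta_2)=0$ and $R^l_{+,s}e^{l,1}_s(0)=0,\ R^l_{-,s}e^{l,1}_s(-1/\theta_2)=1$; $t^{l,00}(s)=R^l_{-,s}e^{l,0}_s(0)$, $t^{l,10}(s)=R^l_{-,s}e^{l,1}_s(0)$. Flux density. With $\delta^r:=\delta$, $\delta^l:=-\delta$, $$Q^i_s(\varphi,\psi):=\mathrm{Re}\Big\{\big[(1-t^{i,00}(s))\varphi(s)-t^{i,10}(s)\psi(s+\delta^i)\big]\,\overline{\big[(1+t^{i,00}(s))\varphi(s)+t^{i,10}(s)\psi(s+\delta^i)\big]}\Big\}.$$ Regular frequency. $\omega$ is regular if: (a) there is a sequence $\varepsilon_j\to0^+$ such that for each $i\in\{l,r\}$, along it, $\lambda^i_{0,\varepsilon}\to\lambda^i_0$ in $\mathbb C$ and $\varphi^i_{0,\varepsilon}\to\varphi^i_0$, $\psi^i_{0,\varepsilon}\to\psi^i_0$ uniformly on $\mathbb R$, for some $\lambda_0^i\in\mathbb C$ and continuous $1$-periodic $\varphi_0^i,\psi_0^i$; (b) for each $i$, $Q^i_0\ne0$, where $Q^i_0\ge 0$ is the value of $Q^i_s(\varphi^i_0,\psi^i_0)$, which is independent of $s$. (When $\omega$ is regular, $\varphi^i_0$ never vanishes.) RtR coefficients. If $\omega^2\notin\sigma(\mathcal A_\theta)$: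 let $u^r\in H^1(a^r,\infty)$, $u^l\in H^1(-\infty,a^l)$ be the unique solutions of $-(\mu_0u')'-\rho_0\omega^2u=0$ with $R^r_{+,0}u^r(a^r)=1$, $R^l_{+,0}u^l(a^l)=1$, and set $\Lambda^i:=R^i_{-,0}u^i(a^i)$. If $\omega$ is regular: $\Lambda^i:=t^{i,00}(a^i\theta_1)+\varphi^i_0(a^i\theta_1)^{-1}\,\psi^i_0(a^i\theta_1+\delta^i)\,t^{i,10}(a^i\theta_1)$, $i\in\{l,r\}$. *)

(* Defs.v *)
From HB Require Import structures.
From mathcomp Require Import all_boot all_order all_algebra.
From mathcomp Require Import all_classical all_reals all_analysis.
From mathcomp Require Import complex.

Set Implicit Arguments.
Unset Strict Implicit.
Unset Printing Implicit Defensive.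

Import Order.TTheory GRing.Theory Num.Theory.
Import numFieldNormedType.Exports.
Import ComplexField.Normc.

Local Open Scope classical_set_scope.
Local Open Scope ring_scope.
Local Open Scope complex_scope.

(* Complex-valued functions of a real variable are handled through their real
   and imaginary parts, since R[i] carries no topology or sigma-algebra. *)
Section complex_valued.
Context {R : realType}.
Local Notation C := R[i].
Local Notation leb := (@lebesgue_measure R).

Definition cmeasurable (D : set R) (f : R -> C) : Prop :=
  measurable_fun D (fun x => complex.Re (f x)) /\
  measurable_fun D (fun x => complex.Im (f x)).

Definition ccontinuous (D : set R) (f : R -> C) : Prop :=
  {within D, continuous (fun x => complex.Re (f x))} /\
  {within D, continuous (fun x => complex.Im (f x))}.

Definition cintegral (D : set R) (f : R -> C) : C :=
  (\int[leb]_(x in D) complex.Re (f x)) +i*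
  (\int[leb]_(x in D) complex.Im (f x)).

Definition L2 (I : set R) (f : R -> C) : Prop :=
  cmeasurable I f /\
  (\int[leb]_(x in I) ((normc (f x)) ^+ 2)%:E < +oo)%E.

(* Norm of L^2(I; w dx). *)
Definition wL2norm (w : R -> R) (I : set R) (f : R -> C) : R :=
  Num.sqrt (\int[leb]_(x in I) (w x * normc (f x) ^+ 2)).

Definition L2norm (I : set R) (f : R -> C) : R := wL2norm (cst 1) I f.

Definition ess_supp (f : R -> C) : set R :=
  ~` \bigcup_(U in [set U | open U /\ ae_eq leb U f (cst 0)]) U.

End complex_valued.

(* One-dimensional Sobolev spaces on an open interval I. *)
Section sobolev.
Context {R : realType}.
Local Notation C := R[i].
Local Notation leb := (@lebesgue_measure R).

(* C^1 functions with compact support in I. *)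
Definition test_function (I : set R) (phi : R -> R) : Prop :=
  [/\ forall x, derivable phi x 1, continuous (derive1 phi) &
      exists K, [/\ compact K, K `<=` I & forall x, ~ K x -> phi x = 0]].

Definition weak_derivative (I : set R) (u v : R -> C) : Prop :=
  forall phi, test_function I phi ->
    cintegral I (fun x => u x * (derive1 phi x)%:C) =
    - cintegral I (fun x => v x * (phi x)%:C).

(* Elements of H^1(I) are identified with their continuous representatives on
   the closure of I; values off the closure of I are irrelevant. *)
Definition H1 (I : set R) (u : R -> C) : Prop :=
  [/\ L2 I u, ccontinuous (closure I) u &
      exists v, L2 I v /\ weak_derivative I u v].

Definition wderiv (I : set R) (u : R -> C) : R -> C :=
  xget (cst 0) [set v | L2 I v /\ weak_derivative I u v].

Definition H1norm (I : set R) (u : R -> C) : R :=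
  Num.sqrt (L2norm I u ^+ 2 + L2norm I (wderiv I u) ^+ 2).

(* Continuous representative of mu u' on the closure of I: at an endpoint of I
   its value is the trace of mu u' taken from inside I. *)
Definition flux (I : set R) (mu : R -> R) (u : R -> C) : R -> C :=
  xget (cst 0) [set w | ccontinuous (closure I) w /\
                        ae_eq leb I w (fun x => (mu x)%:C * wderiv I u x)].

(* u in H^1(I) solves - (mu u')' - rho kappa u = g weakly in I. *)
Definition weak_sol (I : set R) (mu rho : R -> R) (kappa : C) (g u : R -> C) :
    Prop :=
  H1 I u /\
  forall phi, test_function I phi ->
    cintegral I (fun x => (mu x)%:C * wderiv I u x * (derive1 phi x)%:C)
    - cintegral I (fun x => (rho x)%:C * kappa * u x * (phi x)%:C)
    = cintegral I (fun x => g x * (phi x)%:C).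

End sobolev.

(* The operator u |-> - (1 / rho) (mu u')' in L^2(R; rho dx). As rho is bounded
   above and below by positive constants, L^2(R; rho dx) and L^2(R) have the
   same elements. *)
Section operator.
Context {R : realType}.
Local Notation C := R[i].
Local Notation leb := (@lebesgue_measure R).
Variables mu rho : R -> R.

Definition dom_op (u : R -> C) : Prop :=
  H1 setT u /\
  exists2 w, H1 setT w &
    ae_eq leb setT w (fun x => (mu x)%:C * wderiv setT u x).

Definition op (u : R -> C) : R -> C :=
  fun x => - ((rho x)^-1)%:C * wderiv setT (flux setT mu u) x.

(* op - lam is onto L^2 with a bounded (hence well-defined) inverse. *)
Definition resolvent_set : set C := [set lam |
  (forall g, L2 setT g ->
     exists2 u, dom_op u & ae_eq leb setT (fun x => op u x - lam * u x) g) /\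
  (exists M : R, forall u, dom_op u ->
     wL2norm rho setT u <= M * wL2norm rho setT (fun x => op u x - lam * u x))].

Definition spectrum : set C := ~` resolvent_set.

Definition eigenspace (lam : C) : set (R -> C) :=
  [set u | dom_op u /\ ae_eq leb setT (op u) (fun x => lam * u x)].

(* Isolated points of the spectrum that are eigenvalues of finite
   multiplicity. *)
Definition discrete_spectrum : set C := [set lam |
  [/\ spectrum lam,
      exists2 r : R, 0 < r &
        forall lam', spectrum lam' -> normc (lam' - lam) < r -> lam' = lam,
      exists2 u, eigenspace lam u & exists x, u x != 0 &
      exists (n : nat) (b : 'I_n -> R -> C), forall u, eigenspace lam u ->
        exists c : 'I_n -> C, forall x, u x = \sum_(k < n) c k * b k x]].

End operator.

Section coefficients.
Context {R : realType}.

Fixpoint Cn (n : nat) (f : R * R -> R) : Prop :=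
  continuous f /\
  match n with
  | 0%N => True
  | k.+1 =>
    [/\ forall p, derivable f p (1, 0) /\ derivable f p (0, 1),
        Cn k (fun p => 'D_((1, 0) : R * R) f p) &
        Cn k (fun p => 'D_((0, 1) : R * R) f p)]
  end.

Definition periodic_coefficient (f : R * R -> R) : Prop :=
  [/\ continuous f,
      forall x y, f (x + 1, y) = f (x, y),
      forall x y, f (x, y + 1) = f (x, y) &
      exists2 c : R, 0 < c & forall p, c <= f p].

Definition irrationality_measure (delta : R) : \bar R :=
  ereal_sup [set nu%:E | nu in [set nu : R | 0 < nu /\
    infinite_set [set pq : int * nat | (0 < pq.2)%N /\
      `|delta - pq.1%:~R / pq.2%:R| <= (pq.2%:R : R) `^ (- nu)]]].

Definition line_coefficient (f : R -> R) : Prop :=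
  measurable_fun setT f /\
  exists c d : R, 0 < c /\ forall x, c <= f x <= d.

(* f_s(x) = f(s + theta_1 x, theta_2 x) *)
Definition fiber (f : R * R -> R) (th1 th2 s : R) : R -> R :=
  fun x => f (s + th1 * x, th2 * x).

End coefficients.

Variant side := Lside | Rside.

Section half_lines.
Context {R : realType}.
Local Notation C := R[i].
Local Notation leb := (@lebesgue_measure R).

Definition orient (i : side) : R := if i is Rside then 1 else -1.

Definition halfline (i : side) (a : R) : set R :=
  if i is Rside then `]a, +oo[%classic else `]-oo, a[%classic.

Definition cell (i : side) (len : R) : set R :=
  if i is Rside then `]0, len[%classic else `](- len), 0[%classic.

Definition endpoint (al ar : R) (i : side) : R := if i is Rside then ar else al.

(* R^i_+ and R^i_-: with orient Rside = 1 and orient Lside = -1,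
   R^i_{+-} u = -+ orient i * mu u' - i z u. *)
Definition robinP (i : side) (z : R) (I : set R) (mu : R -> R) (u : R -> C)
    (x : R) : C :=
  - (orient i)%:C * flux I mu u x - (0 +i* z) * u x.

Definition robinM (i : side) (z : R) (I : set R) (mu : R -> R) (u : R -> C)
    (x : R) : C :=
  (orient i)%:C * flux I mu u x - (0 +i* z) * u x.

Definition Nper (phi : R -> C) : Prop :=
  [/\ ccontinuous setT phi, forall x, phi (x + 1) = phi x &
      forall x, phi x != 0].

Definition winding (phi : R -> C) (w : R) : Prop :=
  exists arg : R -> R, [/\ continuous arg,
    forall x, phi x = (normc (phi x))%:C * (cos (arg x) +i* sin (arg x)) &
    w = (arg 1 - arg 0) / (2 * pi)].

Definition unif_cvg (f : nat -> R -> C) (g : R -> C) : Prop :=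
  forall eps : R, 0 < eps ->
    \forall j \near \oo, forall x, normc (f j x - g x) < eps.

(* Periodic medium, impedance z and frequency omega. *)
Variables (mup rhop : R * R -> R) (th1 th2 z omega : R).

Local Notation mu_ := (fiber mup th1 th2).
Local Notation rho_ := (fiber rhop th1 th2).

(* delta^r = theta_1 / theta_2, delta^l = - delta^r *)
Definition shift (i : side) : R := orient i * (th1 / th2).

(* p = p^i_eps and sg = s^i_eps, read off the half-line solutions
   u^i_{s,eps}. *)
Definition fundamental_symbols (i : side) (eps : R) (p sg : R -> C) : Prop :=
  forall s, exists u,
    [/\ weak_sol (halfline i 0) (mu_ s) (rho_ s) (omega ^+ 2 +i* eps) (cst 0) u,
        robinP i z (halfline i 0) (mu_ s) u 0 = 1,
        p s = robinP i z (halfline i 0) (mu_ s) u (orient i / th2) &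
        sg s = robinM i z (halfline i 0) (mu_ s) u (orient i / th2)].

(* The weighted translation of symbol m: P^i_eps for m = p^i_eps and S^i_eps
   for m = s^i_eps. *)
Definition wtranslation (i : side) (m phi : R -> C) : R -> C :=
  fun s => m (s - shift i) * phi (s - shift i).

(* (lam, phi) = (lambda^i_{0,eps}, phi^i_{0,eps}) and psi = psi^i_{0,eps}; the
   eigenvalue equation is an equality in L^2_per. *)
Definition fundamental_triple (i : side) (eps : R) (lam : C)
    (phi psi : R -> C) : Prop :=
  exists p sg, fundamental_symbols i eps p sg /\
    [/\ normc lam < 1, Nper phi, winding phi 0, phi 0 = 1 &
        ae_eq leb setT (wtranslation i p phi) (fun s => lam * phi s)] /\
    psi = wtranslation i sg phi.

(* t00 = t^{i,00} and t10 = t^{i,10}, without absorption. *)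
Definition cell_symbols (i : side) (t00 t10 : R -> C) : Prop :=
  forall s, let I := cell i (th2^-1) in let b := orient i / th2 in
  exists e0 e1,
    [/\ weak_sol I (mu_ s) (rho_ s) (omega ^+ 2)%:C (cst 0) e0,
        robinP i z I (mu_ s) e0 0 = 1 & robinM i z I (mu_ s) e0 b = 0] /\
    [/\ weak_sol I (mu_ s) (rho_ s) (omega ^+ 2)%:C (cst 0) e1,
        robinP i z I (mu_ s) e1 0 = 0 & robinM i z I (mu_ s) e1 b = 1] /\
    t00 s = robinM i z I (mu_ s) e0 0 /\ t10 s = robinM i z I (mu_ s) e1 0.

Definition flux_density (i : side) (t00 t10 phi psi : R -> C) (s : R) : R :=
  complex.Re
    (((1 - t00 s) * phi s - t10 s * psi (s + shift i)) *
     conjc ((1 + t00 s) * phi s + t10 s * psi (s + shift i))).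

(* omega is a regular frequency, as witnessed by the sequence eps_, the limits
   phi0 i, psi0 i and the absorption-free cell symbols t00 i, t10 i. *)
Definition regular_along (eps_ : nat -> R) (t00 t10 phi0 psi0 : side -> R -> C) :
    Prop :=
  [/\ forall j, 0 < eps_ j, eps_ j @[j --> \oo] --> (0 : R) &
    forall i,
    [/\ cell_symbols i (t00 i) (t10 i),
        exists (lam : nat -> C) (phi psi : nat -> R -> C) (lam0 : C),
          [/\ forall j, fundamental_triple i (eps_ j) (lam j) (phi j) (psi j),
              normc (lam j - lam0) @[j --> \oo] --> (0 : R),
              unif_cvg phi (phi0 i) & unif_cvg psi (psi0 i)],
        ccontinuous setT (phi0 i) /\ (forall s, phi0 i (s + 1) = phi0 i s),
        ccontinuous setT (psi0 i) /\ (forall s, psi0 i (s + 1) = psi0 i s) &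
        exists q : R, [/\ 0 <= q, q != 0 &
          forall s, flux_density i (t00 i) (t10 i) (phi0 i) (psi0 i) s = q]]].

(* RtR coefficient when omega^2 is outside the spectrum of the periodic
   operator; a = a^i. *)
Definition gap_RtR (i : side) (a : R) (Lam : C) : Prop :=
  exists u,
    [/\ weak_sol (halfline i a) (mu_ 0) (rho_ 0) (omega ^+ 2)%:C (cst 0) u,
        robinP i z (halfline i a) (mu_ 0) u a = 1 &
        Lam = robinM i z (halfline i a) (mu_ 0) u a].

(* RtR coefficient when omega is a regular frequency; a = a^i. *)
Definition regular_RtR (i : side) (a : R) (t00 t10 phi0 psi0 : R -> C) : C :=
  t00 (a * th1) +
  (phi0 (a * th1))^-1 * psi0 (a * th1 + shift i) * t10 (a * th1).

End half_lines.

Section interior.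
Context {R : realType}.
Local Notation C := R[i].
Variables (al ar : R) (mu rho : R -> R) (omega z : R) (Lam : side -> C).

Definition interior_sol (g u : R -> C) : Prop :=
  weak_sol `]al, ar[%classic mu rho (omega ^+ 2)%:C g u /\
  forall i, robinM i z `]al, ar[%classic mu u (endpoint al ar i) =
            Lam i * robinP i z `]al, ar[%classic mu u (endpoint al ar i).

(* Existence, uniqueness and continuous dependence on the source term. *)
Definition interior_wellposed : Prop :=
  [/\ forall g, L2 `]al, ar[%classic g -> exists u, interior_sol g u,
      forall g u v, L2 `]al, ar[%classic g -> interior_sol g u ->
        interior_sol g v -> forall x, al <= x <= ar -> u x = v x &
      exists M : R, forall g u, L2 `]al, ar[%classic g -> interior_sol g u ->
        H1norm `]al, ar[%classic u <= M * L2norm `]al, ar[%classic g].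

End interior.

(* Main.v *)
Require Import Defs.
From HB Require Import structures.
From mathcomp Require Import all_boot all_order all_algebra.
From mathcomp Require Import all_classical all_reals all_analysis.
From mathcomp Require Import measurable_realfun complex.
From mathcomp Require Import ring lra.

Set Implicit Arguments.
Unset Strict Implicit.
Unset Printing Implicit Defensive.

Import Order.TTheory GRing.Theory Num.Theory.
Import numFieldNormedType.Exports.
Import ComplexField.Normc.

Local Open Scope classical_set_scope.
Local Open Scope ring_scope.

(** The equation [- (mu u')' - rho kappa u = g] is treated as a first-order
    system for the pair of [u] and its flux [w = mu u'], both of which are
    primitives ([prim]) of integrable functions; [weak_sol_csol] and
    [csol_weak_sol] translate between weak solutions and such pairs. The
    imaginary part of [kappa] is counted as a source, so that a complex solution
    is a pair of real solutions for one real spectral parameter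
    [lam = omega ^ 2] ([ksol]). The main tool is the Wronskian [u1 w2 - w1 u2] of
    two solutions: it is constant up to the sources ([wronskian]), and at an end
    point it is the antisymmetric form in the incoming and outgoing Robin traces
    [Rp] and [Rm] ([robin_wronskian]).

    Interior problem. If the homogeneous problem has no nonzero solution
    ([inj]), then the solution is recovered from its Wronskians with two
    homogeneous solutions, one for each boundary condition. It is thus bounded by
    the source and by the Robin defects [Rm u - Lam Rp u] at both ends
    ([interior_stable]), which gives well-posedness. For the convergence, the
    difference of [u_eps] and the limit solution has source [i eps rho u_eps] and
    the Robin defects of [u_eps]. If the latter are bounded by [tau Rp u_eps]
    with [tau] small, then both terms can be absorbed ([converge_of_inj]). It
    remains to prove, in each of the two cases, injectivity and the smallness of
    the defects of [u_eps].

    Gap case. The defect of [u_eps] is its Wronskian with the half-line solution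
    that defines [Lam]. It equals [eps] times an integral of the product of the
    two over the half-line. As the energy dissipated on the half-line is bounded
    by the incoming trace ([half_energy]), the defect is at most a multiple of
    [sqrt eps] times that trace ([half_defect]). A nonzero solution of the
    homogeneous interior problem extends by the half-line solutions to an
    eigenfunction of the operator on the line ([gap_inj]), and the corresponding
    eigenvalue belongs to the discrete spectrum ([eigen_discrete]): it is simple
    by a Wronskian, and it is isolated because the equation is boundedly solvable
    orthogonally to the eigenfunction. Such a solution is built from the
    resolvent of the periodic operator by continuation through the perturbed
    interval ([orthogonal_solve]), and a Neumann series extends it to nearby
    complex parameters ([neumann]).

    Regular case. Half-line solutions with absorption are unique up to a factor,
    so [Rm u_eps = Lam_eps Rp u_eps] with the coefficient [Lam_eps] of the
    fundamental solution attached to the end point. Comparing the latter with a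
    cell solution without absorption, again by a Wronskian and the energy
    balance, gives
    [Lam_eps = t00 + (psi_eps / phi_eps) t10 + O(sqrt eps)] ([cell_defect]), whence
    [Lam_eps] tends to [Lam] ([regular_trace]). The flux density of the limit is
    [|phi0| ^ 2 (1 - |Lam| ^ 2)] and is positive: the boundary conditions are
    strictly contractive ([regular_contraction]), and conservation of the energy
    flux gives injectivity ([contraction_inj]). *)


(** * Primitives of integrable functions *)

Notation leb := (@lebesgue_measure _).
Notation intg D f := (leb.-integrable D (EFin \o f)).

(** Opaque to unification, so that rewriting does not depend on the structure
    with which the Lebesgue measure is presented. *)
Definition lint {R : realType} (D : set R) (f : R -> R) : R :=
  \int[leb]_(t in D) f t.

Section integrals.
Context {R : realType}.
Implicit Types (D : set R) (f g : R -> R) (x y z : R).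

Lemma itv_ccP x y t : (`[x, y]%classic : set R) t <-> x <= t <= y.
Proof. by rewrite /= in_itv. Qed.

Lemma intg_meas D f : intg D f -> measurable_fun D f.
Proof. by move/integrableP => [/measurable_EFinP]. Qed.

Lemma intg_sub D D' f : measurable D -> measurable D' -> D' `<=` D ->
  intg D f -> intg D' f.
Proof. by move=> mD mD' sD; apply: integrableS. Qed.

Lemma intg_itvS x y x' y' f : x <= x' -> y' <= y ->
  intg `[x, y] f -> intg `[x', y'] f.
Proof.
move=> xx yy; apply: intg_sub => //.
by move=> t /itv_ccP/andP[a b]; apply/itv_ccP; rewrite (le_trans xx a) (le_trans b yy).
Qed.

Lemma intg_ext D f g : {in D, f =1 g} -> measurable D -> intg D f -> intg D g.
Proof.
by move=> fg mD; apply: eq_integrable => // t tD; rewrite /= fg.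
Qed.

Lemma intg_le D f g : measurable D -> measurable_fun D f ->
  (forall t, D t -> `|f t| <= g t) -> intg D g -> intg D f.
Proof.
move=> mD mf fg; apply: le_integrable => //; first exact/measurable_EFinP.
by move=> t Dt; rewrite /= lee_fin (le_trans (fg _ Dt))// ler_norm.
Qed.

Lemma intg_mul D f g (M : R) : measurable D -> measurable_fun D g ->
  (forall t, D t -> `|g t| <= M) -> intg D f -> intg D (fun t => g t * f t).
Proof.
move=> mD mg gM fi.
have := @integrableMr _ _ R leb D mD g (EFin \o f) mg.
move=> /(_ _ fi); apply.
exists M; split; first exact: num_real.
by move=> k Mk t Dt /=; apply: (le_trans (gM _ Dt)); exact: ltW.
Qed.

Lemma intg_add D f g : measurable D -> intg D f -> intg D g ->
  intg D (fun t => f t + g t).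
Proof.
move=> mD fi gi; have := @integrableD _ (measurableTypeR R) R leb D mD _ _ fi gi.
by apply: eq_integrable => // t _; rewrite /= EFinD.
Qed.

Lemma intg_scale D f (k : R) : measurable D -> intg D f ->
  intg D (fun t => k * f t).
Proof.
move=> mD fi; have := @integrableZl _ (measurableTypeR R) R leb D mD k _ fi.
by apply: eq_integrable => // t _; rewrite /= EFinM.
Qed.

Lemma intg_opp D f : measurable D -> intg D f -> intg D (fun t => - f t).
Proof.
move=> mD fi; have := integrableN fi.
by apply: eq_integrable => // t _; rewrite /= EFinN.
Qed.

Lemma intg_sub2 D f g : measurable D -> intg D f -> intg D g ->
  intg D (fun t => f t - g t).
Proof.
move=> mD fi gi; have := @integrableB _ (measurableTypeR R) R leb D mD _ _ fi gi.
by apply: eq_integrable => // t _; rewrite /= EFinB.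
Qed.

Lemma intg_norm D f : measurable D -> intg D f -> intg D (fun t => `|f t|).
Proof. by move=> mD fi; exact: (integrable_norm fi). Qed.

Lemma intg_union D1 D2 f : measurable D1 -> measurable D2 ->
  intg D1 f -> intg D2 f -> intg (D1 `|` D2) f.
Proof.
move=> m1 m2 /integrableP[/measurable_EFinP f1 i1].
move=> /integrableP[/measurable_EFinP f2 i2]; apply/integrableP; split.
  by apply/measurable_EFinP/measurable_funU.
apply: le_lt_trans (_ : (\int[leb]_(x in D1) `|(EFin \o f) x| +
   \int[leb]_(x in D2) `|(EFin \o f) x|)%E < +oo)%E; last exact: lte_add_pinfty.
have -> : D1 `|` D2 = D1 `|` (D2 `\` D1).
  by rewrite setDE setUIr setUCr setIT.
rewrite ge0_integral_setU//=.
- apply: leeD => //; apply: ge0_subset_integral => //.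
  + exact: measurableD.
  + by apply/measurable_EFinP; apply: measurableT_comp.
- exact: measurableD.
- apply/measurable_EFinP; apply: measurableT_comp => //; apply/measurable_funU => //.
    exact: measurableD.
  by split => //; apply: measurable_funS f2.
- by rewrite disj_set2E; apply/eqP; rewrite setDIK.
Qed.

Lemma intg_join x y z f : x <= y -> y <= z ->
  intg `[x, y] f -> intg `[y, z] f -> intg `[x, z] f.
Proof.
move=> xy yz f1 f2; apply: intg_sub (intg_union _ _ f1 f2) => //.
  exact: measurableU.
move=> t /itv_ccP/andP[a b].
by have [h|h] := leP t y; [left|right]; apply/itv_ccP; rewrite ?a ?h ?b// ltW.
Qed.

Lemma int_split x y z f : x <= y -> y <= z -> intg `[x, z] f ->
  lint `[x, z] f =
  lint `[x, y] f + lint `[y, z] f.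
Proof.
move=> xy yz fi; rewrite /lint.
rewrite -(@Rintegral_itv_obnd_cbnd _ y (BRight z)); last first.
  apply: intg_sub fi => //; apply: subset_itvr; rewrite bnd_simp//.
rewrite -(@Rintegral_itvB _ f (BLeft x) (BRight z) y)// ?bnd_simp//; last first.
by rewrite addrC subrK.
Qed.

Lemma int_pt x f : lint `[x, x] f = 0.
Proof. by rewrite /lint set_itv1 Rintegral_set1. Qed.

Lemma intg_pt x f : intg `[x, x] f.
Proof.
rewrite set_itv1; apply: null_set_integrable => //; last exact: lebesgue_measure_set1.
- exact/measurable_EFinP/measurable_fun_set1.
Qed.

Lemma intg_cst x y (c : R) : intg `[x, y] (fun _ => c).
Proof.
apply: continuous_compact_integrable; first exact: segment_compact.
by apply: continuous_subspaceT => ?; exact: cst_continuous.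
Qed.

Lemma leb_cc x y : x <= y ->
  (leb : {measure set (measurableTypeR R) -> \bar R}) `[x, y]%classic =
  (y - x)%:E.
Proof.
move=> xy; rewrite [LHS](lebesgue_measure_itv `[x, y])/= lte_fin.
move: xy; rewrite le_eqVlt => /orP[/eqP ->|->//].
by rewrite ltxx subrr.
Qed.

Lemma int_cst x y (c : R) : x <= y -> lint `[x, y] (fun t => c) = c * (y - x).
Proof.
by move=> xy; rewrite /lint Rintegral_cst// leb_cc.
Qed.

Lemma int_add D f g : measurable D -> intg D f -> intg D g ->
  lint D (fun t => f t + g t) = lint D f + lint D g.
Proof. by move=> mD fi gi; exact: (@RintegralD _ (measurableTypeR R) R leb D f g mD fi gi). Qed.

Lemma int_scale D f (k : R) : measurable D -> intg D f ->
  lint D (fun t => k * f t) = k * lint D f.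
Proof. by move=> mD fi; exact: (@RintegralZl _ (measurableTypeR R) R leb D f k mD fi). Qed.

Lemma int_opp D f : measurable D -> intg D f ->
  lint D (fun t => - f t) = - lint D f.
Proof.
move=> mD fi; rewrite -mulN1r -int_scale//.
by apply: eq_Rintegral => t _; rewrite mulN1r.
Qed.

Lemma int_sub D f g : measurable D -> intg D f -> intg D g ->
  lint D (fun t => f t - g t) = lint D f - lint D g.
Proof. by move=> mD fi gi; exact: (@RintegralB _ (measurableTypeR R) R leb D f g mD fi gi). Qed.

Lemma int_ge0 D f : (forall t, D t -> 0 <= f t) -> 0 <= lint D f.
Proof. by move=> H; exact: (@Rintegral_ge0 _ (measurableTypeR R) R leb D f H). Qed.

Lemma int_le D f g : measurable D -> intg D f -> intg D g ->
  (forall t, D t -> f t <= g t) -> lint D f <= lint D g.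
Proof. by move=> mD fi gi; exact: (@le_Rintegral _ (measurableTypeR R) R leb D f g mD fi gi). Qed.

Lemma int_le_norm D f : measurable D -> intg D f ->
  `|lint D f| <= lint D (fun t => `|f t|).
Proof. by move=> mD fi; exact: (@le_normr_Rintegral _ (measurableTypeR R) R leb D f mD fi). Qed.

Lemma int_norm_le D f g : measurable D -> intg D f -> intg D g ->
  (forall t, D t -> `|f t| <= g t) ->
  `|lint D f| <= lint D g.
Proof.
move=> mD fi gi fg; apply: le_trans (int_le_norm _ _) _ => //.
by apply: int_le => //; exact: intg_norm.
Qed.

Lemma int_norm_le_cst x y f (M : R) : x <= y -> intg `[x, y] f ->
  (forall t, x <= t <= y -> `|f t| <= M) ->
  `|lint `[x, y] f| <= M * (y - x).
Proof.
move=> xy fi fM; rewrite -int_cst//; apply: int_norm_le => //; exact: intg_cst.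
Qed.

Lemma int_eq D f g : (forall t, D t -> f t = g t) ->
  lint D f = lint D g.
Proof. by move=> fg; apply: eq_Rintegral => t /set_mem; exact: fg. Qed.

Lemma int_small x y f (e : R) : intg `[x, y] f -> 0 < e ->
  exists2 d : R, 0 < d & forall s t, x <= s -> s <= t -> t <= y -> t - s < d ->
    lint `[s, t] (fun r => `|f r|) < e.
Proof.
move=> fi e0.
have fiT : intg setT (f \_ `[x, y]).
  by rewrite -restrict_EFin; apply/integrable_restrict => //; rewrite setTI.
have [d [d0 H]] := integral_normr_continuous fiT e0.
exists d => // s t xs st ty std.
have := H `[s, t]%classic; rewrite leb_cc// lte_fin std.
move=> /(_ (measurable_itv _) isT); apply: le_lt_trans.
rewrite le_eqVlt; apply/orP; left; apply/eqP; apply: int_eq => r /itv_ccP/andP[a b].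
rewrite patchE ifT//; apply/mem_set/itv_ccP.
by rewrite (le_trans xs a) (le_trans b ty).
Qed.

End integrals.

(** Absolute continuity with prescribed derivative, in integrated form. *)
Record prim {R : realType} (D : set R) (F f : R -> R) : Prop := Prim {
  primE : forall x y, D x -> D y -> x <= y ->
    intg `[x, y] f /\ F y - F x = lint `[x, y] f }.

Coercion primE : prim >-> Funclass.

Section primitives.
Context {R : realType}.
Implicit Types (D : set R) (F G f g : R -> R) (x y z e : R).

Lemma prim_sub D D' F f : D' `<=` D -> prim D F f -> prim D' F f.
Proof. by move=> sD pF; split=> x y /sD Dx /sD Dy; exact: pF. Qed.

Lemma prim_ext D F F' f f' : is_interval D -> prim D F f ->
  (forall t, D t -> F t = F' t) -> (forall t, D t -> f t = f' t) ->
  prim D F' f'.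
Proof.
move=> iD pF eF ef; split=> x y Dx Dy xy; have [i e] := pF x y Dx Dy xy.
have eq t : `[x, y]%classic t -> f t = f' t.
  by move=> /itv_ccP txy; apply/ef/(iD x y).
split; first by apply: intg_ext i => // t /set_mem/eq.
by rewrite -(int_eq eq) -e !eF.
Qed.

Lemma prim_lin D F G f g (a b : R) : prim D F f -> prim D G g ->
  prim D (fun t => a * F t + b * G t) (fun t => a * f t + b * g t).
Proof.
move=> pF pG; split=> x y Dx Dy xy.
have [iF eF] := pF x y Dx Dy xy; have [iG eG] := pG x y Dx Dy xy.
split; first by apply: intg_add => //; exact: intg_scale.
rewrite int_add//; [|exact: intg_scale..].
by rewrite !int_scale// -eF -eG; ring.
Qed.

Lemma prim_cst D (c : R) : prim D (fun=> c) (fun=> 0).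
Proof.
split=> x y _ _ xy; split; first exact: intg_cst.
by rewrite int_cst// mul0r subrr.
Qed.

Lemma prim_const0 D F x y : prim D F (fun=> 0) -> D x -> D y -> F x = F y.
Proof.
move=> pF; wlog xy : x y / x <= y.
  by move=> H Dx Dy; case: (leP x y) => [|/ltW] xy; [|symmetry]; exact: H.
move=> Dx Dy; have [_] := pF x y Dx Dy xy.
by rewrite int_cst// mul0r => /eqP; rewrite subr_eq0 eq_sym => /eqP.
Qed.

Lemma prim_glue D F f c : D c -> is_interval D ->
  prim (D `&` [set t | t <= c]) F f -> prim (D `&` [set t | c <= t]) F f ->
  prim D F f.
Proof.
move=> Dc iD p1 p2; split=> x y Dx Dy xy.
have [yc|cy] := leP y c; first by apply: p1 => //; split => //=; exact: le_trans yc.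
have [xc|cx] := leP x c; last first.
  by apply: p2 => //; split => //=; exact: ltW.
have [i1 e1] : intg `[x, c] f /\ F c - F x = lint `[x, c] f.
  by apply: p1 => //; split => //=.
have [i2 e2] : intg `[c, y] f /\ F y - F c = lint `[c, y] f.
  by apply: p2 => //; [split => /=|split => //=|] => //; exact: ltW.
have i : intg `[x, y] f by apply: intg_join i1 i2 => //; exact: ltW.
split; first exact: i.
by rewrite (int_split xc (ltW cy) i) -e1 -e2; ring.
Qed.

Lemma prim_near D F f x e : prim D F f -> D x -> 0 < e ->
  exists2 d : R, 0 < d & forall y, D y -> `|y - x| < d -> `|F y - F x| < e.
Proof.
move=> pF Dx e0.
have [d1 d1_0 H1] : exists2 d : R, 0 < d &
    forall y, D y -> x <= y -> y - x < d -> `|F y - F x| < e.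
  have [[y [Dy xy]]|no] := pselect (exists y, D y /\ x < y); last first.
    exists 1 => // y Dy; rewrite le_eqVlt => /orP[/eqP <-|xy _].
      by rewrite !subrr normr0.
    by exfalso; apply: no; exists y.
  have [i _] := pF _ _ Dx Dy (ltW xy).
  have [d d0 H] := int_small i e0.
  exists (Num.min d (y - x)); first by rewrite lt_min d0 subr_gt0.
  move=> z Dz xz; rewrite lt_min => /andP[zd]; rewrite ltrD2r => zy.
  have [i' ->] := pF _ _ Dx Dz xz.
  apply: le_lt_trans (int_le_norm _ i') _ => //.
  by apply: H => //; exact: ltW.
have [d2 d2_0 H2] : exists2 d : R, 0 < d &
    forall y, D y -> y <= x -> x - y < d -> `|F y - F x| < e.
  have [[y [Dy xy]]|no] := pselect (exists y, D y /\ y < x); last first.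
    exists 1 => // y Dy; rewrite le_eqVlt => /orP[/eqP ->|xy _].
      by rewrite !subrr normr0.
    by exfalso; apply: no; exists y.
  have [i _] := pF _ _ Dy Dx (ltW xy).
  have [d d0 H] := int_small i e0.
  exists (Num.min d (x - y)); first by rewrite lt_min d0 subr_gt0.
  move=> z Dz xz; rewrite lt_min => /andP[zd]; rewrite ltrD2l ltrN2 => zy.
  have [i' eF] := pF _ _ Dz Dx xz.
  rewrite distrC eF.
  apply: le_lt_trans (int_le_norm _ i') _ => //.
  by apply: H => //; exact: ltW.
exists (Num.min d1 d2); first by rewrite lt_min d1_0.
move=> y Dy; rewrite lt_min => /andP[y1 y2].
have [xy|/ltW yx] := leP x y.
  by apply: H1 => //; rewrite (le_lt_trans (ler_norm _)).
by apply: H2 => //; rewrite (le_lt_trans (ler_norm _))// distrC.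
Qed.

Lemma within_contP D F :
  (forall x e, D x -> 0 < e -> exists2 d : R, 0 < d &
    forall y, D y -> `|y - x| < d -> `|F y - F x| < e) <->
  {within D, continuous F}.
Proof.
split => [H|cF].
  apply/subspace_continuousP => x Dx.
  apply/cvgrPdist_lt => e e0.
  have [d d0 Hd] := H x e Dx e0.
  rewrite near_withinE; apply/nbhs_ballP; exists d => //= y.
  by rewrite /ball/= distrC => yd Dy; rewrite distrC; exact: Hd.
move=> x e Dx e0.
have /subspace_continuousP/(_ x Dx)/cvgrPdist_lt/(_ e e0) := cF.
rewrite near_withinE => /nbhs_ballP[d d0 Hd]; exists d => // y Dy yd.
by rewrite distrC; apply: Hd => //; rewrite /ball/= distrC.
Qed.

Lemma prim_cont D F f : prim D F f -> {within D, continuous F}.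
Proof. by move=> pF; apply/within_contP => x e; exact: prim_near pF. Qed.

Lemma prim_meas D F f : measurable D -> prim D F f -> measurable_fun D F.
Proof.
move=> mD /prim_cont cF; apply: subspace_continuous_measurable_fun => //.
Qed.

Lemma prim_bound D F f x y t : is_interval D -> prim D F f -> D x -> D y ->
  x <= t <= y -> `|F t - F x| <= lint `[x, y] (fun r => `|f r|).
Proof.
move=> iD pF Dx Dy txy; have /andP[xt ty] := txy; have xy := le_trans xt ty.
have Dt : D t by exact: (iD x y).
have [i _] := pF _ _ Dx Dy xy.
have [i' ->] := pF _ _ Dx Dt xt.
apply: le_trans (int_le_norm _ i') _ => //.
rewrite (int_split xt ty (intg_norm _ i))//.
by rewrite lerDl int_ge0.
Qed.

End primitives.

Section prim_product.
Context {R : realType}.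
Variables (D : set R) (F G f g : R -> R).
Hypotheses (iD : is_interval D) (pF : prim D F f) (pG : prim D G g).

Let meas_cc (H h : R -> R) (x y : R) : prim D H h -> D x -> D y ->
  measurable_fun `[x, y] H.
Proof.
move=> pH Dx Dy; apply: prim_meas => //; apply: prim_sub pH.
by move=> t /itv_ccP; exact: iD.
Qed.

Let bounded_cc (H h : R -> R) (x y : R) : prim D H h -> D x -> D y ->
  exists M : R, forall t, `[x, y]%classic t -> `|H t| <= M.
Proof.
move=> pH Dx Dy; exists (`|H x| + lint `[x, y] (fun t => `|h t|)) => t /itv_ccP txy.
rewrite -[H t](subrK (H x)) addrC (le_trans (ler_normD _ _))// lerD2l.
exact: prim_bound pH Dx Dy txy.
Qed.

Let product_int (x y : R) : D x -> D y -> x <= y ->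
  intg `[x, y] (fun t => f t * G t + F t * g t).
Proof.
move=> Dx Dy xy.
have [iF _] := pF _ _ Dx Dy xy; have [iG _] := pG _ _ Dx Dy xy.
have [MF bF] := bounded_cc pF Dx Dy; have [MG bG] := bounded_cc pG Dx Dy.
apply: intg_add => //.
  apply: (@intg_ext _ _ (fun t => G t * f t)) => //.
    by move=> t _; rewrite mulrC.
  by apply: (intg_mul _ _ bG) => //; exact: meas_cc pG Dx Dy.
by apply: (intg_mul _ _ bF) => //; exact: meas_cc pF Dx Dy.
Qed.

Let defect (x y : R) : R := F y * G y - F x * G x -
  lint `[x, y] (fun t => f t * G t + F t * g t).

Let mass (x y : R) : R := lint `[x, y] (fun t => `|f t| + `|g t|).

Let mass_int (x y : R) : D x -> D y -> x <= y ->
  intg `[x, y] (fun t => `|f t| + `|g t|).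
Proof.
move=> Dx Dy xy.
have [iF _] := pF _ _ Dx Dy xy; have [iG _] := pG _ _ Dx Dy xy.
by apply: intg_add => //; exact: intg_norm.
Qed.

Let defect_short (x y e : R) : D x -> D y -> x <= y ->
  (forall t, x <= t <= y -> `|F t - F x| <= e /\ `|G y - G t| <= e) ->
  `|defect x y| <= e * mass x y.
Proof.
move=> Dx Dy xy osc.
have [iF eF] := pF _ _ Dx Dy xy; have [iG eG] := pG _ _ Dx Dy xy.
have ip := product_int Dx Dy xy.
have -> : defect x y = lint `[x, y] (fun t => f t * (G y - G t) + (F x - F t) * g t).
  rewrite /defect (_ : F y * G y - F x * G x =
    G y * lint `[x, y] f + F x * lint `[x, y] g); last by rewrite -eF -eG; ring.
  rewrite -!int_scale// -int_add//; [|exact: intg_scale..].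
  rewrite -int_sub//; last by apply: intg_add => //; exact: intg_scale.
  by apply: int_eq => t _; ring.
rewrite -int_scale//; last exact: mass_int.
apply: int_norm_le => //.
- apply: (@intg_ext _ _ (fun t => (G y * f t + F x * g t) - (f t * G t + F t * g t))) => //.
    by move=> t _; ring.
  by apply: intg_sub2 => //; apply: intg_add => //; exact: intg_scale.
- by apply: intg_scale => //; exact: mass_int.
move=> t /itv_ccP/osc[h1 h2].
apply: le_trans (ler_normD _ _) _; rewrite !normrM mulrDr lerD//.
  by rewrite mulrC ler_wpM2r.
by rewrite distrC ler_wpM2r.
Qed.

Let defectD (x y z : R) : D x -> D z -> x <= y -> y <= z ->
  defect x z = defect x y + defect y z.
Proof.
move=> Dx Dz xy yz; rewrite /defect.
rewrite (int_split xy yz); last by apply: product_int => //; exact: le_trans yz.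
by ring.
Qed.

Let massD (x y z : R) : D x -> D z -> x <= y -> y <= z ->
  mass x z = mass x y + mass y z.
Proof.
move=> Dx Dz xy yz; rewrite /mass (int_split xy yz)//.
by apply: mass_int => //; exact: le_trans yz.
Qed.

Let defect_le (e x y : R) : 0 < e -> D x -> D y -> x <= y ->
  `|defect x y| <= e * mass x y.
Proof.
move=> e0 Dx Dy xy.
have [iF _] := pF _ _ Dx Dy xy; have [iG _] := pG _ _ Dx Dy xy.
have [d d0 osc] : exists2 d : R, 0 < d & forall s t, x <= s -> s <= t ->
    t <= y -> t - s < d -> `|F t - F s| <= e /\ `|G t - G s| <= e.
  have [d1 d1_0 H1] := int_small iF e0; have [d2 d2_0 H2] := int_small iG e0.
  exists (Num.min d1 d2); first by rewrite lt_min d1_0.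
  move=> s t xs st ty; rewrite lt_min => /andP[l1 l2].
  have Ds : D s by apply: (iD Dx Dy); rewrite xs (le_trans st ty).
  have Dt : D t by apply: (iD Dx Dy); rewrite ty (le_trans xs st).
  have [iF' ->] := pF _ _ Ds Dt st; have [iG' ->] := pG _ _ Ds Dt st; split.
    by apply: le_trans (int_le_norm _ iF') _ => //; apply/ltW/H1.
  by apply: le_trans (int_le_norm _ iG') _ => //; apply/ltW/H2.
have d20 : 0 < d / 2 by rewrite divr_gt0.
have short s t : x <= s -> s <= t -> t <= y -> t - s <= d / 2 ->
    `|defect s t| <= e * mass s t.
  move=> xs st ty std.
  apply: defect_short => //.
  - by apply: (iD Dx Dy); rewrite xs (le_trans st ty).
  - by apply: (iD Dx Dy); rewrite ty (le_trans xs st).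
  move=> r /andP[sr rt]; split.
    by apply: (osc s r _ _ _ _).1 => //; lra.
  by apply: (osc r t _ _ _ _).2 => //; lra.
have H n : forall s, x <= s -> s <= y -> y - s <= n%:R * (d / 2) ->
    `|defect s y| <= e * mass s y.
  elim: n => [|n IHn] s xs sy ys.
    by apply: short => //; rewrite (le_trans ys)// mul0r ltW.
  have [sm|lg] := leP (y - s) (d / 2); first exact: short.
  have Ds : D s by apply: (iD Dx Dy); rewrite xs sy.
  have s1 : s <= s + d / 2 by rewrite lerDl ltW.
  have s2 : s + d / 2 <= y by rewrite -lerBrDl ltW.
  rewrite (@defectD s (s + d / 2) y)// (@massD s (s + d / 2) y)// mulrDr.
  apply: le_trans (ler_normD _ _) _; apply: lerD.
    by apply: short => //; rewrite addrC addKr.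
  apply: IHn => //; first exact: le_trans s1.
  by move: ys; rewrite -natr1 mulrDl mul1r; lra.
apply: (H (Num.truncn ((y - x) / (d / 2))).+1) => //.
rewrite -ler_pdivrMr//; apply/ltW/truncnS_gt.
Qed.

(** The product rule. Over a short segment the defect of the product formula
    is at most the oscillation of [F] and [G] times the mass of [|f| + |g|];
    these bounds add up along a subdivision, so the total defect is below any
    positive multiple of the total mass. *)
Lemma prim_mul : prim D (fun t => F t * G t) (fun t => f t * G t + F t * g t).
Proof.
split=> x y Dx Dy xy; split; first exact: product_int.
apply/eqP; rewrite -subr_eq0 -normr_le0; apply/ler_addgt0Pl => e e0.
have m0 : 0 <= mass x y by apply: int_ge0 => t _; rewrite addr_ge0.
have k0 : 0 < e / (1 + mass x y) by rewrite divr_gt0// ltr_wpDr.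
rewrite addr0 (le_trans (defect_le k0 Dx Dy xy))//.
by rewrite mulrAC ler_pdivrMr ?ltr_wpDr// ler_pM2l// lerDr.
Qed.

End prim_product.

Section prim_more.
Context {R : realType}.
Implicit Types (D : set R) (F G f g : R -> R) (x y z e : R).

(** Passing to the limit in the integral form asks for uniform convergence of
    the functions and of their derivatives only. *)
Lemma prim_limit D (F_ f_ : nat -> R -> R) F f (C : R) : is_interval D ->
  (forall n, prim D (F_ n) (f_ n)) ->
  (forall x y, D x -> D y -> measurable_fun `[x, y] f) ->
  (forall n t, D t -> `|F_ n t - F t| <= C / 2 ^+ n) ->
  (forall n t, D t -> `|f_ n t - f t| <= C / 2 ^+ n) -> prim D F f.
Proof.
move=> iD pF mf cF cf; split=> x y Dx Dy xy.
have Dt t : `[x, y]%classic t -> D t by move=> /itv_ccP; exact: iD.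
have [i0 _] := pF 0%N x y Dx Dy xy.
have fi : intg `[x, y] f.
  apply: (@intg_ext _ _ (fun t => f_ 0%N t - (f_ 0%N t - f t))) => //.
    by move=> t _; ring.
  apply: intg_sub2 => //; apply: intg_le (intg_cst x y C) => //.
    by apply: measurable_funB; [exact: intg_meas|exact: mf].
  by move=> t /Dt/(cf 0%N); rewrite expr0 divr1.
split => //.
have C0 : 0 <= C by have := cF 0%N x Dx; rewrite expr0 divr1; exact: le_trans.
apply/eqP; rewrite -subr_eq0 -normr_le0; apply/ler_addgt0Pl => e e0.
rewrite addr0.
pose K := C * (2 + (y - x)).
have K0 : 0 <= K by rewrite mulr_ge0// addr_ge0// subr_ge0.
have H n : `|F y - F x - lint `[x, y] f| <= K / 2 ^+ n.
  have [i e1] := pF n x y Dx Dy xy.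
  have -> : F y - F x - lint `[x, y] f = (F_ n x - F x) - (F_ n y - F y) +
      (lint `[x, y] (fun t => f_ n t - f t)) by rewrite int_sub// -e1; ring.
  apply: le_trans (ler_normD _ _) _.
  apply: le_trans (lerD (ler_normB _ _) (int_norm_le_cst xy (intg_sub2 _ i fi) _)) _ => //.
    by move=> t txy; apply: cf; apply: Dt; apply/itv_ccP.
  apply: le_trans (lerD (lerD (cF _ _ Dx) (cF _ _ Dy)) (lexx _)) _.
  by rewrite /K le_eqVlt; apply/orP; left; apply/eqP; ring.
pose n := (Num.truncn (K / e)).+1.
apply: le_trans (H n) _.
rewrite ler_pdivrMr ?exprn_gt0// mulrC -ler_pdivrMr//.
apply: le_trans (ltW (truncnS_gt _)) _.
by rewrite -natrX ler_nat; apply/ltnW/ltn_expl.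
Qed.

End prim_more.

(** * Functions with vanishing weak derivative *)

Section test_functions.
Context {R : realType}.
Implicit Types (d psi phi : R -> R) (x y p q e s t : R).

Lemma lint_supp (D D' : set R) (h : R -> R) : D' `<=` D ->
  (forall t, D t -> ~ D' t -> h t = 0) -> lint D h = lint D' h.
Proof.
move=> sD h0; rewrite /lint Rintegral_mkcond [RHS]Rintegral_mkcond.
congr (Rintegral _ _ _); apply/funext => t; rewrite /patch.
case: ifPn => [/set_mem Dt|nDt]; case: ifPn => [//|nD't].
  by apply: h0 => // /mem_set; apply/negP.
  by move=> /set_mem/sD/mem_set; rewrite (negbTE nDt).
by [].
Qed.

Lemma int_zero (D : set R) (h : R -> R) : (forall t, D t -> h t = 0) ->
  lint D h = 0.
Proof.
by move=> h0; rewrite (int_eq h0) /lint /Rintegral integral0_eq.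
Qed.

Lemma primitive_test (I : set R) psi p q : is_interval I -> I p -> I q ->
  p <= q -> continuous psi -> (forall t, ~ (p < t < q) -> psi t = 0) ->
  lint `[p, q] psi = 0 ->
  exists2 phi, test_function I phi & derive1 phi = psi.
Proof.
move=> iI Ip Iq pq cpsi psi0 mean0.
have ci x y : intg `[x, y] psi.
  apply: continuous_compact_integrable; first exact: segment_compact.
  exact: continuous_subspaceT.
pose phi t := lint `[p - 1, t] psi.
have psi_l t : t < p -> psi t = 0.
  by move=> tp; apply: psi0; rewrite [p < t]ltNge (ltW tp).
have psi_r t : q <= t -> psi t = 0.
  by move=> tp; apply: psi0; rewrite [t < q]ltNge tp andbF.
have phi_l t : t < p -> phi t = 0.
  move=> tp; apply: int_zero => r /itv_ccP/andP[_ rt].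
  by apply: psi_l; exact: le_lt_trans tp.
have phi_r t : q < t -> phi t = 0.
  move=> qt; have p1 : p - 1 <= p by lra.
  rewrite /phi (@int_split _ _ p)// ?(le_trans pq (ltW qt))//.
  rewrite (@int_split _ p q t)// ?ltW// mean0 add0r.
  rewrite [X in _ + X]int_zero => [|r /itv_ccP/andP[/psi_r]//].
  rewrite addr0; apply: int_zero => r /itv_ccP/andP[_ rp].
  by apply: psi0; rewrite [p < r]ltNge rp.
have D t : derivable phi t 1 /\ derive1 phi t = psi t.
  have [tp|pt] := ltP (p - 1) t.
    apply: (@continuous_FTC1_closed _ psi (p - 1) t (t + 1)) => //.
    - by rewrite ltrDl.
    - exact: cpsi.
  have tp : t < p by lra.
  have E : \forall y \near t, phi y = 0.
    near=> y; apply: phi_l; near: y; exact: lt_nbhsl.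
  have -> : psi t = 0 by exact: psi_l.
  have h : is_derive t (1:R) phi 0.
    apply: (@near_eq_is_derive _ _ _ (cst 0)); rewrite ?oner_eq0//.
    by near=> y; rewrite /cst; symmetry; near: y.
  by split; [exact: ex_derive|rewrite derive1E derive_val].
have D1 : derive1 phi = psi by apply/funext => t; exact: (D t).2.
exists phi => //; split.
- by move=> t; exact: (D t).1.
- by rewrite D1.
exists `[p, q]%classic; split.
- exact: segment_compact.
- by move=> t /itv_ccP; exact: iI.
move=> t nt; have [/phi_l//|pt] := ltP t p; have [/phi_r//|tq] := ltP q t.
by exfalso; apply: nt; apply/itv_ccP; rewrite pt.
Unshelve. all: by end_near. Qed.

End test_functions.

Definition clamp {R : realType} (s : R) : R := (1 + `|s| - `|s - 1|) / 2.

(** A continuous cut-off, 1 on [x, y] and 0 off [x - e, y + e], affine in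
    between. Such functions have explicit integrals, and their combinations with
    mean zero are the derivatives of the test functions used below. *)
Definition trapezoid {R : realType} (e x y t : R) : R :=
  clamp ((t - x) / e + 1) - clamp ((t - y) / e).

Section trapezoid.
Context {R : realType}.
Implicit Types (x y e s t : R).

Lemma clamp0 s : s <= 0 -> clamp s = 0.
Proof.
move=> s0; rewrite /clamp ler0_norm// ler0_norm; last by lra.
by field.
Qed.

Lemma clamp1 s : 1 <= s -> clamp s = 1.
Proof.
move=> s1; rewrite /clamp ger0_norm; last lra.
by rewrite ger0_norm; [field|lra].
Qed.

Lemma clamp_mid s : 0 <= s -> s <= 1 -> clamp s = s.
Proof.
move=> s0 s1; rewrite /clamp ger0_norm//.
by rewrite ler0_norm; [field|lra].
Qed.

Lemma clamp_range s : 0 <= clamp s <= 1.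
Proof.
have [s0|/ltW s0] := leP s 0; first by rewrite clamp0// lexx ler01.
have [s1|/ltW s1] := leP s 1; first by rewrite clamp_mid// s0.
by rewrite clamp1// lexx ler01.
Qed.

Lemma clamp_homo s t : s <= t -> clamp s <= clamp t.
Proof.
move=> st; have [s0|/ltW s0] := leP s 0.
  by rewrite clamp0//; case/andP: (clamp_range t).
have [t1|/ltW t1] := leP t 1; last first.
  by rewrite (clamp1 t1); case/andP: (clamp_range s).
by rewrite !clamp_mid// ?(le_trans s0)// (le_trans st).
Qed.

Lemma clamp_cont : continuous (@clamp R).
Proof.
move=> s; rewrite /clamp.
apply: cvgMl; apply: cvgB.
  by apply: cvgD; [exact: cvg_cst|exact: cvg_norm].
by apply: cvg_norm; apply: cvgB; [exact: cvg_id|exact: cvg_cst].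
Qed.

Lemma trapezoid_cont e x y : continuous (trapezoid e x y).
Proof.
move=> t; rewrite /trapezoid; apply: cvgB; (apply: cvg_comp; last exact: clamp_cont).
  apply: cvgD; last exact: cvg_cst.
  by apply: cvgMl; apply: cvgB; [exact: cvg_id|exact: cvg_cst].
by apply: cvgMl; apply: cvgB; [exact: cvg_id|exact: cvg_cst].
Qed.

Lemma trapezoid1 e x y t : 0 < e -> x <= t <= y -> trapezoid e x y t = 1.
Proof.
move=> e0 /andP[xt ty]; rewrite /trapezoid clamp1 ?clamp0 ?subr0//.
  by rewrite pmulr_lle0 ?invr_gt0// subr_le0.
by rewrite lerDr divr_ge0 ?subr_ge0// ltW.
Qed.

Lemma trapezoid0 e x y t : 0 < e -> x <= y -> ~ (x - e < t < y + e) ->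
  trapezoid e x y t = 0.
Proof.
move=> e0 xy nt; rewrite /trapezoid.
have [tx|tx] := leP t (x - e).
  rewrite !clamp0 ?subrr//.
    by rewrite pmulr_lle0 ?invr_gt0// subr_le0; lra.
  by rewrite -(mulfV (lt0r_neq0 e0)) -mulrDl pmulr_lle0 ?invr_gt0//; lra.
have [ty|ty] := ltP t (y + e); first by exfalso; apply: nt; rewrite tx.
have ey : 1 <= (t - y) / e by rewrite ler_pdivlMr// mul1r; lra.
rewrite !clamp1 ?subrr// (le_trans ey)// -[leLHS]addr0 lerD//.
by rewrite ler_pM2r ?invr_gt0//; lra.
Qed.

Lemma trapezoid_range e x y t : 0 < e -> x <= y -> 0 <= trapezoid e x y t <= 1.
Proof.
move=> e0 xy; rewrite /trapezoid; apply/andP; split.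
  rewrite subr_ge0; apply: clamp_homo; rewrite -[leLHS]addr0 lerD//.
  by rewrite ler_pM2r ?invr_gt0//; lra.
case/andP: (clamp_range ((t - y) / e)) => a _.
case/andP: (clamp_range ((t - x) / e + 1)) => _ b; lra.
Qed.

Lemma trapezoid_meas e x y (D : set R) : measurable D ->
  measurable_fun D (trapezoid e x y).
Proof.
move=> mD; apply: (@measurable_funS _ _ _ _ setT) => //.
by apply: continuous_measurable_fun; exact: trapezoid_cont.
Qed.

Lemma trapezoid_intg e x y p q (d : R -> R) : 0 < e -> x <= y ->
  intg `[p, q] d -> intg `[p, q] (fun t => d t * trapezoid e x y t).
Proof.
move=> e0 xy i; apply: (@intg_ext _ _ (fun t => trapezoid e x y t * d t)) => //.
  by move=> t _; rewrite mulrC.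
apply: (@intg_mul _ _ _ _ 1) => //; first exact: trapezoid_meas.
by move=> t _; case/andP: (trapezoid_range t e0 xy) => a b; rewrite ger0_norm.
Qed.

Lemma trapezoid_approx e x y p q (d : R -> R) : 0 < e -> x <= y ->
  p <= x - e -> y + e <= q -> intg `[p, q] d ->
  `|lint `[p, q] (fun t => d t * trapezoid e x y t) - lint `[x, y] d| <=
  lint `[x - e, x] (fun t => `|d t|) + lint `[y, y + e] (fun t => `|d t|).
Proof.
move=> e0 xy px yq i; have it := trapezoid_intg e0 xy i.
have xe : x - e <= x by lra. have ye : y <= y + e by lra.
have i1 : intg `[x - e, y + e] (fun t => d t * trapezoid e x y t).
  exact: intg_itvS it.
have -> : lint `[p, q] (fun t => d t * trapezoid e x y t) =
    lint `[x - e, y + e] (fun t => d t * trapezoid e x y t).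
  apply: lint_supp.
    by move=> t /itv_ccP/andP[a b]; apply/itv_ccP; rewrite (le_trans px a) (le_trans b yq).
  move=> t _ nt; rewrite trapezoid0 ?mulr0// => /andP[a b]; apply: nt.
  by apply/itv_ccP; rewrite !ltW.
rewrite (int_split xe (le_trans xy ye) i1).
rewrite (int_split xy ye); last exact: intg_itvS i1.
rewrite [X in _ + (X + _) - _](@int_eq _ _ _ d); last first.
  by move=> t /itv_ccP/trapezoid1 ->//; rewrite mulr1.
have id1 : intg `[x - e, x] d by apply: intg_itvS i => //; lra.
have id2 : intg `[y, y + e] d by apply: intg_itvS i => //; lra.
rewrite (_ : forall a b c : R, a + (b + c) - b = a + c)//; last by move=> *; ring.
have le_d t : `|d t * trapezoid e x y t| <= `|d t|.
  case/andP: (trapezoid_range t e0 xy) => a b.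
  by rewrite normrM (ger0_norm a) ler_piMr.
apply: le_trans (ler_normD _ _) _; apply: lerD; apply: int_norm_le => //.
- by apply: intg_itvS i1 => //; lra.
- exact: intg_norm.
- by apply: intg_itvS i1 => //; lra.
- exact: intg_norm.
Qed.

End trapezoid.

Section du_bois_reymond.
Context {R : realType}.
Variables (I : set R) (d : R -> R).
Hypotheses (oI : open I) (iI : is_interval I).
Hypothesis id : forall x y, I x -> I y -> intg `[x, y] d.
Hypothesis weak0 : forall phi, test_function I phi ->
  lint I (fun t => d t * derive1 phi t) = 0.

Let room (x : R) : I x -> exists2 e : R, 0 < e &
  forall t, x - e <= t <= x + e -> I t.
Proof.
move=> Ix; have /nbhs_ballP[e e0 He] := open_nbhs_nbhs (conj oI Ix).
exists (e / 2) => /=; first by rewrite divr_gt0.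
move=> t /andP[a b]; apply: He; rewrite /ball/= distrC ltr_norml.
have e2 : 0 < e by []. by lra.
Qed.

(* The weak equation, tested with a primitive of a mean-zero combination of two
   trapezoids. *)
Let two_trapezoids (e x y e' x' y' p q : R) : 0 < e -> x <= y -> 0 < e' ->
  x' <= y' -> I p -> I q -> p <= x - e -> y + e <= q -> p <= x' - e' ->
  y' + e' <= q ->
  lint `[p, q] (trapezoid e' x' y') *
    lint `[p, q] (fun t => d t * trapezoid e x y t) =
  lint `[p, q] (trapezoid e x y) *
    lint `[p, q] (fun t => d t * trapezoid e' x' y' t).
Proof.
move=> e0 xy e0' xy' Ip Iq px yq px' yq'.
have i1 : intg `[p, q] (fun=> 1 : R) := intg_cst p q 1.
have it : intg `[p, q] (trapezoid e x y).
  apply: intg_ext (trapezoid_intg e0 xy i1) => // t _; exact: mul1r.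
have it' : intg `[p, q] (trapezoid e' x' y').
  apply: intg_ext (trapezoid_intg e0' xy' i1) => // t _; exact: mul1r.
set m' := lint _ (trapezoid e' _ _); set m := lint _ (trapezoid e _ _).
pose psi t := m' * trapezoid e x y t - m * trapezoid e' x' y' t.
have cpsi : continuous psi.
  move=> t; apply: cvgB; apply: cvgMr; exact: trapezoid_cont.
have pq : p <= q by lra.
have psi0 t : ~ (p < t < q) -> psi t = 0.
  move=> nt; rewrite /psi !trapezoid0 ?mulr0 ?subrr//.
    by move=> /andP[a b]; apply: nt; rewrite (le_lt_trans px' a) (lt_le_trans b yq').
  by move=> /andP[a b]; apply: nt; rewrite (le_lt_trans px a) (lt_le_trans b yq).
have mean0 : lint `[p, q] psi = 0.
  rewrite /psi int_sub//; [|exact: intg_scale..].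
  by rewrite !int_scale// -/m -/m'; ring.
have [phi tphi dphi] := primitive_test iI Ip Iq pq cpsi psi0 mean0.
have := weak0 tphi; rewrite dphi.
rewrite (@lint_supp _ _ `[p, q]); last 2 first.
- by move=> t /itv_ccP; exact: iI.
- move=> t _ nt; rewrite psi0 ?mulr0// => /andP[a b].
  by apply: nt; apply/itv_ccP; rewrite !ltW.
rewrite (@int_eq _ _ _ (fun t => m' * (d t * trapezoid e x y t) -
    m * (d t * trapezoid e' x' y' t))); last by move=> t _; rewrite /psi; ring.
have Td := trapezoid_intg e0 xy (id Ip Iq).
have Td' := trapezoid_intg e0' xy' (id Ip Iq).
rewrite int_sub//; [|exact: intg_scale..].
by rewrite !int_scale// => /eqP; rewrite subr_eq0 => /eqP.
Qed.

(* Facts irrelevant to an inequality slow down linear arithmetic; those of the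
   section have to stay. *)
Ltac lean_lra := clear - I d oI iI id weak0 room two_trapezoids; lra.

(** Du Bois-Reymond: every continuous function with compact support and mean
    zero is the derivative of a test function, so that trapezoids with the same
    mass have the same integral against [d]. *)
Lemma du_bois_reymond : (exists x, I x) ->
  exists c, forall x y, I x -> I y -> x <= y -> lint `[x, y] d = c * (y - x).
Proof.
move=> [z Iz]; have [r r0 Hr] := room Iz.
pose T0 := trapezoid (r / 4) (z - r / 2) (z + r / 2).
have r40 : 0 < r / 4 by rewrite divr_gt0.
have zz : z - r / 2 <= z + r / 2 by lra.
pose m0 := lint `[z - r, z + r] T0.
pose c := lint `[z - r, z + r] (fun t => d t * T0 t) / m0.
have iT0 p q : intg `[p, q] T0.
  apply: intg_ext (trapezoid_intg r40 zz (intg_cst p q 1)) => //.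
  by move=> t _; exact: mul1r.
have m0_gt0 : 0 < m0.
  have l1 : z - r <= z - r / 2 - r / 4 by lra.
  have l2 : z + r / 2 + r / 4 <= z + r by lra.
  have := trapezoid_approx r40 zz l1 l2 (intg_cst _ _ 1).
  rewrite (@int_eq _ _ (fun t => 1 * _) T0); last by move=> t _; exact: mul1r.
  by rewrite normr1 -/m0 !int_cst ?ler_norml; lra.
exists c => x y Ix Iy xy.
have [rx rx0 Hx] := room Ix; have [ry ry0 Hy] := room Iy.
pose p := Num.min (x - rx) (z - r); pose q := Num.max (y + ry) (z + r).
have Ip : I p.
  rewrite /p; case: leP => _; [apply: Hx|apply: Hr]; lra.
have Iq : I q.
  rewrite /q; case: leP => _; [apply: Hr|apply: Hy]; lra.
have px : p <= x - rx by rewrite /p ge_min lexx.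
have pz : p <= z - r by rewrite /p ge_min lexx orbT.
have qy : y + ry <= q by rewrite /q le_max lexx.
have qz : z + r <= q by rewrite /q le_max lexx orbT.
have T0_supp (h : R -> R) : lint `[p, q] (fun t => h t * T0 t) =
    lint `[z - r, z + r] (fun t => h t * T0 t).
  apply: lint_supp => [t /itv_ccP/andP[a b]|t _ nt].
    by apply/itv_ccP; rewrite (le_trans pz a) (le_trans b qz).
  rewrite /T0 trapezoid0 ?mulr0// => /andP[a b]; apply: nt; apply/itv_ccP.
  by apply/andP; split; lra.
have key e : 0 < e -> e <= rx -> e <= ry ->
    lint `[p, q] (fun t => d t * trapezoid e x y t) =
    c * lint `[p, q] (fun t => 1 * trapezoid e x y t).
  move=> e0 ex ey.
  have f1 : p <= x - e by move: px ex; lean_lra.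
  have f2 : y + e <= q by move: qy ey; lean_lra.
  have f3 : p <= z - r / 2 - r / 4 by move: pz r0; lean_lra.
  have f4 : z + r / 2 + r / 4 <= q by move: qz r0; lean_lra.
  have := two_trapezoids e0 xy r40 zz Ip Iq f1 f2 f3 f4.
  rewrite -/T0 (T0_supp d) => H.
  have m0E : lint `[p, q] T0 = m0.
    have := T0_supp (fun=> 1).
    by rewrite (@int_eq _ `[p, q] _ T0) ?(@int_eq _ `[z - r, z + r] _ T0)//
      => t _; exact: mul1r.
  move: H; rewrite m0E => H.
  rewrite (@int_eq _ _ (fun t => 1 * _) (trapezoid e x y)); last first.
    by move=> t _; exact: mul1r.
  by rewrite /c mulrAC [X in _ = X / _]mulrC -H mulrAC divff ?mul1r// lt0r_neq0.
have ipq := id Ip Iq.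
apply/eqP; rewrite -subr_eq0 -normr_le0; apply/ler_addgt0Pl => e e0.
rewrite addr0.
have e40 : 0 < e / 4 by rewrite divr_gt0.
have [k k0 Hk] := int_small ipq e40.
have c10 : 0 < 1 + `|c| by rewrite ltr_pwDl.
pose h := Num.min (Num.min rx ry) (Num.min (k / 2) (e / 4 / (1 + `|c|))).
have h0 : 0 < h by rewrite !lt_min rx0 ry0 !divr_gt0.
have hx : h <= rx by rewrite /h !ge_min lexx.
have hy : h <= ry by rewrite /h !ge_min lexx orbT.
have hk : h <= k / 2 by rewrite /h !ge_min lexx !orbT.
have hc : h * (1 + `|c|) <= e / 4.
  by rewrite -ler_pdivlMr// /h !ge_min lexx !orbT.
have a1 : p <= x - h by move: px hx; lean_lra.
have a2 : y + h <= q by move: qy hy; lean_lra.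
have s1 : x - (x - h) < k by move: hk k0; lean_lra.
have s2 : y + h - y < k by move: hk k0; lean_lra.
have [xh yh] : x - h <= x /\ y <= y + h by move: h0; lean_lra.
have A1 : lint `[x - h, x] (fun t => `|d t|) < e / 4.
  by apply: Hk => //; exact: (le_trans xy (le_trans yh a2)).
have A2 : lint `[y, y + h] (fun t => `|d t|) < e / 4.
  by apply: Hk => //; exact: (le_trans a1 (le_trans xh xy)).
have A := trapezoid_approx h0 xy a1 a2 ipq.
have B := trapezoid_approx h0 xy a1 a2 (intg_cst p q 1).
move: A B; rewrite key// !normr1 !int_cst//; [|lra..] => A B.
set TT := lint _ (fun t => 1 * _) in A B.
have -> : lint `[x, y] d - c * (y - x) =
  - (c * TT - lint `[x, y] d) + c * (TT - 1 * (y - x)) by ring.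
apply: le_trans (ler_normD _ _) _; rewrite normrN normrM.
have B' : `|c| * `|TT - 1 * (y - x)| <= `|c| * (2 * h).
  by rewrite ler_wpM2l//; apply: le_trans B _; lean_lra.
have : `|c| * (2 * h) = 2 * (h * (1 + `|c|)) - 2 * h by ring.
move: A A1 A2 B' hc h0; lean_lra.
Qed.

End du_bois_reymond.

Section almost_everywhere.
Context {R : realType}.
Implicit Types (I D : set R) (d f g u v : R -> R) (x y z e : R).

Lemma ae_imp (P Q : R -> Prop) : (forall x, P x -> Q x) ->
  {ae @lebesgue_measure R, forall x, P x} ->
  {ae @lebesgue_measure R, forall x, Q x}.
Proof.
move=> PQ; rewrite /prop_near1 /nbhs/= /almost_everywhere.
by apply: negligibleS => x /= nQ /PQ.
Qed.

Lemma ae_and (P Q : R -> Prop) :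
  {ae @lebesgue_measure R, forall x, P x} ->
  {ae @lebesgue_measure R, forall x, Q x} ->
  {ae @lebesgue_measure R, forall x, P x /\ Q x}.
Proof.
rewrite /prop_near1 /nbhs/= /almost_everywhere => nP nQ.
have := negligibleU nP nQ; apply: negligibleS => x /= /not_andP.
by case=> h; [left|right].
Qed.

Lemma ae_all_nat (P : nat -> R -> Prop) :
  (forall n, {ae @lebesgue_measure R, forall x, P n x}) ->
  {ae @lebesgue_measure R, forall x, forall n, P n x}.
Proof.
move=> H; rewrite /prop_near1 /nbhs/= /almost_everywhere.
have : (@lebesgue_measure R).-negligible (\bigcup_n ~` [set x | P n x]).
  by apply: negligible_bigcup => n; exact: H.
by apply: negligibleS => x /= /existsNP[n nP]; exists n.
Qed.

(** Lebesgue differentiation: averages determine a function almost everywhere.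
    The interval is exhausted by segments with rational end points. *)
Lemma constant_averages I d c : open I -> is_interval I ->
  (forall x y, I x -> I y -> intg `[x, y] d) ->
  (forall x y, I x -> I y -> x <= y -> lint `[x, y] d = c * (y - x)) ->
  ae_eq leb I d (fun=> c).
Proof.
move=> oI iI id dc.
have loc p q : I p -> I q ->
    {ae @lebesgue_measure R, forall x, p < x -> x < q -> d x = c}.
  move=> Ip Iq.
  have li : locally_integrable setT (d \_ `[p, q]).
    exact: integrable_locally_restrict (id _ _ Ip Iq).
  have := lebesgue_differentiation li.
  apply: ae_imp => x Lx px xq.
  have iT : intg `[p, q] (d \_ `[p, q]).
    apply: (@intg_ext _ _ d) (id _ _ Ip Iq) => // t tI.
    by rewrite patchE tI.
  have [] := @FTC1_lebesgue_pt _ (d \_ `[p, q]) (BLeft p) x q xq iT.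
  - by rewrite (@lte_fin R).
  - exact: Lx.
  move=> _; rewrite patchE mem_set; last by apply/itv_ccP; rewrite !ltW.
  move=> <-.
  have h : is_derive x (1:R) (fun y => lint `[p, y] (d \_ `[p, q])) c.
    have : is_derive x (1:R) (fun y => c * (y - p)) c.
      by apply: is_derive_eq; rewrite /GRing.scale/=; ring.
    apply: near_eq_is_derive; rewrite ?oner_eq0//.
    near=> y.
    have py : p < y by near: y; exact: lt_nbhsr.
    have yq : y < q by near: y; exact: lt_nbhsl.
    rewrite (@int_eq _ _ _ d); last first.
      move=> t /itv_ccP/andP[pt ty]; rewrite patchE ifT//.
      by apply/mem_set/itv_ccP; rewrite pt (le_trans ty (ltW yq)).
    by rewrite dc ?ltW//; apply: (iI p q) => //; rewrite !ltW.
  by rewrite derive1E derive_val.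
pose P (n : nat) (x : R) := if unpickle n is Some (p, q) then
  I (ratr p) -> I (ratr q) -> ratr p < x -> x < ratr q -> d x = c else True.
have : {ae @lebesgue_measure R, forall x, forall n, P n x}.
  apply: ae_all_nat => n; rewrite /P; case: unpickle => [[p q]|]; last exact: aeW.
  have [Ip|nIp] := pselect (I (ratr p)); last by apply: aeW => x /nIp.
  have [Iq|nIq] := pselect (I (ratr q)); last by apply: aeW => x _ /nIq.
  by apply: ae_imp (loc _ _ Ip Iq) => x H _ _; exact: H.
apply: ae_imp => x Px Ix.
have /nbhs_ballP[e e0 He] := open_nbhs_nbhs (conj oI Ix).
have e1 : 0 < e by [].
have [p] : exists q, ratr q \in `]x - e, x[ by apply: rat_in_itvoo; lra.
rewrite in_itv/= => /andP[p1 p2].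
have [q] : exists q, ratr q \in `]x, x + e[ by apply: rat_in_itvoo; lra.
rewrite in_itv/= => /andP[q1 q2].
have := Px (pickle (p, q)); rewrite /P pickleK; apply => //.
  by apply: He; rewrite /ball/= ltr_norml; lra.
by apply: He; rewrite /ball/= ltr_norml; lra.
Unshelve. all: by end_near. Qed.

(** Nonempty open sets have positive measure. *)
Lemma ae_open_dense (P : R -> Prop) x e : 0 < e ->
  {ae @lebesgue_measure R, forall t, P t} -> exists2 t, x < t < x + e & P t.
Proof.
move=> e0 H; apply: contrapT => no.
have nx : (@lebesgue_measure R).-negligible `]x, (x + e)[%classic.
  apply: negligibleS H => t /= txe Pt; apply: no; exists t => //.
have [A [mA A0 sA]] := nx.
pose mu : {measure set (measurableTypeR R) -> \bar R} := @lebesgue_measure R.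
have : (mu (`]x, (x + e)%R[%classic : set R) <= mu A)%E.
  by apply: le_measure => //; rewrite inE//; exact: measurable_itv.
rewrite [leRHS]A0 [leLHS](lebesgue_measure_itv `]x, (x + e)[)/= lte_fin ltrDl e0.
by rewrite -EFinB addrAC subrr add0r lee_fin leNgt e0.
Qed.

Lemma closure_room I x e : closure I x -> open I -> 0 < e ->
  exists a b, [/\ a < b, forall t, a < t < b -> I t & forall t, a < t < b -> `|t - x| < e].
Proof.
move=> cIx oI e0.
have [y [Iy yx]] := cIx _ (nbhsx_ballx x e e0).
have oB : open (I `&` ball x e) by apply: openI => //; exact: ball_open.
have : (I `&` ball x e) y by [].
move=> /(conj oB)/open_nbhs_nbhs/nbhs_ballP[d d0 Hd].
exists y, (y + d); split; first by rewrite ltrDl.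
  move=> t ty; have [] // := Hd t.
  by rewrite /ball/= distrC ltr_norml; have : 0 < d by []; lra.
move=> t ty; have [] // := Hd t.
  by rewrite /ball/= distrC ltr_norml; have : 0 < d by []; lra.
by move=> _; rewrite /ball/= distrC.
Qed.

(** The points of coincidence are dense. *)
Lemma ae_cont_eq I f g : open I -> {within closure I, continuous f} ->
  {within closure I, continuous g} -> ae_eq leb I f g ->
  forall x, closure I x -> f x = g x.
Proof.
move=> oI /within_contP cf /within_contP cg fg x cx.
apply/eqP; rewrite -subr_eq0 -normr_le0; apply/ler_addgt0Pl => e e0.
rewrite addr0.
have e20 : 0 < e / 2 by rewrite divr_gt0.
have [d1 d10 H1] := cf x _ cx e20; have [d2 d20 H2] := cg x _ cx e20.
have d0 : 0 < Num.min d1 d2 by rewrite lt_min d10.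
have [a [b [ab abI abx]]] := closure_room cx oI d0.
have ba0 : 0 < b - a by rewrite subr_gt0.
have [t tab eqt] := ae_open_dense a ba0 fg.
have {}tab : a < t < b by move: tab; rewrite addrC subrK.
have It := abI _ tab; have := abx _ tab; rewrite lt_min => /andP[t1 t2].
have ct : closure I t by exact: subset_closure.
have h1 := H1 t ct t1; have h2 := H2 t ct t2; have {}eqt := eqt It.
rewrite (_ : f x - g x = (g t - g x) - (f t - f x)); last by rewrite eqt; ring.
by apply: le_trans (ler_normB _ _) _; lra.
Qed.

End almost_everywhere.

(** * Weak derivatives and primitives *)

Definition sqint {R : realType} (I : set R) (f : R -> R) : Prop :=
  measurable_fun I f /\ intg I (fun t => f t ^+ 2).

Section weak_real.
Context {R : realType}.
Variable I : set R.
Hypotheses (oI : open I) (iI : is_interval I) (I0 : exists x, I x).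
Implicit Types (u v f phi : R -> R) (x y z p q e : R).

Lemma closure_between x y z : closure I x -> closure I y -> x < z -> z < y -> I z.
Proof.
move=> cx cy xz zy.
have [a [b [ab aI ax]]] := @closure_room _ I x (z - x) cx oI ltac:(lra).
have [a' [b' [ab' aI' ax']]] := @closure_room _ I y (y - z) cy oI ltac:(lra).
have m : a < (a + b) / 2 < b by rewrite midf_lt// (midf_lt ab).2.
have m' : a' < (a' + b') / 2 < b' by rewrite midf_lt// (midf_lt ab').2.
have Im := aI _ m; have Im' := aI' _ m'.
have := ax _ m; have := ax' _ m'; rewrite !ltr_norml => /andP[l1 l2] /andP[l3 l4].
by apply: (iI Im Im'); apply/andP; split; lra.
Qed.

Lemma closure_interval : is_interval (closure I).
Proof.
move=> x y cx cy z /andP[]; rewrite le_eqVlt => /orP[/eqP <-//|xz].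
rewrite le_eqVlt => /orP[/eqP ->//|zy].
by apply: subset_closure; exact: closure_between cx cy xz zy.
Qed.

Lemma intg_closure f x y : closure I x -> closure I y ->
  intg `]x, y[ f -> intg `[x, y] f.
Proof.
move=> cx cy i; have [xy|yx] := ltP x y; last first.
  have [->|xy] := eqVneq x y; first exact: intg_pt.
  rewrite set_itv_ge ?bnd_simp -?ltNge ?lt_neqAle 1?eq_sym ?xy//.
  exact: integrable_set0.
have U : intg ([set x] `|` `]x, y[ `|` [set y]) f.
  apply: intg_union => //; first exact: measurableU.
    by apply: intg_union => //; rewrite -set_itv1; exact: intg_pt.
  by rewrite -set_itv1; exact: intg_pt.
apply: intg_sub U => //; first by apply: measurableU => //; exact: measurableU.
move=> t /itv_ccP/andP[]; rewrite le_eqVlt => /orP[/eqP <- _|xt]; first by left; left.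
rewrite le_eqVlt => /orP[/eqP ->|ty]; first by right.
by left; right; rewrite /= in_itv/= xt.
Qed.

Lemma sqint_intg f x y : sqint I f -> closure I x -> closure I y ->
  intg `[x, y] f.
Proof.
move=> [mf f2] cx cy; apply: intg_closure => //.
have sub : `]x, y[ `<=` I.
  by move=> t /=; rewrite in_itv/= => /andP[]; exact: closure_between cx cy.
apply: (@intg_le _ _ _ (fun t => 1 + f t ^+ 2)) => //.
- by apply: measurable_funS mf => //; exact: open_measurable.
- move=> t _; have [h|h] := leP `|f t| 1.
    by rewrite (le_trans h)// lerDl sqr_ge0.
  by rewrite -real_normK ?num_real// -[leLHS]add0r lerD// expr2 ler_peMr// ltW.
apply: intg_add => //.
  apply: intg_sub (intg_cst x y 1) => //.
  by move=> t /=; rewrite !in_itv/= => /andP[/ltW -> /ltW ->].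
by apply: intg_sub f2 => //; exact: open_measurable.
Qed.

Lemma prim_exists (D : set R) v z : D z ->
  (forall x y, D x -> D y -> intg `[x, y] v) ->
  exists V, prim D V v /\ V z = 0.
Proof.
move=> Dz iv.
exists (fun x => if z <= x then lint `[z, x] v else - lint `[x, z] v).
rewrite lexx int_pt; split => //; split=> x y Dx Dy xy; split; first exact: iv.
have i p q := @iv p q.
case: (leP z x) => zx; case: (leP z y) => zy.
- rewrite (int_split zx xy); [ring|exact: iv].
- by exfalso; lra.
- rewrite (int_split (ltW zx) zy); [ring|exact: iv].
- rewrite (int_split xy (ltW zy)); [ring|exact: iv].
Qed.

Lemma prim_C1 phi : (forall x, derivable phi x 1) -> continuous (derive1 phi) ->
  prim setT phi (derive1 phi).
Proof.
move=> dphi cphi; split=> x y _ _ xy.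
have i : intg `[x, y] (derive1 phi).
  apply: continuous_compact_integrable; first exact: segment_compact.
  exact: continuous_subspaceT.
split; first exact: i.
move: xy; rewrite le_eqVlt => /orP[/eqP ->|xy]; first by rewrite int_pt subrr.
have cp t : {for t, continuous phi}.
  by apply: differentiable_continuous; exact/derivable1_diffP.
have cA : {within `[x, y], continuous (derive1 phi)}.
  exact: continuous_subspaceT.
have dB : derivable_oo_LRcontinuous phi x y.
  split; first by move=> t _.
    by apply: cvg_at_right_filter; exact: cp.
  by apply: cvg_at_left_filter; exact: cp.
by rewrite /lint /Rintegral (continuous_FTC2 xy cA dB (fun _ _ => erefl)).
Qed.

Lemma open_shrink z : I z -> exists2 p, I p & p < z.
Proof.
move=> Iz; have /nbhs_ballP[e e0 He] := open_nbhs_nbhs (conj oI Iz).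
have : 0 < e by [].
exists (z - e / 2); last by lra.
by apply: He; rewrite /ball/= ltr_norml; lra.
Qed.

Lemma open_grow z : I z -> exists2 p, I p & z < p.
Proof.
move=> Iz; have /nbhs_ballP[e e0 He] := open_nbhs_nbhs (conj oI Iz).
have : 0 < e by [].
exists (z + e / 2); last by lra.
by apply: He; rewrite /ball/= ltr_norml; lra.
Qed.

Lemma test_support phi : test_function I phi ->
  exists p q, [/\ I p, I q, p <= q &
    forall t, ~ (p < t < q) -> phi t = 0 /\ derive1 phi t = 0].
Proof.
move=> [dphi cphi [K [cK KI K0]]].
have [p [q [Ip Iq pq Kpq]]] : exists p q, [/\ I p, I q, p <= q &
    forall t, K t -> p < t < q].
  have [[k Kk]|noK] := pselect (K !=set0); last first.
    have [z Iz] := I0; exists z, z; split => // t Kt.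
    by exfalso; apply: noK; exists t.
  have cid : {within K, continuous (@id R)}.
    by apply: continuous_subspaceT => x; exact: cvg_id.
  have [b /set_mem Kb bmax] := compact_EVT_max (ex_intro _ k Kk) cK cid.
  have [a /set_mem Ka amin] := compact_EVT_min (ex_intro _ k Kk) cK cid.
  have [p Ip pa] := open_shrink (KI _ Ka).
  have [q Iq bq] := open_grow (KI _ Kb).
  have ab : a <= b by apply: amin; exact/mem_set.
  exists p, q; split => //; first by lra.
  move=> t /mem_set Kt; have /= := bmax _ Kt; have /= := amin _ Kt.
  by move=> l1 l2; apply/andP; split; lra.
exists p, q; split => // t nt.
have nK s : ~ (p < s < q) -> phi s = 0.
  by move=> ns; apply: K0 => /Kpq.
split; first exact: nK.
have nKt : ~ K t by move=> /Kpq.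
have oK : open (~` K) by apply: closed_openC; apply: compact_closed => //; exact: norm_hausdorff.
have : nbhs t (~` K) by exact: open_nbhs_nbhs.
move=> nb.
have h : is_derive t (1:R) phi 0.
  apply: (@near_eq_is_derive _ _ _ (cst 0)); rewrite ?oner_eq0//.
  by near=> y; rewrite /cst K0//; near: y.
by rewrite derive1E derive_val.
Unshelve. all: by end_near. Qed.

Lemma lint_test p q (h : R -> R) : I p -> I q ->
  (forall t, ~ (p < t < q) -> h t = 0) -> lint I h = lint `[p, q] h.
Proof.
move=> Ip Iq h0; apply: lint_supp.
  by move=> t /itv_ccP; exact: iI.
move=> t _ nt; apply: h0 => /andP[a b]; apply: nt; apply/itv_ccP.
by rewrite !ltW.
Qed.

(** Integration by parts: the product with a test function is a primitive that
    vanishes at both ends of a segment carrying the support. *)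
Lemma prim_weak V v phi : prim I V v -> test_function I phi ->
  lint I (fun t => V t * derive1 phi t) = - lint I (fun t => v t * phi t).
Proof.
move=> pV tphi; have [p [q [Ip Iq pq h0]]] := test_support tphi.
have [dphi cphi _] := tphi.
have pphi : prim I phi (derive1 phi) by apply: prim_sub (prim_C1 dphi cphi).
have [ip +] := prim_mul iI pV pphi _ _ Ip Iq pq.
have [|-> _] := h0 p; first by rewrite ltxx.
have [|-> _] := h0 q; first by rewrite ltxx andbF.
rewrite !mulr0 subrr.
have [iv _] := pV _ _ Ip Iq pq.
rewrite (@lint_test p q)//; last by move=> t /h0[_ ->]; rewrite mulr0.
rewrite (@lint_test p q)//; last by move=> t /h0[-> _]; rewrite mulr0.
have cphi0 : continuous phi.
  by move=> t; apply: differentiable_continuous; exact/derivable1_diffP.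
have ivp : intg `[p, q] (fun t => v t * phi t).
  apply: (@intg_ext _ _ (fun t => phi t * v t)) => //.
    by move=> t _; rewrite mulrC.
  have [M [_ HM]] : bounded_set (phi @` `[p, q]%classic).
    apply: compact_bounded; apply: continuous_compact; last exact: segment_compact.
    exact: continuous_subspaceT.
  apply: (@intg_mul _ _ _ _ (M + 1)) => //.
    by apply: measurable_funTS; exact: continuous_measurable_fun.
  by move=> t pqt; apply: (HM (M + 1)); [rewrite ltrDl|exists t].
have iVp : intg `[p, q] (fun t => V t * derive1 phi t).
  apply: (@intg_ext _ _ (fun t => (v t * phi t + V t * derive1 phi t) - v t * phi t)) => //.
    by move=> t _; rewrite addrAC subrr add0r.
  exact: intg_sub2.
rewrite int_add// => /eqP; rewrite eq_sym addrC addr_eq0 => /eqP -> //.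
Qed.

(** The difference of [u] and a primitive of [v] has zero weak derivative, and
    is therefore constant almost everywhere. *)
Lemma weak_prim u v : (forall x y, I x -> I y -> intg `[x, y] u) ->
  (forall x y, closure I x -> closure I y -> intg `[x, y] v) ->
  (forall phi, test_function I phi ->
    lint I (fun t => u t * derive1 phi t) = - lint I (fun t => v t * phi t)) ->
  exists2 V, prim (closure I) V v & ae_eq leb I u V.
Proof.
move=> iu iv uv; have [z Iz] := I0.
have [V [pV _]] := prim_exists (subset_closure Iz) iv.
have pVI : prim I V v by apply: prim_sub pV; exact: subset_closure.
have iV x y : I x -> I y -> intg `[x, y] V.
  move=> Ix Iy; apply: continuous_compact_integrable; first exact: segment_compact.
  apply: (@prim_cont _ _ _ v); apply: prim_sub pVI.
  by move=> t /itv_ccP; exact: iI.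
have id x y : I x -> I y -> intg `[x, y] (fun t => u t - V t).
  by move=> Ix Iy; apply: intg_sub2 => //; [exact: iu|exact: iV].
have W phi : test_function I phi ->
    lint I (fun t => (u t - V t) * derive1 phi t) = 0.
  move=> tphi; have [p [q [Ip Iq pq h0]]] := test_support tphi.
  have [dphi cphi _] := tphi.
  have e1 := uv _ tphi; have e2 := prim_weak pVI tphi.
  have mulphi f : intg `[p, q] f -> intg `[p, q] (fun t => f t * derive1 phi t).
    move=> fi; apply: (@intg_ext _ _ (fun t => derive1 phi t * f t)) => //.
      by move=> t _; rewrite mulrC.
    have [M [_ HM]] : bounded_set (derive1 phi @` `[p, q]%classic).
      apply: compact_bounded; apply: continuous_compact; last exact: segment_compact.
      exact: continuous_subspaceT.
    apply: (@intg_mul _ _ _ _ (M + 1)) => //.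
      by apply: measurable_funTS; exact: continuous_measurable_fun.
    by move=> t pqt; apply: (HM (M + 1)); [rewrite ltrDl|exists t].
  rewrite (@lint_test p q)//; last by move=> t /h0[_ ->]; rewrite mulr0.
  move: e1 e2; rewrite (@lint_test p q)//; last by move=> t /h0[_ ->]; rewrite mulr0.
  move=> e1; rewrite (@lint_test p q)//; last by move=> t /h0[_ ->]; rewrite mulr0.
  rewrite -e1 => e2.
  rewrite (@int_eq _ _ _ (fun t => u t * derive1 phi t - V t * derive1 phi t)).
    rewrite int_sub// ?e2 ?subrr//; apply: mulphi; [exact: iu|exact: iV].
  by move=> t _; rewrite mulrBl.
have [c Hc] := du_bois_reymond oI iI id W I0.
exists (fun t => 1 * V t + c * 1).
  apply: (prim_ext closure_interval (prim_lin 1 c pV (prim_cst _ 1))) => // t _.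
  by rewrite mulr0 addr0 mul1r.
apply: ae_imp (constant_averages oI iI id Hc) => t H It.
by rewrite -(subrK (V t) (u t)) H//; ring.
Qed.

Lemma weak_prim_cont u v : {within closure I, continuous u} ->
  (forall x y, closure I x -> closure I y -> intg `[x, y] v) ->
  (forall phi, test_function I phi ->
    lint I (fun t => u t * derive1 phi t) = - lint I (fun t => v t * phi t)) ->
  prim (closure I) u v.
Proof.
move=> cu iv uv; have [|V pV uV] := weak_prim _ iv uv.
  move=> x y Ix Iy; apply: continuous_compact_integrable; first exact: segment_compact.
  apply: continuous_subspaceW cu => t /itv_ccP txy; apply: subset_closure.
  exact: iI txy.
have E := ae_cont_eq oI cu (prim_cont pV) uV.
by apply: (prim_ext closure_interval pV) => // t ct; rewrite E.
Qed.

Lemma prim_unique u v v' : prim I u v -> prim I u v' -> ae_eq leb I v v'.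
Proof.
move=> p1 p2.
have i x y : I x -> I y -> intg `[x, y] (fun t => v t - v' t).
  move=> Ix Iy; have [xy|yx] := leP x y; last first.
    by rewrite set_itv_ge ?bnd_simp -?ltNge//; exact: integrable_set0.
  by apply: intg_sub2 => //; [exact: (p1 _ _ Ix Iy xy).1|exact: (p2 _ _ Ix Iy xy).1].
have H := @constant_averages _ I (fun t => v t - v' t) 0 oI iI i.
apply: ae_imp (H _) => [t E It|x y Ix Iy xy].
  by apply/eqP; rewrite -subr_eq0 E.
have [i1 e1] := p1 x y Ix Iy xy; have [i2 e2] := p2 x y Ix Iy xy.
by rewrite int_sub// -e1 -e2 subrr mul0r.
Qed.

End weak_real.

(** * Real and imaginary parts *)

Local Open Scope complex_scope.

Section complex_parts.
Context {R : realType}.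
Implicit Types (I D : set R) (f g u v : R -> R[i]) (x y z : R).

Definition re (f : R -> R[i]) : R -> R := fun x => complex.Re (f x).
Definition im (f : R -> R[i]) : R -> R := fun x => complex.Im (f x).

Lemma cReMr (a : R[i]) (r : R) : complex.Re (a * r%:C) = complex.Re a * r.
Proof. by case: a => a b /=; rewrite mulr0 subr0. Qed.

Lemma cImMr (a : R[i]) (r : R) : complex.Im (a * r%:C) = complex.Im a * r.
Proof. by case: a => a b /=; rewrite mulr0 add0r. Qed.

Lemma cReMl (a : R[i]) (r : R) : complex.Re (r%:C * a) = r * complex.Re a.
Proof. by rewrite mulrC cReMr mulrC. Qed.

Lemma cImMl (a : R[i]) (r : R) : complex.Im (r%:C * a) = r * complex.Im a.
Proof. by rewrite mulrC cImMr mulrC. Qed.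

Lemma cReM (a b : R[i]) : complex.Re (a * b) =
  complex.Re a * complex.Re b - complex.Im a * complex.Im b.
Proof. by case: a b => a a' [b b']. Qed.

Lemma cImM (a b : R[i]) : complex.Im (a * b) =
  complex.Re a * complex.Im b + complex.Im a * complex.Re b.
Proof. by case: a b => a a' [b b']. Qed.

Lemma cReD (a b : R[i]) : complex.Re (a + b) = complex.Re a + complex.Re b.
Proof. by case: a b => a a' [b b']. Qed.

Lemma cImD (a b : R[i]) : complex.Im (a + b) = complex.Im a + complex.Im b.
Proof. by case: a b => a a' [b b']. Qed.

Lemma cReN (a : R[i]) : complex.Re (- a) = - complex.Re a.
Proof. by case: a. Qed.

Lemma cImN (a : R[i]) : complex.Im (- a) = - complex.Im a.
Proof. by case: a. Qed.

Lemma eq_parts (a b : R[i]) : complex.Re a = complex.Re b ->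
  complex.Im a = complex.Im b -> a = b.
Proof. by case: a b => a a' [b b'] /= -> ->. Qed.

Lemma normc2 (a : R[i]) : normc a ^+ 2 = complex.Re a ^+ 2 + complex.Im a ^+ 2.
Proof. by case: a => a b /=; rewrite sqr_sqrtr// addr_ge0 ?sqr_ge0. Qed.

Lemma L2_parts I f : measurable I ->
  L2 I f <-> sqint I (re f) /\ sqint I (im f).
Proof.
move=> mI; split.
  move=> [[m1 m2] fin].
  have i : intg I (fun x => normc (f x) ^+ 2).
    apply/integrableP; split.
      apply/measurable_EFinP; under eq_fun do rewrite normc2.
      by apply: measurable_funD; exact: measurable_funX.
    apply: le_lt_trans fin; rewrite le_eqVlt; apply/orP; left; apply/eqP.
    by apply: eq_integral => x _ /=; rewrite ger0_norm// sqr_ge0.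
  split; split => //; apply: intg_le i => //.
  - exact: measurable_funX.
  - by move=> x _; rewrite normc2 ger0_norm ?sqr_ge0// lerDl sqr_ge0.
  - exact: measurable_funX.
  - by move=> x _; rewrite normc2 ger0_norm ?sqr_ge0// lerDr sqr_ge0.
move=> [[m1 i1] [m2 i2]]; split; first by split.
have /integrableP[_] := intg_add mI i1 i2.
apply: le_lt_trans; rewrite le_eqVlt; apply/orP; left; apply/eqP.
by apply: eq_integral => x _; rewrite normc2 /= ger0_norm // addr_ge0 ?sqr_ge0.
Qed.

Lemma weak_derivative_parts I u v : weak_derivative I u v <->
  (forall phi, test_function I phi ->
    lint I (fun t => re u t * derive1 phi t) = - lint I (fun t => re v t * phi t)) /\
  (forall phi, test_function I phi ->
    lint I (fun t => im u t * derive1 phi t) = - lint I (fun t => im v t * phi t)).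
Proof.
have E (w : R -> R[i]) (p : R -> R) : cintegral I (fun x => w x * (p x)%:C) =
    lint I (fun t => re w t * p t) +i* lint I (fun t => im w t * p t).
  congr (_ +i* _).
    by apply: int_eq => t _; rewrite /= cReMr.
  by apply: int_eq => t _; rewrite /= cImMr.
split.
  by move=> H; split=> phi /H; rewrite !E => -[].
move=> [H1 H2] phi tphi; rewrite !E H1// H2//.
Qed.

End complex_parts.

Section ae_integrals.
Context {R : realType}.
Implicit Types (I D : set R) (f g : R -> R) (x y z : R).

Lemma intg_ae D f g : measurable D -> measurable_fun D g -> intg D f ->
  ae_eq leb D f g -> intg D g /\ lint D g = lint D f.
Proof.
move=> mD mg fi fg; have mf := intg_meas fi.
have eqn : ae_eq leb D (EFin \o f) (EFin \o g).
  by apply: ae_imp fg => t H Dt; rewrite /= H.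
split; last first.
  rewrite /lint /Rintegral; congr fine; symmetry.
  by apply: ae_eq_integral => //; exact/measurable_EFinP.
apply/integrableP; split; first exact/measurable_EFinP.
have /integrableP[_] := fi; apply: le_lt_trans.
rewrite le_eqVlt; apply/orP; left; apply/eqP; symmetry.
apply: ae_eq_integral => //.
- by apply: measurableT_comp => //; exact/measurable_EFinP.
- by apply: measurableT_comp => //; exact/measurable_EFinP.
- by apply: ae_imp fg => t H Dt; rewrite /= H.
Qed.

Lemma ae_neq x : {ae @lebesgue_measure R, forall t, t != x}.
Proof.
exists [set x]; split => //=; first exact: lebesgue_measure_set1.
by move=> t /= /negP; rewrite negbK => /eqP.
Qed.

Lemma prim_ae I F f g : open I -> is_interval I ->
  (forall x y, closure I x -> closure I y -> measurable_fun `[x, y] g) ->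
  ae_eq leb I f g -> prim (closure I) F f -> prim (closure I) F g.
Proof.
move=> oI iI mg fg pF; split => x y cx cy xy.
have [i ->] := pF x y cx cy xy.
have fg' : ae_eq leb (`[x, y]%classic : set R) f g.
  have := ae_and (ae_and (ae_neq x) (ae_neq y)) fg.
  apply: ae_imp => t [[tx ty] H] /itv_ccP/andP[xt yt]; apply: H.
  apply: (@closure_between _ I _ _ x y) => //; rewrite lt_neqAle.
    by rewrite eq_sym tx.
  by rewrite ty.
by have [] := intg_ae (measurable_itv _) (mg _ _ cx cy) i fg'.
Qed.

End ae_integrals.

(** The equation [- (mu u')' - lam rho u = h] as a first-order system for [u]
    and its flux [w = mu u']. *)
Definition rsol {R : realType} (D : set R) (mu rho : R -> R) (lam : R)
    (h u w : R -> R) : Prop :=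
  prim D u (fun t => (mu t)^-1 * w t) /\
  prim D w (fun t => - (rho t * lam * u t + h t)).

(** The imaginary part of [kappa] couples the real and imaginary parts of the
    solution; it is moved to the source, so that both satisfy the same real
    equation. *)
Definition csol {R : realType} (D : set R) (mu rho : R -> R) (kappa : R[i])
    (g u w : R -> R[i]) : Prop :=
  rsol D mu rho (complex.Re kappa)
    (fun t => re g t - rho t * complex.Im kappa * im u t) (re u) (re w) /\
  rsol D mu rho (complex.Re kappa)
    (fun t => im g t + rho t * complex.Im kappa * re u t) (im u) (im w).

Section coefficients.
Context {R : realType}.
Implicit Types (I : set R) (mu f g : R -> R).

Lemma coef_gt0 mu x : line_coefficient mu -> 0 < mu x.
Proof. by move=> [_ [c [d [c0 /(_ x)/andP[h _]]]]]; exact: lt_le_trans h. Qed.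

Lemma coef_le mu : line_coefficient mu ->
  exists2 K : R, 0 < K & forall x, `|mu x| <= K.
Proof.
move=> hm; have [_ [c [d [c0 cd]]]] := hm.
exists d; first by have /andP[h1 h2] := cd 0; exact: lt_le_trans (le_trans h1 h2).
by move=> x; rewrite gtr0_norm ?coef_gt0//; case/andP: (cd x).
Qed.

Lemma coef_inv_le mu : line_coefficient mu ->
  exists2 K : R, 0 < K & forall x, `|(mu x)^-1| <= K.
Proof.
move=> hm; have [_ [c [d [c0 cd]]]] := hm.
exists c^-1; first by rewrite invr_gt0.
move=> x; have m0 := coef_gt0 x hm; rewrite gtr0_norm ?invr_gt0//.
by rewrite lef_pV2//; case/andP: (cd x).
Qed.

Lemma coef_meas mu I : line_coefficient mu -> measurable I -> measurable_fun I mu.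
Proof. by move=> [m _] mI; apply: measurable_funS m. Qed.

Lemma coef_inv_meas mu I : line_coefficient mu -> measurable I ->
  measurable_fun I (fun t => (mu t)^-1).
Proof.
move=> [mm [c [d [c0 cd]]]] mI.
(* off [c, d] the inverse is modified into a continuous function *)
pose g (x : R) := ((x + c + `|x - c|) / 2)^-1.
have cg : continuous g.
  move=> x; apply: cvgV.
    have : x + c + `|x - c| > 0.
      by have [h|h] := leP 0 (x - c); [rewrite ger0_norm|rewrite ltr0_norm]; lra.
    by move=> h; rewrite gt_eqF// divr_gt0.
  apply: cvgMl; apply: cvgD.
    by apply: cvgD; [exact: cvg_id|exact: cvg_cst].
  by apply: cvg_norm; apply: cvgB; [exact: cvg_id|exact: cvg_cst].
have -> : (fun t => (mu t)^-1) = g \o mu.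
  apply/funext => t /=; rewrite /g ger0_norm; last first.
    by rewrite subr_ge0; case/andP: (cd t).
  by congr (_^-1); field.
apply: (measurable_funS measurableT) => //; apply: measurableT_comp => //.
exact: continuous_measurable_fun.
Qed.

Lemma sqint_mul I (m f : R -> R) (K : R) : measurable I -> measurable_fun I m ->
  (forall t, `|m t| <= K) -> sqint I f -> sqint I (fun t => m t * f t).
Proof.
move=> mI mm mK [mf i]; split; first exact: measurable_funM.
apply: intg_le (intg_scale (K ^+ 2) mI i) => //.
  by apply: measurable_funX; exact: measurable_funM.
move=> t _; rewrite ger0_norm ?sqr_ge0// exprMn ler_wpM2r ?sqr_ge0//.
by rewrite -real_normK ?num_real// ler_pXn2r// nnegrE// (le_trans _ (mK t)).
Qed.

Lemma sqint_add I f g : measurable I -> sqint I f -> sqint I g ->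
  sqint I (fun t => f t + g t).
Proof.
move=> mI [mf fi] [mg gi]; split; first exact: measurable_funD.
apply: intg_le (intg_add mI (intg_scale 2 mI fi) (intg_scale 2 mI gi)) => //.
  by apply: measurable_funX; exact: measurable_funD.
move=> t _; rewrite ger0_norm ?sqr_ge0//.
have := sqr_ge0 (f t - g t); rewrite sqrrB sqrrD; lra.
Qed.

Lemma sqint_scale I f (k : R) : measurable I -> sqint I f ->
  sqint I (fun t => k * f t).
Proof.
by move=> mI; apply: (@sqint_mul _ _ _ `|k|).
Qed.

Lemma sqint_opp I f : measurable I -> sqint I f -> sqint I (fun t => - f t).
Proof.
move=> mI [mf fi]; split; first exact: measurable_funN.
by under eq_fun do rewrite sqrrN.
Qed.

Lemma sqint_prod I f g : measurable I -> sqint I f -> sqint I g ->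
  intg I (fun t => f t * g t).
Proof.
move=> mI [mf fi] [mg gi].
apply: intg_le (intg_add mI fi gi) => //; first exact: measurable_funM.
move=> t _; have := sqr_ge0 (`|f t| - `|g t|).
rewrite normrM sqrrB !real_normK ?num_real// => h.
have := sqr_ge0 (f t); have := sqr_ge0 (g t).
have n0 : 0 <= `|f t| * `|g t| by rewrite mulr_ge0.
by move: h; rewrite -mulr_natr; lra.
Qed.

Lemma sqint_sub I I' f : measurable I -> measurable I' -> I' `<=` I ->
  sqint I f -> sqint I' f.
Proof.
by move=> mI mI' sI [mf fi]; split; [exact: measurable_funS mf|exact: intg_sub fi].
Qed.

Lemma sqint_ae I f g : measurable I -> measurable_fun I g -> sqint I f ->
  ae_eq leb I f g -> sqint I g.
Proof.
move=> mI mg [mf fi] fg; split => //.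
have h := measurable_funX 2 mg.
have := @intg_ae _ I _ (fun t => g t ^+ 2) mI h fi.
by move=> H; apply: (H _).1; apply: ae_imp fg => t E It; rewrite /= E.
Qed.

End coefficients.

(** * Weak solutions and first-order systems *)

Lemma cReM3 {R : realType} (r : R) (k a : R[i]) : complex.Re (r%:C * k * a) =
  r * (complex.Re k * complex.Re a - complex.Im k * complex.Im a).
Proof. by rewrite -mulrA cReMl cReM. Qed.

Lemma cImM3 {R : realType} (r : R) (k a : R[i]) : complex.Im (r%:C * k * a) =
  r * (complex.Re k * complex.Im a + complex.Im k * complex.Re a).
Proof. by rewrite -mulrA cImMl cImM. Qed.

Section bridge.
Context {R : realType}.
Variables (I : set R) (mu rho : R -> R).
Hypotheses (oI : open I) (iI : is_interval I) (I0 : exists x, I x).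
Hypotheses (hmu : line_coefficient mu) (hrho : line_coefficient rho).
Implicit Types (f g u v w : R -> R[i]) (x y z : R).

Let mI : measurable I := open_measurable oI.
Let mcI : measurable (closure I) := closed_measurable (@closed_closure _ I).

Lemma meas_closure (F f : R -> R) x y : prim (closure I) F f -> closure I x ->
  closure I y -> measurable_fun `[x, y] F.
Proof.
move=> pF cx cy; apply: prim_meas => //.
apply: prim_sub pF => t /itv_ccP; exact: (closure_interval oI iI).
Qed.

Lemma meas_open (F f : R -> R) : prim (closure I) F f -> measurable_fun I F.
Proof.
move=> pF; apply: measurable_funS (prim_meas mcI pF) => //.
exact: subset_closure.
Qed.

Lemma re_wderiv u v : L2 I v -> weak_derivative I u v -> 
  L2 I (wderiv I u) /\ weak_derivative I u (wderiv I u).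
Proof. by move=> Lv uv; exact: (@xgetPex _ (cst 0) [set v | _] (ex_intro _ v (conj Lv uv))). Qed.

Lemma ae_eq_parts u v : ae_eq leb I (re u) (re v) -> ae_eq leb I (im u) (im v) ->
  ae_eq leb I u v.
Proof.
move=> h1 h2; apply: ae_imp (ae_and h1 h2) => t [e1 e2] It.
by apply: eq_parts; [exact: e1|exact: e2].
Qed.

Lemma H1_prim u : H1 I u -> [/\ L2 I (wderiv I u),
  prim (closure I) (re u) (re (wderiv I u)) &
  prim (closure I) (im u) (im (wderiv I u))].
Proof.
move=> [Lu [cu1 cu2] [v [Lv uv]]].
have [Lw /weak_derivative_parts[w1 w2]] := re_wderiv Lv uv.
have [s1 s2] := (L2_parts _ mI).1 Lw.
split => //.
- exact: (weak_prim_cont oI iI I0 cu1 (fun x y => sqint_intg oI iI s1) w1).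
- exact: (weak_prim_cont oI iI I0 cu2 (fun x y => sqint_intg oI iI s2) w2).
Qed.

Lemma prim_H1 u v : L2 I u -> L2 I v -> prim (closure I) (re u) (re v) ->
  prim (closure I) (im u) (im v) -> H1 I u /\ ae_eq leb I (wderiv I u) v.
Proof.
move=> Lu Lv p1 p2.
have p1I := prim_sub (@subset_closure _ I) p1.
have p2I := prim_sub (@subset_closure _ I) p2.
have uv : weak_derivative I u v.
  by apply/weak_derivative_parts; split=> phi tphi; exact: prim_weak tphi.
have h : H1 I u.
  by split => //; [split; [exact: prim_cont p1|exact: prim_cont p2]|exists v].
split => //; have [Lw q1 q2] := H1_prim h.
apply: ae_eq_parts.
  by apply: prim_unique p1I => //; apply: prim_sub q1; exact: subset_closure.
by apply: prim_unique p2I => //; apply: prim_sub q2; exact: subset_closure.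
Qed.

Lemma flux_unique u w : {within closure I, continuous (re w)} ->
  {within closure I, continuous (im w)} ->
  ae_eq leb I w (fun x => (mu x)%:C * wderiv I u x) ->
  forall x, closure I x -> flux I mu u x = w x.
Proof.
move=> c1 c2 ww x cx.
have [[d1 d2] fw] := @xgetPex _ (cst 0) [set w | ccontinuous (closure I) w /\
    ae_eq leb I w (fun x => (mu x)%:C * wderiv I u x)] (ex_intro _ w (conj (conj c1 c2) ww)).
apply: eq_parts.
  apply: (ae_cont_eq oI d1 c1 _ cx).
  by apply: ae_imp (ae_and fw ww) => t [e1 e2] It; rewrite e1// /re e2.
apply: (ae_cont_eq oI d2 c2 _ cx).
by apply: ae_imp (ae_and fw ww) => t [e1 e2] It; rewrite e1// /im e2.
Qed.

Let minv_mul (b a : R -> R) : sqint I b -> ae_eq leb I (fun t => mu t * b t) a ->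
  ae_eq leb I b (fun t => (mu t)^-1 * a t).
Proof.
move=> sb; apply: ae_imp => t H It; rewrite -H// mulKf//.
by rewrite gt_eqF// coef_gt0.
Qed.

Lemma test_sqint phi : test_function I phi -> sqint I phi /\ sqint I (derive1 phi).
Proof.
move=> tphi; have [p [q [Ip Iq pq h0]]] := test_support oI I0 tphi.
have [dphi cphi _] := tphi.
have cphi0 : continuous phi.
  by move=> t; apply: differentiable_continuous; exact/derivable1_diffP.
have sq (f : R -> R) : continuous f -> (forall t, ~ (p < t < q) -> f t = 0) ->
    sqint I f.
  move=> cf f0; split; first by apply: measurable_funTS; exact: continuous_measurable_fun.
  have i1 : intg `[p, q] (fun t => f t ^+ 2).
    apply: continuous_compact_integrable; first exact: segment_compact.
    by apply: continuous_subspaceT => t; apply: (@cvgM _ _ _ _ f f); exact: cf.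
  have mD : measurable (I `\` `[p, q]) by exact: measurableD.
  have i2 : intg (I `\` `[p, q]) (fun t => f t ^+ 2).
    apply: (@intg_ext _ _ (fun=> 0)) => //; last exact: integrable0.
    move=> t /set_mem[_ nt]; rewrite f0 ?expr0n// => /andP[a b].
    by apply: nt; apply/itv_ccP; rewrite !ltW.
  apply: intg_sub (intg_union _ _ i1 i2) => //; first exact: measurableU.
  by move=> t It; have [h|h] := pselect (`[p, q]%classic t); [left|right].
by split; apply: sq => // t /h0[].
Qed.

Lemma weak_form (b s q phi : R -> R) : test_function I phi -> sqint I s -> sqint I q ->
  (lint I (fun t => b t * derive1 phi t) - lint I (fun t => s t * phi t) =
   lint I (fun t => q t * phi t)) <->
  lint I (fun t => b t * derive1 phi t) = - lint I (fun t => - (s t + q t) * phi t).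
Proof.
move=> tphi ss sq; have [sp _] := test_sqint tphi.
have -> : lint I (fun t => - (s t + q t) * phi t) =
    - (lint I (fun t => s t * phi t) + lint I (fun t => q t * phi t)).
  rewrite -int_add//; [|exact: sqint_prod..].
  rewrite -int_opp//; first by apply: int_eq => t _; ring.
  by apply: intg_add => //; exact: sqint_prod.
rewrite opprK; split=> [/eqP|->]; last by rewrite addrAC subrr add0r.
by rewrite subr_eq addrC => /eqP.
Qed.

(** The weak equation says that [- (rho kappa u + g)] is the weak derivative of
    [mu u'], which therefore has a representative that is a primitive: the
    flux. *)
Lemma weak_sol_csol kappa g u : L2 I g -> weak_sol I mu rho kappa g u ->
  [/\ csol (closure I) mu rho kappa g u (flux I mu u), L2 I u,
      L2 I (flux I mu u) &
      ae_eq leb I (wderiv I u) (fun t => ((mu t)^-1)%:C * flux I mu u t)].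
Proof.
move=> Lg [hu weq]; have [Lv p1 p2] := H1_prim hu; have [Lu _ _] := hu.
set v := wderiv I u in Lv p1 p2 weq *.
have [v1 v2] := (L2_parts _ mI).1 Lv; have [u1 u2] := (L2_parts _ mI).1 Lu.
have [g1 g2] := (L2_parts _ mI).1 Lg.
have [Km Km0 HKm] := coef_le hmu; have [Kr Kr0 HKr] := coef_le hrho.
have [Ki Ki0 HKi] := coef_inv_le hmu.
have mm := coef_meas hmu mI; have mr := coef_meas hrho mI.
have mv1 := sqint_mul mI mm HKm v1; have mv2 := sqint_mul mI mm HKm v2.
set k1 := complex.Re kappa; set k2 := complex.Im kappa.
pose h1 t := - (rho t * k1 * re u t + (re g t - rho t * k2 * im u t)).
pose h2 t := - (rho t * k1 * im u t + (im g t + rho t * k2 * re u t)).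
have ru (k : R) (b : R -> R) : sqint I b -> sqint I (fun t => rho t * k * b t).
  move=> sb; have := sqint_scale k mI (sqint_mul mI mr HKr sb).
  by congr (sqint _ _); apply/funext => t; ring.
have sh1 : sqint I h1.
  apply: sqint_opp => //; apply: sqint_add => //; first exact: ru.
  by apply: sqint_add => //; apply: sqint_opp => //; exact: ru.
have sh2 : sqint I h2.
  apply: sqint_opp => //; apply: sqint_add => //; first exact: ru.
  by apply: sqint_add => //; exact: ru.
have W1 phi : test_function I phi ->
    lint I (fun t => mu t * re v t * derive1 phi t) = - lint I (fun t => h1 t * phi t).
  move=> tphi.
  pose s t := rho t * k1 * re u t + - (rho t * k2 * im u t).
  have ss : sqint I s by apply: sqint_add => //; [exact: ru|apply: sqint_opp => //; exact: ru].
  have := congr1 (@complex.Re R) (weq _ tphi); rewrite cReD cReN /= => E.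
  have {}E : lint I (fun t => mu t * re v t * derive1 phi t) -
      lint I (fun t => s t * phi t) = lint I (fun t => re g t * phi t).
    have -> : lint I (fun t => re g t * phi t) = lint I (re (fun t => g t * (phi t)%:C)).
      by apply: int_eq => t _; rewrite /re cReMr.
    rewrite [RHS]/lint -E; congr (_ - _).
      by apply: int_eq => t _; rewrite /re cReMr cReMl.
    by apply: int_eq => t _; rewrite /s /re /im cReMr cReM3 -/k1 -/k2; ring.
  rewrite ((weak_form _ tphi ss g1).1 E); congr (- _).
  by apply: int_eq => t _; rewrite /s /h1; ring.
have W2 phi : test_function I phi ->
    lint I (fun t => mu t * im v t * derive1 phi t) = - lint I (fun t => h2 t * phi t).
  move=> tphi.
  pose s t := rho t * k1 * im u t + rho t * k2 * re u t.
  have ss : sqint I s by apply: sqint_add => //; exact: ru.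
  have := congr1 (@complex.Im R) (weq _ tphi); rewrite cImD cImN /= => E.
  have {}E : lint I (fun t => mu t * im v t * derive1 phi t) -
      lint I (fun t => s t * phi t) = lint I (fun t => im g t * phi t).
    have -> : lint I (fun t => im g t * phi t) = lint I (im (fun t => g t * (phi t)%:C)).
      by apply: int_eq => t _; rewrite /im cImMr.
    rewrite [RHS]/lint -E; congr (_ - _).
      by apply: int_eq => t _; rewrite /im cImMr cImMl.
    by apply: int_eq => t _; rewrite /s /re /im cImMr cImM3 -/k1 -/k2; ring.
  rewrite ((weak_form _ tphi ss g2).1 E); congr (- _).
  by apply: int_eq => t _; rewrite /s /h2; ring.
have [V1 pV1 aV1] := weak_prim oI iI I0
  (fun x y Ix Iy => sqint_intg oI iI mv1 (subset_closure Ix) (subset_closure Iy))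
  (fun x y => sqint_intg oI iI sh1) W1.
have [V2 pV2 aV2] := weak_prim oI iI I0
  (fun x y Ix Iy => sqint_intg oI iI mv2 (subset_closure Ix) (subset_closure Iy))
  (fun x y => sqint_intg oI iI sh2) W2.
pose w t := V1 t +i* V2 t.
have fw x : closure I x -> flux I mu u x = w x.
  apply: flux_unique; [exact: prim_cont pV1|exact: prim_cont pV2|].
  apply: ae_eq_parts.
    by apply: ae_imp aV1 => t H It; rewrite /re cReMl [LHS]/= H.
  by apply: ae_imp aV2 => t H It; rewrite /im cImMl [LHS]/= H.
have sV1 : sqint I V1 by apply: sqint_ae aV1 => //; exact: meas_open pV1.
have sV2 : sqint I V2 by apply: sqint_ae aV2 => //; exact: meas_open pV2.
have icI := closure_interval oI iI.
have rf t : closure I t -> V1 t = re (flux I mu u) t by move=> /fw; rewrite /re => ->.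
have jf t : closure I t -> V2 t = im (flux I mu u) t by move=> /fw; rewrite /im => ->.
have mi x y (V : R -> R) h : prim (closure I) V h -> closure I x -> closure I y ->
    measurable_fun `[x, y] (fun t => (mu t)^-1 * V t).
  move=> pV cx cy; apply: measurable_funM; first exact: coef_inv_meas.
  exact: meas_closure pV cx cy.
split => //.
- split; split.
  + apply: (prim_ext icI (prim_ae oI iI _ (minv_mul v1 aV1) p1)) => //.
      by move=> x y; exact: mi pV1.
    by move=> t /rf ->.
  + apply: (prim_ext icI pV1) => // t ct; rewrite /h1; ring.
  + apply: (prim_ext icI (prim_ae oI iI _ (minv_mul v2 aV2) p2)) => //.
      by move=> x y; exact: mi pV2.
    by move=> t /jf ->.
  + apply: (prim_ext icI pV2) => // t ct; rewrite /h2; ring.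
- apply/L2_parts => //; split.
    apply: sqint_ae sV1 _ => //; last by apply: aeW => t It; apply: rf; exact: subset_closure.
    apply: (eq_measurable_fun V1); last exact: meas_open pV1.
    by move=> t /set_mem It; apply: rf; exact: subset_closure.
  apply: sqint_ae sV2 _ => //; last by apply: aeW => t It; apply: jf; exact: subset_closure.
  apply: (eq_measurable_fun V2); last exact: meas_open pV2.
  by move=> t /set_mem It; apply: jf; exact: subset_closure.
apply: ae_eq_parts.
  apply: ae_imp (minv_mul v1 aV1) => t H It.
  by rewrite H// rf; [rewrite /re cReMl|exact: subset_closure].
apply: ae_imp (minv_mul v2 aV2) => t H It.
by rewrite H// jf; [rewrite /im cImMl|exact: subset_closure].
Qed.

(** Conversely, integration by parts against test functions gives back the weak
    equation, and the second component is the flux by uniqueness of continuous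
    representatives. *)
Lemma csol_weak_sol kappa g u w : L2 I u -> L2 I w -> L2 I g ->
  csol (closure I) mu rho kappa g u w ->
  [/\ weak_sol I mu rho kappa g u, forall x, closure I x -> flux I mu u x = w x &
      ae_eq leb I (wderiv I u) (fun t => ((mu t)^-1)%:C * w t)].
Proof.
move=> Lu Lw Lg [[p1 q1] [p2 q2]].
have [u1 u2] := (L2_parts _ mI).1 Lu; have [g1 g2] := (L2_parts _ mI).1 Lg.
have [w1 w2] := (L2_parts _ mI).1 Lw.
have [Kr Kr0 HKr] := coef_le hrho; have [Ki Ki0 HKi] := coef_inv_le hmu.
have mi := coef_inv_meas hmu mI; have mr := coef_meas hrho mI.
set k1 := complex.Re kappa in q1 q2 *; set k2 := complex.Im kappa in q1 q2 *.
pose v t := ((mu t)^-1)%:C * w t.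
have vE1 : re v = (fun t => (mu t)^-1 * re w t) by apply/funext => t; rewrite /re cReMl.
have vE2 : im v = (fun t => (mu t)^-1 * im w t) by apply/funext => t; rewrite /im cImMl.
have Lv : L2 I v.
  by apply/L2_parts => //; rewrite vE1 vE2; split; exact: sqint_mul HKi _.
have [|| hu wdv] := prim_H1 Lu Lv; rewrite ?vE1 ?vE2//.
have fw x : closure I x -> flux I mu u x = w x.
  apply: flux_unique; [exact: prim_cont q1|exact: prim_cont q2|].
  apply: ae_imp wdv => t H It; rewrite H// /v mulrA -rmorphM/= divff ?mul1r//.
  by rewrite gt_eqF// coef_gt0.
split => //; split => // phi tphi.
have ru (k : R) (b : R -> R) : sqint I b -> sqint I (fun t => rho t * k * b t).
  move=> sb; have := sqint_scale k mI (sqint_mul mI mr HKr sb).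
  by congr (sqint _ _); apply/funext => t; ring.
have q1I := prim_weak oI iI I0 (prim_sub (@subset_closure _ I) q1) tphi.
have q2I := prim_weak oI iI I0 (prim_sub (@subset_closure _ I) q2) tphi.
have aw : ae_eq leb I (fun t => (mu t)%:C * wderiv I u t) w.
  apply: ae_imp wdv => t H It; rewrite H// /v mulrA -rmorphM/= divff ?mul1r//.
  by rewrite gt_eqF// coef_gt0.
have [_ sp'] := test_sqint tphi.
have [Lwd _ _] := H1_prim hu; have [d1 d2] := (L2_parts _ mI).1 Lwd.
have [Km Km0 HKm] := coef_le hmu; have mm := coef_meas hmu mI.
apply: eq_parts.
  pose s t := rho t * k1 * re u t + - (rho t * k2 * im u t).
  have ss : sqint I s by apply: sqint_add => //; [exact: ru|apply: sqint_opp => //; exact: ru].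
  have E1 : \int[leb]_(x in I) complex.Re ((mu x)%:C * wderiv I u x * (derive1 phi x)%:C) =
      lint I (fun t => re w t * derive1 phi t).
    transitivity (lint I (fun t => mu t * re (wderiv I u) t * derive1 phi t)).
      by apply: int_eq => t _; rewrite /re cReMr cReMl.
    symmetry; apply: (intg_ae mI _ (sqint_prod mI (sqint_mul mI mm HKm d1) sp') _).2.
      by apply: measurable_funM; [exact: w1.1|exact: sp'.1].
    by apply: ae_imp aw => t H It; rewrite /re -(H It) cReMl.
  rewrite cReD cReN /= E1.
  have -> : \int[leb]_(x in I) complex.Re (g x * (phi x)%:C) = lint I (fun t => re g t * phi t).
    by apply: int_eq => t _; rewrite cReMr.
  have -> : \int[leb]_(x in I) complex.Re ((rho x)%:C * kappa * u x * (phi x)%:C) =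
      lint I (fun t => s t * phi t).
    by apply: int_eq => t _; rewrite /s /re /im cReMr cReM3 -/k1 -/k2; ring.
  apply: (weak_form _ tphi ss g1).2; rewrite q1I; congr (- _).
  by apply: int_eq => t _; rewrite /s; ring.
pose s t := rho t * k1 * im u t + rho t * k2 * re u t.
have ss : sqint I s by apply: sqint_add => //; exact: ru.
have E1 : \int[leb]_(x in I) complex.Im ((mu x)%:C * wderiv I u x * (derive1 phi x)%:C) =
    lint I (fun t => im w t * derive1 phi t).
  transitivity (lint I (fun t => mu t * im (wderiv I u) t * derive1 phi t)).
    by apply: int_eq => t _; rewrite /im cImMr cImMl.
  symmetry; apply: (intg_ae mI _ (sqint_prod mI (sqint_mul mI mm HKm d2) sp') _).2.
    by apply: measurable_funM; [exact: w2.1|exact: sp'.1].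
  by apply: ae_imp aw => t H It; rewrite /im -(H It) cImMl.
rewrite cImD cImN /= E1.
have -> : \int[leb]_(x in I) complex.Im (g x * (phi x)%:C) = lint I (fun t => im g t * phi t).
  by apply: int_eq => t _; rewrite cImMr.
have -> : \int[leb]_(x in I) complex.Im ((rho x)%:C * kappa * u x * (phi x)%:C) =
    lint I (fun t => s t * phi t).
  by apply: int_eq => t _; rewrite /s /re /im cImMr cImM3 -/k1 -/k2; ring.
apply: (weak_form _ tphi ss g2).2; rewrite q2I; congr (- _).
by apply: int_eq => t _; rewrite /s; ring.
Qed.

End bridge.

(** * The Cauchy problem *)

Section picard.
Context {R : realType}.
Implicit Types (x y a b p q K : R) (u w f g h : R -> R).

Lemma geometric_limit (s : nat -> R) (C : R) :
  (forall n, `|s n.+1 - s n| <= C / 2 ^+ n) ->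
  exists l, forall n, `|s n - l| <= 2 * C / 2 ^+ n.
Proof.
move=> sC.
have C0 : 0 <= C by have := sC 0%N; rewrite expr0 divr1; exact: le_trans.
pose r n := 2 * C / 2 ^+ n.
have r0 n : 0 <= r n by rewrite divr_ge0 ?mulr_ge0.
have rS n : r n - r n.+1 = C / 2 ^+ n.
  by rewrite /r exprS; field; rewrite expf_neq0.
have aS n : s n - r n <= s n.+1 - r n.+1.
  have := sC n; rewrite ler_norml -rS => /andP[h _]; lra.
have bS n : s n.+1 + r n.+1 <= s n + r n.
  have := sC n; rewrite ler_norml -rS => /andP[_ h]; lra.
have am m n : (m <= n)%N -> s m - r m <= s n - r n.
  by elim: n => [|n IH]; [case: m|rewrite leq_eqVlt => /orP[/eqP ->//|/IH h]; exact: le_trans (aS n)].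
have bm m n : (m <= n)%N -> s n + r n <= s m + r m.
  by elim: n => [|n IH]; [case: m|rewrite leq_eqVlt => /orP[/eqP ->//|/IH h]; exact: le_trans (bS n) _].
have ab m n : s m - r m <= s n + r n.
  have [mn|/ltnW nm] := leqP m n.
    by have := am _ _ mn; have := r0 n; lra.
  by have := bm _ _ nm; have := r0 m; lra.
pose A := [set s n - r n | n in [set: nat]].
have hA : has_sup A.
  split; first by exists (s 0%N - r 0%N), 0%N.
  by exists (s 0%N + r 0%N) => _ [n _ <-]; exact: ab.
exists (sup A) => n; rewrite -/(r n) ler_norml.
have h1 : s n - r n <= sup A by apply: ub_le_sup; [exact: hA.2|exists n].
have h2 : sup A <= s n + r n.
  by apply: ge_sup; [exact: hA.1|move=> _ [m _ <-]; exact: ab].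
by apply/andP; split; lra.
Qed.

Lemma pow2_small (x c : R) : (forall n, `|x| <= c / 2 ^+ n) -> x = 0.
Proof.
move=> H; apply/eqP; rewrite -normr_le0; apply/ler_addgt0Pl => e e0.
pose n := (Num.truncn (c / e)).+1.
rewrite addr0; apply: le_trans (H n) _.
rewrite ler_pdivrMr ?exprn_gt0// mulrC -ler_pdivrMr//.
apply: le_trans (ltW (truncnS_gt _)) _.
by rewrite -natrX ler_nat; apply/ltnW/ltn_expl.
Qed.

Lemma prim_int a b p f : intg `[a, b] f ->
  prim `[a, b] (fun t => p + lint `[a, t] f) f.
Proof.
move=> fi; split=> x y /itv_ccP/andP[ax xb] /itv_ccP/andP[ay yb] xy.
split; first exact: intg_itvS fi.
rewrite (int_split ax xy); last exact: intg_itvS fi.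
ring.
Qed.

Lemma exp_int a t K : 0 < K -> a <= t ->
  lint `[a, t] (fun s => expR (K * (s - a))) <= expR (K * (t - a)) / K.
Proof.
move=> K0 at_.
have D s : is_derive s (1:R) (fun s => expR (K * (s - a))) (K * expR (K * (s - a))).
  by apply: is_derive_eq; rewrite /GRing.scale/=; ring.
have dE : derive1 (fun s => expR (K * (s - a))) = (fun s => K * expR (K * (s - a))).
  by apply/funext => s; rewrite derive1E derive_val.
have ce : continuous (fun s : R => K * expR (K * (s - a))).
  move=> s; apply: cvgMr; apply: cvg_comp; last exact: continuous_expR.
  by apply: cvgMr; apply: cvgB; [exact: cvg_id|exact: cvg_cst].
have [|s|+] := @prim_C1 R (fun s => expR (K * (s - a))).
  by move=> s; have [] := D s.
  by rewrite dE; exact: ce.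
move=> /(_ a t I I at_); rewrite dE => -[ii].
rewrite int_scale//; last first.
  apply: (@intg_ext _ _ (fun s => K^-1 * (K * expR (K * (s - a))))) => //.
    by move=> s _; rewrite mulKf// gt_eqF.
  exact: intg_scale.
rewrite subrr mulr0 expR0 => e.
rewrite ler_pdivlMr// mulrC -e; lra.
Qed.

Lemma prim_bounded a b F f : prim `[a, b] F f -> exists M, forall t, a <= t <= b -> `|F t| <= M.
Proof.
move=> pF; exists (`|F a| + lint `[a, b] (fun t => `|f t|)) => t tab.
have iab : is_interval (`[a, b]%classic : set R) by exact: interval_is_interval.
have /andP[h1 h2] := tab; have ab := le_trans h1 h2.
rewrite -[F t](subrK (F a)) addrC (le_trans (ler_normD _ _))// lerD2l.
apply: prim_bound pF _ _ tab => //; apply/itv_ccP; by rewrite lexx ab.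
Qed.

(** Linear first-order systems with bounded coefficients are solvable: Picard
    iterates contract by 1/2 in the norm weighted by [exp (- 2 K (t - a))]. *)
Lemma picard a b p q K (c1 c2 g : R -> R) : a <= b ->
  measurable_fun `[a, b] c1 -> measurable_fun `[a, b] c2 ->
  (forall t, `|c1 t| <= K) -> (forall t, `|c2 t| <= K) -> intg `[a, b] g ->
  exists u w, [/\ prim `[a, b] u (fun t => c1 t * w t),
    prim `[a, b] w (fun t => c2 t * u t + g t), u a = p & w a = q].
Proof.
move=> ab m1 m2.
wlog K0 : K / 0 < K.
  move=> H b1 b2; apply: (H (K + 1)) => [|t|t].
  - by have := b1 a; have := normr_ge0 (c1 a); lra.
  - by have := b1 t; lra.
  - by have := b2 t; lra.
move=> b1 b2 gi.
have iab : is_interval (`[a, b]%classic : set R) by exact: interval_is_interval.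
have mulc (c F f : R -> R) : measurable_fun `[a, b] c -> (forall t, `|c t| <= K) ->
    prim `[a, b] F f -> intg `[a, b] (fun t => c t * F t).
  move=> mc bc pF; apply: (@intg_mul _ _ _ _ K) => //.
  by apply: continuous_compact_integrable; [exact: segment_compact|exact: prim_cont pF].
pose step (X : (R -> R) * (R -> R)) : (R -> R) * (R -> R) :=
  ((fun t => p + lint `[a, t] (fun s => c1 s * X.2 s)),
   (fun t => q + lint `[a, t] (fun s => c2 s * X.1 s + g s))).
pose X n := iter n step ((fun=> p), (fun=> q)).
pose u n := (X n).1; pose w n := (X n).2.
have pX n : (exists f, prim `[a, b] (u n) f) /\ (exists f, prim `[a, b] (w n) f).
  elim: n => [|n [[f1 p1] [f2 p2]]].
    by split; exists (fun=> 0); exact: prim_cst.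
  split; eexists; apply: prim_int.
    exact: mulc p2.
  by apply: intg_add => //; exact: mulc p1.
have iu n : intg `[a, b] (fun s => c2 s * u n s + g s).
  by have [[f1 p1] _] := pX n; apply: intg_add => //; exact: mulc p1.
have iw n : intg `[a, b] (fun s => c1 s * w n s).
  by have [_ [f2 p2]] := pX n; exact: mulc p2.
have uS n t : u n.+1 t = p + lint `[a, t] (fun s => c1 s * w n s) by [].
have wS n t : w n.+1 t = q + lint `[a, t] (fun s => c2 s * u n s + g s) by [].
have pu n : prim `[a, b] (u n.+1) (fun s => c1 s * w n s) by exact: (prim_int p (iw n)).
have pw n : prim `[a, b] (w n.+1) (fun s => c2 s * u n s + g s) by exact: (prim_int q (iu n)).
have [A [A0 HA]] : exists A, 0 <= A /\ forall t, a <= t <= b ->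
    `|u 1%N t - u 0%N t| <= A /\ `|w 1%N t - w 0%N t| <= A.
  exists (lint `[a, b] (fun s => `|c1 s * w 0%N s|) + lint `[a, b] (fun s => `|c2 s * u 0%N s + g s|)).
  have n1 : 0 <= lint `[a, b] (fun s => `|c1 s * w 0%N s|) by exact: int_ge0.
  have n2 : 0 <= lint `[a, b] (fun s => `|c2 s * u 0%N s + g s|) by exact: int_ge0.
  split; first exact: addr_ge0.
  have aa : `[a, b]%classic a by apply/itv_ccP; rewrite lexx ab.
  have bb : `[a, b]%classic b by apply/itv_ccP; rewrite lexx ab.
  move=> t tab; split.
    have := prim_bound iab (pu 0%N) aa bb tab.
    rewrite (_ : u 1%N a = u 0%N t); last by rewrite /u/= int_pt addr0.
    by move=> h; apply: le_trans h _; rewrite lerDl.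
  have := prim_bound iab (pw 0%N) aa bb tab.
  rewrite (_ : w 1%N a = w 0%N t); last by rewrite /w/= int_pt addr0.
  by move=> h; apply: le_trans h _; rewrite lerDr.
pose E t := expR (2 * K * (t - a)).
have E1 t : a <= t -> 1 <= E t.
  by move=> h; rewrite /E -expR0 ler_expR mulr_ge0 ?subr_ge0// mulr_ge0// ltW.
have k20 : 0 < 2 * K by rewrite mulr_gt0.
have iE t : intg `[a, t] E.
  apply: continuous_compact_integrable; first exact: segment_compact.
  apply: continuous_subspaceT => s; apply: cvg_comp; last exact: continuous_expR.
  by apply: cvgMr; apply: cvgB; [exact: cvg_id|exact: cvg_cst].
have contract (c F G : R -> R) (B : R) t : 0 <= B -> (forall t, `|c t| <= K) ->
    intg `[a, b] (fun s => c s * F s) -> intg `[a, b] (fun s => c s * G s) ->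
    (forall s, a <= s <= b -> `|F s - G s| <= B * E s) -> a <= t <= b ->
    `|lint `[a, t] (fun s => c s * F s) - lint `[a, t] (fun s => c s * G s)| <= B / 2 * E t.
  move=> B0 bc iF iG FG /andP[at_ tb].
  have iF' : intg `[a, t] (fun s => c s * F s) by exact: intg_itvS iF.
  have iG' : intg `[a, t] (fun s => c s * G s) by exact: intg_itvS iG.
  rewrite -int_sub//.
  apply: (@le_trans _ _ (lint `[a, t] (fun s => K * B * E s))).
    apply: int_norm_le => //.
    - exact: intg_sub2.
    - exact: intg_scale.
    move=> s /itv_ccP/andP[sa st].
    rewrite -mulrBr normrM -mulrA ler_pM// FG// sa (le_trans st tb)//.
  rewrite int_scale//.
  apply: (@le_trans _ _ (K * B * (E t / (2 * K)))).
    by rewrite ler_wpM2l ?mulr_ge0 ?(ltW K0)//; exact: exp_int.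
  rewrite le_eqVlt; apply/orP; left; apply/eqP; field.
  by rewrite gt_eqF.
have HX n : forall t, a <= t <= b ->
    `|u n.+1 t - u n t| <= A / 2 ^+ n * E t /\ `|w n.+1 t - w n t| <= A / 2 ^+ n * E t.
  elim: n => [|n IH] t tab.
    have [h1 h2] := HA t tab; have /andP[/E1 e1 _] := tab.
    by rewrite expr0 divr1; split; [apply: le_trans h1 _|apply: le_trans h2 _];
      rewrite ler_peMr.
  have B0 : 0 <= A / 2 ^+ n by rewrite divr_ge0.
  have eB : A / 2 ^+ n.+1 = A / 2 ^+ n / 2.
    by rewrite exprS; field; rewrite expf_neq0.
  rewrite eB; split.
    rewrite !uS.
    rewrite (_ : forall x y z : R, x + y - (x + z) = y - z); last by move=> *; ring.
    by apply: contract => // s sab; exact: (IH s sab).2.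
  rewrite !wS.
  have i1 : intg `[a, t] (fun s => c2 s * u n.+1 s).
    have [[f1 p1] _] := pX n.+1; apply: intg_itvS (mulc _ _ _ m2 b2 p1) => //.
    by case/andP: tab.
  have i2 : intg `[a, t] (fun s => c2 s * u n s).
    have [[f1 p1] _] := pX n; apply: intg_itvS (mulc _ _ _ m2 b2 p1) => //.
    by case/andP: tab.
  have i3 : intg `[a, t] g by apply: intg_itvS gi => //; case/andP: tab.
  rewrite !int_add//.
  rewrite (_ : forall x y z v : R, x + (y + v) - (x + (z + v)) = y - z); last by move=> *; ring.
  have [[f1 p1] _] := pX n; have [[f1' p1'] _] := pX n.+1.
  apply: contract => //; [exact: mulc p1'|exact: mulc p1|].
  by move=> s sab; exact: (IH s sab).1.
pose C := A * E b.
have Eb t : a <= t <= b -> E t <= E b.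
  by move=> /andP[_ tb]; rewrite /E ler_expR ler_pM2l// lerD2r.
have HC n t : a <= t <= b -> `|u n.+1 t - u n t| <= C / 2 ^+ n /\ `|w n.+1 t - w n t| <= C / 2 ^+ n.
  move=> tab; have [h1 h2] := HX n t tab.
  have h : A / 2 ^+ n * E t <= C / 2 ^+ n.
    by rewrite /C mulrAC ler_pM2r ?invr_gt0 ?exprn_gt0// ler_wpM2l// Eb.
  by split; [exact: le_trans h1 h|exact: le_trans h2 h].
have lim (s : nat -> R -> R) : (forall n t, a <= t <= b -> `|s n.+1 t - s n t| <= C / 2 ^+ n) ->
    exists l : R -> R, forall n t, a <= t <= b -> `|s n t - l t| <= 2 * C / 2 ^+ n.
  move=> sC; have : forall t, exists l, a <= t <= b -> forall n, `|s n t - l| <= 2 * C / 2 ^+ n.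
    move=> t; have [tab|ntab] := pselect (a <= t <= b); last by exists 0.
    by have [l Hl] := geometric_limit (fun n => sC n t tab); exists l.
  by move=> /choice[l Hl]; exists l => n t tab; exact: Hl.
have [U HU] := lim u (fun n t tab => (HC n t tab).1).
have [W HW] := lim w (fun n t tab => (HC n t tab).2).
have C0 : 0 <= C by rewrite mulr_ge0// /E expR_ge0.
exists U, W.
pose M := (K + 1) * (2 * C).
have cvg_meas (s : nat -> R -> R) (l : R -> R) :
    (forall n, measurable_fun `[a, b] (s n)) ->
    (forall n t, a <= t <= b -> `|s n t - l t| <= 2 * C / 2 ^+ n) ->
    measurable_fun `[a, b] l.
  move=> ms sl; apply: (measurable_fun_cvg ms) => t /itv_ccP tab.
  apply/cvgrPdist_le => e e0; near=> n.
  rewrite distrC; apply: le_trans (sl n t tab) _.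
  rewrite ler_pdivrMr ?exprn_gt0// [leRHS]mulrC -ler_pdivrMr//.
  have h : (Num.truncn (2 * C / e)).+1%:R <= (2 ^+ n : R).
    rewrite -natrX ler_nat.
    have hn : ((Num.truncn (2 * C / e)).+1 <= n)%N.
      by near: n; exact: nbhs_infty_ge.
    by apply: (leq_trans hn); apply/ltnW/ltn_expl.
  by apply: (le_trans _ h); apply/ltW/truncnS_gt.
have half n : 2 * C / 2 ^+ n.+1 <= M / 2 ^+ n.
  rewrite /M exprS invfM mulrA ler_pM2r ?invr_gt0 ?exprn_gt0//.
  rewrite ler_pdivrMr//; have := mulr_ge0 (ltW K0) C0; lra.
have Kbd n : K * (2 * C / 2 ^+ n) <= M / 2 ^+ n.
  rewrite /M mulrA ler_pM2r ?invr_gt0 ?exprn_gt0// ler_wpM2r//; lra.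
have mU : measurable_fun `[a, b] U.
  apply: cvg_meas HU => n; have [[f1 p1] _] := pX n; exact: prim_meas p1.
have mW : measurable_fun `[a, b] W.
  apply: cvg_meas HW => n; have [_ [f1 p1]] := pX n; exact: prim_meas p1.
have sub x y (f : R -> R) : `[a, b]%classic x -> `[a, b]%classic y ->
    measurable_fun `[a, b] f -> measurable_fun `[x, y] f.
  move=> ax by_ mf; apply: measurable_funS mf => //.
  by move=> t /itv_ccP; exact: iab.
split.
- apply: (prim_limit (C := M) iab pu) => [x y Dx Dy|n t /itv_ccP tab|n t /itv_ccP tab].
  + by apply: sub => //; exact: measurable_funM.
  + by apply: le_trans (HU n.+1 t tab) _.
  + rewrite -mulrBr normrM; apply: (le_trans _ (Kbd n)).
    by rewrite ler_pM// HW.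
- apply: (prim_limit (C := M) iab pw) => [x y Dx Dy|n t /itv_ccP tab|n t /itv_ccP tab].
  + apply: sub => //; apply: measurable_funD; last exact: intg_meas gi.
    exact: measurable_funM.
  + by apply: le_trans (HW n.+1 t tab) _.
  + rewrite opprD addrACA subrr addr0 -mulrBr normrM; apply: (le_trans _ (Kbd n)).
    by rewrite ler_pM// HU.
- apply/esym/eqP; rewrite -subr_eq0; apply/eqP/(pow2_small (c := 2 * C)) => n.
  have {1}-> : p = u n a by case: n => [|n]; rewrite ?uS ?int_pt ?addr0.
  by apply: HU; rewrite lexx ab.
- apply/esym/eqP; rewrite -subr_eq0; apply/eqP/(pow2_small (c := 2 * C)) => n.
  have {1}-> : q = w n a by case: n => [|n]; rewrite ?wS ?int_pt ?addr0.
  by apply: HW; rewrite lexx ab.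
Unshelve. all: by end_near. Qed.

End picard.

(** * Wronskians and uniqueness *)

Section real_solutions.
Context {R : realType}.
Variables (mu rho : R -> R) (lam : R).
Implicit Types (D : set R) (h u w : R -> R) (x y a b p q : R).

Lemma rsol_sub D D' h u w : D' `<=` D -> rsol D mu rho lam h u w ->
  rsol D' mu rho lam h u w.
Proof. by move=> s [p1 p2]; split; exact: prim_sub s _. Qed.

Lemma rsol_ext D h u w h' u' w' : is_interval D -> rsol D mu rho lam h u w ->
  (forall t, D t -> h t = h' t) -> (forall t, D t -> u t = u' t) ->
  (forall t, D t -> w t = w' t) -> rsol D mu rho lam h' u' w'.
Proof.
move=> iD [p1 p2] eh eu ew; split.
  by apply: (prim_ext iD p1) => // t Dt; rewrite ew.
by apply: (prim_ext iD p2) => // t Dt; rewrite eu// eh.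
Qed.

Lemma rsol_lin D h1 u1 w1 h2 u2 w2 (c d : R) : is_interval D ->
  rsol D mu rho lam h1 u1 w1 -> rsol D mu rho lam h2 u2 w2 ->
  rsol D mu rho lam (fun t => c * h1 t + d * h2 t)
    (fun t => c * u1 t + d * u2 t) (fun t => c * w1 t + d * w2 t).
Proof.
move=> iD [p1 q1] [p2 q2]; split.
  by apply: (prim_ext iD (prim_lin c d p1 p2)) => // t _; ring.
by apply: (prim_ext iD (prim_lin c d q1 q2)) => // t _; ring.
Qed.

(** In the derivative of the Wronskian the terms in [1 / mu] and in [lam rho]
    cancel. *)
Lemma wronskian D h1 u1 w1 h2 u2 w2 : is_interval D ->
  rsol D mu rho lam h1 u1 w1 -> rsol D mu rho lam h2 u2 w2 ->
  prim D (fun t => u1 t * w2 t - w1 t * u2 t)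
    (fun t => h1 t * u2 t - u1 t * h2 t).
Proof.
move=> iD [p1 q1] [p2 q2].
apply: (prim_ext iD (prim_lin 1 (-1) (prim_mul iD p1 q2) (prim_mul iD q1 p2))).
  by move=> t _; ring.
by move=> t _; ring.
Qed.

Hypotheses (hmu : line_coefficient mu) (hrho : line_coefficient rho).

Let iab a b : is_interval (`[a, b]%classic : set R).
Proof. exact: interval_is_interval. Qed.

Lemma cauchy_left a b p q h : a <= b -> intg `[a, b] h ->
  exists u w, [/\ rsol `[a, b] mu rho lam h u w, u a = p & w a = q].
Proof.
move=> ab ih.
have [Ki Ki0 HKi] := coef_inv_le hmu; have [Kr Kr0 HKr] := coef_le hrho.
have L0 : 0 <= Kr * `|lam| by rewrite mulr_ge0// ltW.
have m2 : measurable_fun `[a, b] (fun t => - (rho t * lam)).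
  by apply: measurable_funN; apply: measurable_funM => //; exact: coef_meas.
have b1 t : `|(mu t)^-1| <= Ki + Kr * `|lam| by rewrite (le_trans (HKi t))// lerDl.
have b2 t : `|- (rho t * lam)| <= Ki + Kr * `|lam|.
  by rewrite normrN normrM (@le_trans _ _ (Kr * `|lam|)) ?ler_wpM2r// lerDr ltW.
have ih' : intg `[a, b] (fun t => - h t) by exact: intg_opp.
have [u [w [p1 p2 ua wa]]] := picard p q ab
  (coef_inv_meas hmu (measurable_itv _)) m2 b1 b2 ih'.
exists u, w; split => //; split => //.
by apply: (prim_ext (@iab a b) p2) => // t _; ring.
Qed.

Lemma intg0 (D : set R) : measurable D -> intg D (fun=> 0 : R).
Proof. by move=> mD; exact: (@integrable0 _ (measurableTypeR R) R leb D). Qed.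

Lemma fundamental_system a b : a <= b -> exists u1 w1 u2 w2,
  [/\ rsol `[a, b] mu rho lam (fun=> 0) u1 w1,
      rsol `[a, b] mu rho lam (fun=> 0) u2 w2,
      (u1 a = 1 /\ w1 a = 0) /\ (u2 a = 0 /\ w2 a = 1) &
      forall t, a <= t <= b -> u1 t * w2 t - w1 t * u2 t = 1].
Proof.
move=> ab; have i0 : intg `[a, b] (fun=> 0 : R) by exact: intg0.
have [u1 [w1 [s1 a1 b1]]] := cauchy_left 1 0 ab i0.
have [u2 [w2 [s2 a2 b2]]] := cauchy_left 0 1 ab i0.
exists u1, w1, u2, w2; split => // t tab.
have W := wronskian (@iab a b) s1 s2.
have W0 : prim `[a, b] (fun t => u1 t * w2 t - w1 t * u2 t) (fun=> 0).
  by apply: (prim_ext (@iab a b) W) => // s _; rewrite mul0r mulr0 subrr.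
rewrite (@prim_const0 _ _ _ t a W0); last 2 first.
- exact/itv_ccP.
- by apply/itv_ccP; rewrite lexx ab.
by rewrite a1 b2 b1 a2; ring.
Qed.

Lemma cauchy_right a b p q h : a <= b -> intg `[a, b] h ->
  exists u w, [/\ rsol `[a, b] mu rho lam h u w, u b = p & w b = q].
Proof.
move=> ab ih.
have [u1 [w1 [u2 [w2 [s1 s2 _ W]]]]] := fundamental_system ab.
have [v [k [s _ _]]] := cauchy_left 0 0 ab ih.
have Wb := W b; rewrite lexx ab in Wb; have {}Wb := Wb isT.
pose P := p - v b; pose Q := q - k b.
have := rsol_lin 1 1 (@iab a b) s
  (rsol_lin (P * w2 b - Q * u2 b) (Q * u1 b - P * w1 b) (@iab a b) s1 s2).
move=> S; eexists; eexists; split.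
- apply: (rsol_ext (@iab a b) S) => // t _; ring.
- rewrite /= (_ : _ + _ = v b + P * (u1 b * w2 b - w1 b * u2 b)); last by ring.
  by rewrite Wb /P; ring.
- rewrite /= (_ : _ + _ = k b + Q * (u1 b * w2 b - w1 b * u2 b)); last by ring.
  by rewrite Wb /Q; ring.
Qed.

Let zero_right a b u w : a <= b -> rsol `[a, b] mu rho lam (fun=> 0) u w ->
  (u a = 0 -> w a = 0 -> u b = 0 /\ w b = 0) /\
  (u b = 0 -> w b = 0 -> u a = 0 /\ w a = 0).
Proof.
move=> ab s.
have [u1 [w1 [u2 [w2 [s1 s2 [[a1 b1] [a2 b2]] W]]]]] := fundamental_system ab.
have cst v k : rsol `[a, b] mu rho lam (fun=> 0) v k ->
    u a * k a - w a * v a = u b * k b - w b * v b.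
  move=> s'; have W' := wronskian (@iab a b) s s'.
  have W0 : prim `[a, b] (fun t => u t * k t - w t * v t) (fun=> 0).
    by apply: (prim_ext (@iab a b) W') => // r _; rewrite mul0r mulr0 subrr.
  apply: (@prim_const0 _ _ _ a b W0); apply/itv_ccP; rewrite lexx ?ab//.
have := cst _ _ s1; have := cst _ _ s2; rewrite a1 b1 a2 b2 => c2 c1.
have Wb := W b; rewrite lexx ab in Wb; have {}Wb := Wb isT.
split=> e1 e2; move: c1 c2; rewrite e1 e2 => c1 c2.
  split.
    rewrite -[u b]mulr1 -Wb.
    rewrite (_ : _ * _ = u1 b * (u b * w2 b - w b * u2 b) - u2 b * (u b * w1 b - w b * u1 b)); last by ring.
    by rewrite -c1 -c2; ring.
  rewrite -[w b]mulr1 -Wb.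
  rewrite (_ : _ * _ = w1 b * (u b * w2 b - w b * u2 b) - w2 b * (u b * w1 b - w b * u1 b)); last by ring.
  by rewrite -c1 -c2; ring.
by split; lra.
Qed.

(** Uniqueness for the Cauchy problem: Wronskians with a fundamental system are
    constant. *)
Lemma rsol_zero D u w x y : is_interval D -> D x -> D y ->
  rsol D mu rho lam (fun=> 0) u w -> u x = 0 -> w x = 0 -> u y = 0 /\ w y = 0.
Proof.
move=> iD Dx Dy s ux wx; have [xy|/ltW yx] := leP x y.
  have s' : rsol `[x, y] mu rho lam (fun=> 0) u w.
    by apply: rsol_sub s => t /itv_ccP; exact: iD.
  exact: (zero_right xy s').1.
have s' : rsol `[y, x] mu rho lam (fun=> 0) u w.
  by apply: rsol_sub s => t /itv_ccP; exact: iD.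
exact: (zero_right yx s').2.
Qed.

End real_solutions.

(** A submultiplicative norm, equivalent to the modulus, convenient under the
    integral sign. *)
Definition n1 {R : realType} (c : R[i]) : R := `|complex.Re c| + `|complex.Im c|.

Section one_norm.
Context {R : realType}.
Implicit Types (a b c : R[i]).

Lemma n1_ge0 c : 0 <= n1 c. Proof. by rewrite addr_ge0. Qed.

Lemma n1_0 : n1 (0 : R[i]) = 0. Proof. by rewrite /n1/= normr0 addr0. Qed.

Lemma n1D a b : n1 (a + b) <= n1 a + n1 b.
Proof. by rewrite /n1 cReD cImD addrACA lerD// ler_normD. Qed.

Lemma n1N a : n1 (- a) = n1 a.
Proof. by rewrite /n1 cReN cImN !normrN. Qed.

Lemma n1B a b : n1 (a - b) <= n1 a + n1 b.
Proof. by rewrite (le_trans (n1D _ _))// n1N. Qed.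

Lemma n1M a b : n1 (a * b) <= n1 a * n1 b.
Proof.
rewrite /n1 cReM cImM.
apply: le_trans (lerD (ler_normB _ _) (ler_normD _ _)) _.
by rewrite !normrM le_eqVlt; apply/orP; left; apply/eqP; ring.
Qed.

Lemma normc_n1 c : normc c <= n1 c.
Proof.
rewrite -(@ler_pXn2r _ 2)// ?nnegrE ?n1_ge0//; last by case: c => x y; exact: sqrtr_ge0.
rewrite normc2 /n1 sqrrD !real_normK ?num_real//.
by rewrite -addrA lerD2l lerDr mulrn_wge0// mulr_ge0.
Qed.

Lemma n1_normc c : n1 c <= 2 * normc c.
Proof.
have n0 : 0 <= normc c by case: c => x y; exact: sqrtr_ge0.
have h1 : `|complex.Re c| <= normc c.
  by rewrite -(@ler_pXn2r _ 2)// ?nnegrE// normc2 real_normK ?num_real// lerDl sqr_ge0.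
have h2 : `|complex.Im c| <= normc c.
  by rewrite -(@ler_pXn2r _ 2)// ?nnegrE// normc2 real_normK ?num_real// lerDr sqr_ge0.
rewrite /n1; lra.
Qed.

End one_norm.

(** With a real spectral parameter the complex equation is a pair of uncoupled
    real ones; absorption only enters through the source [h]. *)
Definition ksol {R : realType} (D : set R) (mu rho : R -> R) (lam : R)
    (h u w : R -> R[i]) : Prop :=
  rsol D mu rho lam (re h) (re u) (re w) /\ rsol D mu rho lam (im h) (im u) (im w).

Definition cW {R : realType} (u1 w1 u2 w2 : R -> R[i]) (t : R) : R[i] :=
  u1 t * w2 t - w1 t * u2 t.

Section complex_solutions.
Context {R : realType}.
Variables (mu rho : R -> R).
Implicit Types (D : set R) (lam : R) (h u w : R -> R[i]) (x y a b : R) (p q : R[i]).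

Lemma csol_ksol D kappa g u w : is_interval D -> csol D mu rho kappa g u w ->
  ksol D mu rho (complex.Re kappa)
    (fun t => g t + (0 +i* (rho t * complex.Im kappa)) * u t) u w.
Proof.
move=> iD [s1 s2]; split.
  by apply: (rsol_ext iD s1) => // t _; rewrite /re cReD cReM/=; ring.
by apply: (rsol_ext iD s2) => // t _; rewrite /im cImD cImM/=; ring.
Qed.

Lemma ksol_csol D (lam : R) h u w : is_interval D -> ksol D mu rho lam h u w ->
  csol D mu rho lam%:C h u w.
Proof.
move=> iD [s1 s2]; split; [apply: (rsol_ext iD s1)|apply: (rsol_ext iD s2)] => // t _ /=;
  by rewrite mulr0 mul0r ?subr0 ?addr0.
Qed.

Lemma ksol_ext D lam h u w h' u' w' : is_interval D -> ksol D mu rho lam h u w ->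
  (forall t, D t -> h t = h' t) -> (forall t, D t -> u t = u' t) ->
  (forall t, D t -> w t = w' t) -> ksol D mu rho lam h' u' w'.
Proof.
move=> iD [s1 s2] eh eu ew; split.
  apply: (rsol_ext iD s1) => t Dt; rewrite /re; [rewrite eh|rewrite eu|rewrite ew] => //.
apply: (rsol_ext iD s2) => t Dt; rewrite /im; [rewrite eh|rewrite eu|rewrite ew] => //.
Qed.

Lemma ksol_sub D D' lam h u w : D' `<=` D -> ksol D mu rho lam h u w ->
  ksol D' mu rho lam h u w.
Proof. by move=> s [p1 p2]; split; exact: rsol_sub s _. Qed.

Lemma ksol_add D lam h1 u1 w1 h2 u2 w2 c d : is_interval D ->
  ksol D mu rho lam h1 u1 w1 -> ksol D mu rho lam h2 u2 w2 ->
  ksol D mu rho lam (fun t => c * h1 t + d * h2 t)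
    (fun t => c * u1 t + d * u2 t) (fun t => c * w1 t + d * w2 t).
Proof.
move=> iD [p1 q1] [p2 q2]; split.
  apply: (rsol_ext iD (rsol_lin 1 1 iD
    (rsol_lin (complex.Re c) (- complex.Im c) iD p1 q1)
    (rsol_lin (complex.Re d) (- complex.Im d) iD p2 q2))) => t _;
  by rewrite /re cReD !cReM /re /im; ring.
apply: (rsol_ext iD (rsol_lin 1 1 iD
  (rsol_lin (complex.Im c) (complex.Re c) iD p1 q1)
  (rsol_lin (complex.Im d) (complex.Re d) iD p2 q2))) => t _;
by rewrite /im cImD !cImM /re /im; ring.
Qed.

Lemma cwronskian D lam h1 u1 w1 h2 u2 w2 : is_interval D ->
  ksol D mu rho lam h1 u1 w1 -> ksol D mu rho lam h2 u2 w2 ->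
  prim D (re (cW u1 w1 u2 w2)) (re (fun t => h1 t * u2 t - u1 t * h2 t)) /\
  prim D (im (cW u1 w1 u2 w2)) (im (fun t => h1 t * u2 t - u1 t * h2 t)).
Proof.
move=> iD [p1 q1] [p2 q2]; split.
  apply: (prim_ext iD (prim_lin 1 (-1) (wronskian iD p1 p2) (wronskian iD q1 q2))) => t _;
  by rewrite /re /cW cReD cReN !cReM /re /im; ring.
apply: (prim_ext iD (prim_lin 1 1 (wronskian iD p1 q2) (wronskian iD q1 p2))) => t _;
by rewrite /im /cW cImD cImN !cImM /re /im; ring.
Qed.

End complex_solutions.

(** * The interior problem with Robin conditions *)

Section robin.
Context {R : realType}.
Implicit Types (i : side) (z : R) (U W : R[i]).

Definition Rp i z U W : R[i] := - (orient i)%:C * W - (0 +i* z) * U.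
Definition Rm i z U W : R[i] := (orient i)%:C * W - (0 +i* z) * U.

Lemma orient2 i : (orient i)%:C * (orient i)%:C = 1 :> R[i].
Proof. by case: i; rewrite /= -rmorphM/= ?mulrNN mulr1. Qed.

Lemma iz_neq0 z : z != 0 -> (0 +i* z) != 0 :> R[i].
Proof. by move=> z0; rewrite eq_complex/= eqxx. Qed.

(** The Robin traces are coordinates on the Cauchy data, in which the Wronskian
    is again the determinant up to a factor. *)
Lemma robin_wronskian i z U1 W1 U2 W2 :
  Rp i z U1 W1 * Rm i z U2 W2 - Rm i z U1 W1 * Rp i z U2 W2 =
  2%:R * (0 +i* z) * (orient i)%:C * (W1 * U2 - U1 * W2).
Proof. by rewrite /Rp /Rm; ring. Qed.

Lemma robin_zero i z U W : z != 0 -> Rp i z U W = 0 -> Rm i z U W = 0 ->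
  U = 0 /\ W = 0.
Proof.
move=> z0 e1 e2.
have eU : 2%:R * (0 +i* z) * U = 0.
  have -> : 2%:R * (0 +i* z) * U = - (Rp i z U W + Rm i z U W) by rewrite /Rp /Rm; ring.
  by rewrite e1 e2 addr0 oppr0.
have eW : 2%:R * W = 0.
  have E : (orient i)%:C * (Rm i z U W - Rp i z U W) =
      ((orient i)%:C * (orient i)%:C) * (2%:R * W) by rewrite /Rm /Rp; ring.
  by rewrite orient2 mul1r e1 e2 subr0 mulr0 in E.
have n2 : (2%:R : R[i]) != 0 by rewrite pnatr_eq0.
split.
  by move/eqP: eU; rewrite !mulf_eq0 (negbTE n2) (negbTE (iz_neq0 z0)) => /eqP.
by move/eqP: eW; rewrite mulf_eq0 (negbTE n2) => /eqP.
Qed.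

Lemma robin_data i z P M : z != 0 -> exists U W, Rp i z U W = P /\ Rm i z U W = M.
Proof.
move=> z0; exists (- (P + M) / (2%:R * (0 +i* z))), ((orient i)%:C * (M - P) / 2%:R).
have n2 : (2%:R : R[i]) != 0 by rewrite pnatr_eq0.
have nz := iz_neq0 z0; rewrite /Rp /Rm.
have e : (orient i)%:C * ((orient i)%:C * (M - P) / 2%:R) = (M - P) / 2%:R.
  by rewrite !mulrA orient2 mul1r.
by rewrite mulNr e; split; field; rewrite nz.
Qed.

End robin.

Lemma prim_osc {R : realType} (a b s t : R) (F f : R -> R) :
  prim `[a, b] F f -> `[a, b]%classic s -> `[a, b]%classic t ->
  `|F t - F s| <= lint `[a, b] (fun r => `|f r|).
Proof.
move=> pF; wlog st : s t / s <= t.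
  move=> H Js Jt; have [st|/ltW ts] := leP s t; first exact: H.
  by rewrite distrC; exact: H.
move=> /itv_ccP/andP[as_ sb] /itv_ccP/andP[at_ tb].
have ab : a <= b := le_trans as_ sb.
have [fi _] : intg `[a, b] f /\ F b - F a = lint `[a, b] f.
  by apply: pF => //; apply/itv_ccP; rewrite lexx ab.
have [fi' ->] : intg `[s, t] f /\ F t - F s = lint `[s, t] f.
  by apply: pF => //; apply/itv_ccP; rewrite ?as_ ?sb ?at_ ?tb.
apply: le_trans (int_le_norm _ fi') _ => //.
rewrite (int_split as_ sb (intg_norm _ fi))// (int_split st tb); last first.
  by apply: intg_itvS (intg_norm _ fi).
have := @int_ge0 _ `[a, s] (fun r => `|f r|) (fun r _ => normr_ge0 _).
have := @int_ge0 _ `[t, b] (fun r => `|f r|) (fun r _ => normr_ge0 _).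
lra.
Qed.

Section interior_core.
Context {R : realType}.
Variables (mu rho : R -> R) (lam al ar z : R) (Lam : side -> R[i]).
Hypotheses (hmu : line_coefficient mu) (hrho : line_coefficient rho).
Hypotheses (halr : al <= ar) (hz : z != 0).
Implicit Types (h u w : R -> R[i]) (t : R) (i : side).

Local Notation J := (`[al, ar]%classic : set R).
Let iJ : is_interval J. Proof. exact: interval_is_interval. Qed.
Let Jal : J al. Proof. by apply/itv_ccP; rewrite lexx halr. Qed.
Let Jar : J ar. Proof. by apply/itv_ccP; rewrite lexx halr. Qed.
Let Ji i : J (endpoint al ar i). Proof. by case: i. Qed.

(** What is missing for the pair of [u] and [w] to satisfy the boundary
    condition on side [i]. *)
Definition robin_defect i u w : R[i] :=
  Rm i z (u (endpoint al ar i)) (w (endpoint al ar i)) -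
  Lam i * Rp i z (u (endpoint al ar i)) (w (endpoint al ar i)).

Lemma ksol_cauchy i h (P Q : R[i]) : intg J (re h) -> intg J (im h) ->
  exists u w, [/\ ksol J mu rho lam h u w, u (endpoint al ar i) = P &
    w (endpoint al ar i) = Q].
Proof.
move=> h1 h2.
have C (k : R -> R) (p q : R) : intg J k -> exists u w : R -> R, [/\ rsol J mu rho lam k u w,
    u (endpoint al ar i) = p & w (endpoint al ar i) = q].
  move=> ik; case: i; first exact: cauchy_left.
  exact: cauchy_right.
have [u1 [w1 [s1 a1 b1]]] := C _ (complex.Re P) (complex.Re Q) h1.
have [u2 [w2 [s2 a2 b2]]] := C _ (complex.Im P) (complex.Im Q) h2.
exists (fun t => u1 t +i* u2 t), (fun t => w1 t +i* w2 t); split; first by split.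
  by apply: eq_parts.
by apply: eq_parts.
Qed.

Lemma ksol_bounded h u w : ksol J mu rho lam h u w ->
  exists2 B, 0 <= B & forall t, J t -> n1 (u t) <= B /\ n1 (w t) <= B.
Proof.
move=> [[p1 q1] [p2 q2]].
have [M1 H1] := prim_bounded p1; have [M2 H2] := prim_bounded q1.
have [M3 H3] := prim_bounded p2; have [M4 H4] := prim_bounded q2.
have n0 (F : R -> R) M : (forall t, al <= t <= ar -> `|F t| <= M) -> 0 <= M.
  by move=> H; apply: le_trans (H al _) => //; rewrite lexx halr.
have m1 := n0 _ _ H1; have m2 := n0 _ _ H2; have m3 := n0 _ _ H3; have m4 := n0 _ _ H4.
exists (M1 + M2 + M3 + M4); first by lra.
move=> t /itv_ccP tJ.
have := H1 t tJ; have := H2 t tJ; have := H3 t tJ; have := H4 t tJ.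
by rewrite /n1 /re /im; lra.
Qed.

Hypothesis inj : forall u w, ksol J mu rho lam (fun=> 0) u w ->
  (forall i, robin_defect i u w = 0) -> forall t, J t -> u t = 0 /\ w t = 0.

(* The solution that satisfies the Robin condition at one end point. *)
Let one_sided i : exists e k, [/\ ksol J mu rho lam (fun=> 0) e k,
  Rp i z (e (endpoint al ar i)) (k (endpoint al ar i)) = 1 &
  Rm i z (e (endpoint al ar i)) (k (endpoint al ar i)) = Lam i].
Proof.
have [P [Q [e1 e2]]] := robin_data i 1 (Lam i) hz.
have i0 : intg J (fun=> 0 : R) by exact: intg0.
have [e [k [s a b]]] := @ksol_cauchy i (fun=> 0) P Q i0 i0.
by exists e, k; rewrite a b.
Qed.

Let other i := if i is Rside then Lside else Rside.

Let defect_other i e k : ksol J mu rho lam (fun=> 0) e k ->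
  Rp i z (e (endpoint al ar i)) (k (endpoint al ar i)) = 1 ->
  Rm i z (e (endpoint al ar i)) (k (endpoint al ar i)) = Lam i ->
  robin_defect (other i) e k != 0.
Proof.
move=> s e1 e2; apply/eqP => e0.
have own : robin_defect i e k = 0 by rewrite /robin_defect e1 e2 mulr1 subrr.
have all0 j : robin_defect j e k = 0.
  by move: own e0; rewrite /other; clear; case: i; case: j.
have [ee kk] := inj s all0 (Ji i).
move: e1; rewrite ee kk /Rp !mulr0 subrr => /eqP.
by rewrite eq_sym oner_eq0.
Qed.

(** Existence for the interior problem: correct the particular solution with
    zero data at the left end point. *)
Lemma interior_exists h : intg J (re h) -> intg J (im h) ->
  exists u w, ksol J mu rho lam h u w /\ forall i, robin_defect i u w = 0.
Proof.
move=> h1 h2; have [e [k [s e1 e2]]] := one_sided Lside.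
have nz := defect_other s e1 e2; rewrite /= in nz e1 e2.
have [p [q [sp p0 q0]]] := ksol_cauchy Lside 0 0 h1 h2.
pose c := - robin_defect Rside p q / robin_defect Rside e k.
exists (fun t => 1 * p t + c * e t), (fun t => 1 * q t + c * k t); split.
  apply: (ksol_ext iJ (ksol_add 1 c iJ sp s)) => // t _.
  by rewrite mulr0 addr0 mul1r.
have lin j : robin_defect j (fun t => 1 * p t + c * e t) (fun t => 1 * q t + c * k t) =
    robin_defect j p q + c * robin_defect j e k.
  by rewrite /robin_defect /Rp /Rm; ring.
case; rewrite lin.
  by rewrite /robin_defect /= e1 e2 p0 q0 /Rp /Rm; ring.
by rewrite /c -mulrA mulVf// mulr1 subrr.
Qed.

Let wronskian_const i e k u w : ksol J mu rho lam (fun=> 0) e k ->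
  Rp i z (e (endpoint al ar i)) (k (endpoint al ar i)) = 1 ->
  Rm i z (e (endpoint al ar i)) (k (endpoint al ar i)) = Lam i ->
  cW u w e k (endpoint al ar i) =
  (orient i)%:C * robin_defect i u w / (2%:R * (0 +i* z)).
Proof.
move=> s e1 e2; have := robin_wronskian i z (u (endpoint al ar i))
  (w (endpoint al ar i)) (e (endpoint al ar i)) (k (endpoint al ar i)).
rewrite e1 e2 mulr1 /robin_defect /cW => H.
set U := u _ in H *; set V := w _ in H *; set E := e _ in H *; set K := k _ in H *.
have nz : 2%:R * (0 +i* z) != 0 :> R[i].
  by rewrite mulf_neq0 ?iz_neq0// pnatr_eq0.
apply: (mulIf nz); rewrite divfK//.
rewrite (_ : Rm i z U V - Lam i * Rp i z U V = - (Rp i z U V * Lam i - Rm i z U V)); last by ring.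
rewrite H (_ : (orient i)%:C * - (2 * (0 +i* z) * (orient i)%:C * (V * E - U * K)) =
  ((orient i)%:C * (orient i)%:C) * (2 * (0 +i* z) * (U * K - V * E))); last by ring.
by rewrite orient2; ring.
Qed.

Let cW_const e k e' k' : ksol J mu rho lam (fun=> 0) e k ->
  ksol J mu rho lam (fun=> 0) e' k' -> forall s t, J s -> J t ->
  cW e k e' k' s = cW e k e' k' t.
Proof.
move=> s1 s2 s t Js Jt; have [W1 W2] := cwronskian iJ s1 s2.
have z0 : (fun t : R => 0 * e' t - e t * 0) = (fun=> 0).
  by apply/funext => r; rewrite mul0r mulr0 subrr.
have {}W1 : prim J (re (cW e k e' k')) (fun=> 0).
  by apply: (prim_ext iJ W1) => // r _; rewrite z0.
have {}W2 : prim J (im (cW e k e' k')) (fun=> 0).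
  by apply: (prim_ext iJ W2) => // r _; rewrite z0.
by apply: eq_parts; [exact: prim_const0 W1 Js Jt|exact: prim_const0 W2 Js Jt].
Qed.

(** Stability of the interior problem. With [el], [er] the homogeneous solutions
    satisfying the left, resp. right, condition, the data of [u] at [t] are
    recovered from the Wronskians [u, el], [u, er] (which are controlled by
    the Robin defects and the source), because [el, er] is a nonzero constant. *)
Lemma interior_stable : exists2 M, 0 <= M & forall h u w,
  intg J (re h) -> intg J (im h) -> ksol J mu rho lam h u w ->
  forall t, J t -> n1 (u t) + n1 (w t) <=
    M * (n1 (robin_defect Lside u w) + n1 (robin_defect Rside u w) +
         lint J (fun t => n1 (h t))).
Proof.
have [el [kl [sl l1 l2]]] := one_sided Lside.
have [er [kr [sr r1 r2]]] := one_sided Rside.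
have nzl := defect_other sl l1 l2.
pose W := cW el kl er kr ar.
have W0 : W != 0.
  rewrite /W (wronskian_const el kl sr r1 r2) /= mul1r mulf_neq0//.
  by rewrite invr_eq0 mulf_neq0 ?iz_neq0// pnatr_eq0.
have Wt t : J t -> cW el kl er kr t = W by move=> Jt; exact: cW_const.
have [Bl Bl0 HBl] := ksol_bounded sl; have [Br Br0 HBr] := ksol_bounded sr.
pose N := n1 W^-1; pose Z := n1 (2%:R * (0 +i* z))^-1.
have N0 : 0 <= N := n1_ge0 _. have Z0 : 0 <= Z := n1_ge0 _.
have wr i e k (B : R) h u w t : ksol J mu rho lam (fun=> 0) e k ->
    Rp i z (e (endpoint al ar i)) (k (endpoint al ar i)) = 1 ->
    Rm i z (e (endpoint al ar i)) (k (endpoint al ar i)) = Lam i ->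
    (forall t, J t -> n1 (e t) <= B) ->
    intg J (re h) -> intg J (im h) -> ksol J mu rho lam h u w -> J t ->
    n1 (cW u w e k t) <= Z * n1 (robin_defect i u w) + B * lint J (fun t => n1 (h t)).
  move=> s e1 e2 eB h1 h2 su Jt.
  have [W1 W2] := cwronskian iJ su s.
  set D := fun t => _ in W1 W2.
  have [d1 _] := W1 _ _ Jal Jar halr; have [d2 _] := W2 _ _ Jal Jar halr.
  have nh : intg J (fun t => n1 (h t)) by apply: intg_add => //; exact: intg_norm.
  have dB : lint J (fun t => n1 (D t)) <= B * lint J (fun t => n1 (h t)).
    rewrite -int_scale//; apply: int_le => //.
    - by apply: intg_add => //; exact: intg_norm.
    - exact: intg_scale.
    move=> r Jr; rewrite /D mulr0 subr0 mulrC; apply: le_trans (n1M _ _) _.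
    by rewrite ler_wpM2r ?n1_ge0// eB.
  have ini : n1 (cW u w e k (endpoint al ar i)) <= Z * n1 (robin_defect i u w).
    rewrite (wronskian_const u w s e1 e2) mulrC; apply: le_trans (n1M _ _) _.
    rewrite -/Z ler_wpM2l//; apply: le_trans (n1M _ _) _.
    by rewrite /n1/= normr0 addr0; case: (i) => /=; rewrite ?normrN normr1 mul1r.
  rewrite -[cW u w e k t](subrK (cW u w e k (endpoint al ar i))) addrC.
  apply: le_trans (n1D _ _) _; apply: lerD => //.
  apply: le_trans dB; rewrite int_add//; [|exact: intg_norm..].
  rewrite [n1 (_ - _)]/n1 cReD cImD cReN cImN.
  by apply: lerD; [exact: prim_osc W1 (Ji i) Jt|exact: prim_osc W2 (Ji i) Jt].
exists (2 * N * (Bl + Br) * (Z + Bl + Br)).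
  by rewrite !mulr_ge0// ?addr_ge0.
move=> h u w h1 h2 su t Jt.
have wl := wr Lside el kl Bl h u w t sl l1 l2 (fun t Jt => (HBl t Jt).1) h1 h2 su Jt.
have wrr := wr Rside er kr Br h u w t sr r1 r2 (fun t Jt => (HBr t Jt).1) h1 h2 su Jt.
have eu : u t = (cW u w er kr t * el t - cW u w el kl t * er t) / W.
  by apply: (mulIf W0); rewrite divfK// -(Wt t Jt) /cW; ring.
have ew : w t = (cW u w er kr t * kl t - cW u w el kl t * kr t) / W.
  by apply: (mulIf W0); rewrite divfK// -(Wt t Jt) /cW; ring.
have [bl1 bl2] := HBl t Jt; have [br1 br2] := HBr t Jt.
set A := n1 (robin_defect Lside u w) in wl *.
set B := n1 (robin_defect Rside u w) in wrr *.
set H := lint J _ in wl wrr *.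
have A0 : 0 <= A := n1_ge0 _. have B0 : 0 <= B := n1_ge0 _.
have H0 : 0 <= H by apply: int_ge0 => r _; exact: n1_ge0.
have S0 : 0 <= A + B + H by lra.
have K0 : 0 <= (Z + Bl + Br) by lra.
have wl' : n1 (cW u w el kl t) <= (Z + Bl + Br) * (A + B + H).
  apply: le_trans wl _.
  have := mulr_ge0 Z0 B0; have := mulr_ge0 Z0 H0; have := mulr_ge0 Bl0 A0.
  have := mulr_ge0 Bl0 B0; have := mulr_ge0 Br0 S0; lra.
have wr' : n1 (cW u w er kr t) <= (Z + Bl + Br) * (A + B + H).
  apply: le_trans wrr _.
  have := mulr_ge0 Z0 A0; have := mulr_ge0 Z0 H0; have := mulr_ge0 Br0 A0.
  have := mulr_ge0 Br0 B0; have := mulr_ge0 Bl0 S0; lra.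
have comb (c1 c2 v1 v2 : R[i]) : n1 c1 <= (Z + Bl + Br) * (A + B + H) ->
    n1 c2 <= (Z + Bl + Br) * (A + B + H) -> n1 v1 <= Bl -> n1 v2 <= Br ->
    n1 ((c1 * v1 - c2 * v2) / W) <= N * (Bl + Br) * ((Z + Bl + Br) * (A + B + H)).
  move=> b1 b2 b3 b4; apply: le_trans (n1M _ _) _; rewrite mulrC -/N -mulrA ler_wpM2l//.
  move: b1 b2; set T := (Z + Bl + Br) * _ => b1 b2.
  apply: le_trans (n1B _ _) _; rewrite [leRHS]mulrC mulrDr; apply: lerD.
    by apply: le_trans (n1M _ _) _; apply: ler_pM; rewrite ?n1_ge0.
  by apply: le_trans (n1M _ _) _; apply: ler_pM; rewrite ?n1_ge0.
have c1 : n1 (u t) <= N * (Bl + Br) * ((Z + Bl + Br) * (A + B + H)).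
  by rewrite eu; exact: comb.
have c2 : n1 (w t) <= N * (Bl + Br) * ((Z + Bl + Br) * (A + B + H)).
  by rewrite ew; exact: comb.
apply: le_trans (lerD c1 c2) _; rewrite le_eqVlt; apply/orP; left; apply/eqP; ring.
Qed.

End interior_core.

(** * Changes of variable and decay at infinity *)

Section affine.
Context {R : realType}.
Implicit Types (D : set R) (F f : R -> R) (s b x y t : R).

Lemma lint_affine (s b : R) D f : s ^+ 2 = 1 -> measurable D -> intg D f ->
  let phi := fun t => s * t + b in
  [/\ measurable (phi @^-1` D), intg (phi @^-1` D) (f \o phi) &
      lint (phi @^-1` D) (f \o phi) = lint D f].
Proof.
move=> s1 mD fi phi.
have mphi : measurable_fun [set: measurableTypeR R] (phi : measurableTypeR R -> measurableTypeR R).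
  apply: measurable_funD => //; exact: measurable_funM.
have mpD : measurable (phi @^-1` D).
  by have := mphi measurableT D mD; rewrite setTI.
have mphiD : measurable_fun (phi @^-1` D) phi by apply: measurable_funS mphi.
pose mphi_mixin := isMeasurableFun.Build _ _ (measurableTypeR R) (measurableTypeR R) phi mphi.
pose phiM : {mfun measurableTypeR R >-> measurableTypeR R} := HB.pack phi mphi_mixin.
pose mu : {measure set (measurableTypeR R) -> \bar R} := @lebesgue_measure R.
have inv (A : set (measurableTypeR R)) : measurable A ->
    pushforward mu phiM A = mu A.
  move=> mA; apply/esym/(@lebesgue_measure_unique R (pushforward mu phiM)) => //= _ [[p q]] _ <-.
  rewrite /pushforward.
  have [s_eq|s_eq] : s = 1 \/ s = -1.
    by move/eqP: s1; rewrite sqrf_eq1 => /orP[/eqP ->|/eqP ->]; [left|right].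
    rewrite (_ : phi @^-1` _ = [set` `](p - b), (q - b)]]); last first.
      by apply/seteqP; split=> t /=; rewrite /phi s_eq !in_itv/= mul1r ltrBlDr lerBrDr.
    rewrite [LHS](lebesgue_measure_itv `]p, q]) [RHS](lebesgue_measure_itv `](p - b), (q - b)])/=.
    by rewrite !lte_fin ltrD2r; case: ifP => // _; rewrite -!EFinB; congr EFin; ring.
  rewrite (_ : phi @^-1` _ = [set` `[(b - q), (b - p)[]); last first.
    apply/seteqP; split=> t /=; rewrite /phi s_eq !in_itv/= mulN1r => /andP[h1 h2];
    by apply/andP; split; lra.
  rewrite [LHS](lebesgue_measure_itv `]p, q]) [RHS](lebesgue_measure_itv `[(b - q), (b - p)[)/=.
  by rewrite !lte_fin ltrD2l ltrN2; case: ifP => // _; rewrite -!EFinB; congr EFin; ring.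
have mf := intg_meas fi.
have mfp : measurable_fun (phi @^-1` D) (f \o phi).
  apply: (@measurable_comp _ _ _ _ _ _ D) => //; first by move=> _ [t Dt <-].
have int_abs : (\int[mu]_(t in phi @^-1` D) `|(f (phi t))%:E| = \int[mu]_(t in D) `|(f t)%:E|)%E.
  rewrite -(@ge0_integral_pushforward _ _ _ _ R phiM mphi mu D (fun t => `|(f t)%:E|%E))//.
    by apply: eq_measure_integral => A mA AD; exact: inv.
  by apply/measurable_EFinP; apply: measurableT_comp.
have ip : intg (phi @^-1` D) (f \o phi).
  apply/integrableP; split; first exact/measurable_EFinP.
  by have /integrableP[_] := fi; rewrite -[X in (X < _)%E]int_abs.
split => //.
pose g := f \_ D.
have mg : measurable_fun [set: measurableTypeR R] (EFin \o g).
  by apply/measurable_EFinP; exact: (measurable_restrictT f mD).1 mf.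
have eqg : {in phi @^-1` D, f \o phi =1 g \o phi}.
  by move=> t /set_mem Dt; rewrite /g/= patchE mem_set.
have ig : mu.-integrable (phiM @^-1` D) ((EFin \o g) \o phiM).
  exact: (intg_ext eqg mpD ip).
have E := @integral_pushforward _ _ _ _ R phiM mphi mu D (EFin \o g) mg ig mD.
rewrite /lint /Rintegral; congr fine.
transitivity (\int[mu]_(t in phi @^-1` D) (EFin \o g \o phi) t)%E.
  by apply: eq_integral => t Dt; have /= -> := eqg t Dt.
rewrite -[LHS]E.
transitivity (\int[mu]_(t in D) (EFin \o g) t)%E.
  by apply: eq_measure_integral => A mA AD; exact: inv.
by apply: eq_integral => t Dt; rewrite /g/= patchE Dt.
Qed.

(** Reflections reduce left half-lines to right ones, and translations move
    their end point. *)
Lemma prim_affine s b D F f : s ^+ 2 = 1 -> prim D F f ->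
  prim ((fun t => s * t + b) @^-1` D) (fun t => F (s * t + b))
    (fun t => s * f (s * t + b)).
Proof.
move=> s1 pF; split => x y Dx Dy xy.
have [s_eq|s_eq] : s = 1 \/ s = -1.
  by move/eqP: s1; rewrite sqrf_eq1 => /orP[/eqP ->|/eqP ->]; [left|right].
  have l : s * x + b <= s * y + b by rewrite s_eq !mul1r lerD2r.
  have [fi ->] := pF _ _ Dx Dy l.
  have [_ i1 <-] := lint_affine b s1 (measurable_itv `[s * x + b, s * y + b]) fi.
  have E : (fun t => s * t + b) @^-1` `[s * x + b, s * y + b] = `[x, y]%classic.
    apply/seteqP; split=> t /=; rewrite s_eq !in_itv/= => /andP[h1 h2]; apply/andP; split; lra.
  rewrite E in i1 *; split; first exact: intg_scale.
  by apply: int_eq => t _; rewrite s_eq mul1r.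
have l : s * y + b <= s * x + b by rewrite s_eq !mulN1r lerD2r lerN2.
have [fi fe] := pF _ _ Dy Dx l.
have [_ i1 e1] := lint_affine b s1 (measurable_itv `[s * y + b, s * x + b]) fi.
have E : (fun t => s * t + b) @^-1` `[s * y + b, s * x + b] = `[x, y]%classic.
  apply/seteqP; split=> t /=; rewrite s_eq !in_itv/= => /andP[h1 h2]; apply/andP; split; lra.
rewrite E in i1 e1; split; first exact: intg_scale.
by rewrite int_scale// e1 -fe s_eq; ring.
Qed.

End affine.

Section decay.
Context {R : realType}.
Implicit Types (F f : R -> R) (a x y : R) (i : side).

Lemma int_splity a y f : a <= y -> intg `[a, +oo[ f ->
  lint `[a, +oo[ f = lint `[a, y] f + lint `]y, +oo[ f.
Proof.
move=> ay fi; rewrite /lint -(Rintegral_itvB fi) ?bnd_simp//.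
by rewrite addrC subrK.
Qed.

Lemma intg_seg a x y f : a <= x -> intg `[a, +oo[ f -> intg `[x, y] f.
Proof.
move=> ax; apply: intg_sub => // t /itv_ccP/andP[xt _].
by rewrite /= in_itv/= andbT (le_trans ax).
Qed.

Lemma int_tail a f (e : R) : intg `[a, +oo[ f -> 0 < e ->
  exists2 y0, a <= y0 & forall y, y0 <= y -> lint `]y, +oo[ (fun t => `|f t|) < e.
Proof.
move=> fi e0; have ni := intg_norm (measurable_itv `[a, +oo[) fi.
pose A (n : nat) : set R := `[a, a + n%:R]%classic.
have UA : \bigcup_n A n = `[a, +oo[%classic.
  apply/seteqP; split => [t [n _] /itv_ccP/andP[h _]|t /=].
    by rewrite /= in_itv/= h.
  rewrite in_itv/= andbT => at_; exists (Num.truncn (t - a)).+1 => //; apply/itv_ccP.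
  by rewrite at_/= -lerBlDl; apply/ltW/truncnS_gt.
have C : (\int[leb]_(t in A n) (`|f t|)%:E @[n --> \oo] -->
    (\int[leb]_(t in \bigcup_n A n) (`|f t|)%:E))%E.
  apply: ge0_nondecreasing_set_cvg_integral => //.
  - move=> m n mn; apply/subsetPset => t /itv_ccP/andP[h1 h2]; apply/itv_ccP.
    by rewrite h1 (le_trans h2)// lerD2l ler_nat.
  - by move=> n; exact: measurable_itv.
  - move=> n; apply/measurable_EFinP; apply: measurable_funS (intg_meas ni) => //.
    by rewrite -UA; exact: bigcup_sup.
have E (D : set R) : measurable D -> intg D f ->
    (\int[leb]_(t in D) (`|f t|)%:E = (lint D (fun t => `|f t|))%:E)%E.
  move=> mD iD; rewrite /lint /Rintegral fineK//.
  exact: (@integrable_fin_num _ (measurableTypeR R) R leb D mD _ (intg_norm mD iD)).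
move: C; rewrite UA E//.
move=> /fine_cvgP[_] /cvgrPdist_lt /(_ e e0) [n _ /(_ n (leqnn n))] /=.
rewrite E; [|exact: measurable_itv|exact: intg_seg fi].
rewrite /= => H; exists (a + n%:R); first by rewrite lerDl.
move=> y ny; have ay : a <= y by rewrite (le_trans _ ny)// lerDl.
have := int_splity ay ni; move: H; set T := lint `[a, +oo[ _.
have i1 : intg `[a, y] (fun t => `|f t|) by exact: intg_seg ni.
have an : a <= a + n%:R by rewrite lerDl.
rewrite (int_split an ny i1).
have := @int_ge0 _ `[a + n%:R, y] (fun r => `|f r|) (fun r _ => normr_ge0 _).
rewrite /A ltr_norml => p /andP[_ h] k; lra.
Qed.

Lemma decay_right a F f : prim `[a, +oo[ F f -> intg `[a, +oo[ F ->
  intg `[a, +oo[ f -> F a = - lint `[a, +oo[ f.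
Proof.
move=> pF iF fi.
have mem y : a <= y -> `[a, +oo[%classic y by move=> ay; rewrite /= in_itv/= ay.
apply/eqP; rewrite -addr_eq0; apply/eqP; set l := F a + _.
have near_l e : 0 < e -> exists2 y0, a <= y0 & forall y, y0 <= y -> `|F y - l| < e.
  move=> e0; have [y0 ay0 H] := int_tail fi e0; exists y0 => // y yy.
  have ay := le_trans ay0 yy.
  have [_ e1] := pF _ _ (mem _ (lexx a)) (mem _ ay) ay.
  have -> : F y - l = - lint `]y, +oo[ f.
    by rewrite /l (int_splity ay fi) -e1; ring.
  rewrite normrN; apply: le_lt_trans (int_le_norm _ _) (H _ yy) => //.
  apply: intg_sub fi => //; apply: subset_itvr; by rewrite bnd_simp.
apply/eqP; apply: contrapT => /negP l0.
have e0 : 0 < `|l| / 2 by rewrite divr_gt0// normr_gt0.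
have [y0 ay0 H] := near_l _ e0.
have Fbig t : y0 <= t -> `|l| / 2 <= `|F t|.
  move=> /H h; have := ler_normB (F t) (F t - l).
  rewrite opprB addrC subrK; lra.
have nF := intg_norm (measurable_itv _) iF.
set K := lint `[a, +oo[ (fun t => `|F t|).
have big (m : nat) : `|l| / 2 * m%:R <= K.
  have ym : y0 <= y0 + m%:R by rewrite lerDl.
  rewrite -[m%:R](_ : y0 + m%:R - y0 = _); last by ring.
  rewrite -int_cst//.
  apply: (@le_trans _ _ (lint `[y0, y0 + m%:R] (fun t => `|F t|))).
    apply: int_le => //; [exact: intg_cst|exact: intg_seg nF|].
    by move=> t /itv_ccP/andP[/Fbig].
  rewrite /K (int_splity (le_trans ay0 ym) nF).
  rewrite (int_split ay0 ym); last exact: intg_seg nF.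
  have := @int_ge0 _ `[a, y0] (fun r => `|F r|) (fun r _ => normr_ge0 _).
  have := @int_ge0 _ `]y0 + m%:R, +oo[ (fun r => `|F r|) (fun r _ => normr_ge0 _).
  lra.
have := big (Num.truncn (K / (`|l| / 2))).+1.
rewrite leNgt => /negP; apply.
by rewrite mulrC -ltr_pdivrMr//; exact: truncnS_gt.
Qed.

Definition chalf i a : set R :=
  if i is Rside then `[a, +oo[%classic else `]-oo, a]%classic.

Lemma chalf_interval i a : is_interval (chalf i a).
Proof. by case: i; exact: interval_is_interval. Qed.

Lemma chalf_meas i a : measurable (chalf i a).
Proof. by case: i; exact: measurable_itv. Qed.

(** An integrable function with integrable derivative vanishes at infinity. *)
Lemma decay i a F f : prim (chalf i a) F f -> intg (chalf i a) F ->
  intg (chalf i a) f -> F a = - orient i * lint (chalf i a) f.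
Proof.
case: i => /= pF iF fi; last by rewrite mulN1r; exact: decay_right.
have s1 : (-1) ^+ 2 = 1 :> R by rewrite sqrrN expr1n.
have E : (fun t => -1 * t + 0) @^-1` `]-oo, a] = `[(- a), +oo[%classic.
  by apply/seteqP; split=> t /=; rewrite !in_itv/= andbT; lra.
have pG := prim_affine 0 s1 pF; rewrite E in pG.
have [_ iG _] := lint_affine 0 s1 (measurable_itv `]-oo, a]) iF; rewrite E in iG.
have [_ ig eg] := lint_affine 0 s1 (measurable_itv `]-oo, a]) fi; rewrite E in ig eg.
have := decay_right pG iG (intg_scale (-1) (measurable_itv _) ig).
rewrite int_scale// eg mulrNN mul1r addr0 => ->.
by rewrite opprK mul1r mulN1r opprK.
Qed.

End decay.

(** * Energy balance on a half-line *)

Section half_line.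
Context {R : realType}.
Implicit Types (D : set R) (f g h u w : R -> R) (a x y : R) (i : side).

Lemma cauchy_schwarz D f g : measurable D -> sqint D f -> sqint D g ->
  lint D (fun t => f t * g t) ^+ 2 <=
  lint D (fun t => f t ^+ 2) * lint D (fun t => g t ^+ 2).
Proof.
move=> mD sf sg; have ifg := sqint_prod mD sf sg.
have [mf i1] := sf; have [mg i2] := sg.
set A := lint D (fun t => f t ^+ 2); set G := lint D (fun t => g t ^+ 2).
set B := lint D (fun t => f t * g t).
have G0 : 0 <= G by apply: int_ge0 => t _; rewrite sqr_ge0.
have Q (s : R) : 0 <= A - 2 * s * B + s ^+ 2 * G.
  have : 0 <= lint D (fun t => (f t - s * g t) ^+ 2) by apply: int_ge0 => t _; rewrite sqr_ge0.
  rewrite (@int_eq _ _ _ (fun t => f t ^+ 2 + (- 2 * s * (f t * g t) + s ^+ 2 * g t ^+ 2))); last first.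
    by move=> t _; ring.
  rewrite int_add//; last by apply: intg_add => //; exact: intg_scale.
  rewrite int_add//; [|exact: intg_scale..].
  by rewrite !int_scale// -/A -/B -/G; lra.
move: G0; rewrite le_eqVlt => /orP[/eqP G0|G0].
  rewrite -G0 mulr0 -[leRHS](expr0n _ 2)/=.
  have [->|B0] := eqVneq B 0; first by rewrite expr0n.
  have := Q ((A + 1) / (2 * B)); rewrite -G0 mulr0 addr0.
  rewrite (_ : 2 * ((A + 1) / (2 * B)) * B = A + 1); last by field.
  lra.
have := Q (B / G); rewrite (_ : A - 2 * (B / G) * B + (B / G) ^+ 2 * G = (A * G - B ^+ 2) / G); last first.
  by field; rewrite gt_eqF.
by rewrite pmulr_lge0 ?invr_gt0// subr_ge0.
Qed.

Lemma halfline_open i a : open (halfline i a : set R).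
Proof. by case: i; rewrite /halfline; exact: interval_open. Qed.

Lemma halfline_interval i a : is_interval (halfline i a : set R).
Proof. by case: i; rewrite /halfline; exact: interval_is_interval. Qed.

Lemma halfline_ex i a : exists x, (halfline i a : set R) x.
Proof.
case: i; [exists (a - 1)|exists (a + 1)]; rewrite /= in_itv/=; lra.
Qed.

Lemma closure_halfline i a : closure (halfline i a : set R) = chalf i a.
Proof.
case: i; rewrite /halfline /chalf.
  have -> : `]-oo, a[%classic = [set x : R | x < a] by apply/seteqP; split=> t; rewrite /= in_itv.
  by rewrite closure_lt; apply/seteqP; split=> t; rewrite /= in_itv.
have -> : `]a, +oo[%classic = [set x : R | a < x] by apply/seteqP; split=> t; rewrite /= in_itv/= andbT.
by rewrite closure_gt; apply/seteqP; split=> t; rewrite /= in_itv/= andbT.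
Qed.

Lemma sqint_chalf i a f : sqint (halfline i a) f -> sqint (chalf i a) f.
Proof.
have E : chalf i a = halfline i a `|` [set a].
  case: i; apply/seteqP; split=> t; rewrite /= !in_itv/= ?andbT le_eqVlt.
  - by move=> /orP[/eqP ->|h]; [right|left].
  - by move=> [->|->]; rewrite ?eqxx ?orbT.
  - by move=> /orP[/eqP ->|h]; [right|left].
  - by move=> [->|->]; rewrite ?eqxx ?orbT.
move=> [mf fi]; rewrite E.
have mh := open_measurable (@halfline_open i a).
split; first by apply/measurable_funU => //; split => //; exact: measurable_fun_set1.
by apply: intg_union => //; rewrite -set_itv1; exact: intg_pt.
Qed.

Variables (mu rho : R -> R).
Hypotheses (hmu : line_coefficient mu) (hrho : line_coefficient rho).

(** The Wronskian of square-integrable solutions vanishes at infinity. *)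
Lemma wronskian_half i a lam h1 u1 w1 h2 u2 w2 :
  rsol (chalf i a) mu rho lam h1 u1 w1 -> rsol (chalf i a) mu rho lam h2 u2 w2 ->
  sqint (chalf i a) h1 -> sqint (chalf i a) u1 -> sqint (chalf i a) w1 ->
  sqint (chalf i a) h2 -> sqint (chalf i a) u2 -> sqint (chalf i a) w2 ->
  u1 a * w2 a - w1 a * u2 a =
  - orient i * lint (chalf i a) (fun t => h1 t * u2 t - u1 t * h2 t).
Proof.
move=> s1 s2 qh1 qu1 qw1 qh2 qu2 qw2.
have mD := chalf_meas i a.
rewrite -(decay (wronskian (@chalf_interval _ i a) s1 s2))//.
  by apply: intg_sub2 => //; exact: sqint_prod.
by apply: intg_sub2 => //; exact: sqint_prod.
Qed.

Lemma rho_sqint D (k : R) f : measurable D -> sqint D f -> sqint D (fun t => rho t * k * f t).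
Proof.
move=> mD sf; have [K K0 HK] := coef_le hrho.
have := sqint_scale k mD (sqint_mul mD (coef_meas hrho mD) HK sf).
by congr (sqint _ _); apply/funext => t; ring.
Qed.

(** Energy flux through the end point of a half-line: absorption is the
    difference between incoming and outgoing Robin traces. *)
Lemma half_energy i a lam z e (u w : R -> R[i]) :
  ksol (chalf i a) mu rho lam (fun t => (0 +i* (rho t * e)) * u t) u w ->
  sqint (chalf i a) (re u) -> sqint (chalf i a) (im u) ->
  sqint (chalf i a) (re w) -> sqint (chalf i a) (im w) ->
  normc (Rp i z (u a) (w a)) ^+ 2 - normc (Rm i z (u a) (w a)) ^+ 2 =
  4 * z * e * lint (chalf i a) (fun t => rho t * (re u t ^+ 2 + im u t ^+ 2)).
Proof.
move=> [s1 s2] u1 u2 w1 w2; have mD := chalf_meas i a.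
have iD := @chalf_interval _ i a.
have {}s1 : rsol (chalf i a) mu rho lam (fun t => rho t * (- e) * im u t) (re u) (re w).
  by apply: (rsol_ext iD s1) => // t _; rewrite /re cReM/= /im; ring.
have {}s2 : rsol (chalf i a) mu rho lam (fun t => rho t * e * re u t) (im u) (im w).
  by apply: (rsol_ext iD s2) => // t _; rewrite /im cImM/= /re; ring.
have := wronskian_half s1 s2 (rho_sqint _ mD u2) u1 w1 (rho_sqint _ mD u1) u2 w2.
rewrite (@int_eq _ _ _ (fun t => - e * (rho t * (re u t ^+ 2 + im u t ^+ 2)))); last first.
  by move=> t _; ring.
rewrite int_scale//; last first.
  have := intg_add mD (sqint_prod mD (rho_sqint 1 mD u1) u1) (sqint_prod mD (rho_sqint 1 mD u2) u2).
  by congr (intg _ _); apply/funext => t /=; ring.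
set L := lint _ _ => H.
have {H} : re u a * im w a - re w a * im u a = orient i * e * L by rewrite H; ring.
have o2 : orient i * orient i = 1 :> R by case: (i); rewrite /= ?mulrNN mulr1.
rewrite !normc2 /Rp /Rm !(cReD, cImD, cReN, cImN, cReM, cImM)/= -/(re u a) -/(re w a) -/(im u a) -/(im w a) => H.
transitivity (4 * z * orient i * (re u a * im w a - re w a * im u a)); first by ring.
by rewrite H -[RHS]mul1r -o2; ring.
Qed.

(** Comparison of a half-line solution with absorption [e] to an outgoing
    solution [(U, W)] without absorption, with Robin data [(1, Lam)]: their
    Wronskian is [e] times an L2 product, and the energy identity bounds
    [e] times the square of the L2 norm of the former. *)
Lemma half_defect i a lam z Lam (U W : R -> R[i]) : 0 < z ->
  ksol (chalf i a) mu rho lam (fun=> 0) U W ->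
  sqint (chalf i a) (re U) -> sqint (chalf i a) (im U) ->
  sqint (chalf i a) (re W) -> sqint (chalf i a) (im W) ->
  Rp i z (U a) (W a) = 1 -> Rm i z (U a) (W a) = Lam ->
  exists2 C, 0 <= C & forall e (u w : R -> R[i]), 0 < e ->
    ksol (chalf i a) mu rho lam (fun t => (0 +i* (rho t * e)) * u t) u w ->
    sqint (chalf i a) (re u) -> sqint (chalf i a) (im u) ->
    sqint (chalf i a) (re w) -> sqint (chalf i a) (im w) ->
    n1 (Rm i z (u a) (w a) - Lam * Rp i z (u a) (w a)) ^+ 2 <=
    C * e * n1 (Rp i z (u a) (w a)) ^+ 2.
Proof.
move=> z0 S qU1 qU2 qW1 qW2 eP eM.
have mD := chalf_meas i a; have iD := @chalf_interval _ i a.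
have [Kr Kr0 HKr] := coef_le hrho.
pose NU := lint (chalf i a) (fun t => re U t ^+ 2) + lint (chalf i a) (fun t => im U t ^+ 2).
have pos (f : R -> R) : 0 <= lint (chalf i a) (fun t => f t ^+ 2).
  by apply: int_ge0 => t _; rewrite sqr_ge0.
have NU0 : 0 <= NU by rewrite addr_ge0.
exists (16 * z * Kr * NU); first by rewrite !mulr_ge0// ltW.
move=> e u w e0 su u1 u2 w1 w2.
have en := half_energy z su u1 u2 w1 w2; set E := lint _ _ in en.
have iE : intg (chalf i a) (fun t => rho t * (re u t ^+ 2 + im u t ^+ 2)).
  have := intg_add mD (sqint_prod mD (rho_sqint 1 mD u1) u1) (sqint_prod mD (rho_sqint 1 mD u2) u2).
  by congr (intg _ _); apply/funext => t /=; ring.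
have rho0 t : 0 <= rho t by exact/ltW/coef_gt0.
have E0 : 0 <= E by apply: int_ge0 => t _; rewrite mulr_ge0// addr_ge0 ?sqr_ge0.
have EP : 4 * z * e * E <= n1 (Rp i z (u a) (w a)) ^+ 2.
  have n0 (c : R[i]) : 0 <= normc c by case: c => x y; exact: sqrtr_ge0.
  have h : normc (Rp i z (u a) (w a)) ^+ 2 <= n1 (Rp i z (u a) (w a)) ^+ 2.
    by rewrite ler_pXn2r ?nnegrE ?n1_ge0// normc_n1.
  by apply: le_trans h; rewrite -en lerBlDr lerDl sqr_ge0.
(* the complex Wronskian is made of four real ones, which differ by the
     function [b] in the source and by its sign [s] *)
have real_W (b f k g l : R -> R) (s : R) : s ^+ 2 = 1 ->
    rsol (chalf i a) mu rho lam (fun t => rho t * (s * e) * b t) f k ->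
    rsol (chalf i a) mu rho lam (fun=> 0) g l ->
    sqint (chalf i a) b -> sqint (chalf i a) f -> sqint (chalf i a) k ->
    sqint (chalf i a) g -> sqint (chalf i a) l ->
    (forall t, b t ^+ 2 <= re u t ^+ 2 + im u t ^+ 2) ->
    lint (chalf i a) (fun t => g t ^+ 2) <= NU ->
    (f a * l a - k a * g a) ^+ 2 <= e ^+ 2 * (Kr * E * NU).
  move=> s1 r1 r2 qb qf qk qg ql bE gN.
  have q0 : sqint (chalf i a) (fun=> 0 : R).
    split; first exact: measurable_cst.
    by rewrite (_ : (fun=> _) = (fun=> 0)) ?intg0//; apply/funext => t; rewrite expr0n.
  rewrite (wronskian_half r1 r2 (rho_sqint _ mD qb) qf qk q0 qg ql).
  rewrite (@int_eq _ _ _ (fun t => s * e * (rho t * 1 * b t * g t))); last by move=> t _; ring.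
  have qrb := rho_sqint 1 mD qb.
  rewrite int_scale//; last exact: sqint_prod.
  have o2 : orient i * orient i = 1 :> R by case: (i); rewrite /= ?mulrNN mulr1.
  set L := lint _ _.
  have -> : (- orient i * (s * e * L)) ^+ 2 = (orient i * orient i) * (s ^+ 2) * (e ^+ 2 * L ^+ 2) by ring.
  rewrite o2 s1 !mul1r ler_pM2l ?exprn_gt0//.
  apply: le_trans (cauchy_schwarz mD qrb qg) _; apply: ler_pM => //; try exact: pos.
  rewrite -int_scale//; apply: int_le => //; [exact: qrb.2|exact: intg_scale|].
  move=> t _; rewrite mulr1 exprMn expr2 -!mulrA ler_pM//.
  - by rewrite mulr_ge0// sqr_ge0.
  - by rewrite -[leLHS]ger0_norm.
  - by rewrite ler_wpM2l.
have [s1 s2] := su; have [S1 S2] := S.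
have {}s1 : rsol (chalf i a) mu rho lam (fun t => rho t * (-1 * e) * im u t) (re u) (re w).
  by apply: (rsol_ext iD s1) => // t _; rewrite /re cReM/= /im; ring.
have {}s2 : rsol (chalf i a) mu rho lam (fun t => rho t * (1 * e) * re u t) (im u) (im w).
  by apply: (rsol_ext iD s2) => // t _; rewrite /im cImM/= /re; ring.
have m1 : (-1) ^+ 2 = 1 :> R by rewrite sqrrN expr1n.
have p1 : 1 ^+ 2 = 1 :> R by rewrite expr1n.
have bi t : im u t ^+ 2 <= re u t ^+ 2 + im u t ^+ 2 by rewrite lerDr sqr_ge0.
have br t : re u t ^+ 2 <= re u t ^+ 2 + im u t ^+ 2 by rewrite lerDl sqr_ge0.
have N1 : lint (chalf i a) (fun t => re U t ^+ 2) <= NU by rewrite lerDl.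
have N2 : lint (chalf i a) (fun t => im U t ^+ 2) <= NU by rewrite lerDr.
have A := real_W _ _ _ _ _ _ m1 s1 S1 u2 u1 w1 qU1 qW1 bi N1.
have B := real_W _ _ _ _ _ _ m1 s1 S2 u2 u1 w1 qU2 qW2 bi N2.
have C := real_W _ _ _ _ _ _ p1 s2 S1 u1 u2 w2 qU1 qW1 br N1.
have D := real_W _ _ _ _ _ _ p1 s2 S2 u1 u2 w2 qU2 qW2 br N2.
set X := e ^+ 2 * _ in A B C D.
have W4 : n1 (cW u w U W a) ^+ 2 <= 16 * X.
  rewrite /n1 /cW cReD cImD cReN cImN !cReM !cImM -/(re u a) -/(re w a) -/(im u a) -/(im w a)
    -/(re U a) -/(re W a) -/(im U a) -/(im W a).
  set p := re u a * re W a - re w a * re U a in A.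
  set q := re u a * im W a - re w a * im U a in B.
  set r := im u a * re W a - im w a * re U a in C.
  set v := im u a * im W a - im w a * im U a in D.
  have -> : re u a * re W a - im u a * im W a - (re w a * re U a - im w a * im U a) = p - v.
    by rewrite /p /v; ring.
  have -> : re u a * im W a + im u a * re W a - (re w a * im U a + im w a * re U a) = q + r.
    by rewrite /q /r; ring.
  have h : `|p - v| + `|q + r| <= `|p| + `|v| + (`|q| + `|r|).
    by apply: lerD; [exact: ler_normB|exact: ler_normD].
  have h2 : (`|p - v| + `|q + r|) ^+ 2 <= (`|p| + `|v| + (`|q| + `|r|)) ^+ 2.
    by rewrite ler_pXn2r ?nnegrE ?addr_ge0.
  apply: le_trans h2 _.
  move: A B C D; rewrite -(real_normK (num_real p)) -(real_normK (num_real q))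
    -(real_normK (num_real r)) -(real_normK (num_real v)) => A B C D.
  have := sqr_ge0 (`|p| - `|q|); have := sqr_ge0 (`|p| - `|r|); have := sqr_ge0 (`|p| - `|v|).
  have := sqr_ge0 (`|q| - `|r|); have := sqr_ge0 (`|q| - `|v|); have := sqr_ge0 (`|r| - `|v|).
  lra.
have DE : Rm i z (u a) (w a) - Lam * Rp i z (u a) (w a) =
    2%:R * (0 +i* z) * (orient i)%:C * cW u w U W a.
  have := robin_wronskian i z (u a) (w a) (U a) (W a); rewrite eP eM /cW => H.
  rewrite (_ : u a * W a - w a * U a = - (w a * U a - u a * W a)); last by ring.
  by rewrite mulrN -H; ring.
have nz : n1 (2%:R * (0 +i* z) * (orient i)%:C) <= 2 * z.
  apply: le_trans (n1M _ _) _.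
  have -> : n1 (orient i)%:C = 1 :> R by rewrite /n1/= normr0 addr0; case: (i); rewrite /= ?normrN normr1.
  rewrite mulr1; apply: le_trans (n1M _ _) _.
  rewrite {2}/n1/= normr0 add0r gtr0_norm//; apply: ler_wpM2r; first exact: ltW.
  have -> : 2%:R = (2 : R)%:C :> R[i] by apply/eqP; rewrite eq_complex /= addr0 !eqxx.
  by rewrite /n1/= normr0 addr0 ger0_norm ?ler0n.
have dW : n1 (Rm i z (u a) (w a) - Lam * Rp i z (u a) (w a)) <= 2 * z * n1 (cW u w U W a).
  by rewrite DE; apply: le_trans (n1M _ _) _; rewrite ler_wpM2r ?n1_ge0.
have z20 : 0 <= 2 * z by lra.
apply: (@le_trans _ _ ((2 * z * n1 (cW u w U W a)) ^+ 2)).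
  by rewrite ler_pXn2r ?nnegrE ?n1_ge0// mulr_ge0// n1_ge0.
rewrite exprMn; apply: (@le_trans _ _ ((2 * z) ^+ 2 * (16 * X))).
  by rewrite ler_wpM2l// sqr_ge0.
have -> : (2 * z) ^+ 2 * (16 * X) = 16 * z * Kr * NU * e * (4 * z * e * E) by rewrite /X; ring.
by rewrite ler_wpM2l// !mulr_ge0// ltW.
Qed.

End half_line.

(** * The L2 norm on the line *)

Definition nrm {R : realType} (D : set R) (f : R -> R) : R :=
  Num.sqrt (lint D (fun t => f t ^+ 2)).

Section l2_norm.
Context {R : realType}.
Implicit Types (D : set R) (f g h m u w : R -> R) (a x y k K : R) (i : side).

Lemma nrm_ge0 D f : 0 <= nrm D f. Proof. exact: sqrtr_ge0. Qed.

Lemma lint_sqr_ge0 D f : 0 <= lint D (fun t => f t ^+ 2).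
Proof. by apply: int_ge0 => t _; rewrite sqr_ge0. Qed.

Lemma nrm_sqr D f : nrm D f ^+ 2 = lint D (fun t => f t ^+ 2).
Proof. by rewrite sqr_sqrtr ?lint_sqr_ge0. Qed.

Lemma nrm_le D f K : 0 <= K -> lint D (fun t => f t ^+ 2) <= K ^+ 2 -> nrm D f <= K.
Proof. by move=> K0 h; rewrite -(ger0_norm K0) -sqrtr_sqr ler_wsqrtr. Qed.

Lemma cauchy_schwarz_nrm D f g : measurable D -> sqint D f -> sqint D g ->
  `|lint D (fun t => f t * g t)| <= nrm D f * nrm D g.
Proof.
move=> mD sf sg; have := cauchy_schwarz mD sf sg.
by rewrite -sqrtrM ?lint_sqr_ge0// -sqrtr_sqr => /ler_wsqrtr.
Qed.

Lemma nrmD D f g : measurable D -> sqint D f -> sqint D g ->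
  nrm D (fun t => f t + g t) <= nrm D f + nrm D g.
Proof.
move=> mD sf sg; apply: nrm_le; first by rewrite addr_ge0 ?nrm_ge0.
have fg := sqint_prod mD sf sg; have [_ f2] := sf; have [_ g2] := sg.
rewrite (@int_eq _ _ _ (fun t => f t ^+ 2 + (2 * (f t * g t) + g t ^+ 2))); last first.
  by move=> t _; ring.
rewrite int_add//; last by apply: intg_add => //; exact: intg_scale.
rewrite int_add//; last exact: intg_scale.
rewrite int_scale// -!nrm_sqr.
have h : lint D (fun t => f t * g t) <= nrm D f * nrm D g.
  exact: le_trans (ler_norm _) (cauchy_schwarz_nrm mD sf sg).
lra.
Qed.

Lemma nrmM D m f K : measurable D -> measurable_fun D m -> (forall t, `|m t| <= K) ->
  sqint D f -> nrm D (fun t => m t * f t) <= K * nrm D f.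
Proof.
move=> mD mm mK sf.
have K0 : 0 <= K by apply: le_trans (mK 0); exact: normr_ge0.
apply: nrm_le; first by rewrite mulr_ge0 ?nrm_ge0.
rewrite exprMn nrm_sqr -int_scale//; last exact: sf.2.
apply: int_le => //; [exact: (sqint_mul mD mm mK sf).2|apply: intg_scale => //; exact: sf.2|].
move=> t _; rewrite exprMn ler_wpM2r ?sqr_ge0//.
by rewrite -real_normK ?num_real// ler_pXn2r ?nnegrE.
Qed.

Lemma nrmZ D k f : measurable D -> sqint D f ->
  nrm D (fun t => k * f t) <= `|k| * nrm D f.
Proof. by move=> mD sf; apply: nrmM. Qed.

Lemma nrm_eq D f g : (forall t, D t -> f t = g t) -> nrm D f = nrm D g.
Proof. by move=> fg; congr Num.sqrt; apply: int_eq => t Dt; rewrite fg. Qed.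

Lemma lint_subset D D' f : measurable D -> measurable D' -> D' `<=` D ->
  intg D f -> (forall t, 0 <= f t) -> lint D' f <= lint D f.
Proof.
move=> mD mD' sD fi f0; rewrite /lint /Rintegral fine_le//.
- exact: integrable_fin_num (intg_sub mD mD' sD fi).
- exact: integrable_fin_num fi.
- apply: ge0_subset_integral => //; first exact: measurable_int fi.
  by move=> t _; rewrite lee_fin.
Qed.

Lemma nrm_subset D D' f : measurable D -> measurable D' -> D' `<=` D ->
  sqint D f -> nrm D' f <= nrm D f.
Proof.
move=> mD mD' sD sf; apply: ler_wsqrtr; apply: lint_subset => //; first exact: sf.2.
by move=> t; exact: sqr_ge0.
Qed.

Lemma line_split a : setT = (chalf Lside a : set R) `|` chalf Rside a.
Proof.
apply/seteqP; split=> // t _; rewrite /= !in_itv/= andbT.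
by case: (leP t a) => h; [left|right; exact: ltW].
Qed.

Lemma right_split al ar : al <= ar -> chalf Rside al = (`[al, ar]%classic : set R) `|` chalf Rside ar.
Proof.
move=> h; apply/seteqP; split => t; rewrite /= !in_itv/= !andbT.
  by move=> ->; case: (leP t ar) => hh; [left|right; exact: ltW].
by move=> [/andP[]//|]; exact: le_trans.
Qed.

Lemma int_right_open a f : intg (chalf Rside a) f ->
  lint `]a, +oo[ f = lint (chalf Rside a) f.
Proof. by move=> fi; rewrite /= (@int_splity _ a a f)// int_pt add0r. Qed.

Lemma int_setU D1 D2 f : measurable D1 -> measurable D2 -> intg (D1 `|` D2) f ->
  [disjoint D1 & D2] -> lint (D1 `|` D2) f = lint D1 f + lint D2 f.
Proof. by move=> m1 m2 fi dj; exact: Rintegral_setU. Qed.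

Lemma int_line a f : intg (setT : set R) f ->
  lint setT f = lint (chalf Lside a) f + lint (chalf Rside a) f.
Proof.
move=> fi; rewrite -int_right_open; last by apply: intg_sub fi => //; exact: chalf_meas.
have -> : setT = (chalf Lside a : set R) `|` `]a, +oo[%classic.
  apply/seteqP; split=> // t _; rewrite /= !in_itv/= andbT.
  by case: (leP t a); [left|right].
have mL := chalf_meas Lside a; have mR := measurable_itv `]a, +oo[ : measurable (`]a, +oo[%classic : set R).
apply: int_setU => //; first by apply: intg_sub fi => //; exact: measurableU.
by apply/disj_setPS => t; rewrite /= !in_itv/= andbT => -[h1 h2]; move: (le_lt_trans h1 h2); rewrite ltxx.
Qed.

Lemma int_right al ar f : al <= ar -> intg (chalf Rside al) f ->
  lint (chalf Rside al) f = lint `[al, ar] f + lint (chalf Rside ar) f.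
Proof.
move=> h fi; rewrite -(@int_right_open ar); first exact: int_splity.
apply: intg_sub fi; [exact: chalf_meas..|].
by rewrite (right_split h) => t; right.
Qed.

Lemma int_three al ar f : al <= ar -> intg (setT : set R) f ->
  lint setT f = lint (chalf Lside al) f + (lint `[al, ar] f + lint (chalf Rside ar) f).
Proof.
move=> h fi; rewrite (int_line al fi) (int_right h)//.
by apply: intg_sub fi => //; exact: chalf_meas.
Qed.

Lemma sqint_pieces al ar f : al <= ar -> sqint (chalf Lside al) f ->
  sqint `[al, ar] f -> sqint (chalf Rside ar) f -> sqint setT f.
Proof.
move=> h [m1 i1] [m2 i2] [m3 i3].
rewrite (line_split al) (right_split h); have mL := chalf_meas Lside al; have mR := chalf_meas Rside ar.
have mJ : measurable (`[al, ar]%classic `|` chalf Rside ar : set R) by exact: measurableU.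
split.
  by apply/measurable_funU => //; split => //; apply/measurable_funU.
by apply: intg_union => //; apply: intg_union.
Qed.

Lemma nrm_pieces al ar f : al <= ar -> sqint setT f ->
  nrm setT f <= nrm (chalf Lside al) f + nrm `[al, ar] f + nrm (chalf Rside ar) f.
Proof.
move=> h [_ f2]; apply: nrm_le; first by rewrite !addr_ge0 ?nrm_ge0.
rewrite (int_three h f2) -!nrm_sqr.
set p := nrm _ _; set q := nrm _ _; set r := nrm _ _.
have p0 : 0 <= p by exact: nrm_ge0. have q0 : 0 <= q by exact: nrm_ge0.
have r0 : 0 <= r by exact: nrm_ge0.
have := mulr_ge0 p0 q0; have := mulr_ge0 p0 r0; have := mulr_ge0 q0 r0.
lra.
Qed.

Lemma nrm_bounded al ar f K : al <= ar -> 0 <= K -> intg `[al, ar] (fun t => f t ^+ 2) ->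
  (forall t, al <= t <= ar -> `|f t| <= K) ->
  nrm `[al, ar] f <= K * Num.sqrt (ar - al).
Proof.
move=> h K0 fi fK; apply: nrm_le; first by rewrite mulr_ge0 ?sqrtr_ge0.
rewrite exprMn sqr_sqrtr ?subr_ge0//; apply: le_trans (ler_norm _) _.
apply: int_norm_le_cst => // t /fK ft; rewrite ger0_norm ?sqr_ge0//.
by rewrite -real_normK ?num_real// ler_pXn2r ?nnegrE.
Qed.

(** Fatou's lemma. *)
Lemma sqint_limit (f_ : nat -> R -> R) f C : 
  (forall n, sqint setT (f_ n)) -> (forall n, nrm setT (f_ n) <= C) ->
  (forall t, f_ n t @[n --> \oo] --> f t) -> sqint setT f.
Proof.
move=> sf fC cf.
have mf : measurable_fun setT f.
  apply: (measurable_fun_cvg (h := f_)) => [n|t _]; [exact: (sf n).1|exact: cf].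
split=> //.
apply/integrableP; split.
  by apply/measurable_EFinP; exact: measurable_funX.
have C0 : 0 <= C by apply: le_trans (fC 0%N); exact: nrm_ge0.
apply: (@le_lt_trans _ _ ((C ^+ 2)%:E)); last exact: ltry.
have E : (\int[leb]_(t in setT) `|((f t ^+ 2)%R)%:E| =
   \int[leb]_(t in setT) limn_einf (fun n => ((f_ n t ^+ 2)%R)%:E))%E.
  apply: eq_integral => t _ /=; rewrite ger0_norm ?sqr_ge0//.
  have cv : (f_ n t ^+ 2)%:E @[n --> \oo] --> (f t ^+ 2)%:E.
    apply: cvg_EFin; first by near=> n.
    by rewrite /comp /= expr2; under eq_fun do rewrite expr2; apply: cvgM.
  by rewrite (cvg_limn_einf_sup cv).1.
rewrite E; apply: le_trans (fatou _ _ _ _) _ => //.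
- by move=> n; apply/measurable_EFinP; apply: measurable_funX; exact: (sf n).1.
- by move=> n t _; rewrite lee_fin sqr_ge0.
rewrite limn_einf_lim; apply: lime_le; first exact: is_cvg_einfs.
near=> n; apply: (@le_trans _ _ (\int[leb]_t ((f_ n t ^+ 2)%R)%:E)%E).
  by apply: ereal_inf_lbound; exists n => /=.
have fin := integrable_fin_num measurableT (sf n).2.
rewrite -(fineK fin) lee_fin.
have : nrm setT (f_ n) ^+ 2 <= C ^+ 2 by rewrite ler_pXn2r ?nnegrE ?nrm_ge0.
by rewrite nrm_sqr.
Unshelve. all: by end_near.
Qed.

End l2_norm.

(** * Solutions on the whole line *)

Section line.
Context {R : realType}.
Implicit Types (D : set R) (F f g h u w : R -> R) (a x y k : R) (i : side).

Lemma prim_line F f i a : prim setT F f -> prim (chalf i a) F f.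
Proof. exact: prim_sub. Qed.

Lemma intg_line f i a : intg (setT : set R) f -> intg (chalf i a) f.
Proof. by apply: intg_sub => //; exact: chalf_meas. Qed.

Lemma sqint_line f i a : sqint setT f -> sqint (chalf i a) f.
Proof. by apply: sqint_sub => //; exact: chalf_meas. Qed.

Lemma line_zero F f : prim setT F f -> intg (setT : set R) F ->
  intg (setT : set R) f -> lint setT f = 0.
Proof.
move=> pF iF fi; rewrite (int_line 0 fi).
have := decay (@prim_line _ _ Lside 0 pF) (intg_line _ _ iF) (intg_line _ _ fi).
have := decay (@prim_line _ _ Rside 0 pF) (intg_line _ _ iF) (intg_line _ _ fi).
rewrite /orient => -> h; lra.
Qed.

Lemma le_sqrt_scale x k s : 0 <= k -> 0 <= s -> x ^+ 2 <= k * s ^+ 2 ->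
  `|x| <= Num.sqrt k * s.
Proof.
move=> k0 s0 h; rewrite -[leRHS](ger0_norm (mulr_ge0 (sqrtr_ge0 k) s0)).
by rewrite -ler_sqr ?nnegrE// !real_normK ?num_real// exprMn sqr_sqrtr.
Qed.

Lemma rsol_coef D mu rho mu' rho' lam h u w : is_interval D ->
  (forall t, D t -> mu t = mu' t) -> (forall t, D t -> rho t = rho' t) ->
  rsol D mu rho lam h u w -> rsol D mu' rho' lam h u w.
Proof.
move=> iD em er [p1 p2]; split.
  by apply: (prim_ext iD p1) => // t Dt; rewrite em.
by apply: (prim_ext iD p2) => // t Dt; rewrite er.
Qed.

Definition piece (al ar : R) (f1 f2 f3 : R -> R) (t : R) : R :=
  if t <= al then f1 t else if t <= ar then f2 t else f3 t.

Lemma piece_left al ar f1 f2 f3 t : t <= al -> piece al ar f1 f2 f3 t = f1 t.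
Proof. by rewrite /piece => ->. Qed.

Lemma piece_mid al ar f1 f2 f3 t : f1 al = f2 al -> al <= t -> t <= ar ->
  piece al ar f1 f2 f3 t = f2 t.
Proof.
rewrite /piece => e a1 a2; case: (leP t al) => [h1|_]; last by rewrite a2.
by rewrite (@le_anti _ _ t al) ?a1 ?h1.
Qed.

Lemma piece_right al ar f1 f2 f3 t : al <= ar -> f1 al = f2 al -> f2 ar = f3 ar ->
  ar <= t -> piece al ar f1 f2 f3 t = f3 t.
Proof.
move=> alr e e' a1; case: (leP t ar) => h1; last first.
  by rewrite /piece leNgt (le_lt_trans alr h1)/= leNgt h1.
by rewrite (@le_anti _ _ t ar) ?h1// piece_mid.
Qed.

(** No condition on derivatives is needed at the junctions: continuity of both
    components is exactly what makes the three pieces one solution. *)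
Lemma glue3 al ar mu rho lam h u1 w1 u2 w2 u3 w3 : al <= ar ->
  rsol (chalf Lside al) mu rho lam h u1 w1 -> rsol `[al, ar] mu rho lam h u2 w2 ->
  rsol (chalf Rside ar) mu rho lam h u3 w3 ->
  u1 al = u2 al -> w1 al = w2 al -> u2 ar = u3 ar -> w2 ar = w3 ar ->
  rsol setT mu rho lam h (piece al ar u1 u2 u3) (piece al ar w1 w2 w3).
Proof.
move=> alr s1 s2 s3 e1 e2 e3 e4.
have L : forall t, (chalf Lside al : set R) t -> t <= al by move=> t; rewrite /= in_itv.
have Rr : forall t, (chalf Rside ar : set R) t -> ar <= t by move=> t; rewrite /= in_itv/= andbT.
have {}s1 : rsol (chalf Lside al) mu rho lam h (piece al ar u1 u2 u3) (piece al ar w1 w2 w3).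
  by apply: (rsol_ext (@chalf_interval _ _ _) s1) => // t /L ?; rewrite piece_left.
have {}s2 : rsol `[al, ar] mu rho lam h (piece al ar u1 u2 u3) (piece al ar w1 w2 w3).
  by apply: (rsol_ext (@interval_is_interval _ _) s2) => // t /itv_ccP/andP[? ?]; rewrite piece_mid.
have {}s3 : rsol (chalf Rside ar) mu rho lam h (piece al ar u1 u2 u3) (piece al ar w1 w2 w3).
  by apply: (rsol_ext (@chalf_interval _ _ _) s3) => // t /Rr ?; rewrite piece_right.
have iT : is_interval (setT : set R) by [].
have glue F f : prim (chalf Lside al) F f -> prim `[al, ar] F f -> prim (chalf Rside ar) F f ->
    prim setT F f.
  move=> g1 g2 g3; apply: (@prim_glue _ setT F f al) => //.
    by apply: prim_sub g1 => t [_ /=]; rewrite in_itv.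
  have -> : [set: R] `&` [set t | al <= t] = chalf Rside al.
    by apply/seteqP; split => t; rewrite /= in_itv/= andbT; [case|].
  apply: (@prim_glue _ _ F f ar) => //; [by rewrite /= in_itv/= andbT|exact: chalf_interval| |].
    by apply: prim_sub g2 => t [] /=; rewrite !in_itv/= andbT => -> ->.
  by apply: prim_sub g3 => t [] /= _; rewrite in_itv/= andbT.
by split; apply: glue; [exact: s1.1|exact: s2.1|exact: s3.1|exact: s1.2|exact: s2.2|exact: s3.2].
Qed.

Lemma sqint_piece al ar f1 f2 f3 F : al <= ar ->
  prim setT (piece al ar f1 f2 f3) F -> f1 al = f2 al -> f2 ar = f3 ar ->
  sqint (chalf Lside al) f1 -> sqint (chalf Rside ar) f3 ->
  sqint setT (piece al ar f1 f2 f3).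
Proof.
move=> alr pF m1 m2 [_ h1] [_ h3]; have mp := prim_meas measurableT pF.
have mc i a : measurable (chalf i a : set R) by exact: chalf_meas.
apply: (@sqint_pieces _ al ar) => //.
- split; first exact: measurable_funS mp.
  by apply: (intg_ext _ (mc _ _) h1) => t; rewrite inE /= in_itv/= => tal; rewrite piece_left.
- split; first exact: measurable_funS mp.
  have [B HB] := prim_bounded (prim_sub (@subsetT _ `[al, ar]%classic) pF).
  apply: (@intg_le _ _ _ (fun=> B ^+ 2)) => //; last exact: intg_cst.
    by apply: measurable_funX; exact: measurable_funS mp.
  move=> t /itv_ccP/HB hB; rewrite normrX ler_pXn2r ?nnegrE//.
  by apply: le_trans hB.
- split; first exact: measurable_funS mp.
  apply: (intg_ext _ (mc _ _) h3) => t; rewrite inE /= in_itv/= andbT => art.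
  by congr (_ ^+ 2); rewrite piece_right.
Qed.

Variables (mu rho : R -> R) (lam : R).
Hypotheses (hmu : line_coefficient mu) (hrho : line_coefficient rho).

Lemma source_meas D u h : measurable D -> sqint D u -> sqint D h ->
  sqint D (fun t => rho t * lam * u t + h t).
Proof. by move=> mD su sh; apply: sqint_add => //; exact: rho_sqint. Qed.

(** Testing the equation with the solution itself bounds the flux in L2, and
    integrating the derivatives of [u ^ 2] and [w ^ 2] from infinity then
    bounds both pointwise. *)
Lemma line_bound : exists2 C, 0 <= C & forall h u w,
  rsol setT mu rho lam h u w -> sqint setT u -> sqint setT w -> sqint setT h ->
  nrm setT w <= C * (nrm setT u + nrm setT h) /\
  forall x, `|u x| + `|w x| <= C * (nrm setT u + nrm setT h).
Proof.
have [Km Km0 HKm] := coef_le hmu; have [Ki Ki0 HKi] := coef_inv_le hmu.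
have [Kr Kr0 HKr] := coef_le hrho.
pose L := Kr * `|lam| + 1.
have L0 : 0 < L by rewrite ltr_wpDl// mulr_ge0// ltW.
pose B := Num.sqrt (Km * L); have B0 : 0 <= B by exact: sqrtr_ge0.
exists (B + (Num.sqrt (2 * Ki * B) + Num.sqrt (2 * B * L))); first by rewrite !addr_ge0 ?sqrtr_ge0.
move=> h u w [p1 p2] su sw sh.
have mT : measurable (setT : set R) by exact: measurableT.
have ss := source_meas mT su sh; set s := fun t => rho t * lam * u t + h t in ss.
have sv : sqint setT (fun t => (mu t)^-1 * w t).
  exact: (sqint_mul mT (coef_inv_meas hmu mT) HKi sw).
set v := fun t => (mu t)^-1 * w t in sv.
set a := nrm setT u; set c := nrm setT h; set b := nrm setT w.
have a0 : 0 <= a by exact: nrm_ge0. have c0 : 0 <= c by exact: nrm_ge0.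
have b0 : 0 <= b by exact: nrm_ge0.
have iT : is_interval (setT : set R) by [].
have nv : nrm setT v <= Ki * b by exact: nrmM (coef_inv_meas hmu mT) HKi sw.
have ns : nrm setT s <= L * (a + c).
  apply: le_trans (nrmD mT (rho_sqint hrho lam mT su) sh) _.
  have : nrm setT (fun t => rho t * lam * u t) <= Kr * `|lam| * a.
    apply: nrmM => //; first exact: measurable_funM (coef_meas hrho mT) (measurable_cst _).
    by move=> t; rewrite normrM ler_wpM2r.
  rewrite -/c /L => h1; have := mulr_ge0 (mulr_ge0 (ltW Kr0) (normr_ge0 lam)) c0; lra.
have Bb : b <= B * (a + c).
  have pf := prim_mul iT p1 p2.
  have i1 := sqint_prod mT sv sw; have i2 := sqint_prod mT su ss.
  have i3 : intg (setT : set R) (fun t => (mu t)^-1 * w t * w t + u t * - (rho t * lam * u t + h t)).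
    have := intg_sub2 mT i1 i2; congr (intg _ _); apply/funext => t /=; rewrite /v /s; ring.
  have := line_zero pf (sqint_prod mT su sw) i3.
  rewrite (@int_eq _ _ _ (fun t => v t * w t - u t * s t)); last by move=> t _; rewrite /v /s; ring.
  rewrite int_sub// => /eqP; rewrite subr_eq0 => /eqP e.
  rewrite -[b]ger0_norm//; apply: le_sqrt_scale; [by rewrite mulr_ge0 ?ltW|by rewrite addr_ge0|].
  rewrite nrm_sqr; apply: (@le_trans _ _ (Km * lint setT (fun t => v t * w t))).
    rewrite -int_scale//; apply: int_le => //; [exact: sw.2|exact: intg_scale|].
    move=> t _; have -> : Km * (v t * w t) = Km * (mu t)^-1 * w t ^+ 2 by rewrite /v; ring.
    rewrite -[leLHS]mul1r ler_wpM2r ?sqr_ge0//.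
    have m0 := coef_gt0 t hmu; rewrite ler_pdivlMr ?mul1r//.
    by apply: le_trans (HKm t); exact: ler_norm.
  rewrite -mulrA ler_pM2l// e; apply: le_trans (ler_norm _) _.
  apply: le_trans (cauchy_schwarz_nrm mT su ss) _; rewrite -/a.
  apply: (@le_trans _ _ (a * (L * (a + c)))); first by rewrite ler_wpM2l.
  by rewrite mulrCA ler_pM2l// expr2 ler_wpM2r ?addr_ge0// lerDl.
have tail f g x : sqint setT f -> sqint setT g ->
    `|lint (chalf Rside x) (fun t => f t * g t)| <= nrm setT f * nrm setT g.
  move=> sf sg; have mc := chalf_meas Rside x.
  apply: le_trans (cauchy_schwarz_nrm mc (sqint_line _ _ sf) (sqint_line _ _ sg)) _.
  by apply: ler_pM; rewrite ?nrm_ge0//; apply: nrm_subset.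
have sq (F f : R -> R) x : prim setT F f -> sqint setT F -> sqint setT f ->
    F x ^+ 2 <= 2 * (nrm setT F * nrm setT f).
  move=> pF sF sf; have mc := chalf_meas Rside x.
  have i1 := intg_line Rside x (sqint_prod mT sF sf).
  have := decay (prim_line Rside x (prim_mul iT pF pF)) (intg_line _ _ sF.2).
  rewrite (_ : (fun t => f t * F t + F t * f t) = (fun t => 2 * (F t * f t))); last first.
    by apply/funext => t; ring.
  move=> /(_ (intg_scale _ mc i1)); rewrite int_scale// -expr2 => ->.
  have := tail _ _ x sF sf; have := ler_norm (- lint (chalf Rside x) (fun t => F t * f t)).
  rewrite normrN /orient => h1 h2; lra.
have ac0 : 0 <= a + c by rewrite addr_ge0.
have ub x : `|u x| <= Num.sqrt (2 * Ki * B) * (a + c).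
  apply: le_sqrt_scale => //; first by rewrite !mulr_ge0// ltW.
  apply: le_trans (sq _ _ x p1 su sv) _; rewrite -!mulrA ler_pM2l//.
  apply: (@le_trans _ _ (a * (Ki * (B * (a + c))))).
    by rewrite ler_wpM2l//; apply: le_trans nv _; rewrite ler_pM2l.
  rewrite mulrCA ler_pM2l// mulrCA ler_wpM2l// expr2 ler_wpM2r// lerDl//.
have wb x : `|w x| <= Num.sqrt (2 * B * L) * (a + c).
  apply: le_sqrt_scale => //; first by rewrite !mulr_ge0// ltW.
  have sN : sqint setT (fun t => - (rho t * lam * u t + h t)) by exact: sqint_opp.
  apply: le_trans (sq _ _ x p2 sw sN) _; rewrite -!mulrA ler_pM2l//.
  have -> : nrm setT (fun t => - (rho t * lam * u t + h t)) = nrm setT s.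
    by congr Num.sqrt; apply: int_eq => t _; rewrite sqrrN.
  apply: (@le_trans _ _ (B * (a + c) * (L * (a + c)))); last by rewrite expr2; lra.
  by apply: ler_pM => //; exact: nrm_ge0.
split; last first.
  move=> x; have := ub x; have := wb x; rewrite -/a -/c => h1 h2.
  have := mulr_ge0 B0 ac0; lra.
apply: le_trans Bb _; rewrite -/a -/c ler_wpM2r// lerDl addr_ge0 ?sqrtr_ge0//.
Qed.

End line.

(** * The operator orthogonally to an eigenfunction *)

(** The solution is expressed by its Wronskians with a fundamental system, and
    these grow at most by the integral of the source. *)
Lemma rsol_bounded {R : realType} (mu rho : R -> R) (lam al ar : R) :
  line_coefficient mu -> line_coefficient rho -> al <= ar ->
  exists2 M : R, 0 <= M & forall h u w, intg `[al, ar] h ->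
    rsol `[al, ar] mu rho lam h u w -> forall t, al <= t <= ar ->
    `|u t| + `|w t| <= M * (`|u al| + `|w al| + lint `[al, ar] (fun t => `|h t|)).
Proof.
move=> hmu hrho alr; have [f1 [k1 [f2 [k2 [s1 s2 [[a1 b1] [a2 b2]] W]]]]] :=
  fundamental_system lam hmu hrho alr.
have iJ : is_interval (`[al, ar]%classic : set R) by exact: interval_is_interval.
have Jal : (`[al, ar]%classic : set R) al by rewrite /= in_itv/= lexx.
have Jar : (`[al, ar]%classic : set R) ar by rewrite /= in_itv/= alr lexx.
have [B1 H1] := prim_bounded s1.1; have [B2 H2] := prim_bounded s1.2.
have [B3 H3] := prim_bounded s2.1; have [B4 H4] := prim_bounded s2.2.
pose B := 1 + (`|B1| + `|B2| + (`|B3| + `|B4|)).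
have n1 := normr_ge0 B1; have n2 := normr_ge0 B2; have n3 := normr_ge0 B3; have n4 := normr_ge0 B4.
have B0 : 0 <= B by rewrite /B; lra.
have bd t : al <= t <= ar -> [/\ `|f1 t| <= B, `|k1 t| <= B, `|f2 t| <= B & `|k2 t| <= B].
  move=> h; have := H1 _ h; have := H2 _ h; have := H3 _ h; have := H4 _ h.
  have := ler_norm B1; have := ler_norm B2; have := ler_norm B3; have := ler_norm B4.
  by move: n1 n2 n3 n4; rewrite /B; clear; move=> *; split; lra.
exists (4 * B * B + 4 * B) => [|h u w ih su t tJ].
  by rewrite addr_ge0 ?mulr_ge0.
have Jt : (`[al, ar]%classic : set R) t by apply/itv_ccP.
have ni := intg_norm (measurable_itv `[al, ar]) ih; set H := lint _ _.
have H0 : 0 <= H by apply: int_ge0.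
set N := `|u al| + `|w al| + H.
have wr f k : rsol `[al, ar] mu rho lam (fun=> 0) f k ->
    (forall s, al <= s <= ar -> `|f s| <= B) -> `|f al| <= 1 -> `|k al| <= 1 ->
    `|u t * k t - w t * f t| <= (1 + B) * N.
  move=> sf fB f1' k1'; have [at_ ta] := andP tJ.
  have pW := wronskian iJ su sf.
  have := prim_osc pW Jal Jt; set X := lint _ _ => h1.
  have h2 : X <= B * H.
    rewrite /X /H -int_scale//; apply: int_le => //.
    - by apply: intg_norm => //; have [] := pW _ _ Jal Jar alr.
    - exact: intg_scale.
    - by move=> s /itv_ccP sJ; rewrite mulr0 subr0 normrM mulrC ler_wpM2r// fB.
  have h3 : `|u al * k al - w al * f al| <= `|u al| + `|w al|.
    apply: le_trans (ler_normB _ _) _; rewrite !normrM.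
    by apply: lerD; rewrite -[leRHS]mulr1 ler_wpM2l.
  have h4 := ler_normD (u t * k t - w t * f t - (u al * k al - w al * f al)) (u al * k al - w al * f al).
  rewrite subrK in h4.
  have := mulr_ge0 B0 (normr_ge0 (u al)); have := mulr_ge0 B0 (normr_ge0 (w al)).
  by move: h1 h2 h3 h4 H0; rewrite /N; clear; lra.
have [c1 c2 c3 c4] := bd t tJ.
have g1 := wr _ _ s1 (fun s hs => let: And4 p _ _ _ := bd s hs in p).
have g2 := wr _ _ s2 (fun s hs => let: And4 _ _ p _ := bd s hs in p).
rewrite a1 b1 normr1 normr0 in g1; rewrite a2 b2 normr1 normr0 in g2.
have {}g1 := g1 (lexx _) ler01; have {}g2 := g2 ler01 (lexx _).
set A := u t * k1 t - _ in g1; set C := u t * k2 t - _ in g2.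
have eu : u t = C * f1 t - A * f2 t.
  by rewrite -[LHS]mulr1 -(W t tJ) /A /C; ring.
have ew : w t = C * k1 t - A * k2 t.
  by rewrite -[LHS]mulr1 -(W t tJ) /A /C; ring.
have N0 : 0 <= N by rewrite /N !addr_ge0.
have est x y : `|x| <= B -> `|y| <= B -> `|C * x - A * y| <= 2 * ((1 + B) * N * B).
  move=> hx hy; apply: le_trans (ler_normB _ _) _; rewrite !normrM.
  have e1 : `|C| * `|x| <= (1 + B) * N * B by apply: ler_pM.
  have e2 : `|A| * `|y| <= (1 + B) * N * B by apply: ler_pM.
  by move: e1 e2; clear; lra.
have := est _ _ c1 c3; have := est _ _ c2 c4; rewrite -eu -ew; clear; lra.
Qed.

Section isolated.
Context {R : realType}.
Variables (mu rho mu0 rho0 : R -> R) (lam al ar : R).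
Hypotheses (hmu : line_coefficient mu) (hrho : line_coefficient rho).
Hypotheses (hmu0 : line_coefficient mu0) (hrho0 : line_coefficient rho0).
Hypothesis halr : al <= ar.
Hypotheses (emu : forall t, ~ (al < t < ar) -> mu t = mu0 t).
Hypotheses (erho : forall t, ~ (al < t < ar) -> rho t = rho0 t).
Hypothesis resolvent0 : exists2 K : R, 0 <= K & forall h, sqint setT h ->
  exists v k, [/\ rsol setT mu0 rho0 lam h v k, sqint setT v, sqint setT k &
    nrm setT v <= K * nrm setT h].
Variables u0 w0 : R -> R.
Hypotheses (s0 : rsol setT mu rho lam (fun=> 0) u0 w0).
Hypotheses (q0 : sqint setT u0) (r0 : sqint setT w0).
Hypothesis unit0 : lint setT (fun t => rho t * u0 t * u0 t) = 1.
Implicit Types (f g h u w : R -> R) (t x : R).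

Let mT : measurable (setT : set R). Proof. exact: measurableT. Qed.
Let iT : is_interval (setT : set R). Proof. by []. Qed.

Let sqint0 (D : set R) : measurable D -> sqint D (fun=> 0 : R).
Proof.
move=> mD; split; first exact: measurable_cst.
by rewrite (_ : (fun=> _) = (fun=> 0)) ?intg0//; apply/funext => t; rewrite expr0n.
Qed.

Let weight_sqint u : sqint setT u -> sqint setT (fun t => rho t * u t).
Proof.
by move=> su; have := rho_sqint hrho 1 mT su; congr sqint; apply/funext => t; rewrite mulr1.
Qed.

Let ground_neq0 x : ~ (u0 x = 0 /\ w0 x = 0).
Proof.
move=> [h1 h2]; have z t : u0 t = 0.
  by have [] := rsol_zero hmu hrho iT I I s0 h1 h2 (y := t).
have := unit0; rewrite int_zero => [/eqP|t _]; last by rewrite z mulr0.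
by rewrite eq_sym oner_eq0.
Qed.

Let ground_pos x : 0 < u0 x ^+ 2 + w0 x ^+ 2.
Proof.
rewrite lt_neqAle addr_ge0 ?sqr_ge0// andbT eq_sym paddr_eq0 ?sqr_ge0// !sqrf_eq0.
by apply/negP => /andP[/eqP h1 /eqP h2]; apply: (ground_neq0 (x := x)).
Qed.

(** Square-integrable solutions have a constant Wronskian, which is zero
    because it is integrable over the line. *)
Lemma kernel_line u w : rsol setT mu rho lam (fun=> 0) u w -> sqint setT u ->
  sqint setT w -> exists c, forall t, u t = c * u0 t /\ w t = c * w0 t.
Proof.
move=> su qu qw.
have sl i := wronskian_half (rsol_sub (@subsetT _ _) su : rsol (chalf i 0) mu rho lam _ u w)
  (rsol_sub (@subsetT _ _) s0).
have := sl Rside; rewrite int_zero; last by move=> t _; ring.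
rewrite mulr0 => W0.
have {}W0 : u 0 * w0 0 - w 0 * u0 0 = 0.
  have z := sqint0 (chalf_meas Rside 0).
  by apply: W0 => //; exact: sqint_line.
pose c := (u 0 * u0 0 + w 0 * w0 0) / (u0 0 ^+ 2 + w0 0 ^+ 2).
have p := ground_pos 0; have nz : u0 0 ^+ 2 + w0 0 ^+ 2 != 0 by rewrite gt_eqF.
have e1 : 1 * u 0 + - c * u0 0 = 0.
  rewrite /c; transitivity (w0 0 * (u 0 * w0 0 - w 0 * u0 0) / (u0 0 ^+ 2 + w0 0 ^+ 2)); first by field.
  by rewrite W0 mulr0 mul0r.
have e2 : 1 * w 0 + - c * w0 0 = 0.
  rewrite /c; transitivity (- u0 0 * (u 0 * w0 0 - w 0 * u0 0) / (u0 0 ^+ 2 + w0 0 ^+ 2)); first by field.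
  by rewrite W0 mulr0 mul0r.
exists c => t.
have := rsol_lin 1 (- c) iT su s0.
rewrite (_ : (fun t => 1 * 0 + _) = fun=> 0); last by apply/funext => ?; ring.
move=> s; have [z1 z2] := rsol_zero hmu hrho iT I I s e1 e2 (y := t).
by split; lra.
Qed.

(** Integrate the Wronskian with the ground state over the line. *)
Lemma solvable_orthogonal h u w : rsol setT mu rho lam h u w -> sqint setT u ->
  sqint setT w -> sqint setT h -> lint setT (fun t => h t * u0 t) = 0.
Proof.
move=> su qu qw qh; have pW := wronskian iT su s0.
rewrite -[RHS](line_zero pW).
- by apply: int_eq => t _; ring.
- by apply: intg_sub2 => //; exact: sqint_prod.
- by apply: intg_sub2 => //; apply: sqint_prod => //; exact: sqint0.
Qed.

Let pair_bound f : sqint setT f ->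
  exists2 k, 0 <= k & forall g, sqint setT g -> `|lint setT (fun t => f t * g t)| <= k * nrm setT g.
Proof. by move=> sf; exists (nrm setT f) => [|g sg]; [exact: nrm_ge0|exact: cauchy_schwarz_nrm]. Qed.

(* Facts irrelevant to an inequality slow down linear arithmetic; those of the
   section have to stay. *)
Ltac lean_lra := clear - mu rho mu0 rho0 lam al ar hmu hrho hmu0 hrho0 halr emu erho
  resolvent0 u0 w0 s0 q0 r0 unit0 mT iT sqint0 weight_sqint ground_neq0 ground_pos pair_bound; lra.

(** Solvability orthogonally to the ground state: the solution for the
    unperturbed coefficients is kept on the left, continued through the
    perturbed interval, and then leaves the unperturbed solution on the right
    by a multiple of the ground state, precisely because the source is
    orthogonal to it. *)
Lemma orthogonal_solve : exists2 C, 0 <= C & forall h, sqint setT h ->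
  lint setT (fun t => h t * u0 t) = 0 -> exists u w,
  [/\ rsol setT mu rho lam h u w, sqint setT u, sqint setT w,
      lint setT (fun t => rho t * u t * u0 t) = 0 & nrm setT u <= C * nrm setT h].
Proof.
have [K K0 HK] := resolvent0.
have [C1 C10 HC1] := line_bound lam hmu0 hrho0.
have [M M0 HM] := rsol_bounded lam hmu hrho halr.
have p0 := ground_pos ar; set P := u0 ar ^+ 2 + w0 ar ^+ 2 in p0.
have [k k0 Hk] := pair_bound (weight_sqint q0).
pose S := Num.sqrt (ar - al); pose C2 := C1 * (K + 1).
pose C3 := M * (C2 + S).
pose C4 := (`|u0 ar| + `|w0 ar|) * (C3 + C2) / P.
pose C5 := K + C3 * S + (K + C4 * nrm setT u0).
have S0 : 0 <= S by exact: sqrtr_ge0.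
have C20 : 0 <= C2 by rewrite mulr_ge0 ?addr_ge0.
have C30 : 0 <= C3 by rewrite mulr_ge0 ?addr_ge0.
have C40 : 0 <= C4 by apply: divr_ge0; [apply: mulr_ge0; apply: addr_ge0|exact: ltW].
have n00 : 0 <= nrm setT u0 by exact: nrm_ge0.
have C50 : 0 <= C5.
  by apply: addr_ge0; apply: addr_ge0 => //; apply: mulr_ge0.
exists (C5 + k * C5 * nrm setT u0) => [|h qh oh].
  by apply: addr_ge0 => //; apply: mulr_ge0 => //; apply: mulr_ge0.
have [v [kv [sv qv qk nv]]] := HK h qh.
set H := nrm setT h in nv.
have H0 : 0 <= H by exact: nrm_ge0.
have vb x : `|v x| + `|kv x| <= C2 * H.
  have [_ /(_ x) b] := HC1 _ _ _ sv qv qk qh; apply: le_trans b _.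
  by rewrite /C2 -mulrA; apply: ler_wpM2l => //; rewrite -/H mulrDl mul1r; lra.
have mJ : measurable (`[al, ar]%classic : set R) by exact: measurable_itv.
have JT : (`[al, ar]%classic : set R) `<=` setT by [].
have qhJ := sqint_sub mT mJ JT qh.
have ihJ : intg `[al, ar] h.
  have q1 : sqint `[al, ar] (fun=> 1 : R).
    by split; [exact: measurable_cst|exact: intg_cst].
  have := sqint_prod mJ q1 qhJ; congr (intg _ _); apply/funext => t /=; exact: mul1r.
have [u1 [w1 [s1 a1 b1]]] := cauchy_left lam hmu hrho (v al) (kv al) halr ihJ.
have hJ : lint `[al, ar] (fun t => `|h t|) <= S * H.
  have q1 : sqint `[al, ar] (fun=> 1 : R).
    by split; [exact: measurable_cst|exact: intg_cst].
  have qn : sqint `[al, ar] (fun t => `|h t|).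
    split; first by apply: measurableT_comp => //; exact: qhJ.1.
    by have := qhJ.2; congr (intg _ _); apply/funext => t /=; rewrite real_normK ?num_real.
  have := cauchy_schwarz_nrm mJ q1 qn; rewrite (@int_eq _ _ _ (fun t => `|h t|)); last by move=> t _; exact: mul1r.
  move/(le_trans (ler_norm _)) => h1; apply: le_trans h1 _; apply: ler_pM; rewrite ?nrm_ge0//.
    apply: nrm_le => //; rewrite (@int_eq _ _ _ (fun=> 1)); last by move=> t _; rewrite expr1n.
    by rewrite int_cst// mul1r sqr_sqrtr ?subr_ge0.
  rewrite (_ : nrm _ _ = nrm `[al, ar] h); first exact: nrm_subset.
  by congr Num.sqrt; apply: int_eq => t _; rewrite real_normK ?num_real.
have ub t : al <= t <= ar -> `|u1 t| + `|w1 t| <= C3 * H.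
  move=> /(HM _ _ _ ihJ s1); rewrite a1 b1 => h1; apply: le_trans h1 _.
  by rewrite /C3 -mulrA ler_wpM2l// mulrDl lerD.
have arJ : al <= ar <= ar by rewrite halr lexx.
(* the mismatch at the right end is proportional to the ground state *)
have sLm : rsol (chalf Lside al) mu rho lam h v kv.
  apply: (rsol_coef (@chalf_interval _ _ _) _ _ (rsol_sub (@subsetT _ _) sv)) => t;
    rewrite /= in_itv/= => ta; [rewrite emu|rewrite erho] => // /andP[at_ _];
    by move: (lt_le_trans at_ ta); rewrite ltxx.
have sRm : rsol (chalf Rside ar) mu rho lam h v kv.
  apply: (rsol_coef (@chalf_interval _ _ _) _ _ (rsol_sub (@subsetT _ _) sv)) => t;
    rewrite /= in_itv/= andbT => ta; [rewrite emu|rewrite erho] => // /andP[_ at_];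
    by move: (lt_le_trans at_ ta); rewrite ltxx.
have mc i a : measurable (chalf i a : set R) by exact: chalf_meas.
have wL := wronskian_half sLm (rsol_sub (@subsetT _ _) s0) (sqint_line _ _ qh)
  (sqint_line _ _ qv) (sqint_line _ _ qk) (sqint0 (mc _ _)) (sqint_line _ _ q0) (sqint_line _ _ r0).
have wR := wronskian_half sRm (rsol_sub (@subsetT _ _) s0) (sqint_line _ _ qh)
  (sqint_line _ _ qv) (sqint_line _ _ qk) (sqint0 (mc _ _)) (sqint_line _ _ q0) (sqint_line _ _ r0).
have Jal : (`[al, ar]%classic : set R) al by rewrite /= in_itv/= lexx.
have Jar : (`[al, ar]%classic : set R) ar by apply/itv_ccP.
have [_ wJ] := (wronskian (@interval_is_interval _ _) s1 (rsol_sub JT s0)) _ _ Jal Jar halr.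
have simp' (f : R -> R) (D : set R) : lint D (fun t => h t * u0 t - f t * 0) = lint D (fun t => h t * u0 t).
  by apply: int_eq => t _; ring.
rewrite !simp' in wL wR wJ; rewrite a1 b1 wL in wJ.
have W0 : (u1 ar - v ar) * w0 ar - (w1 ar - kv ar) * u0 ar = 0.
  have := oh; rewrite (int_three halr (sqint_prod mT qh q0)).
  by move: wJ wR; rewrite /orient; lean_lra.
pose c := ((u1 ar - v ar) * u0 ar + (w1 ar - kv ar) * w0 ar) / P.
have nz : P != 0 by rewrite gt_eqF.
have e1 : u1 ar = v ar + c * u0 ar.
  rewrite /c; apply/eqP; rewrite -subr_eq0; apply/eqP.
  transitivity (w0 ar * ((u1 ar - v ar) * w0 ar - (w1 ar - kv ar) * u0 ar) / P); last by rewrite W0 mulr0 mul0r.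
  by rewrite /P; field; rewrite -/P.
have e2 : w1 ar = kv ar + c * w0 ar.
  rewrite /c; apply/eqP; rewrite -subr_eq0; apply/eqP.
  transitivity (- u0 ar * ((u1 ar - v ar) * w0 ar - (w1 ar - kv ar) * u0 ar) / P); last by rewrite W0 mulr0 mul0r.
  by rewrite /P; field; rewrite -/P.
have cb : `|c| <= C4 * H.
  rewrite /c normrM normfV (gtr0_norm p0) /C4 mulrAC ler_pM2r ?invr_gt0//.
  apply: le_trans (ler_normD _ _) _; rewrite !normrM.
  have x1 : `|u1 ar - v ar| <= (C3 + C2) * H.
    apply: le_trans (ler_normB _ _) _; have := ub _ arJ; have := vb ar.
    have := normr_ge0 (w1 ar); have := normr_ge0 (kv ar); lean_lra.
  have x2 : `|w1 ar - kv ar| <= (C3 + C2) * H.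
    apply: le_trans (ler_normB _ _) _; have := ub _ arJ; have := vb ar.
    have := normr_ge0 (u1 ar); have := normr_ge0 (v ar); lean_lra.
  have y1 := ler_wpM2r (normr_ge0 (u0 ar)) x1; have y2 := ler_wpM2r (normr_ge0 (w0 ar)) x2.
  by move: y1 y2; lean_lra.
have sR' : rsol (chalf Rside ar) mu rho lam h (fun t => v t + c * u0 t) (fun t => kv t + c * w0 t).
  have := rsol_lin 1 c (@chalf_interval _ _ _) sRm (rsol_sub (@subsetT _ _) s0).
  by move/(rsol_ext (@chalf_interval _ _ _)); apply=> t _; ring.
have s := glue3 halr sLm s1 sR' (esym a1) (esym b1) e1 e2.
set u := piece _ _ _ _ _ in s; set w := piece _ _ _ _ _ in s.
have qu : sqint setT u.
  apply: (sqint_piece halr s.1) => //; first exact: sqint_line.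
  by apply: sqint_line; apply: sqint_add => //; exact: sqint_scale.
have qw : sqint setT w.
  apply: (sqint_piece halr s.2) => //; first exact: sqint_line.
  by apply: sqint_line; apply: sqint_add => //; exact: sqint_scale.
have nu : nrm setT u <= C5 * H.
  apply: le_trans (nrm_pieces halr qu) _.
  have x1 : nrm (chalf Lside al) u <= K * H.
    rewrite (_ : nrm _ u = nrm (chalf Lside al) v); last first.
      by apply: nrm_eq => t; rewrite /= in_itv/= /u /piece => ->.
    by apply: le_trans (nrm_subset mT _ _ qv) nv.
  have x2 : nrm `[al, ar] u <= C3 * H * S.
    apply: nrm_bounded => //; [by rewrite mulr_ge0|exact: (sqint_sub mT mJ JT qu).2|].
    move=> t tJ; have ut : u t = u1 t.
      by move: tJ => /andP[t1 t2]; rewrite /u piece_mid.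
    by rewrite ut; have := ub t tJ; have := normr_ge0 (w1 t); lean_lra.
  have x3 : nrm (chalf Rside ar) u <= (K + C4 * nrm setT u0) * H.
    have q3 : sqint setT (fun t => v t + c * u0 t) by apply: sqint_add => //; exact: sqint_scale.
    rewrite (_ : nrm _ u = nrm (chalf Rside ar) (fun t => v t + c * u0 t)); last first.
      by apply: nrm_eq => t; rewrite /= in_itv/= andbT => art; rewrite /u piece_right.
    apply: le_trans (nrm_subset mT (mc _ _) (@subsetT _ _) q3) _.
    apply: le_trans (nrmD mT qv (sqint_scale c mT q0)) _.
    have := nrmZ c mT q0; have := ler_wpM2r (nrm_ge0 setT u0) cb; move: nv; lean_lra.
  by move: x1 x2 x3; rewrite /C5; lean_lra.
(* the component along the ground state can be subtracted without changing
   the equation *)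
pose al0 := lint setT (fun t => rho t * u0 t * u t).
have ab : `|al0| <= k * (C5 * H) by apply: le_trans (Hk _ qu) _; rewrite ler_wpM2l.
exists (fun t => u t + - al0 * u0 t), (fun t => w t + - al0 * w0 t); split.
- have := rsol_lin 1 (- al0) iT s s0.
  by move/(rsol_ext iT); apply=> t _; ring.
- by apply: sqint_add => //; exact: sqint_scale.
- by apply: sqint_add => //; exact: sqint_scale.
- rewrite (@int_eq _ _ _ (fun t => rho t * u0 t * u t + - al0 * (rho t * u0 t * u0 t))); last by move=> t _; ring.
  have i1 := sqint_prod mT (weight_sqint q0) qu; have i2 := sqint_prod mT (weight_sqint q0) q0.
  rewrite int_add//; last exact: intg_scale.
  by rewrite int_scale// unit0 -/al0; ring.
- apply: le_trans (nrmD mT qu (sqint_scale _ mT q0)) _.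
  have := nrmZ (- al0) mT q0; rewrite normrN => h1.
  have := ler_wpM2r (nrm_ge0 setT u0) ab; move: h1 nu; rewrite -/H; lean_lra.
Qed.

End isolated.

(** * Neumann series *)

Section series.
Context {R : realType}.
Implicit Types (f : nat -> R -> R) (t A : R) (n : nat).

Definition psum f n t : R := \sum_(k < n.+1) f k t.

Lemma psum0 f t : psum f 0 t = f 0%N t.
Proof. by rewrite /psum big_ord_recl big_ord0 addr0. Qed.

Lemma psumS f n t : psum f n.+1 t = psum f n t + f n.+1 t.
Proof. by rewrite /psum big_ord_recr. Qed.

Lemma sqint_psum f n : (forall k, sqint setT (f k)) -> sqint setT (psum f n).
Proof.
move=> sf; elim: n => [|n IH].
  by rewrite (_ : psum f 0 = f 0%N)//; apply/funext => t; rewrite psum0.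
rewrite (_ : psum f n.+1 = fun t => psum f n t + f n.+1 t).
  by apply: sqint_add => //; exact: measurableT.
by apply/funext => t; rewrite psumS.
Qed.

Lemma nrm_psum f A n : 0 <= A -> (forall k, sqint setT (f k)) ->
  (forall k, nrm setT (f k) <= A / 2 ^+ k) -> nrm setT (psum f n) <= 2 * A.
Proof.
move=> A0 sf fA.
suff h : nrm setT (psum f n) <= 2 * A - A / 2 ^+ n.
  by apply: le_trans h _; rewrite gerBl divr_ge0// exprn_ge0.
elim: n => [|n IH].
  rewrite (_ : psum f 0 = f 0%N); last by apply/funext => t; rewrite psum0.
  by have := fA 0%N; rewrite expr0 divr1; lra.
rewrite (_ : psum f n.+1 = fun t => psum f n t + f n.+1 t); last first.
  by apply/funext => t; rewrite psumS.
apply: le_trans (nrmD measurableT (sqint_psum n sf) (sf _)) _.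
have e : A / 2 ^+ n = 2 * (A / 2 ^+ n.+1).
  by rewrite exprS; field; rewrite expf_neq0//.
have := fA n.+1; rewrite e in IH; lra.
Qed.

(** A series with geometrically small terms, in the supremum and L2 norms. *)
Lemma series_limit f A : 0 <= A -> (forall k, sqint setT (f k)) ->
  (forall k, nrm setT (f k) <= A / 2 ^+ k) ->
  (forall k t, `|f k t| <= A / 2 ^+ k) ->
  exists F, sqint setT F /\ forall n t, `|psum f n t - F t| <= 2 * A / 2 ^+ n.
Proof.
move=> A0 sf fA bf.
have lim t : exists l, forall n, `|psum f n t - l| <= 2 * A / 2 ^+ n.
  apply: geometric_limit => n; rewrite psumS addrAC subrr add0r.
  apply: le_trans (bf _ _) _; rewrite ler_wpM2l// lef_pV2 ?posrE ?exprn_gt0//.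
  by rewrite exprS ler_peMl ?exprn_ge0// ler1n.
have [F HF] := choice lim; exists F; split=> [|n t]; last exact: HF.
apply: (@sqint_limit _ (psum f) F (2 * A)) => [n|n|t]; [exact: sqint_psum|exact: nrm_psum|].
apply/cvgrPdist_le => e e0; have : (2 * A / 2 ^+ n) @[n --> \oo] --> (0 : R).
  rewrite -[X in _ --> X](mulr0 (2 * A)); apply: cvgM; first exact: cvg_cst.
  under eq_fun do rewrite -exprVn; apply: cvg_expr.
  by rewrite ger0_norm ?invr_ge0// invf_lt1// ltr1n.
move/cvgrPdist_le => /(_ e e0); apply: filterS => n; rewrite sub0r normrN => h.
rewrite distrC; apply: le_trans (HF t n) _; apply: le_trans h; exact: ler_norm.
Qed.

Lemma rsol_psum (mu rho : R -> R) (lam : R) (h u w : nat -> R -> R) n :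
  (forall k, rsol setT mu rho lam (h k) (u k) (w k)) ->
  rsol setT mu rho lam (psum h n) (psum u n) (psum w n).
Proof.
move=> s; have iT : is_interval (setT : set R) by [].
elim: n => [|n IH].
  by apply: (rsol_ext iT (s 0%N)) => t _; rewrite psum0.
have := rsol_lin 1 1 iT IH (s n.+1).
by move/(rsol_ext iT); apply=> t _; rewrite psumS !mul1r.
Qed.

End series.

Section perturbed_parameter.
Context {R : realType}.
Variables (mu rho : R -> R) (lam : R).
Hypotheses (hmu : line_coefficient mu) (hrho : line_coefficient rho).
Variables u0 w0 : R -> R.
Hypotheses (s0 : rsol setT mu rho lam (fun=> 0) u0 w0).
Hypotheses (q0 : sqint setT u0) (r0 : sqint setT w0).
Hypothesis unit0 : lint setT (fun t => rho t * u0 t * u0 t) = 1.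
Hypothesis solve0 : exists2 C, 0 <= C & forall h, sqint setT h ->
  lint setT (fun t => h t * u0 t) = 0 -> exists u w,
  [/\ rsol setT mu rho lam h u w, sqint setT u, sqint setT w,
      lint setT (fun t => rho t * u t * u0 t) = 0 & nrm setT u <= C * nrm setT h].
Implicit Types (f g h u w : R -> R) (a b t x : R).

Let mT : measurable (setT : set R). Proof. exact: measurableT. Qed.
Let iT : is_interval (setT : set R). Proof. by []. Qed.

Lemma weight_sqint u : sqint setT u -> sqint setT (fun t => rho t * u t).
Proof.
by move=> su; have := rho_sqint hrho 1 mT su; congr sqint; apply/funext => t; rewrite mulr1.
Qed.

Lemma sqint_comb a b f g : sqint setT f -> sqint setT g ->
  sqint setT (fun t => a * f t + b * g t).
Proof. by move=> sf sg; apply: sqint_add => //; exact: sqint_scale. Qed.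

Lemma nrm_comb a b f g : sqint setT f -> sqint setT g ->
  nrm setT (fun t => a * f t + b * g t) <= `|a| * nrm setT f + `|b| * nrm setT g.
Proof.
move=> sf sg; apply: le_trans (nrmD mT (sqint_scale a mT sf) (sqint_scale b mT sg)) _.
by apply: lerD; exact: nrmZ.
Qed.

Lemma pair_comb a b f g : sqint setT f -> sqint setT g ->
  lint setT (fun t => rho t * (a * f t + b * g t) * u0 t) =
  a * lint setT (fun t => rho t * f t * u0 t) + b * lint setT (fun t => rho t * g t * u0 t).
Proof.
move=> sf sg; have i1 := sqint_prod mT (weight_sqint sf) q0.
have i2 := sqint_prod mT (weight_sqint sg) q0.
rewrite -!int_scale// -int_add//; [|exact: intg_scale..].
by apply: int_eq => t _; ring.
Qed.

(* Facts irrelevant to an inequality slow down linear arithmetic; those of the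
   section have to stay. *)
Ltac lean_lra := clear - mu rho lam hmu hrho u0 w0 s0 q0 r0 unit0 solve0 mT iT; lra.

(** The resolvent of the reduced operator, extended to nearby complex spectral
    parameters [lam + a + i b] by a Neumann series. *)
Lemma neumann : exists2 r, 0 < r & forall a b g1 g2, `|a| + `|b| <= r ->
  sqint setT g1 -> sqint setT g2 ->
  lint setT (fun t => rho t * g1 t * u0 t) = 0 ->
  lint setT (fun t => rho t * g2 t * u0 t) = 0 -> exists u1 w1 u2 w2,
  [/\ rsol setT mu rho lam (fun t => rho t * (g1 t + (a * u1 t - b * u2 t))) u1 w1,
      rsol setT mu rho lam (fun t => rho t * (g2 t + (b * u1 t + a * u2 t))) u2 w2,
      sqint setT u1 /\ sqint setT u2 & sqint setT w1 /\ sqint setT w2].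
Proof.
have [C C0 HC] := solve0; have [Kr Kr0 HKr] := coef_le hrho.
have [C1 C10 HC1] := line_bound lam hmu hrho.
have [Ki Ki0 HKi] := coef_inv_le hmu.
pose good h := sqint setT h /\ lint setT (fun t => h t * u0 t) = 0.
have /choice[T HT] h : exists p : (R -> R) * (R -> R), good h ->
    [/\ rsol setT mu rho lam h p.1 p.2, sqint setT p.1, sqint setT p.2,
      lint setT (fun t => rho t * p.1 t * u0 t) = 0 & nrm setT p.1 <= C * nrm setT h].
  have [[qh oh]|ng] := pselect (good h); last by exists (u0, u0).
  by have [u [w s]] := HC h qh oh; exists (u, w).
exists (2 * (C * Kr + 1))^-1.
  by rewrite invr_gt0 mulr_gt0// ltr_wpDl// mulr_ge0// ltW.
move=> a b g1 g2 abr qg1 qg2 og1 og2.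
have abC : Kr * (`|a| + `|b|) * C <= 1 / 2.
  have CK : 0 < C * Kr + 1 by rewrite ltr_wpDl// mulr_ge0// ltW.
  apply: (@le_trans _ _ (Kr * (2 * (C * Kr + 1))^-1 * C)).
    by apply: ler_wpM2r => //; apply: ler_wpM2l => //; exact: ltW.
  rewrite (_ : Kr * (2 * (C * Kr + 1))^-1 * C = (C * Kr) / (C * Kr + 1) / 2).
    by rewrite ler_pM2r// ler_pdivrMr// mul1r lerDl.
  by field; rewrite gt_eqF.
pose fix H n : (R -> R) * (R -> R) := if n is m.+1 then
    (fun t => rho t * (a * (T (H m).1).1 t + - b * (T (H m).2).1 t),
     fun t => rho t * (b * (T (H m).1).1 t + a * (T (H m).2).1 t))
  else (fun t => rho t * g1 t, fun t => rho t * g2 t).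
pose A := nrm setT (H 0%N).1 + nrm setT (H 0%N).2.
have A0 : 0 <= A by rewrite addr_ge0// nrm_ge0.
have inv n : [/\ good (H n).1, good (H n).2 &
    nrm setT (H n).1 + nrm setT (H n).2 <= A / 2 ^+ n].
  elim: n => [|n [G1 G2 N]].
    by split; [split => //; exact: weight_sqint..|rewrite expr0 divr1].
  have [t1 t2 t3 t4 t5] := HT _ G1; have [v1 v2 v3 v4 v5] := HT _ G2.
  split.
  - by split; [apply: weight_sqint; exact: sqint_comb|rewrite /= pair_comb// t4 v4 !mulr0 addr0].
  - by split; [apply: weight_sqint; exact: sqint_comb|rewrite /= pair_comb// t4 v4 !mulr0 addr0].
  have wn f : sqint setT f -> nrm setT (fun t => rho t * f t) <= Kr * nrm setT f.
    by move=> sf; exact: nrmM (coef_meas hrho mT) HKr sf.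
  have k1 := wn _ (sqint_comb a (- b) t2 v2); have k2 := wn _ (sqint_comb b a t2 v2).
  have l1 := nrm_comb a (- b) t2 v2; have l2 := nrm_comb b a t2 v2; rewrite normrN in l1.
  set X := nrm setT _ in t5 l1 l2; set Y := nrm setT _ in v5 l1 l2.
  have k3 := ler_wpM2l (ltW Kr0) l1; have k4 := ler_wpM2l (ltW Kr0) l2.
  set p := `|a| in abC k3 k4; set q := `|b| in abC k3 k4.
  have XY : X + Y <= C * (A / 2 ^+ n).
    apply: le_trans (_ : X + Y <= C * (nrm setT (H n).1 + nrm setT (H n).2)) _; first by rewrite mulrDr; exact: lerD.
    by rewrite ler_wpM2l.
  have pq : 0 <= Kr * (p + q).
    by apply: mulr_ge0; [exact: ltW|apply: addr_ge0; exact: normr_ge0].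
  apply: (@le_trans _ _ (Kr * (p + q) * (X + Y))).
    by move: k1 k2 k3 k4; rewrite /=; lean_lra.
  apply: le_trans (ler_wpM2l pq XY) _.
  rewrite mulrA exprS (_ : A / (2 * 2 ^+ n) = 1 / 2 * (A / 2 ^+ n)).
    by apply: ler_wpM2r => //; rewrite divr_ge0// exprn_ge0.
  by field; rewrite expf_neq0.
pose h1 n := (H n).1; pose h2 n := (H n).2.
pose v1 n := (T (h1 n)).1; pose v2 n := (T (h2 n)).1.
pose k1 n := (T (h1 n)).2; pose k2 n := (T (h2 n)).2.
have half_ge (x y z : R) : 0 <= x -> 0 <= y -> x + y <= z -> x <= z /\ y <= z.
  by move=> *; split; lra.
pose B := (C1 + 1) * (C + 1) * A.
have B0 : 0 <= B by apply: mulr_ge0 => //; apply: mulr_ge0; exact: addr_ge0.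
have bounds n h : good h -> nrm setT h <= A / 2 ^+ n ->
    [/\ nrm setT (T h).1 <= B / 2 ^+ n, nrm setT (T h).2 <= B / 2 ^+ n,
      forall t, `|(T h).1 t| <= B / 2 ^+ n & forall t, `|(T h).2 t| <= B / 2 ^+ n].
  move=> G N; have [t1 t2 t3 t4 t5] := HT _ G.
  have [b1 b2] := HC1 _ _ _ t1 t2 t3 G.1.
  have N0 := nrm_ge0 setT h.
  have x1 : nrm setT (T h).1 + nrm setT h <= (C + 1) * (A / 2 ^+ n).
    apply: (@le_trans _ _ ((C + 1) * nrm setT h)); first by lra.
    by rewrite ler_wpM2l// addr_ge0.
  have x2 := ler_wpM2l C10 x1.
  have x3 : B / 2 ^+ n = C1 * ((C + 1) * (A / 2 ^+ n)) + (C + 1) * (A / 2 ^+ n).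
    by rewrite /B; ring.
  have x4 : 0 <= (C + 1) * (A / 2 ^+ n).
    by apply: mulr_ge0; [rewrite addr_ge0|rewrite divr_ge0// exprn_ge0].
  have x5 := mulr_ge0 C10 x4; rewrite x3.
  have x6 := nrm_ge0 setT (T h).1.
  have [y1 y2] : nrm setT (T h).1 <= C1 * ((C + 1) * (A / 2 ^+ n)) + (C + 1) * (A / 2 ^+ n) /\
      nrm setT (T h).2 <= C1 * ((C + 1) * (A / 2 ^+ n)) + (C + 1) * (A / 2 ^+ n).
    by move: N0 x1 x2 x4 x5 x6 b1; lean_lra.
  split=> // t; have := b2 t.
    by have := normr_ge0 ((T h).2 t); move: x2 x4; lean_lra.
  by have := normr_ge0 ((T h).1 t); move: x2 x4; lean_lra.
have i1 n : good (h1 n) /\ nrm setT (h1 n) <= A / 2 ^+ n.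
  by have [G _ N] := inv n; split=> //; have [] := half_ge _ _ _ (nrm_ge0 _ _) (nrm_ge0 _ _) N.
have i2 n : good (h2 n) /\ nrm setT (h2 n) <= A / 2 ^+ n.
  by have [_ G N] := inv n; split=> //; have [] := half_ge _ _ _ (nrm_ge0 _ _) (nrm_ge0 _ _) N.
have ser (h : nat -> R -> R) : (forall n, good (h n) /\ nrm setT (h n) <= A / 2 ^+ n) ->
    exists U W, [/\ sqint setT U, sqint setT W,
      forall n t, `|psum (fun n => (T (h n)).1) n t - U t| <= 2 * B / 2 ^+ n &
      forall n t, `|psum (fun n => (T (h n)).2) n t - W t| <= 2 * B / 2 ^+ n].
  move=> Hh.
  have q1 n : sqint setT (T (h n)).1 by have [G _] := Hh n; have [] := HT _ G.
  have q2 n : sqint setT (T (h n)).2 by have [G _] := Hh n; have [] := HT _ G.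
  have b1 n := bounds n (h n) (Hh n).1 (Hh n).2.
  have [U [qU HU]] := series_limit B0 q1 (fun n => let: And4 p _ _ _ := b1 n in p)
    (fun n => let: And4 _ _ p _ := b1 n in p).
  have [W [qW HW]] := series_limit B0 q2 (fun n => let: And4 _ p _ _ := b1 n in p)
    (fun n => let: And4 _ _ _ p := b1 n in p).
  by exists U, W.
have [U1 [W1 [qU1 qW1 HU1 HW1]]] := ser h1 i1.
have [U2 [W2 [qU2 qW2 HU2 HW2]]] := ser h2 i2.
have rs h : good h -> rsol setT mu rho lam h (T h).1 (T h).2 by move=> G; have [] := HT _ G.
pose D := 2 * B * (1 + Ki + Kr * `|lam| + 2 * Kr * (`|a| + `|b|)).
have limit (h : nat -> R -> R) U W g x y : (forall n, good (h n)) ->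
    sqint setT U -> sqint setT W -> sqint setT g -> `|x| <= `|a| + `|b| -> `|y| <= `|a| + `|b| ->
    (forall n t, `|psum (fun n => (T (h n)).1) n t - U t| <= 2 * B / 2 ^+ n) ->
    (forall n t, `|psum (fun n => (T (h n)).2) n t - W t| <= 2 * B / 2 ^+ n) ->
    (forall n t, psum h n.+1 t = rho t * (g t + (x * psum v1 n t + y * psum v2 n t))) ->
    rsol setT mu rho lam (fun t => rho t * (g t + (x * U1 t + y * U2 t))) U W.
  move=> Gh qU qW qg xa ya cU cW eh.
  have s n := rsol_psum n.+1 (fun k => rs (h k) (Gh k)).
  have sub (f : R -> R) p q : sqint setT f -> measurable_fun (`[p, q]%classic : set R) f.
    by move=> [mf _]; exact: measurable_funS mf.
  have c0 : 0 <= `|a| + `|b| by rewrite addr_ge0.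
  have p2 n : 2 * B / 2 ^+ n.+1 <= 2 * B / 2 ^+ n.
    apply: ler_wpM2l; first by rewrite mulr_ge0.
    by rewrite lef_pV2 ?posrE ?exprn_gt0// exprS ler_peMl ?exprn_ge0// ler1n.
  have cD (K : R) n : 0 <= K -> K <= 1 + Ki + Kr * `|lam| + 2 * Kr * (`|a| + `|b|) ->
      K * (2 * B / 2 ^+ n) <= D / 2 ^+ n.
    move=> K0 KD; rewrite (_ : D / 2 ^+ n =
      (1 + Ki + Kr * `|lam| + 2 * Kr * (`|a| + `|b|)) * (2 * B / 2 ^+ n)); last by rewrite /D; ring.
    apply: ler_wpM2r => //.
    by apply: divr_ge0; [exact: mulr_ge0|exact: exprn_ge0].
  have s0' : 0 <= Kr * `|lam| by apply: mulr_ge0 => //; exact: ltW.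
  have s1' : 0 <= Kr * (`|a| + `|b|) by apply: mulr_ge0 => //; exact: ltW.
  have one n (F f : R -> R) t : `|F t - f t| <= 2 * B / 2 ^+ n -> `|F t - f t| <= D / 2 ^+ n.
    move=> hF; apply: le_trans hF _; rewrite -[leLHS]mul1r; apply: cD => //.
    by move: Ki0 s0' s1'; lean_lra.
  split.
    apply: (@prim_limit _ _ _ (fun n t => (mu t)^-1 * psum (fun n => (T (h n)).2) n.+1 t) _ _ D iT (fun n => (s n).1)).
    - move=> p q _ _; apply: measurable_funM; last exact: sub.
      by apply: measurable_funS (coef_inv_meas hmu mT).
    - by move=> n t _; apply: one; apply: le_trans (p2 n); exact: cU.
    - move=> n t _; rewrite -mulrBr normrM.
      apply: (@le_trans _ _ (Ki * (2 * B / 2 ^+ n))).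
        by apply: ler_pM => //; apply: le_trans (p2 n); exact: cW.
      by apply: cD; [exact: ltW|move: s0' s1'; lean_lra].
  apply: (@prim_limit _ _ _ (fun n t => - (rho t * lam * psum (fun n => (T (h n)).1) n.+1 t + psum h n.+1 t)) _ _ D iT (fun n => (s n).2)).
  - move=> p q _ _; apply: sub; apply: sqint_opp => //; apply: source_meas => //.
    apply: weight_sqint; apply: sqint_add => //; exact: sqint_comb.
  - by move=> n t _; apply: one; apply: le_trans (p2 n); exact: cW.
  - move=> n t _; rewrite eh.
    set P := psum _ _ t; set Q1 := psum _ _ t; set Q2 := psum _ _ t.
    have -> : - (rho t * lam * P + rho t * (g t + (x * Q1 + y * Q2))) -
        - (rho t * lam * U t + rho t * (g t + (x * U1 t + y * U2 t))) =
        - (rho t * (lam * (P - U t) + (x * (Q1 - U1 t) + y * (Q2 - U2 t)))) by ring.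
    rewrite normrN normrM.
    apply: (@le_trans _ _ (Kr * ((`|lam| + 2 * (`|a| + `|b|)) * (2 * B / 2 ^+ n)))).
      apply: ler_pM => //; apply: le_trans (ler_normD _ _) _.
      rewrite normrM mulrDl; apply: lerD.
        by apply: ler_wpM2l => //; apply: le_trans (p2 n); exact: cU.
      apply: le_trans (ler_normD _ _) _; rewrite !normrM.
      have j1 : `|x| * `|Q1 - U1 t| <= (`|a| + `|b|) * (2 * B / 2 ^+ n).
        by apply: ler_pM => //; exact: HU1.
      have j2 : `|y| * `|Q2 - U2 t| <= (`|a| + `|b|) * (2 * B / 2 ^+ n).
        by apply: ler_pM => //; exact: HU2.
      by apply: le_trans (lerD j1 j2) _; rewrite -mulrDl [2 * (_ + _)]mulr_natl mulr2n.
    apply: (@le_trans _ _ (Kr * (`|lam| + 2 * (`|a| + `|b|)) * (2 * B / 2 ^+ n))); first by rewrite !mulrA.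
    apply: cD; first by apply: mulr_ge0; [exact: ltW|apply: addr_ge0 => //; apply: mulr_ge0].
    by move: Ki0; lean_lra.
have an : `|a| <= `|a| + `|b| by rewrite lerDl.
have bn : `|b| <= `|a| + `|b| by rewrite lerDr.
have nbn : `|- b| <= `|a| + `|b| by rewrite normrN.
have e1 n t : psum h1 n.+1 t = rho t * (g1 t + (a * psum v1 n t + - b * psum v2 n t)).
  elim: n => [|n IH]; first by rewrite psumS !psum0 /h1 /= /v1 /v2 /h1 /h2 /=; ring.
  by rewrite psumS IH !psumS {1}/h1 /= -/(h1 n.+1) -/(h2 n.+1) -/(v1 n.+1) -/(v2 n.+1); ring.
have e2 n t : psum h2 n.+1 t = rho t * (g2 t + (b * psum v1 n t + a * psum v2 n t)).
  elim: n => [|n IH]; first by rewrite psumS !psum0 /h2 /= /v1 /v2 /h1 /h2 /=; ring.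
  by rewrite psumS IH !psumS {1}/h2 /= -/(h1 n.+1) -/(h2 n.+1) -/(v1 n.+1) -/(v2 n.+1); ring.
exists U1, W1, U2, W2; split=> //.
  have := limit h1 U1 W1 g1 a (- b) (fun n => (i1 n).1) qU1 qW1 qg1 an nbn HU1 HW1 e1.
  by move/(rsol_ext iT); apply=> // t _; ring.
exact: limit h2 U2 W2 g2 b a (fun n => (i2 n).1) qU2 qW2 qg2 bn an HU2 HW2 e2.
Qed.

End perturbed_parameter.

(** * Spectral parameters near the eigenvalue *)

Section near_eigenvalue.
Context {R : realType}.
Variables (mu rho : R -> R) (lam : R).
Hypotheses (hmu : line_coefficient mu) (hrho : line_coefficient rho).
Variables u0 w0 : R -> R.
Hypotheses (s0 : rsol setT mu rho lam (fun=> 0) u0 w0).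
Hypotheses (q0 : sqint setT u0) (r0 : sqint setT w0).
Hypothesis unit0 : lint setT (fun t => rho t * u0 t * u0 t) = 1.
Hypothesis solve0 : exists2 C, 0 <= C & forall h, sqint setT h ->
  lint setT (fun t => h t * u0 t) = 0 -> exists u w,
  [/\ rsol setT mu rho lam h u w, sqint setT u, sqint setT w,
      lint setT (fun t => rho t * u t * u0 t) = 0 & nrm setT u <= C * nrm setT h].
Implicit Types (f g h u w : R -> R) (a b t x : R).

Let mT : measurable (setT : set R). Proof. exact: measurableT. Qed.
Let iT : is_interval (setT : set R). Proof. by []. Qed.

Let square_pos a b : (a, b) != (0, 0) -> 0 < a ^+ 2 + b ^+ 2.
Proof.
move=> ab; rewrite lt_neqAle addr_ge0 ?sqr_ge0// andbT eq_sym paddr_eq0 ?sqr_ge0//.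
by rewrite !sqrf_eq0; apply: contraNN ab => /andP[/eqP -> /eqP ->].
Qed.

(** The component along the ground state is corrected explicitly: there the
    operator acts as multiplication by [- (a + i b)]. *)
Lemma solve_near : exists2 r, 0 < r & forall a b g1 g2, `|a| + `|b| <= r ->
  (a, b) != (0, 0) -> sqint setT g1 -> sqint setT g2 -> exists u1 w1 u2 w2,
  [/\ rsol setT mu rho lam (fun t => rho t * (g1 t + (a * u1 t - b * u2 t))) u1 w1,
      rsol setT mu rho lam (fun t => rho t * (g2 t + (b * u1 t + a * u2 t))) u2 w2,
      sqint setT u1 /\ sqint setT u2 & sqint setT w1 /\ sqint setT w2].
Proof.
have [r rp Hr] := neumann hmu hrho q0 solve0.
exists r => // a b g1 g2 abr ab qg1 qg2.
have s2 := square_pos ab; have nz : a ^+ 2 + b ^+ 2 != 0 by rewrite gt_eqF.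
pose b1 := lint setT (fun t => rho t * g1 t * u0 t).
pose b2 := lint setT (fun t => rho t * g2 t * u0 t).
have red g : sqint setT g -> let c := lint setT (fun t => rho t * g t * u0 t) in
    sqint setT (fun t => 1 * g t + - c * u0 t) /\
    lint setT (fun t => rho t * (1 * g t + - c * u0 t) * u0 t) = 0.
  by move=> qg c; split; [exact: sqint_comb|rewrite pair_comb// unit0 -/c; ring].
have [p1 o1] := red _ qg1; have [p2 o2] := red _ qg2.
have [u1 [w1 [u2 [w2 [t1 t2 [x1 x2] [y1 y2]]]]]] := Hr a b _ _ abr p1 p2 o1 o2.
pose c1 := (b1 * a + b2 * b) / (a ^+ 2 + b ^+ 2).
pose c2 := (b2 * a - b1 * b) / (a ^+ 2 + b ^+ 2).
have e1 : b1 = a * c1 - b * c2 by rewrite /c1 /c2; field.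
have e2 : b2 = b * c1 + a * c2 by rewrite /c1 /c2; field.
exists (fun t => 1 * u1 t + - c1 * u0 t), (fun t => 1 * w1 t + - c1 * w0 t).
exists (fun t => 1 * u2 t + - c2 * u0 t), (fun t => 1 * w2 t + - c2 * w0 t).
split; [| |by split; exact: sqint_comb|by split; exact: sqint_comb].
  have := rsol_lin 1 (- c1) iT t1 s0; move/(rsol_ext iT); apply=> // t _.
  by rewrite -/b1 e1; ring.
have := rsol_lin 1 (- c2) iT t2 s0; move/(rsol_ext iT); apply=> // t _.
by rewrite -/b2 e2; ring.
Qed.

(* Facts irrelevant to an inequality slow down linear arithmetic; those of the
   section have to stay. *)
Ltac lean_lra := clear - mu rho lam hmu hrho u0 w0 s0 q0 r0 unit0 solve0 mT iT square_pos; lra.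

(** Orthogonally to the ground state the bounded inverse absorbs the small
    change of the spectral parameter; along it, the symmetry of the operator
    determines the component of the solution by that of the source. *)
Lemma bounded_near : exists2 r, 0 < r & forall a b, `|a| + `|b| <= r ->
  (a, b) != (0, 0) -> exists2 M, 0 <= M & forall g1 g2 u1 w1 u2 w2,
  rsol setT mu rho lam (fun t => rho t * (g1 t + (a * u1 t + - b * u2 t))) u1 w1 ->
  rsol setT mu rho lam (fun t => rho t * (g2 t + (b * u1 t + a * u2 t))) u2 w2 ->
  sqint setT g1 -> sqint setT g2 -> sqint setT u1 -> sqint setT u2 ->
  sqint setT w1 -> sqint setT w2 ->
  nrm setT u1 + nrm setT u2 <= M * (nrm setT g1 + nrm setT g2).
Proof.
have [C C0 HC] := solve0; have [Kr Kr0 HKr] := coef_le hrho.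
exists (2 * (C * Kr + 1))^-1.
  by rewrite invr_gt0 mulr_gt0// ltr_wpDl// mulr_ge0// ltW.
move=> a b abr ab.
have abC : C * (Kr * (`|a| + `|b|)) <= 1 / 2.
  have CK : 0 < C * Kr + 1 by rewrite ltr_wpDl// mulr_ge0// ltW.
  apply: (@le_trans _ _ (C * (Kr * (2 * (C * Kr + 1))^-1))).
    by apply: ler_wpM2l => //; apply: ler_wpM2l => //; exact: ltW.
  rewrite (_ : C * (Kr * (2 * (C * Kr + 1))^-1) = (C * Kr) / (C * Kr + 1) / 2).
    by rewrite ler_pM2r// ler_pdivrMr// mul1r lerDl.
  by field; rewrite gt_eqF.
have s2 := square_pos ab; have nz : a ^+ 2 + b ^+ 2 != 0 by rewrite gt_eqF.
pose n0 := nrm setT u0; have n00 : 0 <= n0 by exact: nrm_ge0.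
pose k := nrm setT (fun t => rho t * u0 t); have k0 : 0 <= k by exact: nrm_ge0.
pose m := (`|a| + `|b|) / (a ^+ 2 + b ^+ 2).
have m0 : 0 <= m by apply: divr_ge0; [exact: addr_ge0|exact: ltW].
exists (2 * (C * Kr + m * k * n0)).
  by apply: mulr_ge0 => //; apply: addr_ge0; [apply: mulr_ge0 => //; exact: ltW|apply: mulr_ge0 => //; exact: mulr_ge0].
move=> g1 g2 u1 w1 u2 w2 t1 t2 qg1 qg2 qu1 qu2 qw1 qw2.
have split_ground h u w : rsol setT mu rho lam h u w -> sqint setT h -> sqint setT u ->
    sqint setT w -> nrm setT u <= C * nrm setT h + `|lint setT (fun t => rho t * u t * u0 t)| * n0.
  move=> s qh qu qw; have oh := solvable_orthogonal s0 q0 r0 s qu qw qh.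
  have [v [y [sv qv qy ov nv]]] := HC h qh oh.
  have sd := rsol_lin 1 (- 1) iT s sv.
  rewrite (_ : (fun t => 1 * h t + _) = fun=> 0) in sd; last by apply/funext => t; ring.
  have [c Hc] := kernel_line hmu hrho s0 q0 r0 unit0 sd (sqint_comb 1 (-1) qu qv) (sqint_comb 1 (-1) qw qy).
  have eu t : u t = 1 * v t + c * u0 t by have [h1 _] := Hc t; lra.
  have -> : lint setT (fun t => rho t * u t * u0 t) = c.
    rewrite (@int_eq _ _ _ (fun t => rho t * (1 * v t + c * u0 t) * u0 t)); last by move=> t _; rewrite eu.
    by rewrite pair_comb// ov unit0; ring.
  rewrite (nrm_eq (fun t _ => eu t)).
  apply: le_trans (nrm_comb _ _ qv q0) _; rewrite normr1 mul1r.
  by apply: lerD.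
have qs (g f : R -> R) : sqint setT g -> sqint setT f -> sqint setT (fun t => rho t * (g t + f t)).
  by move=> *; apply: weight_sqint => //; exact: sqint_add.
have q1 := qs _ _ qg1 (sqint_comb a (- b) qu1 qu2).
have q2 := qs _ _ qg2 (sqint_comb b a qu1 qu2).
have z1 := split_ground _ _ _ t1 q1 qu1 qw1; have z2 := split_ground _ _ _ t2 q2 qu2 qw2.
(* tested with the ground state, the two equations become a linear system
   that expresses the components of [u1], [u2] by those of [g1], [g2] *)
pose a1 := lint setT (fun t => rho t * u1 t * u0 t).
pose a2 := lint setT (fun t => rho t * u2 t * u0 t).
pose b1 := lint setT (fun t => rho t * g1 t * u0 t).
pose b2 := lint setT (fun t => rho t * g2 t * u0 t).
have eq g (x y : R) : sqint setT g ->
    lint setT (fun t => rho t * (g t + (x * u1 t + y * u2 t)) * u0 t) =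
    lint setT (fun t => rho t * g t * u0 t) + (x * a1 + y * a2).
  move=> qg; have qc := sqint_comb x y qu1 qu2.
  rewrite -(pair_comb hrho q0 x y qu1 qu2) -[X in X + _]mul1r -[X in _ + X]mul1r -(pair_comb hrho q0 1 1 qg qc).
  by apply: int_eq => t _; ring.
have f1 := solvable_orthogonal s0 q0 r0 t1 qu1 qw1 q1; rewrite eq// -/b1 in f1.
have f2 := solvable_orthogonal s0 q0 r0 t2 qu2 qw2 q2; rewrite eq// -/b2 in f2.
have d1 : a1 = - (a * b1 + b * b2) / (a ^+ 2 + b ^+ 2).
  have -> : b1 = - (a * a1 - b * a2) by lra.
  have -> : b2 = - (b * a1 + a * a2) by lra.
  by field.
have d2 : a2 = (b * b1 - a * b2) / (a ^+ 2 + b ^+ 2).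
  have -> : b1 = - (a * a1 - b * a2) by lra.
  have -> : b2 = - (b * a1 + a * a2) by lra.
  by field.
have bb g : sqint setT g -> `|lint setT (fun t => rho t * g t * u0 t)| <= k * nrm setT g.
  move=> qg; have := cauchy_schwarz_nrm mT (weight_sqint hrho q0) qg; rewrite -/k.
  by congr (`|_| <= _); apply: int_eq => t _; ring.
have B1 : `|b1| <= k * nrm setT g1 by exact: bb.
have B2 : `|b2| <= k * nrm setT g2 by exact: bb.
have A12 : `|a1| + `|a2| <= m * (`|b1| + `|b2|).
  rewrite d1 d2 !normrM normrN normfV (gtr0_norm s2) -mulrDl /m mulrAC ler_pM2r ?invr_gt0//.
  apply: le_trans (lerD (ler_normD _ _) (ler_normB _ _)) _; rewrite !normrM; lean_lra.
have A12' : `|a1| + `|a2| <= m * k * (nrm setT g1 + nrm setT g2).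
  apply: le_trans A12 _; rewrite -mulrA ler_wpM2l// mulrDr.
  exact: lerD.
have nh g (x y : R) : sqint setT g -> nrm setT (fun t => rho t * (g t + (x * u1 t + y * u2 t))) <=
    Kr * (nrm setT g + (`|x| * nrm setT u1 + `|y| * nrm setT u2)).
  move=> qg; have qc := sqint_comb x y qu1 qu2.
  apply: le_trans (nrmM mT (coef_meas hrho mT) HKr (sqint_add mT qg qc)) _.
  apply: ler_wpM2l; first exact: ltW.
  by apply: le_trans (nrmD mT qg qc) _; rewrite lerD2l; exact: nrm_comb.
have N1 := nh _ a (- b) qg1; have N2 := nh _ b a qg2; rewrite normrN in N1.
set U1 := nrm setT u1 in z1 N1 N2 *; set U2 := nrm setT u2 in z2 N1 N2 *.
set G1 := nrm setT g1 in A12' N1 *; set G2 := nrm setT g2 in A12' N2 *.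
have U0 : 0 <= U1 + U2 by apply: addr_ge0; exact: nrm_ge0.
have N12 := ler_wpM2l C0 (lerD N1 N2).
have key : U1 + U2 <= C * Kr * (G1 + G2) + C * (Kr * (`|a| + `|b|)) * (U1 + U2) + m * k * n0 * (G1 + G2).
  apply: le_trans (lerD z1 z2) _; rewrite -/a1 -/a2.
  have y1 := ler_wpM2r n00 A12'; move: N12 y1; lean_lra.
have := ler_wpM2r U0 abC; move: key; lean_lra.
Qed.

End near_eigenvalue.

(** * Isolation of the eigenvalue *)

Lemma prim_ae_line {R : realType} (F f g : R -> R) : measurable_fun setT g ->
  ae_eq leb setT f g -> prim setT F f -> prim setT F g.
Proof.
move=> mg fg; have iT : is_interval (setT : set R) by [].
have := @prim_ae _ setT F f g openT iT; rewrite closureT; apply=> // x y _ _.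
exact: measurable_funS mg.
Qed.

Lemma re_sub_scale {R : realType} (c : R[i]) (f g : R -> R[i]) t :
  re (fun x => f x - c * g x) t = re f t - (complex.Re c * re g t - complex.Im c * im g t).
Proof. by rewrite /re /im cReD cReN cReM. Qed.

Lemma im_sub_scale {R : realType} (c : R[i]) (f g : R -> R[i]) t :
  im (fun x => f x - c * g x) t = im f t - (complex.Re c * im g t + complex.Im c * re g t).
Proof. by rewrite /re /im cImD cImN cImM. Qed.

Lemma L2_sub_scale {R : realType} (c : R[i]) (f g : R -> R[i]) : L2 setT f -> L2 setT g ->
  L2 setT (fun t => f t - c * g t).
Proof.
have mT : measurable (setT : set R) by exact: measurableT.
move=> /(L2_parts _ mT)[f1 f2] /(L2_parts _ mT)[g1 g2]; apply/(L2_parts _ mT); split.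
  rewrite (_ : re _ = fun t => re f t + (- complex.Re c * re g t + complex.Im c * im g t)).
    by apply: sqint_add => //; exact: sqint_comb.
  by apply/funext => t; rewrite /re cReD cReN cReM /im; ring.
rewrite (_ : im _ = fun t => im f t + (- complex.Re c * im g t + - complex.Im c * re g t)).
  by apply: sqint_add => //; exact: sqint_comb.
by apply/funext => t; rewrite /im cImD cImN cImM /re; ring.
Qed.

Lemma wL2norm_ae {R : realType} (rho : R -> R) (f g : R -> R[i]) :
  line_coefficient rho -> L2 setT f -> L2 setT g -> ae_eq leb setT f g ->
  wL2norm rho setT f = wL2norm rho setT g.
Proof.
move=> hrho Lf Lg fg; congr Num.sqrt; rewrite /Rintegral; congr fine.
have m (k : R -> R[i]) : L2 setT k -> measurable_fun setT (fun x => (rho x * normc (k x) ^+ 2)%:E).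
  move=> [[m1 m2] _]; apply/measurable_EFinP; apply: measurable_funM; first exact: coef_meas.
  by under eq_fun do rewrite normc2; apply: measurable_funD; apply: measurable_funX.
apply: ae_eq_integral; [exact: measurableT|exact: m|exact: m|].
by apply: ae_imp fg => t H I0; rewrite H.
Qed.

Section domain.
Context {R : realType}.
Variables (mu rho : R -> R).
Hypotheses (hmu : line_coefficient mu) (hrho : line_coefficient rho).
Implicit Types (u w f g k : R -> R[i]) (x t : R).

Let mT : measurable (setT : set R). Proof. exact: measurableT. Qed.
Let iT : is_interval (setT : set R). Proof. by []. Qed.
Let oT : open (setT : set R). Proof. exact: openT. Qed.
Let T0 : exists x, (setT : set R) x. Proof. by exists 0. Qed.

(** For a function of the domain, [op] plays the role of a prescribed right-hand
    side, measured from the real number [lam]. *)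
Lemma dom_op_pair (lam : R) u : dom_op mu u ->
  [/\ L2 setT u, L2 setT (flux setT mu u), L2 setT (op mu rho u) &
   ksol setT mu rho lam (fun t => (rho t)%:C * (op mu rho u t - lam%:C * u t)) u (flux setT mu u)].
Proof.
move=> [Hu [w Hw ew]].
have fw : flux setT mu u = w.
  apply/funext => x; case: (Hw) => _ [cr ci] _.
  by apply: (flux_unique oT cr ci ew); rewrite closureT.
have [Lu _ _] := Hu; have [Lw _ _] := Hw.
have [Ldu p1 p2] := H1_prim oT iT T0 Hu; have [Ldw r1 r2] := H1_prim oT iT T0 Hw.
rewrite closureT in p1 p2 r1 r2.
have [Kr Kr0 HKr] := coef_inv_le hrho.
have [d1 d2] := (L2_parts _ mT).1 Ldw; have [w1 w2] := (L2_parts _ mT).1 Lw.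
have opE : op mu rho u = (fun t => - ((rho t)^-1)%:C * wderiv setT w t).
  by rewrite /op fw.
rewrite fw; split; [exact: Lu|exact: Lw| |].
  rewrite opE; apply/(L2_parts _ mT); split.
    rewrite (_ : re _ = fun t => (rho t)^-1 * - re (wderiv setT w) t).
      by apply: sqint_mul (coef_inv_meas hrho mT) HKr _; [exact: mT|exact: sqint_opp].
    by apply/funext => t; rewrite /re mulNr cReN cReMl mulrN.
  rewrite (_ : im _ = fun t => (rho t)^-1 * - im (wderiv setT w) t).
    by apply: sqint_mul (coef_inv_meas hrho mT) HKr _; [exact: mT|exact: sqint_opp].
  by apply/funext => t; rewrite /im mulNr cImN cImMl mulrN.
have minv (s : R -> R) : sqint setT s -> measurable_fun setT (fun t => (mu t)^-1 * s t).
  by move=> [ms _]; apply: measurable_funM => //; exact: coef_inv_meas.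
have er : ae_eq leb setT (re (wderiv setT u)) (fun t => (mu t)^-1 * re w t).
  apply: ae_imp ew => t H I0; rewrite /re H// cReMl mulKf//.
  by rewrite gt_eqF// coef_gt0.
have ei : ae_eq leb setT (im (wderiv setT u)) (fun t => (mu t)^-1 * im w t).
  apply: ae_imp ew => t H I0; rewrite /im H// cImMl mulKf//.
  by rewrite gt_eqF// coef_gt0.
have rn t : rho t != 0 by rewrite gt_eqF// coef_gt0.
split; split.
- exact: prim_ae_line (minv _ w1) er p1.
- apply: (prim_ext iT r1) => // t _.
  by rewrite /re opE cReMl cReD cReN mulNr cReN !cReMl; field.
- exact: prim_ae_line (minv _ w2) ei p2.
- apply: (prim_ext iT r2) => // t _.
  by rewrite /im opE cImMl cImD cImN mulNr cImN !cImMl; field.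
Qed.

Lemma pair_dom_op u w k : L2 setT u -> L2 setT w -> L2 setT k ->
  prim setT (re u) (fun t => (mu t)^-1 * re w t) ->
  prim setT (im u) (fun t => (mu t)^-1 * im w t) ->
  prim setT (re w) (re k) -> prim setT (im w) (im k) ->
  dom_op mu u /\ ae_eq leb setT (op mu rho u) (fun t => - ((rho t)^-1)%:C * k t).
Proof.
move=> Lu Lw Lk p1 p2 r1 r2.
have [Ki Ki0 HKi] := coef_inv_le hmu.
have [w1 w2] := (L2_parts _ mT).1 Lw.
pose v t := ((mu t)^-1)%:C * w t.
have v1 : re v = fun t => (mu t)^-1 * re w t by apply/funext => t; rewrite /re /v cReMl.
have v2 : im v = fun t => (mu t)^-1 * im w t by apply/funext => t; rewrite /im /v cImMl.
have Lv : L2 setT v.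
  by apply/(L2_parts _ mT); rewrite v1 v2; split; apply: sqint_mul (coef_inv_meas hmu mT) HKi _.
have [Hu du] : H1 setT u /\ ae_eq leb setT (wderiv setT u) v.
  by apply: prim_H1 => //; rewrite closureT ?v1 ?v2.
have [Hw dw] : H1 setT w /\ ae_eq leb setT (wderiv setT w) k.
  by apply: prim_H1 => //; rewrite closureT.
have ew : ae_eq leb setT w (fun x => (mu x)%:C * wderiv setT u x).
  apply: ae_imp du => t H I0; rewrite H// /v mulrA -rmorphM mulfV ?mul1r//.
  by rewrite gt_eqF// coef_gt0.
split; first by split=> //; exists w.
have fw : flux setT mu u = w.
  apply/funext => x; case: (Hw) => _ [cr ci] _.
  by apply: (flux_unique oT cr ci ew); rewrite closureT.
by apply: ae_imp dw => t H I0; rewrite /op fw H.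
Qed.

Let weight_int f : L2 setT f ->
  [/\ intg (setT : set R) (fun t => rho t * normc (f t) ^+ 2),
      intg (setT : set R) (fun t => normc (f t) ^+ 2) &
      lint setT (fun t => normc (f t) ^+ 2) = nrm setT (re f) ^+ 2 + nrm setT (im f) ^+ 2].
Proof.
move=> /(L2_parts _ mT)[f1 f2].
have E : (fun t => normc (f t) ^+ 2) = fun t => re f t ^+ 2 + im f t ^+ 2.
  by apply/funext => t; rewrite normc2.
rewrite E; have i : intg (setT : set R) (fun t => re f t ^+ 2 + im f t ^+ 2).
  by apply: intg_add => //; [exact: f1.2|exact: f2.2].
split=> //; last by rewrite int_add// ?nrm_sqr//; [exact: f1.2|exact: f2.2].
have [Kr Kr0 HKr] := coef_le hrho.
rewrite (_ : (fun t => rho t * _) = (fun t => rho t * (re f t ^+ 2 + im f t ^+ 2))).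
  by apply: intg_mul i => //; exact: coef_meas.
by apply/funext => t; rewrite normc2.
Qed.

Lemma weighted_norm_le : exists2 K, 0 <= K & forall f, L2 setT f ->
  wL2norm rho setT f <= K * (nrm setT (re f) + nrm setT (im f)).
Proof.
have [Kr Kr0 HKr] := coef_le hrho.
exists (Num.sqrt Kr) => [|f Lf]; first exact: sqrtr_ge0.
have [i1 i2 e] := weight_int Lf.
rewrite /wL2norm -/(lint _ _).
have p0 := nrm_ge0 setT (re f); have q0 := nrm_ge0 setT (im f).
rewrite -[leRHS]ger0_norm ?mulr_ge0 ?sqrtr_ge0 ?addr_ge0// -sqrtr_sqr; apply: ler_wsqrtr.
rewrite exprMn sqr_sqrtr ?(ltW Kr0)//.
apply: (@le_trans _ _ (Kr * (nrm setT (re f) ^+ 2 + nrm setT (im f) ^+ 2))).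
  rewrite -e -int_scale//; apply: int_le => //; first exact: intg_scale.
  by move=> t _; rewrite ler_wpM2r ?sqr_ge0//; apply: le_trans (HKr t); exact: ler_norm.
rewrite ler_pM2l//; have := mulr_ge0 p0 q0; lra.
Qed.

Lemma le_weighted_norm : exists2 K, 0 <= K & forall f, L2 setT f ->
  nrm setT (re f) + nrm setT (im f) <= K * wL2norm rho setT f.
Proof.
have [mr [c [d [c0 cd]]]] := hrho.
exists (2 * Num.sqrt c^-1) => [|f Lf]; first by rewrite mulr_ge0 ?sqrtr_ge0.
have [i1 i2 e] := weight_int Lf.
have X : nrm setT (re f) ^+ 2 + nrm setT (im f) ^+ 2 <= c^-1 * lint setT (fun t => rho t * normc (f t) ^+ 2).
  rewrite -e -int_scale//; apply: int_le => //; first exact: intg_scale.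
  move=> t _; rewrite mulrA -[leLHS]mul1r ler_wpM2r ?sqr_ge0//.
  by rewrite mulrC ler_pdivlMr// mul1r; have /andP[] := cd t.
have sq (x : R) : 0 <= x -> x ^+ 2 <= c^-1 * lint setT (fun t => rho t * normc (f t) ^+ 2) ->
    x <= Num.sqrt c^-1 * wL2norm rho setT f.
  move=> x0 h; rewrite /wL2norm -/(lint _ _) -sqrtrM ?invr_ge0 ?(ltW c0)//.
  by rewrite -[leLHS]ger0_norm// -sqrtr_sqr; exact: ler_wsqrtr.
have n1 := nrm_ge0 setT (re f); have n2 := nrm_ge0 setT (im f).
have h1 : nrm setT (re f) <= Num.sqrt c^-1 * wL2norm rho setT f.
  by apply: sq => //; apply: le_trans X; rewrite lerDl sqr_ge0.
have h2 : nrm setT (im f) <= Num.sqrt c^-1 * wL2norm rho setT f.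
  by apply: sq => //; apply: le_trans X; rewrite lerDr sqr_ge0.
lra.
Qed.

End domain.

Lemma weight_pos {R : realType} (rho v f : R -> R) x : line_coefficient rho ->
  prim setT v f -> sqint setT v -> v x != 0 -> 0 < lint setT (fun t => rho t * v t * v t).
Proof.
move=> hrho pv qv vx; have mT : measurable (setT : set R) by exact: measurableT.
have [mr [c [d [c0 cd]]]] := hrho.
have e0 : 0 < `|v x| / 2 by rewrite divr_gt0// normr_gt0.
have [r r0 Hr] := prim_near (x := x) pv I e0.
have Hb t : x <= t <= x + r / 2 -> `|v x| / 2 <= `|v t|.
  move=> /andP[t1 t2]; have := Hr t I.
  rewrite ger0_norm ?subr_ge0// => near_x; have {near_x} := near_x (_ : t - x < r).
  move=> /(_ ltac:(lra)).
  have := ler_normB (v t) (v t - v x); rewrite opprB addrC subrK; lra.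
have iJ : intg `[x, x + r / 2] (fun=> c * (`|v x| / 2) ^+ 2) by exact: intg_cst.
have xr : x <= x + r / 2 by lra.
have iv : intg (setT : set R) (fun t => rho t * v t * v t).
  by have := sqint_prod mT (rho_sqint hrho 1 mT qv) qv; congr (intg _ _); apply/funext => t /=; rewrite mulr1.
have vv t : 0 <= rho t * v t * v t.
  by rewrite -mulrA mulr_ge0 -?expr2 ?sqr_ge0// ltW// coef_gt0.
apply: (@lt_le_trans _ _ (lint `[x, x + r / 2] (fun=> c * (`|v x| / 2) ^+ 2))).
  rewrite int_cst// mulr_gt0//; last by lra.
  by rewrite mulr_gt0// exprn_gt0.
have sub : (`[x, x + r / 2]%classic : set R) `<=` setT by [].
have mJ : measurable (`[x, x + r / 2]%classic : set R) by exact: measurable_itv.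
apply: le_trans (lint_subset mT mJ sub iv vv).
apply: int_le => //; first exact: (intg_sub mT mJ sub iv).
move=> t /itv_ccP/Hb h; rewrite -mulrA -expr2 ler_pM ?(ltW c0) ?sqr_ge0//; first by have /andP[] := cd t.
by rewrite -(real_normK (num_real (v t))) ler_pXn2r ?nnegrE// ltW.
Qed.

Section discrete.
Context {R : realType}.
Variables (mu rho mu0 rho0 : R -> R) (lam al ar : R).
Hypotheses (hmu : line_coefficient mu) (hrho : line_coefficient rho).
Hypotheses (hmu0 : line_coefficient mu0) (hrho0 : line_coefficient rho0).
Hypothesis halr : al <= ar.
Hypotheses (emu : forall t, ~ (al < t < ar) -> mu t = mu0 t).
Hypotheses (erho : forall t, ~ (al < t < ar) -> rho t = rho0 t).

Let mT : measurable (setT : set R). Proof. exact: measurableT. Qed.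
Let iT : is_interval (setT : set R). Proof. by []. Qed.

(** The real form of the resolvent, for sources given without the weight. *)
Lemma resolvent_line : resolvent_set mu0 rho0 lam%:C ->
  exists2 K : R, 0 <= K & forall h, sqint setT h ->
  exists v k, [/\ rsol setT mu0 rho0 lam h v k, sqint setT v, sqint setT k &
    nrm setT v <= K * nrm setT h].
Proof.
move=> [onto [M bound]].
have [K1 K10 H1] := weighted_norm_le hrho0; have [K2 K20 H2] := le_weighted_norm hrho0.
have [Ki Ki0 HKi] := coef_inv_le hrho0.
exists (K2 * (`|M| * (K1 * Ki))) => [|h qh].
  by rewrite !mulr_ge0// ltW.
pose g t : R[i] := ((rho0 t)^-1 * h t)%:C.
have qg : sqint setT (fun t => (rho0 t)^-1 * h t).
  exact: sqint_mul mT (coef_inv_meas hrho0 mT) HKi qh.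
have q0 : sqint setT (fun=> 0 : R).
  split; first exact: measurable_cst.
  by rewrite (_ : (fun=> _) = (fun=> 0)) ?intg0//; apply/funext => t; rewrite expr0n.
have Lg : L2 setT g by apply/(L2_parts _ mT).
have [u du eu] := onto g Lg.
have [Lu Lw Lo [s1 s2]] := dom_op_pair hmu0 hrho0 lam du.
have [u1 u2] := (L2_parts _ mT).1 Lu; have [w1 w2] := (L2_parts _ mT).1 Lw.
exists (re u), (re (flux setT mu0 u)); split=> //.
  split; first exact: s1.1.
  apply: prim_ae_line s1.2.
    by have := sqint_opp mT (source_meas lam hrho0 mT u1 qh) => -[m _].
  apply: ae_imp eu => t H I0; rewrite /re cReMl H// /g /=; field.
  by rewrite gt_eqF// coef_gt0.
have Ld := L2_sub_scale lam%:C Lo Lu.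
have nd : wL2norm rho0 setT (fun t => op mu0 rho0 u t - lam%:C * u t) <= K1 * (Ki * nrm setT h).
  have -> : wL2norm rho0 setT (fun t => op mu0 rho0 u t - lam%:C * u t) = wL2norm rho0 setT g.
    exact: wL2norm_ae.
  apply: le_trans (H1 _ Lg) _; rewrite ler_wpM2l//.
  have -> : nrm setT (im g) = 0.
    by rewrite /nrm int_zero ?sqrtr0// => t _; rewrite expr0n.
  by rewrite addr0; exact: nrmM (coef_inv_meas hrho0 mT) HKi qh.
have M0 : wL2norm rho0 setT u <= `|M| * (K1 * (Ki * nrm setT h)).
  apply: le_trans (bound _ du) _; apply: (@le_trans _ _ (`|M| * wL2norm rho0 setT (fun t => op mu0 rho0 u t - lam%:C * u t))).
    by rewrite ler_wpM2r ?sqrtr_ge0// ler_norm.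
  by rewrite ler_wpM2l.
have := ler_wpM2l K20 M0; have := H2 _ Lu; have := nrm_ge0 setT (im u).
lra.
Qed.

(** Real and imaginary parts of an eigenfunction are eigenfunctions, one of
    which is normalized and taken as the ground state: the eigenspace is spanned
    by it, and nearby parameters are in the resolvent set. *)
Lemma eigen_discrete (u w : R -> R[i]) : resolvent_set mu0 rho0 lam%:C ->
  ksol setT mu rho lam (fun=> 0) u w -> L2 setT u -> L2 setT w ->
  (exists x, u x != 0) -> discrete_spectrum mu rho lam%:C.
Proof.
move=> res [su1 su2] /(L2_parts _ mT)[u1 u2] /(L2_parts _ mT)[w1 w2] [x ux].
have [u0 [w0 [s0 q0 r0 unit0]]] : exists u0 w0, [/\ rsol setT mu rho lam (fun=> 0) u0 w0,
    sqint setT u0, sqint setT w0 & lint setT (fun t => rho t * u0 t * u0 t) = 1].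
  have nrmlz v k : rsol setT mu rho lam (fun=> 0) v k -> sqint setT v -> sqint setT k ->
      v x != 0 -> exists u0 w0, [/\ rsol setT mu rho lam (fun=> 0) u0 w0,
    sqint setT u0, sqint setT w0 & lint setT (fun t => rho t * u0 t * u0 t) = 1].
    move=> s qv qk vx; have I0 := weight_pos hrho s.1 qv vx; set I := lint _ _ in I0.
    exists (fun t => (Num.sqrt I)^-1 * v t), (fun t => (Num.sqrt I)^-1 * k t).
    split; [|exact: sqint_scale|exact: sqint_scale|].
      have := rsol_lin (Num.sqrt I)^-1 0 iT s s; move/(rsol_ext iT); apply=> t _; ring.
    rewrite (@int_eq _ _ _ (fun t => (Num.sqrt I)^-1 ^+ 2 * (rho t * v t * v t))); last by move=> t _; ring.
    rewrite int_scale//; last exact: sqint_prod mT (weight_sqint hrho qv) qv.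
    by rewrite exprVn sqr_sqrtr ?(ltW I0)// mulVf// gt_eqF.
  have [ru|ru] := eqVneq (re u x) 0; last exact: nrmlz su1 u1 w1 ru.
  apply: nrmlz su2 u2 w2 _; apply: contraNN ux => /eqP iu.
  by apply/eqP/eq_parts; [exact: ru|exact: iu].
have solve0 := orthogonal_solve hmu hrho hmu0 hrho0 halr emu erho (resolvent_line res) s0 q0 r0 unit0.
have z0 : sqint setT (fun=> 0 : R).
  split; first exact: measurable_cst.
  by rewrite (_ : (fun=> _) = (fun=> 0)) ?intg0//; apply/funext => t; rewrite expr0n.
have p0 : prim setT (fun=> 0 : R) (fun=> 0) by exact: prim_cst.
have rn t : rho t != 0 by rewrite gt_eqF// coef_gt0.
pose U0 t : R[i] := (u0 t)%:C.
have LU0 : L2 setT U0 by apply/(L2_parts _ mT).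
have [K2 K20 H2] := le_weighted_norm hrho; have [K1 K10 H1] := weighted_norm_le hrho.
have eU0 : Defs.eigenspace mu rho lam%:C U0.
  have [d e] : dom_op mu U0 /\ ae_eq leb setT (op mu rho U0) (fun t => - ((rho t)^-1)%:C * (- (rho t * lam * u0 t))%:C).
    apply: (@pair_dom_op _ _ rho hmu U0 (fun t => (w0 t)%:C) (fun t => (- (rho t * lam * u0 t))%:C)).
    - exact: LU0.
    - by apply/(L2_parts _ mT).
    - by apply/(L2_parts _ mT); split=> //; apply: sqint_opp => //; exact: rho_sqint.
    - exact: s0.1.
    - by apply: (prim_ext iT p0) => // t _; rewrite /im /= mulr0.
    - by apply: (prim_ext iT s0.2) => // t _; rewrite /re /= addr0.
    - exact: p0.
  split=> //; apply: ae_imp e => t H I0; rewrite H// -rmorphN -!rmorphM; congr (_%:C).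
  by field.
have nU0 : 0 < nrm setT u0.
  rewrite lt_neqAle nrm_ge0 andbT eq_sym; apply/eqP => n0.
  have := cauchy_schwarz_nrm mT (weight_sqint hrho q0) q0.
  by rewrite unit0 n0 mulr0 normr1 ler10.
split.
- move=> [_ [M HM]]; have := HM _ eU0.1.
  have [_ _ Lo _] := dom_op_pair hmu hrho lam eU0.1.
  have L0 : L2 setT (fun=> 0 : R[i]) by apply/(L2_parts _ mT).
  rewrite (wL2norm_ae hrho (L2_sub_scale lam%:C Lo LU0) L0); last first.
    by apply: ae_imp eU0.2 => t H I0; rewrite H// subrr.
  rewrite /wL2norm -[X in M * Num.sqrt X]/(lint _ _) int_zero ?sqrtr0 ?mulr0; last first.
    by move=> t _; rewrite normc2 /= expr0n /= addr0 mulr0.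
  rewrite -/(wL2norm _ _ _) => h; have := le_trans (H2 _ LU0) (ler_wpM2l K20 h).
  have : 0 <= nrm setT (im U0) by exact: nrm_ge0.
  rewrite mulr0 (_ : re U0 = u0)//; lra.
- have [r1 r1p S1] := solve_near hmu hrho s0 q0 r0 unit0 solve0.
  have [r2 r2p S2] := bounded_near hmu hrho s0 q0 r0 unit0 solve0.
  exists (Num.min r1 r2 / 2); first by rewrite divr_gt0// lt_min r1p.
  move=> lam' sp near; apply: contrapT => ne; apply: sp.
  pose a := complex.Re lam' - lam; pose b := complex.Im lam'.
  have ab : (a, b) != (0, 0).
    apply/eqP => -[/eqP]; rewrite subr_eq0 => /eqP a0 b0; apply: ne.
    by apply: eq_parts.
  have nab : `|a| + `|b| <= Num.min r1 r2.
    have -> : `|a| + `|b| = n1 (lam' - lam%:C) by rewrite /n1 cReD cImD cReN cImN /= subr0.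
    by apply: le_trans (n1_normc _) _; rewrite mulrC -ler_pdivlMr//; exact: ltW.
  have [nab1 nab2] : `|a| + `|b| <= r1 /\ `|a| + `|b| <= r2.
    by split; apply: le_trans nab _; rewrite ge_min lexx ?orbT.
  split.
  + move=> g Lg; have [g1 g2] := (L2_parts _ mT).1 Lg.
    have [v1 [k1 [v2 [k2 [t1 t2 [q1 q2] [y1 y2]]]]]] := S1 a b _ _ nab1 ab g1 g2.
    pose v t : R[i] := v1 t +i* v2 t; pose k t : R[i] := k1 t +i* k2 t.
    pose d t : R[i] := - (rho t)%:C * (lam' * v t + g t).
    have Lv : L2 setT v by apply/(L2_parts _ mT).
    have Ld : L2 setT d.
      have /(L2_parts _ mT)[x1 x2] := L2_sub_scale (- lam') Lg Lv.
      apply/(L2_parts _ mT); split.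
        rewrite (_ : re d = fun t => rho t * (- 1) * re (fun t => g t - - lam' * v t) t); first exact: rho_sqint.
        by apply/funext => t; rewrite /re /d mulNr cReN cReMl mulNr opprK [g t + _]addrC; ring.
      rewrite (_ : im d = fun t => rho t * (- 1) * im (fun t => g t - - lam' * v t) t); first exact: rho_sqint.
      by apply/funext => t; rewrite /im /d mulNr cImN cImMl mulNr opprK [g t + _]addrC; ring.
    have [dv ev] : dom_op mu v /\ ae_eq leb setT (op mu rho v) (fun t => - ((rho t)^-1)%:C * d t).
      apply: (@pair_dom_op _ _ rho hmu v k d) => //.
      - by apply/(L2_parts _ mT).
      - exact: t1.1.
      - exact: t2.1.
      - apply: (prim_ext iT t1.2) => // t _.
        by rewrite /re /d mulNr cReN cReMl cReD cReM /= /a /b /re; ring.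
      - apply: (prim_ext iT t2.2) => // t _.
        by rewrite /im /d mulNr cImN cImMl cImD cImM /= /a /b /im; ring.
    exists v => //; apply: ae_imp ev => t H I0; rewrite H// /d mulNr mulNr mulrN opprK mulrA.
    by rewrite -rmorphM mulVf// mul1r addrC addKr.
  + have [M M0 HM] := S2 a b nab2 ab; exists (K1 * (M * K2)) => v dv.
    have [Lv Lk Lo [t1 t2]] := dom_op_pair hmu hrho lam dv.
    have Lg := L2_sub_scale lam' Lo Lv.
    set g := (fun x => op mu rho v x - _) in Lg *.
    have gr t : re g t = re (op mu rho v) t - (complex.Re lam' * re v t - complex.Im lam' * im v t).
      exact: re_sub_scale.
    have gi t : im g t = im (op mu rho v) t - (complex.Re lam' * im v t + complex.Im lam' * re v t).
      exact: im_sub_scale.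
    have [g1 g2] := (L2_parts _ mT).1 Lg; have [v1 v2] := (L2_parts _ mT).1 Lv.
    have [k1 k2] := (L2_parts _ mT).1 Lk.
    have := HM (re g) (im g) (re v) (re (flux setT mu v)) (im v) (im (flux setT mu v)) _ _ g1 g2 v1 v2 k1 k2.
    move=> h; apply: le_trans (H1 _ Lv) _; rewrite -!mulrA; apply: ler_wpM2l => //.
    apply: le_trans (h _ _) _.
    * apply: (rsol_ext iT t1) => // t _.
      by rewrite gr /re cReMl !cReD !cReN cReMl /a /b /im; ring.
    * apply: (rsol_ext iT t2) => // t _.
      by rewrite gi /im cImMl !cImD !cImN cImMl /a /b /re; ring.
    by apply: ler_wpM2l => //; exact: H2.
- exists U0 => //; apply: contrapT => nz.
  have u00 t : u0 t = 0.
    by apply/eqP; apply: contrapT => /negP h; apply: nz; exists t; rewrite eq_complex /= eqxx andbT.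
  by have := unit0; rewrite int_zero => [/eqP|t _]; [rewrite eq_sym oner_eq0|rewrite u00 mulr0].
- exists 1%N, (fun _ => U0) => v [dv ev].
  have [/(L2_parts _ mT)[v1 v2] /(L2_parts _ mT)[k1 k2] _ [t1 t2]] := dom_op_pair hmu hrho lam dv.
  have e1 : rsol setT mu rho lam (fun=> 0) (re v) (re (flux setT mu v)).
    split; first exact: t1.1.
    apply: prim_ae_line t1.2.
      by have := sqint_opp mT (source_meas lam hrho mT v1 z0) => -[m _].
    by apply: ae_imp ev => t H I0; rewrite /re H// subrr mulr0.
  have e2 : rsol setT mu rho lam (fun=> 0) (im v) (im (flux setT mu v)).
    split; first exact: t2.1.
    apply: prim_ae_line t2.2.
      by have := sqint_opp mT (source_meas lam hrho mT v2 z0) => -[m _].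
    by apply: ae_imp ev => t H I0; rewrite /im H// subrr mulr0.
  have [c1 Hc1] := kernel_line hmu hrho s0 q0 r0 unit0 e1 v1 k1.
  have [c2 Hc2] := kernel_line hmu hrho s0 q0 r0 unit0 e2 v2 k2.
  exists (fun _ => c1 +i* c2) => t; rewrite big_ord_recl big_ord0 addr0.
  apply: eq_parts.
    by have [h _] := Hc1 t; rewrite cReMr /= -h.
  by have [h _] := Hc2 t; rewrite cImMr /= -h.
Qed.

End discrete.

(** * Supports, fibers and intervals *)

Section support.
Context {R : realType}.

(** Lindelof: the complement of the essential support is covered by countably
    many rational intervals on which the function vanishes almost everywhere. *)
Lemma zero_off_support (f : R -> R[i]) (D : set R) : ess_supp f `<=` D ->
  {ae @lebesgue_measure R, forall x, ~ D x -> f x = 0}.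
Proof.
move=> fD.
pose J (pq : rat * rat) : set R := [set x | ratr pq.1 < x < ratr pq.2].
pose P n x := forall pq : rat * rat, unpickle n = Some pq ->
  ae_eq leb (J pq) f (cst 0) -> J pq x -> f x = 0.
have aP n : {ae @lebesgue_measure R, forall x, P n x}.
  case E : (unpickle n : option (rat * rat)) => [pq|]; last first.
    by apply: aeW => x pq; rewrite E.
  have [h|h] := pselect (ae_eq leb (J pq) f (cst 0)); last first.
    by apply: aeW => x pq'; rewrite E => -[<-].
  by apply: ae_imp h => x H pq'; rewrite E => -[<-] _; exact: H.
apply: ae_imp (ae_all_nat aP) => x H nD.
have : ~ ess_supp f x by move=> /fD.
rewrite /ess_supp /setC /= => /contrapT[U [oU U0] Ux].
have [e /= e0 He] : exists2 e : R, 0 < e & forall y, `|y - x| < e -> U y.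
  have /nbhs_ballP[e /= e0 He] := open_nbhs_nbhs (conj oU Ux).
  by exists e => // y yx; apply: He; rewrite /ball/= distrC.
have [p p1] : exists q : rat, x - e < ratr q < x.
  have : x - e < x by lra.
  by move/rat_in_itvoo => [q]; rewrite in_itv/= => ?; exists q.
have [q q1] : exists q : rat, x < ratr q < x + e.
  have : x < x + e by lra.
  by move/rat_in_itvoo => [q']; rewrite in_itv/= => ?; exists q'.
have /andP[p2 p3] := p1; have /andP[q2 q3] := q1.
apply: (H (pickle (p, q)) (p, q)); [by rewrite pickleK| |by rewrite /J /= p3].
apply: ae_imp U0 => y U0 /= /andP[y1 y2]; apply: U0; apply: He.
by rewrite ltr_norml; apply/andP; split; lra.
Qed.

End support.

Section periodicity.
Context {R : realType}.
Implicit Types (f : R * R -> R) (x y s th : R).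

Lemma periodic_shift (g : R -> R) : (forall x, g (x + 1) = g x) ->
  forall (n : int) x, g (x + n%:~R) = g x.
Proof.
move=> h n x; have nat_shift (k : nat) z : g (z + k%:R) = g z.
  by elim: k z => [|k IH] z; rewrite ?addr0// -natr1 addrA h.
case: n => k; first exact: nat_shift.
by rewrite NegzE mulrNz -[RHS](nat_shift k.+1) -[X in _ = g X](subrK (k.+1%:R)) -(nat_shift k.+1 (x - k.+1%:~R)) subrK subrK.
Qed.

(** Boundedness comes from compactness of a period cell. *)
Lemma periodic_line_coefficient f th1 th2 s : periodic_coefficient f ->
  line_coefficient (fiber f th1 th2 s).
Proof.
move=> [cf p1 p2 [c c0 cf0]].
pose K : set (R * R) := `[0, 1]%classic `*` `[0, 1]%classic.
have cK : compact K by apply: compact_setX; exact: segment_compact.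
have /compact_bounded : compact (f @` K).
  by apply: continuous_compact => //; exact: continuous_subspaceT.
move=> [M [_ HM]].
have bound p : f p <= `|M| + 1.
  case: p => x y.
  have e1 : f (x, y) = f (x - (Num.floor x)%:~R, y - (Num.floor y)%:~R).
    rewrite -[in LHS](subrK (Num.floor x)%:~R x) -[in LHS](subrK (Num.floor y)%:~R y).
    rewrite (periodic_shift (g := fun x => f (x, _))) => [|?]; last exact: p1.
    by rewrite (periodic_shift (g := fun y => f (_, y))) => [|?]; last exact: p2.
  rewrite e1; apply: le_trans (ler_norm _) _; apply: HM.
    by apply: le_lt_trans (ler_norm _) _; rewrite ltrDl.
  exists (x - (Num.floor x)%:~R, y - (Num.floor y)%:~R) => //.
  have fl (z : R) : 0 <= z - (Num.floor z)%:~R <= 1.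
    have := floor_itv z; rewrite intrD => /andP[a b]; rewrite subr_ge0 a/=; lra.
  by split; rewrite /= in_itv/= fl.
have cfib : continuous (fiber f th1 th2 s).
  move=> x; have c1 : s + th1 * t @[t --> x] --> s + th1 * x.
    by apply: cvgD; [exact: cvg_cst|apply: cvgM; [exact: cvg_cst|exact: cvg_id]].
  have c2 : th2 * t @[t --> x] --> th2 * x.
    by apply: cvgM; [exact: cvg_cst|exact: cvg_id].
  have H := @continuous2_cvg _ _ _ _ (nbhs x) _ _ _ (fun p q : R => f (p, q)) _ _ _ c1 c2.
  apply: H.
  by under eq_fun do rewrite -surjective_pairing; exact: cf.
split; first exact: continuous_measurable_fun.
by exists c, (`|M| + 1); split=> // x; rewrite cf0 bound.
Qed.

(** Seen from a point whose second coordinate [a * th2] is an integer, the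
    medium is the fiber through [a * th1]. *)
Lemma fiber_translate f th1 th2 a x : periodic_coefficient f ->
  a * th2 \is a Num.int -> fiber f th1 th2 (a * th1) x = fiber f th1 th2 0 (x + a).
Proof.
move=> [cf p1 p2 _] /intrP[n en]; rewrite /fiber add0r !mulrDr.
rewrite [th2 * a]mulrC en (periodic_shift (g := fun y => f (_, y))) => [|?]; last exact: p2.
by rewrite [th1 * a]mulrC addrC.
Qed.

End periodicity.

Section closures.
Context {R : realType}.
Implicit Types (a b t : R).

Lemma closure_open_interval a b : a < b ->
  closure (`]a, b[%classic : set R) = `[a, b]%classic.
Proof.
move=> ab; apply/seteqP; split.
  have /closure_id -> : closed (`[a, b]%classic : set R) by exact: interval_closed.
  apply: closure_subset => t.
  by rewrite /= !in_itv/= => /andP[/ltW -> /ltW ->].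
move=> t /itv_ccP/andP[t1 t2] B /nbhs_ballP[e /= e0 He].
pose m := (a + b) / 2; pose s := Num.min 1 (e / (2 * (`|m - t| + 1))).
have D : 0 < 2 * (`|m - t| + 1) by rewrite mulr_gt0// ltr_wpDl.
have s0 : 0 < s by rewrite lt_min ltr01 divr_gt0.
have s1 : s <= 1 by rewrite ge_min lexx.
have s2 : s * (2 * (`|m - t| + 1)) <= e by rewrite -ler_pdivlMr// ge_min lexx orbT.
exists (t + s * (m - t)); split; last first.
  apply: He; rewrite /ball/= opprD addrA subrr sub0r normrN normrM (gtr0_norm s0).
  have := mulr_ge0 (ltW s0) (normr_ge0 (m - t)); lra.
rewrite /= in_itv/=; have am : a < m by rewrite /m; lra. have mb : m < b by rewrite /m; lra.
have h1 : 0 < s * (m - a) by rewrite mulr_gt0// subr_gt0.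
have h2 : 0 < s * (b - m) by rewrite mulr_gt0// subr_gt0.
have h3 : 0 <= (1 - s) * (t - a) by rewrite mulr_ge0// subr_ge0.
have h4 : 0 <= (1 - s) * (b - t) by rewrite mulr_ge0// subr_ge0.
by apply/andP; split; lra.
Qed.

End closures.

Lemma weak_sol_ksol {R : realType} (I : set R) (mu rho : R -> R) (kappa : R[i])
    (g u : R -> R[i]) : open I -> is_interval I -> (exists x, I x) ->
  line_coefficient mu -> line_coefficient rho -> L2 I g ->
  weak_sol I mu rho kappa g u ->
  [/\ ksol (closure I) mu rho (complex.Re kappa)
        (fun t => g t + (0 +i* (rho t * complex.Im kappa)) * u t) u (flux I mu u),
      L2 I u, L2 I (flux I mu u) &
      ae_eq leb I (wderiv I u) (fun t => ((mu t)^-1)%:C * flux I mu u t)].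
Proof.
move=> oI iI I0 hmu hrho Lg ws.
have [cs Lu Lw aw] := weak_sol_csol oI iI I0 hmu hrho Lg ws; split=> //.
by apply: csol_ksol cs; exact: closure_interval.
Qed.

(** * Well-posedness and stability of the interior problem *)

Section energy.
Context {R : realType}.

Lemma normc_ge0 (c : R[i]) : 0 <= normc c.
Proof. by case: c => x y; exact: sqrtr_ge0. Qed.

(** The energy flux [Im (conj U * W)] is the difference between the energies of
    the incoming and outgoing traces. *)
Lemma robin_energy i (z : R) (U W : R[i]) :
  normc (Rp i z U W) ^+ 2 - normc (Rm i z U W) ^+ 2 =
  4 * z * orient i * (complex.Re U * complex.Im W - complex.Re W * complex.Im U).
Proof.
have o2 : orient i * orient i = 1 :> R by case: i; rewrite /= ?mulrNN mulr1.
by rewrite !normc2 /Rp /Rm !(cReD, cImD, cReN, cImN, cReM, cImM)/=; ring.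
Qed.

(** The energy flux of a solution of the homogeneous equation is constant, and
    contractive boundary conditions make it leave through both ends. *)
Lemma contraction_inj (mu rho : R -> R) (lam al ar z : R) (Lam : side -> R[i]) :
  line_coefficient mu -> line_coefficient rho -> al <= ar -> 0 < z ->
  (forall i, normc (Lam i) < 1) ->
  forall u w, ksol `[al, ar] mu rho lam (fun=> 0) u w ->
  (forall i, robin_defect al ar z Lam i u w = 0) ->
  forall t, (`[al, ar]%classic : set R) t -> u t = 0 /\ w t = 0.
Proof.
move=> hmu hrho alr z0 L1 u w [s1 s2] def t Jt.
have iJ : is_interval (`[al, ar]%classic : set R) by exact: interval_is_interval.
have Jal : (`[al, ar]%classic : set R) al by rewrite /= in_itv/= lexx.
have Jar : (`[al, ar]%classic : set R) ar by rewrite /= in_itv/= alr lexx.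
have [_ flow] := (wronskian iJ s1 s2) _ _ Jal Jar alr.
rewrite int_zero in flow; last by move=> r _; rewrite /re /im /=; ring.
pose P i := normc (Rp i z (u (endpoint al ar i)) (w (endpoint al ar i))).
have P0 i : 0 <= P i by exact: normc_ge0.
have en i : (1 - normc (Lam i) ^+ 2) * P i ^+ 2 = 4 * z * orient i *
    (re u (endpoint al ar i) * im w (endpoint al ar i) -
     re w (endpoint al ar i) * im u (endpoint al ar i)).
  rewrite /re /im -robin_energy; have /eqP := def i; rewrite subr_eq0 => /eqP ->.
  by rewrite normcM -/(P i); ring.
have c0 i : 0 < 1 - normc (Lam i) ^+ 2.
  rewrite subr_gt0 -[ltRHS](expr1n _ 2) ltr_pXn2r ?nnegrE ?normc_ge0//.
have el := en Lside; have er := en Rside; rewrite /= in el er.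
have nl := mulr_ge0 (ltW (c0 Lside)) (sqr_ge0 (P Lside)).
have nr := mulr_ge0 (ltW (c0 Rside)) (sqr_ge0 (P Rside)).
have zr : (1 - normc (Lam Lside) ^+ 2) * P Lside ^+ 2 = 0.
  move: nl nr; rewrite er; set X := re u ar * _ - _ in flow er *.
  rewrite el; set Y := re u al * _ - _ in flow el *.
  have -> : X = Y by lra.
  move=> h1 h2; lra.
have Pl : P Lside = 0.
  by apply/eqP; move/eqP: zr; rewrite mulf_eq0 (gt_eqF (c0 _))/= sqrf_eq0.
have Rp0 : Rp Lside z (u al) (w al) = 0.
  exact: eq0_normc.
have Rm0 : Rm Lside z (u al) (w al) = 0.
  by have /eqP := def Lside; rewrite subr_eq0 /= Rp0 mulr0 => /eqP.
have [U0 W0] := robin_zero (lt0r_neq0 z0) Rp0 Rm0.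
have [a1 b1] := rsol_zero hmu hrho iJ Jal Jt s1 (congr1 (@complex.Re R) U0) (congr1 (@complex.Re R) W0).
have [a2 b2] := rsol_zero hmu hrho iJ Jal Jt s2 (congr1 (@complex.Im R) U0) (congr1 (@complex.Im R) W0).
by split; apply: eq_parts.
Qed.

End energy.

Lemma ksol_diff {R : realType} (D : set R) (mu rho : R -> R) (lam : R)
    (h1 u1 w1 h2 u2 w2 : R -> R[i]) : is_interval D ->
  ksol D mu rho lam h1 u1 w1 -> ksol D mu rho lam h2 u2 w2 ->
  ksol D mu rho lam (fun t => h1 t - h2 t) (fun t => u1 t - u2 t) (fun t => w1 t - w2 t).
Proof.
move=> iD s1 s2; apply: (ksol_ext iD (ksol_add 1 (-1) iD s1 s2)) => t _;
  by rewrite mul1r mulN1r.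
Qed.

Section interior_problem.
Context {R : realType}.
Variables (mu rho : R -> R) (omega al ar z : R) (Lam : side -> R[i]).
Hypotheses (hmu : line_coefficient mu) (hrho : line_coefficient rho).
Hypotheses (halr : al < ar) (hz : 0 < z).
Local Notation I := (`]al, ar[%classic : set R).
Local Notation J := (`[al, ar]%classic : set R).
Local Notation defect := (robin_defect al ar z Lam).
Implicit Types (f g h u w : R -> R[i]) (t B : R).

Let oI : open I. Proof. exact: interval_open. Qed.
Let iI : is_interval I. Proof. exact: interval_is_interval. Qed.
Let iJ : is_interval J. Proof. exact: interval_is_interval. Qed.
Let I0 : exists x, I x.
Proof. by exists ((al + ar) / 2); rewrite /= in_itv/= !midf_lt. Qed.
Let mI : measurable I. Proof. exact: measurable_itv. Qed.
Let mJ : measurable J. Proof. exact: measurable_itv. Qed.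
Let alr : al <= ar. Proof. exact: ltW. Qed.
Let IJ : I `<=` J.
Proof. by move=> t; rewrite /= !in_itv/= => /andP[/ltW -> /ltW ->]. Qed.
Let cI : closure I = J. Proof. exact: closure_open_interval. Qed.
Let Jend i : J (endpoint al ar i).
Proof. by case: i; rewrite /= in_itv/= lexx ?halr ?alr. Qed.

Lemma lint_open_closed (k : R -> R) : intg J k -> lint I k = lint J k.
Proof.
move=> ki; have mk := intg_meas ki.
have sub (X : set R) : measurable X -> X `<=` J -> intg X k by move=> mX sX; exact: (intg_sub mJ).
rewrite /lint -(Rintegral_itv_bndo_bndc (a := BLeft al)).
  rewrite -(Rintegral_itv_obnd_cbnd (r := al) (b := BLeft ar))//.
  by apply: sub => //; exact: IJ.
apply: sub; first exact: measurable_itv.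
by move=> t; rewrite /= !in_itv/= => /andP[-> /ltW ->].
Qed.

Lemma L2_seg g : L2 I g -> sqint J (re g) /\ sqint J (im g).
Proof.
have cl : closure I al by rewrite cI; exact: Jend Lside.
have cr : closure I ar by rewrite cI; exact: Jend Rside.
have sq (k : R -> R) : sqint I k -> sqint J k.
  move=> [mk ki]; have E : J = I `|` ([set al] `|` [set ar]).
    apply/seteqP; split=> t.
      rewrite /= !in_itv/= le_eqVlt => /andP[/orP[/eqP ->|h1]]; first by right; left.
      by rewrite le_eqVlt => /orP[/eqP ->|h2]; [right; right|left; rewrite h1].
    by move=> [/IJ//|[->|->]]; [exact: Jend Lside|exact: Jend Rside].
  split; last exact: intg_closure cl cr ki.
  rewrite E; apply/measurable_funU => //; first by apply: measurableU; exact: measurable_set1.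
  split=> //; apply/measurable_funU; [exact: measurable_set1..|].
  by split; exact: measurable_fun_set1.
by move=> /(L2_parts _ mI)[g1 g2]; split; exact: sq.
Qed.

Let seg_intg (k : R -> R) : sqint J k -> intg J k.
Proof.
move=> qk; have q1 : sqint J (fun=> 1 : R).
  by split; [exact: measurable_cst|exact: intg_cst].
have := sqint_prod mJ q1 qk; congr (intg _ _); apply/funext => t /=; exact: mul1r.
Qed.

Lemma lint_n1_L2norm : exists2 K, 0 <= K & forall g, L2 I g ->
  lint J (fun t => n1 (g t)) <= K * L2norm I g.
Proof.
exists (2 * Num.sqrt (ar - al)) => [|g Lg]; first by rewrite mulr_ge0 ?sqrtr_ge0.
have [g1 g2] := L2_seg Lg; have S0 := sqrtr_ge0 (ar - al).
have NE : L2norm I g ^+ 2 = lint J (fun t => re g t ^+ 2) + lint J (fun t => im g t ^+ 2).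
  rewrite /L2norm /wL2norm sqr_sqrtr; last first.
    by apply: int_ge0 => t _; rewrite mul1r sqr_ge0.
  rewrite -int_add//; [|exact: g1.2|exact: g2.2].
  rewrite -lint_open_closed; last by apply: intg_add => //; [exact: g1.2|exact: g2.2].
  by apply: int_eq => t _; rewrite mul1r normc2.
have N0 : 0 <= L2norm I g by exact: sqrtr_ge0.
have one (k : R -> R) : sqint J k -> lint J (fun t => k t ^+ 2) <= L2norm I g ^+ 2 ->
    lint J (fun t => `|k t|) <= Num.sqrt (ar - al) * L2norm I g.
  move=> qk kN; have q1 : sqint J (fun=> 1 : R).
    by split; [exact: measurable_cst|exact: intg_cst].
  have qn : sqint J (fun t => `|k t|).
    split; first by apply: measurableT_comp => //; exact: qk.1.
    by have := qk.2; congr (intg _ _); apply/funext => t /=; rewrite real_normK ?num_real.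
  have := cauchy_schwarz_nrm mJ q1 qn; rewrite (@int_eq _ _ _ (fun t => `|k t|)); last by move=> t _; exact: mul1r.
  move/(le_trans (ler_norm _)) => h1; apply: le_trans h1 _; apply: ler_pM; rewrite ?nrm_ge0//.
    apply: nrm_le => //; rewrite (@int_eq _ _ _ (fun=> 1)); last by move=> t _; rewrite expr1n.
    by rewrite int_cst// mul1r sqr_sqrtr ?subr_ge0.
  apply: nrm_le => //; rewrite (@int_eq _ _ _ (fun t => k t ^+ 2))// => t _.
  by rewrite real_normK ?num_real.
rewrite int_add//; [|by apply: intg_norm => //; exact: seg_intg..].
have := one _ g1 ltac:(rewrite NE lerDl; exact: lint_sqr_ge0).
have := one _ g2 ltac:(rewrite NE lerDr; exact: lint_sqr_ge0).
lra.
Qed.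

(** On the bounded interval the H1 norm is controlled by the supremum of the
    solution and of its flux. *)
Lemma H1norm_bound : exists2 K, 0 <= K & forall u w B, 0 <= B -> L2 I u ->
  L2 I w -> prim J (re u) (fun t => (mu t)^-1 * re w t) ->
  prim J (im u) (fun t => (mu t)^-1 * im w t) ->
  (forall t, J t -> n1 (u t) + n1 (w t) <= B) -> H1norm I u <= K * B.
Proof.
have [Ki Ki0 HKi] := coef_inv_le hmu.
pose S := Num.sqrt (ar - al); have S0 : 0 <= S by exact: sqrtr_ge0.
exists ((1 + Ki) * S) => [|u w B B0 Lu Lw p1 p2 uB].
  by rewrite mulr_ge0// addr_ge0// ltW.
pose v t := ((mu t)^-1)%:C * w t.
have v1 : re v = fun t => (mu t)^-1 * re w t by apply/funext => t; rewrite /re /v cReMl.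
have v2 : im v = fun t => (mu t)^-1 * im w t by apply/funext => t; rewrite /im /v cImMl.
have mi := coef_inv_meas hmu mI.
have Lv : L2 I v.
  have [w1 w2] := (L2_parts _ mI).1 Lw.
  by apply/(L2_parts _ mI); rewrite v1 v2; split; apply: sqint_mul mi HKi _.
have [Hu du] : H1 I u /\ ae_eq leb I (wderiv I u) v.
  by apply: prim_H1 => //; rewrite cI ?v1 ?v2.
have bound (k : R -> R[i]) C : 0 <= C -> L2 I k -> (forall t, J t -> n1 (k t) <= C) ->
    L2norm I k <= C * S.
  move=> C0 Lk kC; rewrite /L2norm /wL2norm -/(lint _ _).
  rewrite -[leRHS]ger0_norm ?mulr_ge0// -sqrtr_sqr; apply: ler_wsqrtr.
  have [k1 k2] := (L2_parts _ mI).1 Lk.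
  have iC : intg J (fun=> C ^+ 2 : R) by exact: intg_cst.
  apply: (@le_trans _ _ (lint I (fun=> C ^+ 2))).
    apply: int_le => //; [|exact: (intg_sub mJ mI IJ iC)|].
      have := intg_add mI k1.2 k2.2; congr (intg _ _); apply/funext => t /=.
      by rewrite mul1r normc2.
    move=> t It; rewrite mul1r ler_pXn2r ?nnegrE ?normc_ge0//.
    by apply: le_trans (normc_n1 _) _; apply: kC; exact: IJ.
  rewrite lint_open_closed// int_cst// exprMn sqr_sqrtr ?subr_ge0//.
have Lwd : L2 I (wderiv I u).
  by have [] := H1_prim oI iI I0 Hu.
have b1 : L2norm I u <= B * S.
  by apply: bound => // t /uB h; have := n1_ge0 (w t); lra.
have b2 : L2norm I (wderiv I u) <= Ki * B * S.
  have -> : L2norm I (wderiv I u) = L2norm I v.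
    congr Num.sqrt; rewrite /Rintegral; congr fine.
    have m (k : R -> R[i]) : L2 I k -> measurable_fun I (fun x => (cst 1 x * normc (k x) ^+ 2)%:E).
      move=> [[m1 m2] _]; apply/measurable_EFinP; apply: measurable_funM; first exact: measurable_cst.
      rewrite (_ : (fun x => _) = fun x => complex.Re (k x) ^+ 2 + complex.Im (k x) ^+ 2).
        by apply: measurable_funD; apply: measurable_funX.
      by apply/funext => x; rewrite normc2.
    apply: ae_eq_integral; [exact: mI|exact: m|exact: m|].
    by apply: ae_imp du => t H It; rewrite H.
  apply: bound => //; first by rewrite mulr_ge0// ltW.
  move=> t /uB h; rewrite /v; apply: le_trans (n1M _ _) _.
  rewrite {1}/n1 /= normr0 addr0; apply: ler_pM => //; first exact: n1_ge0.
  by have := n1_ge0 (u t); lra.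
rewrite /H1norm; apply: (@le_trans _ _ (B * S + Ki * B * S)); last by lra.
have n0 k : 0 <= L2norm I k by exact: sqrtr_ge0.
set X := L2norm I u in b1 *; set Y := L2norm I (wderiv I u) in b2 *.
have X0 : 0 <= X by exact: n0. have Y0 : 0 <= Y by exact: n0.
apply: (@le_trans _ _ (X + Y)); last exact: lerD.
rewrite -[leRHS]ger0_norm ?addr_ge0// -sqrtr_sqr; apply: ler_wsqrtr.
have := mulr_ge0 X0 Y0; lra.
Qed.

Lemma interior_solP g u : L2 I g -> interior_sol al ar mu rho omega z Lam g u ->
  [/\ ksol J mu rho (omega ^+ 2) g u (flux I mu u), L2 I u, L2 I (flux I mu u) &
      forall i, defect i u (flux I mu u) = 0].
Proof.
move=> Lg [ws rb]; have [s Lu Lw _] := weak_sol_ksol oI iI I0 hmu hrho Lg ws.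
rewrite cI /= in s; split=> //.
  apply: (ksol_ext iJ s) => // t _; rewrite mulr0 (_ : 0 +i* 0 = 0)// mul0r addr0 //.
by move=> i; rewrite /robin_defect; apply/eqP; rewrite subr_eq0; apply/eqP; exact: rb.
Qed.

Lemma defectB i u v w k :
  defect i (fun t => u t - v t) (fun t => w t - k t) = defect i u w - defect i v k.
Proof.
rewrite /robin_defect /Rm /Rp; set x := endpoint al ar i.
move: (orient i)%:C (0 +i* z) (Lam i) (u x) (v x) (w x) (k x) => a b c p q r s.
ring.
Qed.

Hypothesis inj : forall u w, ksol J mu rho (omega ^+ 2) (fun=> 0) u w ->
  (forall i, defect i u w = 0) -> forall t, J t -> u t = 0 /\ w t = 0.

Let z0 : z != 0. Proof. by rewrite gt_eqF. Qed.

(** The defects of a solution vanish, so that stability reduces to a bound by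
    the source, first in the supremum norm and then in H1. *)
Lemma wellposed_of_inj : interior_wellposed al ar mu rho omega z Lam.
Proof.
have [M M0 HM] := interior_stable hmu hrho alr z0 inj.
have [K K0 HK] := H1norm_bound; have [K1 K10 HK1] := lint_n1_L2norm.
split.
- move=> g Lg; have [g1 g2] := L2_seg Lg.
  have [u [w [s def]]] := interior_exists hmu hrho alr z0 inj (seg_intg g1) (seg_intg g2).
  have [B B0 HB] := ksol_bounded alr s.
  have Lb (k : R -> R[i]) (d1 d2 : R -> R) : prim J (re k) d1 -> prim J (im k) d2 ->
      (forall t, J t -> n1 (k t) <= B) -> L2 I k.
    move=> q1 q2 kB.
    have one (m d : R -> R) : prim J m d -> (forall t, J t -> `|m t| <= B) -> sqint I m.
      move=> pm mB; split; first exact: measurable_funS IJ (prim_meas mJ pm).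
      apply: (@intg_le _ _ _ (fun=> B ^+ 2)) => //.
      - by apply: measurable_funX; exact: measurable_funS IJ (prim_meas mJ pm).
      - by move=> t It; rewrite normrX ler_pXn2r ?nnegrE// mB//; exact: IJ.
      - by apply: (intg_sub mJ mI IJ); exact: intg_cst.
    apply/(L2_parts _ mI); split; [apply: one q1 _|apply: one q2 _] => t /kB; rewrite /n1 /re /im.
      by have := normr_ge0 (complex.Im (k t)); lra.
    by have := normr_ge0 (complex.Re (k t)); lra.
  have [[p1 q1] [p2 q2]] := s.
  have Lu := Lb u _ _ p1 p2 (fun t Jt => (HB t Jt).1).
  have Lw := Lb w _ _ q1 q2 (fun t Jt => (HB t Jt).2).
  have cs : csol (closure I) mu rho (omega ^+ 2)%:C g u w by rewrite cI; exact: ksol_csol.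
  have [ws fw _] := csol_weak_sol oI iI I0 hmu hrho Lu Lw Lg cs.
  exists u; split=> // i; have /eqP := def i; rewrite subr_eq0 => /eqP.
  by rewrite /robinM /robinP fw// cI; exact: Jend.
- move=> g u v Lg hu hv x xJ; have Jx : J x by apply/itv_ccP.
  have [s1 _ _ d1] := interior_solP Lg hu; have [s2 _ _ d2] := interior_solP Lg hv.
  have s0 : ksol J mu rho (omega ^+ 2) (fun=> 0) (fun t => u t - v t)
      (fun t => flux I mu u t - flux I mu v t).
    by have := ksol_diff iJ s1 s2; under [fun t => g t - g t]eq_fun do rewrite subrr.
  have [|e _] := inj s0 _ Jx; first by move=> i; rewrite defectB d1 d2 subrr.
  by apply/eqP; rewrite -subr_eq0; apply/eqP.
- exists (K * (M * K1)) => g u Lg hu.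
  have [s Lu Lw d] := interior_solP Lg hu; have [g1 g2] := L2_seg Lg.
  have [[p1 q1] [p2 q2]] := s.
  have N0 : 0 <= L2norm I g by exact: sqrtr_ge0.
  rewrite -!mulrA; apply: HK Lu Lw p1 p2 _; first by rewrite !mulr_ge0.
  move=> t Jt; apply: le_trans (HM _ _ _ (seg_intg g1) (seg_intg g2) s t Jt) _.
  by rewrite !d n1_0 !add0r; apply: ler_wpM2l => //; exact: HK1.
Qed.

(* Facts irrelevant to an inequality slow down linear arithmetic; those of the
   section have to stay. *)
Ltac lean_lra := clear - mu rho omega al ar z Lam hmu hrho halr hz oI iI iJ I0 mI mJ
  alr IJ cI Jend seg_intg inj z0; lra.

(** If the Robin defects of [u_eps] are small compared to its incoming traces,
    then the difference to the limit solution, whose source is proportional to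
    [eps], can be absorbed. *)
Lemma converge_of_inj f uint : L2 I f ->
  interior_sol al ar mu rho omega z Lam f uint ->
  forall e : R, 0 < e -> exists2 eta : R, 0 < eta & forall (eps tau : R) u w,
    0 <= eps -> 0 <= tau -> eps + tau < eta ->
    L2 I u -> L2 I w ->
    ksol J mu rho (omega ^+ 2) (fun t => f t + (0 +i* (rho t * eps)) * u t) u w ->
    (forall i, n1 (defect i u w) <= tau *
       n1 (Rp i z (u (endpoint al ar i)) (w (endpoint al ar i)))) ->
    H1norm I (fun t => u t - uint t) < e.
Proof.
move=> Lf hu e e0; have [M M0 HM] := interior_stable hmu hrho alr z0 inj.
have [K K0 HK] := H1norm_bound; have [Kr Kr0 HKr] := coef_le hrho.
have [s0 Lu0 Lw0 d0] := interior_solP Lf hu; set w0 := flux I mu uint in s0 Lw0 d0.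
have [B B0 HB] := ksol_bounded alr s0.
have l0 : 0 < ar - al by rewrite subr_gt0.
pose T := (1 + z) + Kr; have T0 : 0 < T by rewrite ltr_wpDl// addr_ge0// ltW.
pose C0 := 4 * B + B * (ar - al) + 1.
have C00 : 0 < C0 by rewrite ltr_wpDl// addr_ge0 ?mulr_ge0// ltW.
pose L := 2 + (ar - al).
have L0 : 0 < L by rewrite addr_gt0.
pose A := M * T + 1; have A0 : 0 < A by rewrite ltr_wpDl// mulr_ge0// ltW.
have X1 : 0 < 2 * L * A by apply: mulr_gt0 => //; exact: mulr_gt0.
have X2 : 0 < 4 * (K + 1) * A * C0.
  by apply: mulr_gt0 => //; apply: mulr_gt0 => //; apply: mulr_gt0 => //; exact: ltr_wpDl.
exists (Num.min (2 * L * A)^-1 (e / (4 * (K + 1) * A * C0))).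
  by rewrite lt_min invr_gt0 X1/= divr_gt0.
move=> eps tau u w eps0 tau0 small Lu Lw s def.
have {small} [small1 small2] : (eps + tau) * (2 * L * A) <= 1 /\ (eps + tau) * (4 * (K + 1) * A * C0) < e.
  move: small; rewrite lt_min => /andP[h1 h2]; split.
    by rewrite -ler_pdivlMr// mul1r; exact: ltW.
  by rewrite -ltr_pdivlMr.
pose d t := u t - uint t; pose k t := w t - w0 t.
have sd : ksol J mu rho (omega ^+ 2) (fun t => (0 +i* (rho t * eps)) * u t) d k.
  by apply: (ksol_ext iJ (ksol_diff iJ s s0)) => // t _; rewrite addrAC subrr add0r.
pose q t := n1 (d t) + n1 (k t).
have q0 t : 0 <= q t by rewrite addr_ge0 ?n1_ge0.
have [Bd Bd0 HBd] := ksol_bounded alr sd.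
have [u1 u2] := L2_seg Lu; have [h1 h2] := L2_seg Lu0.
have nb (m : R -> R[i]) : intg J (re m) -> intg J (im m) -> intg J (fun t => n1 (m t)).
  by move=> *; apply: intg_add => //; exact: intg_norm.
have [[pd1 pk1] [pd2 pk2]] := sd.
have bi (m m' : R -> R) : prim J m m' -> (forall t, J t -> `|m t| <= Bd) -> intg J m.
  move=> pm mB; apply: (@intg_le _ _ _ (fun=> Bd)) => //; first exact: prim_meas pm.
  exact: intg_cst.
have re_n1 (c : R[i]) : `|complex.Re c| <= n1 c by rewrite lerDl.
have im_n1 (c : R[i]) : `|complex.Im c| <= n1 c by rewrite lerDr.
have id1 : intg J (fun t => n1 (d t)).
  apply: nb; [apply: bi pd1 _|apply: bi pd2 _] => t /HBd[h _]; apply: le_trans h.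
    exact: re_n1.
  exact: im_n1.
have ik1 : intg J (fun t => n1 (k t)).
  apply: nb; [apply: bi pk1 _|apply: bi pk2 _] => t /HBd[_ h]; apply: le_trans h.
    exact: re_n1.
  exact: im_n1.
have iq : intg J q by exact: intg_add.
pose Y := q al + q ar + lint J q.
have Y0 : 0 <= Y by rewrite !addr_ge0//; apply: int_ge0.
have qe i : q (endpoint al ar i) <= q al + q ar by case: i; rewrite /= ?lerDl ?lerDr.
have Q0 : 0 <= lint J q by apply: int_ge0.
have dd i : n1 (defect i d k) <= tau * ((1 + z) * (q (endpoint al ar i) + 2 * B)).
  have -> : defect i d k = defect i u w.
    by rewrite defectB d0 subr0.
  apply: le_trans (def i) _; apply: ler_wpM2l => //.
  set x := endpoint al ar i; have Jx : J x by exact: Jend.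
  have [b1 b2] := HB _ Jx.
  have c1 : n1 (u x) <= n1 (d x) + n1 (uint x) by rewrite -[u x](subrK (uint x)); exact: n1D.
  have c2 : n1 (w x) <= n1 (k x) + n1 (w0 x) by rewrite -[w x](subrK (w0 x)); exact: n1D.
  have c3 : n1 (Rp i z (u x) (w x)) <= n1 (w x) + z * n1 (u x).
    rewrite /Rp; apply: le_trans (n1B _ _) _; apply: lerD.
      rewrite mulNr n1N; apply: le_trans (n1M _ _) _.
      by rewrite {1}/n1 /= normr0 addr0; case: (i) => /=; rewrite ?normrN normr1 mul1r.
    by apply: le_trans (n1M _ _) _; rewrite {1}/n1 /= normr0 add0r gtr0_norm.
  have c4 := ler_wpM2l (ltW hz) c1; have c5 := n1_ge0 (d x); have c6 := n1_ge0 (k x).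
  have c7 := ler_wpM2l (ltW hz) b1; have c8 := mulr_ge0 (ltW hz) c6; have c9 := mulr_ge0 (ltW hz) B0.
  by move: b1 b2 c1 c2 c3 c4 c5 c6 c7 c8 c9 B0; rewrite /q; lean_lra.
have src : lint J (fun t => n1 ((0 +i* (rho t * eps)) * u t)) <= eps * (Kr * (lint J q + B * (ar - al))).
  have isrc : intg J (fun t => eps * Kr * (q t + B)).
    by apply: intg_scale => //; apply: intg_add => //; exact: intg_cst.
  have -> : eps * (Kr * (lint J q + B * (ar - al))) = lint J (fun t => eps * Kr * (q t + B)).
    rewrite int_scale//; last by apply: intg_add => //; exact: intg_cst.
    by rewrite int_add//; [rewrite int_cst//; ring|exact: intg_cst].
  apply: int_le => //.
    have [r1 r2] : sqint J (re (fun t => (0 +i* (rho t * eps)) * u t)) /\ sqint J (im (fun t => (0 +i* (rho t * eps)) * u t)).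
      split.
        have := rho_sqint hrho (- eps) mJ u2; congr (sqint _ _); apply/funext => t.
        by rewrite /re cReM /= /im; ring.
      have := rho_sqint hrho eps mJ u1; congr (sqint _ _); apply/funext => t.
      by rewrite /im cImM /= /re; ring.
    by apply: nb; exact: seg_intg.
  move=> t Jt; apply: le_trans (n1M _ _) _.
  rewrite {1}/n1 /= normr0 add0r normrM (ger0_norm eps0) [eps * Kr]mulrC.
  have [b1 _] := HB _ Jt.
  have c1 : n1 (u t) <= q t + B.
    have : n1 (u t) <= n1 (d t) + n1 (uint t) by rewrite -[u t](subrK (uint t)); exact: n1D.
    by have := n1_ge0 (k t); move: b1; rewrite /q; lean_lra.
  apply: ler_pM; rewrite ?mulr_ge0 ?n1_ge0//; exact: ler_wpM2r.
have sJ : intg J (re (fun t => (0 +i* (rho t * eps)) * u t)) /\ intg J (im (fun t => (0 +i* (rho t * eps)) * u t)).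
  split; apply: seg_intg.
    have := rho_sqint hrho (- eps) mJ u2; congr (sqint _ _); apply/funext => t.
    by rewrite /re cReM /= /im; ring.
  have := rho_sqint hrho eps mJ u1; congr (sqint _ _); apply/funext => t.
  by rewrite /im cImM /= /re; ring.
have et0 : 0 <= eps + tau by exact: addr_ge0.
have YC0 : 0 <= Y + C0 by apply: addr_ge0 => //; exact: ltW.
have qb t : J t -> q t <= (eps + tau) * A * (Y + C0).
  move=> Jt; apply: le_trans (HM _ _ _ sJ.1 sJ.2 sd t Jt) _.
  have dl := dd Lside; have dr := dd Rside; rewrite /= in dl dr.
  apply: (@le_trans _ _ (M * ((eps + tau) * (T * (Y + C0))))).
    apply: ler_wpM2l => //; apply: le_trans (lerD (lerD dl dr) src) _.
    have x1 : 0 <= Y + C0 - (lint J q + B * (ar - al)).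
      rewrite /Y /C0; have := q0 al; have := q0 ar; move: B0; lean_lra.
    have x2 : 0 <= Y + C0 - (q al + q ar + 4 * B).
      have := mulr_ge0 B0 (ltW l0); move: Q0; rewrite /Y /C0; lean_lra.
    have x3 : 0 <= q al + q ar + 4 * B by rewrite !addr_ge0// mulr_ge0.
    have x4 : 0 <= lint J q + B * (ar - al) by rewrite addr_ge0// mulr_ge0// ltW.
    have y1 : tau * ((1 + z) * (q al + q ar + 4 * B)) <= (eps + tau) * ((1 + z) * (Y + C0)).
      apply: ler_pM => //; [by rewrite mulr_ge0// addr_ge0// ltW|by rewrite lerDr|].
      by apply: ler_wpM2l; [rewrite addr_ge0// ltW|rewrite -subr_ge0].
    have y2 : eps * (Kr * (lint J q + B * (ar - al))) <= (eps + tau) * (Kr * (Y + C0)).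
      apply: ler_pM => //; [by rewrite mulr_ge0// ltW|by rewrite lerDl|].
      by apply: ler_wpM2l; [exact: ltW|rewrite -subr_ge0].
    by move: y1 y2; rewrite /T; lean_lra.
  have y3 := mulr_ge0 et0 YC0.
  by move: y3; rewrite /A; lean_lra.
have YC : Y <= C0.
  have Jal := Jend Lside; have Jar := Jend Rside.
  have b1 := qb _ Jal; have b2 := qb _ Jar.
  have b3 : lint J q <= (eps + tau) * A * (Y + C0) * (ar - al).
    by rewrite -int_cst//; apply: int_le => //; exact: intg_cst.
  have b4 : Y <= (eps + tau) * (2 * L * A) * (Y + C0) / 2 by rewrite {1}/Y /L /=; rewrite /= in b1 b2; move: b1 b2 b3; lean_lra.
  have := ler_wpM2r YC0 small1; move: b4; lean_lra.
have [Ld Lk] : L2 I d /\ L2 I k.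
  have sb (m m' : R -> R[i]) : L2 I m -> L2 I m' -> L2 I (fun t => m t - m' t).
    move=> /(L2_parts _ mI)[a1 a2] /(L2_parts _ mI)[b1 b2]; apply/(L2_parts _ mI).
    split; [rewrite (_ : re _ = fun t => re m t + - re m' t)|rewrite (_ : im _ = fun t => im m t + - im m' t)];
      try (by apply: sqint_add => //; exact: sqint_opp); apply/funext => t; [rewrite /re cReD cReN|rewrite /im cImD cImN] => //.
  by split; exact: sb.
have F : H1norm I d <= K * ((eps + tau) * A * (2 * C0)).
  apply: HK Ld Lk pd1 pd2 _.
    by apply: mulr_ge0; [apply: mulr_ge0 => //; exact: ltW|apply: mulr_ge0 => //; exact: ltW].
  move=> t Jt; apply: le_trans (qb t Jt) _; apply: ler_wpM2l.
    by apply: mulr_ge0 => //; exact: ltW.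
  by move: YC; lean_lra.
apply: le_lt_trans F _; apply: le_lt_trans small2.
have x1 : 0 <= (eps + tau) * A * C0 by apply: mulr_ge0; [apply: mulr_ge0 => //; exact: ltW|exact: ltW].
have := mulr_ge0 K0 x1; move: x1; lean_lra.
Qed.

End interior_problem.

(** * Frequencies in a gap *)

Definition csq {R : realType} (D : set R) (u : R -> R[i]) : Prop :=
  sqint D (re u) /\ sqint D (im u).

Lemma RpB {R : realType} i (z : R) (c U1 W1 U2 W2 : R[i]) :
  Rp i z (c * U1 - U2) (c * W1 - W2) = c * Rp i z U1 W1 - Rp i z U2 W2.
Proof. rewrite /Rp; move: (orient i)%:C (0 +i* z) => *; ring. Qed.

Lemma RmB {R : realType} i (z : R) (c U1 W1 U2 W2 : R[i]) :
  Rm i z (c * U1 - U2) (c * W1 - W2) = c * Rm i z U1 W1 - Rm i z U2 W2.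
Proof. rewrite /Rm; move: (orient i)%:C (0 +i* z) => *; ring. Qed.

Section half_line_data.
Context {R : realType}.
Implicit Types (i : side) (a : R) (u w : R -> R[i]).

Lemma csq_chalf i a u : L2 (halfline i a) u -> csq (chalf i a) u.
Proof.
move=> /(L2_parts _ (open_measurable (@halfline_open _ i a)))[u1 u2].
by split; exact: sqint_chalf.
Qed.

Lemma L2_zero (D : set R) : measurable D -> L2 D (cst (0 : R[i])).
Proof.
move=> mD; apply/(L2_parts _ mD).
suff q : sqint D (fun=> 0 : R) by split; exact: q.
split; first exact: measurable_cst.
by rewrite (_ : (fun=> _) = (fun=> 0)) ?intg0//; apply/funext => t; rewrite expr0n.
Qed.

Lemma half_line_sol i a (mu rho : R -> R) (kappa : R[i]) u :
  line_coefficient mu -> line_coefficient rho ->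
  weak_sol (halfline i a) mu rho kappa (cst 0) u ->
  let w := flux (halfline i a) mu u in
  [/\ ksol (chalf i a) mu rho (complex.Re kappa)
        (fun t => (0 +i* (rho t * complex.Im kappa)) * u t) u w,
      csq (chalf i a) u & csq (chalf i a) w].
Proof.
move=> hmu hrho ws w; have oI := @halfline_open _ i a.
have [s Lu Lw _] := weak_sol_ksol oI (@halfline_interval _ i a) (@halfline_ex _ i a)
  hmu hrho (L2_zero (open_measurable oI)) ws.
split; [|exact: csq_chalf|exact: csq_chalf].
rewrite closure_halfline in s.
by apply: (ksol_ext (@chalf_interval _ i a) s) => // t _; rewrite add0r.
Qed.

(** The source of the problem on the whole line lives in the interior, hence
    disappears on the closed half-lines. *)
Lemma drop_source i a (mu rho : R -> R) (lam : R) (f k u w : R -> R[i]) :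
  {ae @lebesgue_measure R, forall x, halfline i a x -> f x = 0} ->
  measurable_fun (chalf i a) (re k) -> measurable_fun (chalf i a) (im k) ->
  measurable_fun (chalf i a) rho -> csq (chalf i a) u ->
  ksol (chalf i a) mu rho lam (fun t => f t + k t) u w ->
  ksol (chalf i a) mu rho lam k u w.
Proof.
move=> f0 mk1 mk2 mrho [[mu1 _] [mu2 _]] [[p1 q1] [p2 q2]].
have sub x y : closure (halfline i a) x -> closure (halfline i a) y ->
    (`[x, y]%classic : set R) `<=` chalf i a.
  rewrite closure_halfline => hx hy t /itv_ccP h; exact: (chalf_interval hx hy h).
have drop (W b1 b2 : R -> R) : measurable_fun (chalf i a) b2 ->
    ae_eq leb (halfline i a) b1 b2 -> prim (chalf i a) W b1 -> prim (chalf i a) W b2.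
  move=> mb eb; have := @prim_ae _ (halfline i a) W b1 b2 (@halfline_open _ i a) (@halfline_interval _ i a).
  rewrite closure_halfline; apply=> // x y cx cy.
  apply: measurable_funS mb; [exact: chalf_meas|].
  by apply: sub; rewrite closure_halfline.
have mc (b v : R -> R) : measurable_fun (chalf i a) b -> measurable_fun (chalf i a) v ->
    measurable_fun (chalf i a) (fun t => - (rho t * lam * v t + b t)).
  move=> mb mv; apply: measurableT_comp => //; apply: measurable_funD => //.
  by apply: measurable_funM => //; apply: measurable_funM => //; exact: measurable_cst.
split; split=> //.
  apply: drop q1; first exact: mc.
  by apply: ae_imp f0 => t H It; rewrite /re cReD H// add0r.
apply: drop q2; first exact: mc.
by apply: ae_imp f0 => t H It; rewrite /im cImD H// add0r.
Qed.

End half_line_data.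

Section setting.
Context {R : realType}.
Variables (mup rhop : R * R -> R) (th1 th2 z omega : R).
Hypotheses (hmup : periodic_coefficient mup) (hrhop : periodic_coefficient rhop).
Hypothesis hz : 0 < z.
Variables (al ar : R) (mu rho : R -> R).
Hypotheses (halr : al < ar) (hmu : line_coefficient mu) (hrho : line_coefficient rho).
Hypothesis hmu0 : forall x, ~ (al < x < ar) -> mu x = fiber mup th1 th2 0 x.
Hypothesis hrho0 : forall x, ~ (al < x < ar) -> rho x = fiber rhop th1 th2 0 x.
Variable f : R -> R[i].
Hypotheses (hf : L2 setT f) (hsupp : ess_supp f `<=` `]al, ar[%classic).
Local Notation mu0 := (fiber mup th1 th2 0).
Local Notation rho0 := (fiber rhop th1 th2 0).
Local Notation J := (`[al, ar]%classic : set R).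
Local Notation I := (`]al, ar[%classic : set R).
Local Notation aend := (endpoint al ar).
Implicit Types (i : side) (u w : R -> R[i]) (t : R).

Let mT : measurable (setT : set R). Proof. exact: measurableT. Qed.
Let iT : is_interval (setT : set R). Proof. by []. Qed.
Let alr : al <= ar. Proof. exact: ltW. Qed.
Let cmu0 s : line_coefficient (fiber mup th1 th2 s).
Proof. exact: periodic_line_coefficient. Qed.
Let crho0 s : line_coefficient (fiber rhop th1 th2 s).
Proof. exact: periodic_line_coefficient. Qed.

Let outside i t : chalf i (aend i) t -> ~ (al < t < ar).
Proof.
case: i; rewrite /= in_itv/= ?andbT => h /andP[h1 h2].
  by move: (lt_le_trans h1 h); rewrite ltxx.
by move: (lt_le_trans h2 h); rewrite ltxx.
Qed.

Lemma ksol_outside i (lam : R) (h u w : R -> R[i]) :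
  ksol (chalf i (aend i)) mu rho lam h u w <-> ksol (chalf i (aend i)) mu0 rho0 lam h u w.
Proof.
split=> -[s1 s2]; split.
- by apply: rsol_coef s1; [exact: chalf_interval|move=> t /outside/hmu0|move=> t /outside/hrho0].
- by apply: rsol_coef s2; [exact: chalf_interval|move=> t /outside/hmu0|move=> t /outside/hrho0].
- by apply: rsol_coef s1; [exact: chalf_interval|move=> t /outside/hmu0|move=> t /outside/hrho0].
- by apply: rsol_coef s2; [exact: chalf_interval|move=> t /outside/hmu0|move=> t /outside/hrho0].
Qed.

(** On the half-lines the coefficients are periodic and the source is absent,
    so that the half-line theory applies to the restrictions of [u]. *)
Lemma line_solution (eps : R) u : weak_sol setT mu rho (omega ^+ 2 +i* eps) f u ->
  let w := flux setT mu u in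
  [/\ L2 I u, L2 I w,
      ksol J mu rho (omega ^+ 2) (fun t => f t + (0 +i* (rho t * eps)) * u t) u w &
      forall i, [/\ ksol (chalf i (aend i)) mu0 rho0 (omega ^+ 2)
          (fun t => (0 +i* (rho0 t * eps)) * u t) u w,
        csq (chalf i (aend i)) u & csq (chalf i (aend i)) w]].
Proof.
move=> ws w; have T0 : exists x, (setT : set R) x by exists 0.
have [s Lu Lw _] := weak_sol_ksol openT iT T0 hmu hrho hf ws.
rewrite closureT /= in s.
have mI : measurable I by exact: measurable_itv.
have [u1 u2] := (L2_parts _ mT).1 Lu; have [w1 w2] := (L2_parts _ mT).1 Lw.
have mc i a : measurable (chalf i a : set R) by exact: chalf_meas.
have cu i : csq (chalf i (aend i)) u by split; exact: sqint_line.
have cw i : csq (chalf i (aend i)) w by split; exact: sqint_line.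
split.
- by apply/(L2_parts _ mI); split; exact: (sqint_sub mT mI (@subsetT _ _)).
- by apply/(L2_parts _ mI); split; exact: (sqint_sub mT mI (@subsetT _ _)).
- exact: ksol_sub s.
- move=> i; split=> //.
  have sk : ksol (chalf i (aend i)) mu rho (omega ^+ 2) (fun t => (0 +i* (rho t * eps)) * u t) u w.
    apply: drop_source (ksol_sub (@subsetT _ _) s) => //.
    + apply: ae_imp (zero_off_support hsupp) => t H It; apply: H.
      rewrite /= in_itv /= => h; apply: (@outside i t) h.
      by rewrite -closure_halfline; exact: subset_closure.
    + have [m _] := rho_sqint hrho (- eps) (mc i (aend i)) (cu i).2; move: m; congr measurable_fun.
      by apply/funext => t; rewrite /re cReM /= /im; ring.
    + have [m _] := rho_sqint hrho eps (mc i (aend i)) (cu i).1; move: m; congr measurable_fun.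
      by apply/funext => t; rewrite /im cImM /= /re; ring.
    + exact: coef_meas.
  have := (ksol_outside _ _ _ _ _).1 sk; move/(ksol_ext (@chalf_interval _ _ _)); apply=> // t.
  by move/outside/hrho0 => ->.
Qed.

Let scale_sol i (lam : R) (c : R[i]) u w : ksol (chalf i (aend i)) mu rho lam (fun=> 0) u w ->
  ksol (chalf i (aend i)) mu rho lam (fun=> 0) (fun t => c * u t) (fun t => c * w t).
Proof.
move=> s; apply: (ksol_ext (@chalf_interval _ _ _) (ksol_add c 0 (@chalf_interval _ _ _) s s)) => t _.
- by rewrite mulr0 mul0r addr0.
- by rewrite mul0r addr0.
- by rewrite mul0r addr0.
Qed.

Let csq_scale i (c : R[i]) u : csq (chalf i (aend i)) u -> csq (chalf i (aend i)) (fun t => c * u t).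
Proof.
have mc := chalf_meas i (aend i).
move=> [u1 u2]; split.
  rewrite (_ : re _ = fun t => complex.Re c * re u t + - complex.Im c * im u t).
    by apply: sqint_add => //; exact: sqint_scale.
  by apply/funext => t; rewrite /re cReM /im; ring.
rewrite (_ : im _ = fun t => complex.Re c * im u t + complex.Im c * re u t).
  by apply: sqint_add => //; exact: sqint_scale.
by apply/funext => t; rewrite /im cImM /re; ring.
Qed.

(** A nonzero solution of the homogeneous interior problem extends to both
    half-lines, where it is square-integrable: it is an eigenfunction, and
    its eigenvalue is isolated since it lies in a gap of the periodic medium. *)
Lemma gap_inj (Lam : side -> R[i]) :
  resolvent_set mu0 rho0 (omega ^+ 2)%:C -> ~ discrete_spectrum mu rho (omega ^+ 2)%:C ->
  (forall i, gap_RtR mup rhop th1 th2 z omega i (aend i) (Lam i)) ->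
  forall u w, ksol J mu rho (omega ^+ 2) (fun=> 0) u w ->
  (forall i, robin_defect al ar z Lam i u w = 0) -> forall t, J t -> u t = 0 /\ w t = 0.
Proof.
move=> res nd gap u w s def.
have z0 : z != 0 by rewrite gt_eqF.
have ext i : exists v k, [/\ ksol (chalf i (aend i)) mu rho (omega ^+ 2) (fun=> 0) v k,
    csq (chalf i (aend i)) v, csq (chalf i (aend i)) k, v (aend i) = u (aend i) &
    k (aend i) = w (aend i)].
  have [e [ws eP eM]] := gap i.
  have [se qe qk] := half_line_sol (cmu0 0) (crho0 0) ws; set k := flux _ _ _ in se qk.
  pose c := Rp i z (u (aend i)) (w (aend i)).
  have {}se : ksol (chalf i (aend i)) mu rho (omega ^+ 2) (fun=> 0) e k.
    apply/ksol_outside; apply: (ksol_ext (@chalf_interval _ _ _) se) => // t _ /=.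
    by rewrite mulr0 (_ : 0 +i* 0 = 0)// mul0r.
  exists (fun t => c * e t), (fun t => c * k t).
  have eP' : Rp i z (e (aend i)) (k (aend i)) = 1 by [].
  have eM' : Rm i z (e (aend i)) (k (aend i)) = Lam i by [].
  have dP : Rp i z (c * e (aend i) - u (aend i)) (c * k (aend i) - w (aend i)) = 0.
    by rewrite RpB eP' mulr1 subrr.
  have dM : Rm i z (c * e (aend i) - u (aend i)) (c * k (aend i) - w (aend i)) = 0.
    have := def i; rewrite /robin_defect -/c -eM' => /eqP; rewrite subr_eq0 => /eqP h.
    by rewrite RmB h mulrC subrr.
  have [/eqP h1 /eqP h2] := robin_zero z0 dP dM.
  split; [exact: scale_sol|exact: csq_scale|exact: csq_scale|..]; apply/eqP; rewrite -subr_eq0.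
    exact: h1.
  exact: h2.
have [vl [kl [sl ql1 ql2 el1 el2]]] := ext Lside; have [vr [kr [sr qr1 qr2 er1 er2]]] := ext Rside.
rewrite /= in sl ql1 ql2 el1 el2 sr qr1 qr2 er1 er2.
pose U t : R[i] := piece al ar (re vl) (re u) (re vr) t +i* piece al ar (im vl) (im u) (im vr) t.
pose W t : R[i] := piece al ar (re kl) (re w) (re kr) t +i* piece al ar (im kl) (im w) (im kr) t.
have S : ksol setT mu rho (omega ^+ 2) (fun=> 0) U W.
  split.
    have [[s1 _] [sl1 _] [sr1 _]] := And3 s sl sr.
    exact: (glue3 alr sl1 s1 sr1 (congr1 (@complex.Re R) el1) (congr1 (@complex.Re R) el2)
      (congr1 (@complex.Re R) (esym er1)) (congr1 (@complex.Re R) (esym er2))).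
  have [[_ s1] [_ sl1] [_ sr1]] := And3 s sl sr.
  exact: (glue3 alr sl1 s1 sr1 (congr1 (@complex.Im R) el1) (congr1 (@complex.Im R) el2)
      (congr1 (@complex.Im R) (esym er1)) (congr1 (@complex.Im R) (esym er2))).
have LU : L2 setT U.
  apply/(L2_parts _ mT); split.
    by apply: (sqint_piece alr S.1.1 (congr1 (@complex.Re R) el1) (congr1 (@complex.Re R) (esym er1)) ql1.1 qr1.1).
  by apply: (sqint_piece alr S.2.1 (congr1 (@complex.Im R) el1) (congr1 (@complex.Im R) (esym er1)) ql1.2 qr1.2).
have LW : L2 setT W.
  apply/(L2_parts _ mT); split.
    by apply: (sqint_piece alr S.1.2 (congr1 (@complex.Re R) el2) (congr1 (@complex.Re R) (esym er2)) ql2.1 qr2.1).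
  by apply: (sqint_piece alr S.2.2 (congr1 (@complex.Im R) el2) (congr1 (@complex.Im R) (esym er2)) ql2.2 qr2.2).
have U0 t : U t = 0.
  apply/eqP; apply: contrapT => /negP Ut; apply: nd.
  by apply: (eigen_discrete hmu hrho (cmu0 0) (crho0 0) alr hmu0 hrho0 res S LU LW); exists t.
have u0 t : J t -> u t = 0.
  move=> /itv_ccP/andP[t1 t2]; apply: eq_parts.
    have := congr1 (@complex.Re R) (U0 t); rewrite /= piece_mid//.
    exact: (congr1 (@complex.Re R) el1).
  have := congr1 (@complex.Im R) (U0 t); rewrite /= piece_mid//.
  exact: (congr1 (@complex.Im R) el1).
(* then the flux is constant, and zero because its integral against 1 / mu is *)
have flux0 (v k : R -> R) : rsol J mu rho (omega ^+ 2) (fun=> 0) v k ->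
    (forall t, J t -> v t = 0) -> forall t, J t -> k t = 0.
  move=> [p q] v0 t Jt; have iJ : is_interval J by exact: interval_is_interval.
  have Jal : J al by rewrite /= in_itv/= lexx. have Jar : J ar by rewrite /= in_itv/= alr lexx.
  have k0 : prim J k (fun=> 0).
    by apply: (prim_ext iJ q) => // r Jr; rewrite v0// mulr0 addr0 oppr0.
  have kc r : J r -> k r = k t by move=> Jr; exact: prim_const0 k0 Jr Jt.
  have [i1] := p _ _ Jal Jar alr; rewrite !v0// subrr.
  have [Km Km0 HKm] := coef_le hmu.
  have imu : intg J (fun r => (mu r)^-1).
    have [Ki Ki0 HKi] := coef_inv_le hmu.
    apply: (@intg_le _ _ _ (fun=> Ki)) => //; [exact: coef_inv_meas|exact: intg_cst].
  rewrite (@int_eq _ _ _ (fun r => k t * (mu r)^-1)); last by move=> r Jr; rewrite kc// mulrC.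
  rewrite int_scale//.
  move/esym/eqP; rewrite mulf_eq0 => /orP[/eqP//|/eqP h0].
  have : Km^-1 * (ar - al) <= lint J (fun r => (mu r)^-1).
    rewrite -int_cst//; apply: int_le => //; first exact: intg_cst.
    move=> r _; rewrite lef_pV2 ?posrE//; last exact: (coef_gt0 r hmu).
    by apply: le_trans (HKm r); exact: ler_norm.
  rewrite h0 pmulr_rle0 ?invr_gt0// subr_le0 => h.
  by move: (lt_le_trans halr h); rewrite ltxx.
move=> t Jt; split; first exact: u0.
apply: eq_parts.
  by apply: (flux0 _ _ s.1) => // r Jr; rewrite /re u0.
by apply: (flux0 _ _ s.2) => // r Jr; rewrite /im u0.
Qed.

(** Here the defects are of size [sqrt eps]: [u_eps] is compared with the
    half-line solution of the same frequency without absorption. *)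
Lemma gap_case :
  ~ spectrum mu0 rho0 (omega ^+ 2)%:C -> ~ discrete_spectrum mu rho (omega ^+ 2)%:C ->
  forall Lam : side -> R[i],
  (forall i, gap_RtR mup rhop th1 th2 z omega i (aend i) (Lam i)) ->
  interior_wellposed al ar mu rho omega z Lam /\
  forall (uint : R -> R[i]) (u_ : R -> R -> R[i]),
    interior_sol al ar mu rho omega z Lam f uint ->
    (forall eps : R, 0 < eps ->
       weak_sol setT mu rho (omega ^+ 2 +i* eps) f (u_ eps)) ->
    H1norm I (fun x => u_ eps x - uint x) @[eps --> (0 : R)^'+] --> (0 : R).
Proof.
move=> /contrapT res nd Lam gap; have inj := gap_inj res nd gap.
split; first exact: wellposed_of_inj.
move=> uint u_ hu hu_.
have mI : measurable I by exact: measurable_itv.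
have LfI : L2 I f.
  have [f1 f2] := (L2_parts _ mT).1 hf.
  by apply/(L2_parts _ mI); split; exact: (sqint_sub mT mI (@subsetT _ _)).
have [C C0 HC] : exists2 C, 0 <= C & forall i (e : R), 0 < e ->
    n1 (robin_defect al ar z Lam i (u_ e) (flux setT mu (u_ e))) <= Num.sqrt (C * e) *
    n1 (Rp i z (u_ e (aend i)) (flux setT mu (u_ e) (aend i))).
  have one i : exists2 C, 0 <= C & forall e : R, 0 < e ->
      n1 (robin_defect al ar z Lam i (u_ e) (flux setT mu (u_ e))) ^+ 2 <= C * e *
      n1 (Rp i z (u_ e (aend i)) (flux setT mu (u_ e) (aend i))) ^+ 2.
    have [v [ws eP eM]] := gap i.
    have [sv [qv1 qv2] [qk1 qk2]] := half_line_sol (cmu0 0) (crho0 0) ws; set k := flux _ _ _ in sv qk1 qk2.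
    have {}sv : ksol (chalf i (aend i)) mu0 rho0 (omega ^+ 2) (fun=> 0) v k.
      apply: (ksol_ext (@chalf_interval _ _ _) sv) => // t _ /=.
      by rewrite mulr0 (_ : 0 +i* 0 = 0)// mul0r.
    have eP' : Rp i z (v (aend i)) (k (aend i)) = 1 by [].
    have eM' : Rm i z (v (aend i)) (k (aend i)) = Lam i by [].
    have [C C0 HC] := half_defect (crho0 0) hz sv qv1 qv2 qk1 qk2 eP' eM'.
    exists C => // e e0; have [_ _ _ /(_ i)[se [qu1 qu2] [qw1 qw2]]] := line_solution (hu_ e e0).
    exact: HC.
  have [Cl Cl0 HCl] := one Lside; have [Cr Cr0 HCr] := one Rside.
  exists (Cl + Cr) => [|i e e0]; first exact: addr_ge0.
  have CC : 0 <= (Cl + Cr) * e by rewrite mulr_ge0 ?addr_ge0// ltW.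
  rewrite -[leLHS]ger0_norm ?n1_ge0//; apply: le_sqrt_scale => //; first exact: n1_ge0.
  case: i; [apply: le_trans (HCl e e0) _|apply: le_trans (HCr e e0) _];
    apply: ler_wpM2r; rewrite ?sqr_ge0// ler_wpM2r ?(ltW e0)// ?lerDl ?lerDr//.
apply/cvgrPdist_lt => e e0.
have [eta eta0 Heta] := converge_of_inj hmu hrho halr hz inj LfI hu e0.
have h20 : 0 < eta / 2 by rewrite divr_gt0.
near=> eps.
have eps0 : 0 < eps by near: eps; exact: nbhs_right_gt.
have small1 : eps < eta / 2 by near: eps; exact: nbhs_right_lt.
have small2 : eps < (eta / 2) ^+ 2 / (C + 1).
  by near: eps; apply: nbhs_right_lt; rewrite divr_gt0 ?exprn_gt0// ltr_wpDl.
have tau : Num.sqrt (C * eps) <= eta / 2.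
  rewrite -[leRHS]ger0_norm ?(ltW h20)// -sqrtr_sqr; apply: ler_wsqrtr.
  move: small2; rewrite ltr_pdivlMr ?ltr_wpDl// => h.
  have := ltW eps0; lra.
have [Lu Lw sJ _] := line_solution (hu_ eps eps0).
rewrite sub0r normrN ger0_norm ?sqrtr_ge0//.
apply: (Heta eps (Num.sqrt (C * eps)) (u_ eps) _ (ltW eps0) (sqrtr_ge0 _) _ Lu Lw sJ).
  by rewrite [ltRHS](splitr eta) ltr_leD.
by move=> i; exact: HC.
Unshelve. all: by end_near.
Qed.

End setting.

(** * Absorbing half-lines and cells *)

Section absorbing.
Context {R : realType}.
Implicit Types (i : side) (a lam eps : R) (u w v k : R -> R[i]).

(** With absorption the square-integrable solutions on a half-line are unique
    up to a factor: their Wronskian is constant and integrable. *)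
Lemma absorbing_wronskian i a (mu rho : R -> R) lam eps u w v k :
  ksol (chalf i a) mu rho lam (fun t => (0 +i* (rho t * eps)) * u t) u w ->
  ksol (chalf i a) mu rho lam (fun t => (0 +i* (rho t * eps)) * v t) v k ->
  csq (chalf i a) u -> csq (chalf i a) w -> csq (chalf i a) v -> csq (chalf i a) k ->
  u a * k a - w a * v a = 0.
Proof.
move=> su sv [u1 u2] [w1 w2] [v1 v2] [k1 k2].
have iD := @chalf_interval _ i a; have mD := chalf_meas i a.
have [p q] := cwronskian iD su sv.
have z t : (0 +i* (rho t * eps)) * u t * v t - u t * ((0 +i* (rho t * eps)) * v t) = 0.
  by rewrite mulrCA mulrA subrr.
have i0 : intg (chalf i a) (fun=> 0 : R) by exact: intg0.
have p0 : prim (chalf i a) (re (cW u w v k)) (fun=> 0).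
  by apply: (prim_ext iD p) => // t _; rewrite /re z.
have q0 : prim (chalf i a) (im (cW u w v k)) (fun=> 0).
  by apply: (prim_ext iD q) => // t _; rewrite /im z.
have ip (f g f' g' : R -> R) : sqint (chalf i a) f -> sqint (chalf i a) g ->
    sqint (chalf i a) f' -> sqint (chalf i a) g' ->
    intg (chalf i a) (fun t => f t * g t) /\ intg (chalf i a) (fun t => f' t * g' t).
  by move=> *; split; exact: sqint_prod.
apply: eq_parts.
  have := decay p0 _ i0; rewrite int_zero// mulr0; apply.
  rewrite (_ : re _ = fun t => (re u t * re k t - im u t * im k t) - (re w t * re v t - im w t * im v t)).
    by apply: intg_sub2 => //; apply: intg_sub2 => //; exact: sqint_prod.
  by apply/funext => t; rewrite /re /cW cReD cReN !cReM.
have := decay q0 _ i0; rewrite int_zero// mulr0; apply.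
rewrite (_ : im _ = fun t => (re u t * im k t + im u t * re k t) - (re w t * im v t + im w t * re v t)).
  by apply: intg_sub2 => //; apply: intg_add => //; exact: sqint_prod.
by apply/funext => t; rewrite /im /cW cImD cImN !cImM.
Qed.

Lemma rsol_translate i a (mu rho mu' rho' : R -> R) lam (h u w : R -> R) :
  (forall t, mu' t = mu (t + a)) -> (forall t, rho' t = rho (t + a)) ->
  rsol (chalf i a) mu rho lam h u w ->
  rsol (chalf i 0) mu' rho' lam (fun t => h (t + a)) (fun t => u (t + a)) (fun t => w (t + a)).
Proof.
move=> em er [p q]; have s1 : (1 : R) ^+ 2 = 1 by rewrite expr1n.
have E : (fun t => 1 * t + a) @^-1` (chalf i a) = chalf i 0.
  by case: i {p q}; apply/seteqP; split => t; rewrite /= !in_itv/= ?andbT; lra.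
have := prim_affine a s1 p; have := prim_affine a s1 q; rewrite E => q' p'.
have iD := @chalf_interval _ i (0 : R).
split; [apply: (prim_ext iD p')|apply: (prim_ext iD q')] => t _; rewrite ?mul1r ?em ?er//.
Qed.

Lemma sqint_translate i a (f b : R -> R) : prim (chalf i 0) (fun t => f (t + a)) b ->
  sqint (chalf i a) f -> sqint (chalf i 0) (fun t => f (t + a)).
Proof.
move=> p [_ fi]; split; first exact: prim_meas (chalf_meas i 0) p.
have s1 : (1 : R) ^+ 2 = 1 by rewrite expr1n.
have E : (fun t => 1 * t + a) @^-1` (chalf i a) = chalf i 0.
  by case: i {p fi}; apply/seteqP; split => t; rewrite /= !in_itv/= ?andbT; lra.
have [_ + _] := lint_affine a s1 (chalf_meas i a) fi; rewrite E.
by congr (intg _ _); apply/funext => t /=; rewrite mul1r.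
Qed.

Lemma ksol_translate i a (mu rho mu' rho' : R -> R) lam (h u w : R -> R[i]) :
  (forall t, mu' t = mu (t + a)) -> (forall t, rho' t = rho (t + a)) ->
  ksol (chalf i a) mu rho lam h u w -> csq (chalf i a) u -> csq (chalf i a) w ->
  [/\ ksol (chalf i 0) mu' rho' lam (fun t => h (t + a)) (fun t => u (t + a)) (fun t => w (t + a)),
      csq (chalf i 0) (fun t => u (t + a)) & csq (chalf i 0) (fun t => w (t + a))].
Proof.
move=> em er [s1 s2] [u1 u2] [w1 w2].
have t1 := rsol_translate em er s1; have t2 := rsol_translate em er s2.
split; first by split.
  by split; [exact: sqint_translate t1.1 u1|exact: sqint_translate t2.1 u2].
by split; [exact: sqint_translate t1.2 w1|exact: sqint_translate t2.2 w2].
Qed.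

End absorbing.

Section cell_estimate.
Context {R : realType}.
Variables (mu rho : R -> R) (i : side) (lam len z : R).
Hypotheses (hmu : line_coefficient mu) (hrho : line_coefficient rho).
Hypotheses (len0 : 0 < len) (hz : 0 < z).
Implicit Types (u w : R -> R[i]).

Let m : R := if i is Rside then 0 else - len.
Let M : R := if i is Rside then len else 0.
Local Notation D := (`[m, M]%classic : set R).

Let mM : m < M. Proof. by rewrite /m /M; case: (i); rewrite ?oppr_lt0. Qed.
Let D0 : D 0.
Proof. by rewrite /m /M; case: (i); rewrite /= in_itv/= lexx ?oppr_le0 ltW. Qed.
Let Db : D (orient i * len).
Proof.
rewrite /m /M; case: (i); rewrite /= in_itv/= ?mulN1r ?mul1r lexx ?andbT ?oppr_le0 ltW//.
Qed.
Let DH : D `<=` chalf i 0.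
Proof.
move=> t; rewrite /m /M; case: (i); rewrite /= !in_itv/= ?andbT => /andP[]//.
Qed.

Lemma cell_bounds : cell i len = (`]m, M[%classic : set R).
Proof. by rewrite /cell /m /M; case: (i). Qed.

Lemma closure_cell : closure (cell i len) = D.
Proof. by rewrite cell_bounds; exact: closure_open_interval. Qed.

Lemma cell_sol e : weak_sol (cell i len) mu rho lam%:C (cst 0) e ->
  ksol D mu rho lam (fun=> 0) e (flux (cell i len) mu e).
Proof.
have oI : open (cell i len) by rewrite cell_bounds; exact: interval_open.
have iI : is_interval (cell i len) by rewrite cell_bounds; exact: interval_is_interval.
have I0 : exists x, (cell i len) x.
  by exists ((m + M) / 2); rewrite cell_bounds /= in_itv/= !midf_lt.
move=> ws; have [s _ _ _] := weak_sol_ksol oI iI I0 hmu hrho (L2_zero (open_measurable oI)) ws.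
rewrite closure_cell in s; apply: (ksol_ext (@interval_is_interval _ _) s) => // t _ /=.
by rewrite mulr0 (_ : 0 +i* 0 = 0)// mul0r addr0.
Qed.

Variables (e0 k0 e1 k1 : R -> R[i]) (t00 t10 : R[i]).
Hypotheses (s0 : ksol D mu rho lam (fun=> 0) e0 k0) (s1 : ksol D mu rho lam (fun=> 0) e1 k1).
Local Notation b := (orient i * len).
Hypotheses (P0 : Rp i z (e0 0) (k0 0) = 1) (M0b : Rm i z (e0 b) (k0 b) = 0).
Hypotheses (P1 : Rp i z (e1 0) (k1 0) = 0) (M1b : Rm i z (e1 b) (k1 b) = 1).
Hypotheses (M0 : Rm i z (e0 0) (k0 0) = t00) (M1 : Rm i z (e1 0) (k1 0) = t10).

Let iD : is_interval D. Proof. exact: interval_is_interval. Qed.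
Let mD : measurable D. Proof. exact: measurable_itv. Qed.

Let prim_zero_const (F f : R -> R) x y : prim D F f -> (forall t, D t -> f t = 0) ->
  D x -> D y -> F x = F y.
Proof.
move=> p f0; apply: prim_const0; apply: (prim_ext iD p) => // t Dt; exact: f0.
Qed.

(** Reciprocity in the cell, from the Wronskian of its two basis solutions. *)
Lemma reciprocity : Rp i z (e0 b) (k0 b) = t10.
Proof.
have [p q] := cwronskian iD s0 s1.
have zz t : 0 * e1 t - e0 t * 0 = 0 by rewrite mul0r mulr0 subrr.
have c : cW e0 k0 e1 k1 0 = cW e0 k0 e1 k1 b.
  apply: eq_parts; [apply: (prim_zero_const p _ D0 Db)|apply: (prim_zero_const q _ D0 Db)] => t _.
    by rewrite /re zz.
  by rewrite /im zz.
have h0 := robin_wronskian i z (e0 0) (k0 0) (e1 0) (k1 0).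
have hb := robin_wronskian i z (e0 b) (k0 b) (e1 b) (k1 b).
rewrite P0 M0 P1 M1 mul1r mulr0 subr0 in h0.
rewrite M0b M1b mulr1 mul0r subr0 in hb.
rewrite h0 hb; congr (_ * _); apply/eqP; rewrite -eqr_opp !opprB; apply/eqP.
exact/esym.
Qed.

(** The coefficient of the half-line with absorption, expressed by the symbols
    of a cell without absorption, up to a term controlled by the dissipated
    energy. *)
Lemma cell_defect : exists2 C, 0 <= C & forall eps u w, 0 < eps ->
  ksol (chalf i 0) mu rho lam (fun t => (0 +i* (rho t * eps)) * u t) u w ->
  csq (chalf i 0) u -> csq (chalf i 0) w -> Rp i z (u 0) (w 0) = 1 ->
  n1 (Rm i z (u 0) (w 0) - (t00 + Rm i z (u b) (w b) * t10)) ^+ 2 <= C * eps.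
Proof.
have [Kr Kr0 HKr] := coef_le hrho.
have [mr [c [d [c0 cd]]]] := hrho.
have [B B0 HB] : exists2 B, 0 <= B & forall t, D t -> n1 (e0 t) <= B.
  by have [B B0 HB] := ksol_bounded (ltW mM) s0; exists B => // t /HB[].
pose S := Num.sqrt (M - m); have S0 : 0 <= S by exact: sqrtr_ge0.
pose K := Kr * B * S * (2 * z).
have K0 : 0 <= K.
  by apply: mulr_ge0; [apply: mulr_ge0 => //; apply: mulr_ge0 => //; exact: ltW|rewrite mulr_ge0// ltW].
exists (K ^+ 2 * 2 / (4 * z * c)).
  apply: divr_ge0; first by rewrite mulr_ge0// sqr_ge0.
  by apply: mulr_ge0; [rewrite mulr_ge0// ltW|exact: ltW].
move=> eps u w eps0 s [u1 u2] [w1 w2] P.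
have mc := chalf_meas i (0 : R).
(* the energy dissipated on the half-line bounds [eps] times the square of
   the L2 norm of [u] *)
have en := half_energy hrho z s u1 u2 w1 w2; set E := lint _ _ in en.
pose p := nrm (chalf i 0) (re u); pose q := nrm (chalf i 0) (im u).
have p0 : 0 <= p by exact: nrm_ge0. have q0 : 0 <= q by exact: nrm_ge0.
have iu : intg (chalf i 0) (fun t => re u t ^+ 2 + im u t ^+ 2) by exact: intg_add mc u1.2 u2.2.
have pq : c * (p ^+ 2 + q ^+ 2) <= E.
  rewrite !nrm_sqr -int_add//; [|exact: u1.2|exact: u2.2].
  rewrite -int_scale//; apply: int_le => //; first exact: intg_scale.
    by apply: (intg_mul mc (coef_meas hrho mc) (fun t _ => HKr t)) iu.
  move=> t _; rewrite ler_wpM2r ?addr_ge0 ?sqr_ge0//; by have /andP[] := cd t.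
have EP : 4 * z * eps * E <= 1.
  rewrite -en P (_ : normc 1 = 1 :> R); last exact: normc1.
  by rewrite expr1n gerBl sqr_ge0.
have zc : 0 < 4 * z * c by rewrite !mulr_gt0.
have epq : eps * (p ^+ 2 + q ^+ 2) <= (4 * z * c)^-1.
  rewrite -[leRHS]mul1r ler_pdivlMr//.
  have := ler_wpM2l (ltW (mulr_gt0 (mulr_gt0 (ltr0n _ 4 : (0 < 4 :> R)) hz) eps0)) pq; lra.
(* of the two solutions only [u] has a source, proportional to [eps] *)
have su : ksol D mu rho lam (fun t => (0 +i* (rho t * eps)) * u t) u w := ksol_sub DH s.
have [a1 a2] := cwronskian iD su s0.
set h := fun t : R => _ - _ in a1 a2.
have hb t : D t -> n1 (h t) <= eps * Kr * B * n1 (u t).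
  move=> Dt; rewrite /h mulr0 subr0; apply: le_trans (n1M _ _) _.
  apply: le_trans (ler_wpM2r (n1_ge0 _) (n1M _ _)) _.
  rewrite {1}/n1 /= normr0 add0r normrM (gtr0_norm eps0).
  have := HKr t; have := HB t Dt; have n0 := n1_ge0 (u t); have n0' := n1_ge0 (e0 t) => hB hK.
  rewrite [`|rho t| * eps]mulrC -!mulrA ler_pM2l// ler_pM ?mulr_ge0//.
  by rewrite mulrC ler_wpM2r.
have uD : csq D u by split; [exact: (sqint_sub mc mD DH u1)|exact: (sqint_sub mc mD DH u2)].
have q1 : sqint D (fun=> 1 : R).
  by split; [exact: measurable_cst|exact: intg_cst].
have one (f : R -> R) : sqint D f -> intg D f /\ lint D (fun t => `|f t|) <= S * nrm D f.
  move=> qf; split.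
    have := sqint_prod mD q1 qf; congr (intg _ _); apply/funext => t /=; exact: mul1r.
  have qn : sqint D (fun t => `|f t|).
    split; first by apply: measurableT_comp => //; exact: qf.1.
    by have := qf.2; congr (intg _ _); apply/funext => t /=; rewrite real_normK ?num_real.
  have := cauchy_schwarz_nrm mD q1 qn; rewrite (@int_eq _ _ _ (fun t => `|f t|)); last by move=> t _; exact: mul1r.
  move/(le_trans (ler_norm _)) => h1; apply: le_trans h1 _; apply: ler_pM; rewrite ?nrm_ge0//.
    apply: nrm_le => //; rewrite (@int_eq _ _ _ (fun=> 1)); last by move=> t _; rewrite expr1n.
    by rewrite int_cst ?(ltW mM)// mul1r sqr_sqrtr// subr_ge0 ltW.
  apply: nrm_le; first exact: nrm_ge0.
  by rewrite nrm_sqr (@int_eq _ _ _ (fun t => f t ^+ 2))// => t _; rewrite real_normK ?num_real.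
have [iu1 lu1] := one _ uD.1; have [iu2 lu2] := one _ uD.2.
have inu : intg D (fun t => n1 (u t)) by apply: intg_add => //; exact: intg_norm.
have lu : lint D (fun t => n1 (u t)) <= S * (p + q).
  rewrite int_add//; [|exact: intg_norm..]; rewrite mulrDr; apply: lerD.
    by apply: le_trans lu1 _; rewrite ler_wpM2l//; exact: nrm_subset.
  by apply: le_trans lu2 _; rewrite ler_wpM2l//; exact: nrm_subset.
have Jm : D m by rewrite /= in_itv/= lexx ltW. have JM : D M by rewrite /= in_itv/= lexx ltW.
have [ih1 _] := a1 _ _ Jm JM (ltW mM); have [ih2 _] := a2 _ _ Jm JM (ltW mM).
have diff : n1 (cW u w e0 k0 0 - cW u w e0 k0 b) <= eps * (Kr * B * (S * (p + q))).
  apply: (@le_trans _ _ (lint D (fun t => n1 (h t)))).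
    rewrite int_add//; [|exact: intg_norm..].
    rewrite {1}/n1 cReD cImD cReN cImN.
    by apply: lerD; [exact: prim_osc a1 Db D0|exact: prim_osc a2 Db D0].
  apply: (@le_trans _ _ (lint D (fun t => eps * Kr * B * n1 (u t)))).
    apply: int_le => //; [by apply: intg_add => //; exact: intg_norm|exact: intg_scale].
  rewrite int_scale// -!mulrA; apply: ler_wpM2l; first exact: ltW.
  apply: ler_wpM2l; first exact: ltW. by apply: ler_wpM2l.
have id : Rm i z (u 0) (w 0) - (t00 + Rm i z (u b) (w b) * t10) =
    2%:R * (0 +i* z) * (orient i)%:C * (cW u w e0 k0 0 - cW u w e0 k0 b).
  have h0 := robin_wronskian i z (u 0) (w 0) (e0 0) (k0 0).
  have hbb := robin_wronskian i z (u b) (w b) (e0 b) (k0 b).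
  rewrite P P0 M0 mul1r mulr1 in h0; rewrite M0b mulr0 sub0r reciprocity in hbb.
  rewrite /cW; move: h0 hbb; set A := 2%:R * _ * _; set X := Rm i z (u 0) (w 0).
  set Y := Rm i z (u b) (w b) * t10.
  move: (u 0) (w 0) (e0 0) (k0 0) (u b) (w b) (e0 b) (k0 b) => x1 x2 x3 x4 y1 y2 y3 y4 h0 hbb.
  transitivity (- (t00 - X) + (- Y)); first by ring.
  by rewrite h0 hbb; ring.
have n2 : n1 (2%:R * (0 +i* z) * (orient i)%:C) <= 2 * z.
  apply: le_trans (n1M _ _) _.
  have -> : n1 (orient i)%:C = 1 :> R by rewrite /n1/= normr0 addr0; case: (i); rewrite /= ?normrN normr1.
  rewrite mulr1; apply: le_trans (n1M _ _) _.
  rewrite {2}/n1/= normr0 add0r gtr0_norm//; apply: ler_wpM2r; first exact: ltW.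
  have -> : 2%:R = (2 : R)%:C :> R[i] by apply/eqP; rewrite eq_complex /= addr0 !eqxx.
  by rewrite /n1/= normr0 addr0 ger0_norm ?ler0n.
have fin : n1 (Rm i z (u 0) (w 0) - (t00 + Rm i z (u b) (w b) * t10)) <= K * (eps * (p + q)).
  rewrite id; apply: le_trans (n1M _ _) _.
  apply: (@le_trans _ _ (2 * z * (eps * (Kr * B * (S * (p + q)))))).
    by apply: ler_pM => //; exact: n1_ge0.
  by rewrite /K; lra.
have pq0 : 0 <= p + q by exact: addr_ge0.
apply: (@le_trans _ _ ((K * (eps * (p + q))) ^+ 2)).
  by rewrite ler_pXn2r ?nnegrE ?n1_ge0// mulr_ge0// mulr_ge0// ltW.
have -> : (K * (eps * (p + q))) ^+ 2 = K ^+ 2 * (eps ^+ 2 * (p + q) ^+ 2) by ring.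
apply: (@le_trans _ _ (K ^+ 2 * (eps * (2 * (eps * (p ^+ 2 + q ^+ 2)))))).
  apply: ler_wpM2l; first exact: sqr_ge0.
  rewrite expr2 -mulrA; apply: ler_wpM2l; first exact: ltW.
  rewrite [leRHS]mulrCA; apply: ler_wpM2l; first exact: ltW.
  have := sqr_ge0 (p - q); lra.
have -> : K ^+ 2 * 2 / (4 * z * c) * eps = K ^+ 2 * (eps * (2 * (4 * z * c)^-1)) by ring.
apply: ler_wpM2l; first exact: sqr_ge0.
apply: ler_wpM2l; first exact: ltW.
by apply: ler_wpM2l.
Qed.

End cell_estimate.

(** * Regular frequencies *)

Lemma Re_conjM {R : realType} (x y : R[i]) :
  complex.Re (x * conjc y) = complex.Re x * complex.Re y + complex.Im x * complex.Im y.
Proof. by case: x => a b; case: y => c d /=; rewrite mulrN opprK. Qed.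

Section regular.
Context {R : realType}.
Variables (mup rhop : R * R -> R) (th1 th2 z omega : R).
Hypotheses (hmup : periodic_coefficient mup) (hrhop : periodic_coefficient rhop).
Hypotheses (hth2 : 0 < th2) (hz : 0 < z).
Variables (al ar : R) (mu rho : R -> R).
Hypotheses (halr : al < ar) (hmu : line_coefficient mu) (hrho : line_coefficient rho).
Hypotheses (hal : al * th2 \is a Num.int) (har : ar * th2 \is a Num.int).
Hypothesis hmu0 : forall x, ~ (al < x < ar) -> mu x = fiber mup th1 th2 0 x.
Hypothesis hrho0 : forall x, ~ (al < x < ar) -> rho x = fiber rhop th1 th2 0 x.
Variable f : R -> R[i].
Hypotheses (hf : L2 setT f) (hsupp : ess_supp f `<=` `]al, ar[%classic).
Variables (eps_ : nat -> R) (t00 t10 phi0 psi0 : side -> R -> R[i]).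
Hypothesis reg : regular_along mup rhop th1 th2 z omega eps_ t00 t10 phi0 psi0.
Local Notation aend := (endpoint al ar).
Local Notation Lam i :=
  (regular_RtR th1 th2 i (aend i) (t00 i) (t10 i) (phi0 i) (psi0 i)).
Local Notation phi_ i := (phi0 i (aend i * th1)).
Local Notation psi_ i := (psi0 i (aend i * th1 + Defs.shift th1 th2 i)).

Let aint i : aend i * th2 \is a Num.int. Proof. by case: i. Qed.

(** The positive flux density prevents the limit profile from vanishing and
    makes the coefficient a strict contraction. *)
Lemma regular_contraction i : phi_ i != 0 /\ normc (Lam i) < 1.
Proof.
have [_ _ /(_ i)[_ _ _ _ [q [q0 qn /(_ (aend i * th1)) hq]]]] := reg.
have qp : 0 < q by rewrite lt_neqAle eq_sym qn.
move: hq; rewrite /flux_density Re_conjM => hq.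
have pn : phi_ i != 0.
  apply/eqP => p0; move: hq; rewrite p0 !mulr0 sub0r add0r cReN cImN => hq.
  have := sqr_ge0 (complex.Re (t10 i (aend i * th1) * psi_ i)).
  have := sqr_ge0 (complex.Im (t10 i (aend i * th1) * psi_ i)).
  lra.
split=> //.
have eX : Lam i * phi_ i = t00 i (aend i * th1) * phi_ i + t10 i (aend i * th1) * psi_ i.
  rewrite /regular_RtR mulrDl; congr (_ + _).
  by rewrite mulrC !mulrA mulfV// mul1r mulrC.
have e1 : (1 - t00 i (aend i * th1)) * phi_ i - t10 i (aend i * th1) * psi_ i = phi_ i - Lam i * phi_ i.
  by rewrite eX mulrBl mul1r opprD addrA.
have e2 : (1 + t00 i (aend i * th1)) * phi_ i + t10 i (aend i * th1) * psi_ i = phi_ i + Lam i * phi_ i.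
  by rewrite eX mulrDl mul1r addrA.
rewrite e1 e2 in hq.
have {}hq : normc (phi_ i) ^+ 2 * (1 - normc (Lam i) ^+ 2) = q.
  rewrite -hq mulrBr mulr1 -exprMn [normc _ * _]mulrC -normcM !normc2.
  set X := Lam i * _; rewrite !cReD !cImD !cReN !cImN; ring.
have n0 : 0 < normc (phi_ i) ^+ 2.
  rewrite exprn_gt0// lt_neqAle normc_ge0 andbT eq_sym; apply: contraNN pn => /eqP h.
  exact/eqP/eq0_normc.
have := qp; rewrite -hq pmulr_rgt0// subr_gt0 => h.
by rewrite -(@ltr_pXn2r _ 2) ?nnegrE ?normc_ge0// expr1n.
Qed.

(** Only the relation [sg * p = q] is known about [sg], which explains why the
    bound goes through [(sg - psi / phi) * p]. *)
Let limit_quotient (phi psi sg p q : R[i]) (d : R) : phi != 0 -> p != 0 ->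
  sg * p = q -> normc (p - phi) <= d -> normc (q - psi) <= d -> d <= normc phi / 2 ->
  normc (sg - phi^-1 * psi) <= 2 / normc phi * ((1 + normc (phi^-1 * psi)) * d).
Proof.
move=> phn pn e dp dq dph; set sig := phi^-1 * psi.
have nphi : 0 < normc phi.
  rewrite lt_neqAle normc_ge0 andbT eq_sym; apply: contraNN phn => /eqP h.
  exact/eqP/eq0_normc.
have es : sig * phi = psi by rewrite /sig mulrAC mulVf// mul1r.
have key : (sg - sig) * p = (q - psi) - sig * (p - phi).
  by rewrite mulrBl e mulrBr es; move: (sig * p) => X; ring.
have np : normc phi / 2 <= normc p.
  have := le_normcD p (phi - p); rewrite addrC subrK -(normcN (phi - p)) opprB => h.
  lra.
have h : normc (sg - sig) * normc p <= (1 + normc sig) * d.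
  rewrite -normcM key; apply: le_trans (le_normcD _ _) _; rewrite normcN normcM mulrDl mul1r.
  by apply: lerD => //; apply: ler_wpM2l => //; exact: normc_ge0.
have h2 : normc (sg - sig) * (normc phi / 2) <= (1 + normc sig) * d.
  by apply: le_trans h; apply: ler_wpM2l => //; exact: normc_ge0.
have -> : 2 / normc phi * ((1 + normc sig) * d) = (1 + normc sig) * d / (normc phi / 2).
  by field; rewrite gt_eqF.
by rewrite ler_pdivlMr// divr_gt0.
Qed.

(** The coefficient of the half-line with absorption converges to the limit
    coefficient along the sequence, and it governs the traces of the solution
    on the line. *)
Lemma regular_trace i (eta : R) : 0 < eta -> \forall j \near \oo, forall u,
  weak_sol setT mu rho (omega ^+ 2 +i* eps_ j) f u ->
  n1 (robin_defect al ar z (fun i => Lam i) i u (flux setT mu u)) <=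
  eta * n1 (Rp i z (u (aend i)) (flux setT mu u (aend i))).
Proof.
move=> eta0; have [phn _] := regular_contraction i.
have [ep ec /(_ i)[cs [lam [phi [psi [lam0 [ft _ cphi cpsi]]]]] _ _ _]] := reg.
pose s := aend i * th1.
have cmu := periodic_line_coefficient th1 th2 s hmup.
have crho := periodic_line_coefficient th1 th2 s hrhop.
have len0 : 0 < th2^-1 by rewrite invr_gt0.
have [e0 [e1 [[ws0 P0 M0b] [[ws1 P1 M1b] [E0 E1]]]]] := cs s.
have se0 := cell_sol cmu crho len0 ws0; have se1 := cell_sol cmu crho len0 ws1.
have [C C0 HC] := cell_defect crho len0 hz se0 se1 P0 M0b P1 M1b (esym E0) (esym E1).
pose T1 := t10 i s; pose sig := (phi_ i)^-1 * psi_ i.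
have nphi : 0 < normc (phi_ i).
  rewrite lt_neqAle normc_ge0 andbT eq_sym; apply: contraNN phn => /eqP h.
  exact/eqP/eq0_normc.
pose K := 2 * (2 / normc (phi_ i) * (1 + normc sig)) * (n1 T1 + 1).
have K0 : 0 < K.
  apply: mulr_gt0; last by apply: ltr_wpDl => //; exact: n1_ge0.
  apply: mulr_gt0 => //; apply: mulr_gt0; first exact: divr_gt0.
  by apply: ltr_wpDr => //; exact: normc_ge0.
pose d := Num.min (normc (phi_ i) / 2) (eta / 2 / K).
have d0 : 0 < d by rewrite lt_min !divr_gt0.
have small0 : 0 < (eta / 2) ^+ 2 / (C + 1) by rewrite divr_gt0 ?exprn_gt0 ?divr_gt0// ltr_wpDl.
have /cvgrPdist_lt/(_ _ small0) ne := ec.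
near=> j.
have d1 : normc (phi j s - phi_ i) <= d.
  by apply: ltW; near: j; apply: filterS (cphi d d0) => k h; exact: (h s).
have d2 : normc (psi j (s + Defs.shift th1 th2 i) - psi_ i) <= d.
  by apply: ltW; near: j; apply: filterS (cpsi d d0) => k h; exact: (h (s + Defs.shift th1 th2 i)).
have eps0 := ep j.
have small : eps_ j < (eta / 2) ^+ 2 / (C + 1).
  have : `|0 - eps_ j| < (eta / 2) ^+ 2 / (C + 1) by near: j; exact: ne.
  by rewrite sub0r normrN gtr0_norm.
move=> u wsu.
have [p [sg [fs [[_ [_ _ phin] _ _ _] psiE]]]] := ft j.
have [v [wsv Pv _ sgE]] := fs s.
have [sv cv ck] := half_line_sol cmu crho wsv; set k := flux _ _ _ in sv ck.
have pv : Rp i z (v 0) (k 0) = 1 by exact: Pv.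
have est := HC (eps_ j) v k eps0 sv cv ck pv.
pose LamE := Rm i z (v 0) (k 0).
have sgq : sg s * phi j s = psi j (s + Defs.shift th1 th2 i) by rewrite psiE /wtranslation addrK.
have lq := limit_quotient phn (phin s) sgq d1 d2 ltac:(by rewrite ge_min lexx).
have [_ _ _ /(_ i)[su cu cw]] := line_solution hmu hrho hmu0 hrho0 hf hsupp wsu.
set w := flux setT mu u in su cw *.
have em t : fiber mup th1 th2 s t = fiber mup th1 th2 0 (t + aend i).
  exact: fiber_translate.
have er t : fiber rhop th1 th2 s t = fiber rhop th1 th2 0 (t + aend i).
  exact: fiber_translate.
have [su' cu' cw'] := ksol_translate em er su cu cw.
have {}su' : ksol (chalf i 0) (fiber mup th1 th2 s) (fiber rhop th1 th2 s) (omega ^+ 2)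
    (fun t => (0 +i* (fiber rhop th1 th2 s t * eps_ j)) * u (t + aend i))
    (fun t => u (t + aend i)) (fun t => w (t + aend i)).
  by apply: (ksol_ext (@chalf_interval _ i 0) su') => // t _; rewrite er.
have := absorbing_wronskian su' sv cu' cw' cv ck; rewrite !add0r => W0.
have := robin_wronskian i z (u (aend i)) (w (aend i)) (v 0) (k 0).
have -> : w (aend i) * v 0 - u (aend i) * k 0 = 0 by rewrite -[LHS]opprB W0 oppr0.
rewrite pv mulr1 mulr0 => /eqP; rewrite subr_eq0 => /eqP RmE.
rewrite /robin_defect -RmE -/LamE mulrC -mulrBl.
apply: le_trans (n1M _ _) _; apply: ler_wpM2r; first exact: n1_ge0.
have -> : LamE - Lam i = (LamE - (t00 i s + sg s * T1)) + (sg s - sig) * T1.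
  by rewrite /regular_RtR -/s -/T1 -/sig mulrBl; ring.
apply: le_trans (n1D _ _) _; rewrite [leRHS](splitr eta); apply: lerD.
  have h20 : 0 <= eta / 2 by rewrite divr_ge0// ltW.
  rewrite -(@ler_pXn2r _ 2) ?nnegrE ?n1_ge0//.
  have sgE' : sg s = Rm i z (v (orient i / th2)) (k (orient i / th2)) by rewrite sgE.
  have := est; rewrite -sgE' -/LamE => h.
  apply: le_trans h _.
  move: small; rewrite ltr_pdivlMr ?ltr_wpDl// => h; have := ltW eps0; lra.
apply: le_trans (n1M _ _) _.
have n1s : n1 (sg s - sig) <= 2 * (2 / normc (phi_ i) * ((1 + normc sig) * d)).
  by apply: le_trans (n1_normc _) _; rewrite ler_pM2l.
apply: le_trans (ler_wpM2r (n1_ge0 _) n1s) _.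
have dK : d * K <= eta / 2 by rewrite -ler_pdivlMr// ge_min lexx orbT.
apply: le_trans dK; rewrite /K.
set A := 2 / normc (phi_ i) * (1 + normc sig).
have -> : 2 / normc (phi_ i) * ((1 + normc sig) * d) = A * d by rewrite /A mulrA.
have A0 : 0 <= A.
  by apply: mulr_ge0; [rewrite divr_ge0// ltW|rewrite addr_ge0// normc_ge0].
have := mulr_ge0 A0 (ltW d0); have := n1_ge0 T1; lra.
Unshelve. all: by end_near.
Qed.

Lemma regular_case : interior_wellposed al ar mu rho omega z (fun i => Lam i) /\
  forall (uint : R -> R[i]) (u_ : R -> R -> R[i]),
    interior_sol al ar mu rho omega z (fun i => Lam i) f uint ->
    (forall eps : R, 0 < eps ->
       weak_sol setT mu rho (omega ^+ 2 +i* eps) f (u_ eps)) ->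
    H1norm `]al, ar[%classic (fun x => u_ (eps_ j) x - uint x) @[j --> \oo] --> (0 : R).
Proof.
have inj := contraction_inj (Lam := fun i => Lam i) (lam := omega ^+ 2) hmu hrho (ltW halr) hz
  (fun i => (regular_contraction i).2).
split; first exact: wellposed_of_inj.
move=> uint u_ hu hu_.
have mI : measurable (`]al, ar[%classic : set R) by exact: measurable_itv.
have mT : measurable (setT : set R) by exact: measurableT.
have LfI : L2 `]al, ar[%classic f.
  have [f1 f2] := (L2_parts _ mT).1 hf.
  by apply/(L2_parts _ mI); split; exact: (sqint_sub mT mI (@subsetT _ _)).
have [ep ec _] := reg.
apply/cvgrPdist_lt => e e0.
have [eta eta0 Heta] := converge_of_inj hmu hrho halr hz inj LfI hu e0.
have h20 : 0 < eta / 2 by rewrite divr_gt0.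
have /cvgrPdist_lt/(_ _ h20) ne := ec.
near=> j.
have small : eps_ j < eta / 2.
  have : `|0 - eps_ j| < eta / 2 by near: j; exact: ne.
  by rewrite sub0r normrN gtr0_norm.
have wsj := hu_ _ (ep j).
have tl : n1 (robin_defect al ar z (fun i => Lam i) Lside (u_ (eps_ j)) (flux setT mu (u_ (eps_ j)))) <=
  eta / 2 * n1 (Rp Lside z (u_ (eps_ j) (aend Lside)) (flux setT mu (u_ (eps_ j)) (aend Lside))).
  by move: (u_ (eps_ j)) wsj; near: j; exact: regular_trace.
have tr : n1 (robin_defect al ar z (fun i => Lam i) Rside (u_ (eps_ j)) (flux setT mu (u_ (eps_ j)))) <=
  eta / 2 * n1 (Rp Rside z (u_ (eps_ j) (aend Rside)) (flux setT mu (u_ (eps_ j)) (aend Rside))).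
  by move: (u_ (eps_ j)) wsj; near: j; exact: regular_trace.
have [Lu Lw sJ _] := line_solution hmu hrho hmu0 hrho0 hf hsupp wsj.
rewrite sub0r normrN ger0_norm ?sqrtr_ge0//.
apply: (Heta (eps_ j) (eta / 2) _ _ (ltW (ep j)) (ltW h20) _ Lu Lw sJ).
  by rewrite [ltRHS](splitr eta) ltrD2r.
by case.
Unshelve. all: by end_near.
Qed.

End regular.

Theorem proposition5p27 (R : realType)
  (mup rhop : R * R -> R) (th1 th2 z omega : R)
  (hmup : periodic_coefficient mup) (hrhop : periodic_coefficient rhop)
  (hth2 : 0 < th2) (hirr : irrational (th1 / th2)) (hz : 0 < z)
  (hdioph_fin : (irrationality_measure (th1 / th2) < +oo)%E)
  (hdioph : exists m : nat,
    [/\ (irrationality_measure (th1 / th2) < (m%:R : R)%:E)%E,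
        Cn m mup & Cn m rhop])
  (al ar : R) (halr : al < ar)
  (hal : al * th2 \is a Num.int) (har : ar * th2 \is a Num.int)
  (mu rho : R -> R) (hmu : line_coefficient mu) (hrho : line_coefficient rho)
  (hmu0 : forall x, ~ (al < x < ar) -> mu x = fiber mup th1 th2 0 x)
  (hrho0 : forall x, ~ (al < x < ar) -> rho x = fiber rhop th1 th2 0 x)
  (f : R -> R[i]) (hf : L2 setT f)
  (hsupp : ess_supp f `<=` `]al, ar[%classic) :
  (~ spectrum (fiber mup th1 th2 0) (fiber rhop th1 th2 0) (omega ^+ 2)%:C ->
   ~ discrete_spectrum mu rho (omega ^+ 2)%:C ->
   forall Lam : side -> R[i],
   (forall i, gap_RtR mup rhop th1 th2 z omega i (endpoint al ar i) (Lam i)) ->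
   interior_wellposed al ar mu rho omega z Lam /\
   forall (uint : R -> R[i]) (u_ : R -> R -> R[i]),
     interior_sol al ar mu rho omega z Lam f uint ->
     (forall eps : R, 0 < eps ->
       weak_sol setT mu rho (omega ^+ 2 +i* eps) f (u_ eps)) ->
     H1norm `]al, ar[%classic (fun x => u_ eps x - uint x)
       @[eps --> (0 : R)^'+] --> (0 : R))
  /\
  (spectrum (fiber mup th1 th2 0) (fiber rhop th1 th2 0) (omega ^+ 2)%:C ->
   forall (eps_ : nat -> R) (t00 t10 phi0 psi0 : side -> R -> R[i]),
   regular_along mup rhop th1 th2 z omega eps_ t00 t10 phi0 psi0 ->
   let Lam := fun i => regular_RtR th1 th2 i (endpoint al ar i)
                         (t00 i) (t10 i) (phi0 i) (psi0 i) in
   interior_wellposed al ar mu rho omega z Lam /\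
   forall (uint : R -> R[i]) (u_ : R -> R -> R[i]),
     interior_sol al ar mu rho omega z Lam f uint ->
     (forall eps : R, 0 < eps ->
       weak_sol setT mu rho (omega ^+ 2 +i* eps) f (u_ eps)) ->
     H1norm `]al, ar[%classic (fun x => u_ (eps_ j) x - uint x)
       @[j --> \oo] --> (0 : R)).
Proof.
split=> [nsp nd Lam gap|_ eps_ t00 t10 phi0 psi0 reg].
  exact: (gap_case hmup hrhop hz halr hmu hrho hmu0 hrho0 hf hsupp nsp nd gap).
exact: (regular_case hmup hrhop hth2 hz halr hmu hrho hal har hmu0 hrho0 hf hsupp reg).
Qed.
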